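(* Let $(M,g)$ be a simply connected, complete Riemannian 3-manifold with constant positive scalar curvature $S$. Let $k$ be a nowhere vanishing smooth vector field on $M$ satisfying $R(k,\cdot,\cdot,\cdot)=0$. Then $(M,g)$ splits isometrically as a Riemannian product $\mathbb{R}\times S^2$, and there is a smooth function $f\colon M\to\mathbb{R}$ such that $(M,g,fk)$ is a non-Einstein shrinking Ricci soliton with constant $\lambda=S$, i.e. $\mathrm{Ric}+\tfrac12\mathscr{L}_{fk}\,g=\tfrac{S}{2}g$ and $g$ is not an Einstein metric.
   Context: $R$ is the Riemann curvature 4-tensor of $g$, $\mathrm{Ric}$ its Ricci tensor, and $\mathscr{L}$ denotes the Lie derivative. In the product $\mathbb{R}\times S^2$, $\mathbb{R}$ carries its standard metric and $S^2$ is the 2-sphere with a round metric (not to be confused with the scalar curvature $S$; the round metric necessarily has scalar curvature $S$). A Ricci soliton $(M,g,V)$ with constant $\lambda$ is a Riemannian manifold with a vector field $V$ satisfying $\mathrm{Ric}+\tfrac12\mathscr{L}_V g=\tfrac{\lambda}{2}g$ (note the normalization $\lambda/2$); it is shrinking if $\lambda>0$. Einstein means $\mathrm{Ric}=c\,g$ for some constant $c$. *)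

(* Defs.v *)
From HB Require Import structures.
From mathcomp Require Import all_boot all_order all_algebra.
From mathcomp Require Import ring.
From mathcomp Require Import all_classical all_reals all_analysis.

Set Implicit Arguments.
Unset Strict Implicit.
Unset Printing Implicit Defensive.

Import Order.TTheory GRing.Theory Num.Theory.
Import numFieldNormedType.Exports.

Local Open Scope classical_set_scope.
Local Open Scope ring_scope.

(* Manifolds are presented by an atlas, and tensor fields by their components *)
(* in the charts of the atlas, subject to the usual transformation laws.      *)
(* Points of R^n and tangent vectors are row vectors.                         *)

Section SmoothFunctions.
Variable R : realType.

Definition pderiv n (i : 'I_n) (f : 'rV[R]_n -> R) (x : 'rV[R]_n) : R :=
  'D_(delta_mx 0 i) f x.

(* C^oo on an open set A: all iterated partial derivatives exist and are      *)
(* continuous at every point of A. Only the values of f on A matter.          *)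
Definition smooth_on n (A : set 'rV[R]_n) (f : 'rV[R]_n -> R) : Prop :=
  forall s : seq 'I_n, forall x, A x ->
    let h := foldr (@pderiv n) f s in
    {for x, continuous h} /\ forall i, derivable h x (delta_mx 0 i).

Definition smooth_mx_on n p q (A : set 'rV[R]_n)
    (F : 'rV[R]_n -> 'M[R]_(p, q)) : Prop :=
  forall i j, smooth_on A (fun x => F x i j).

(* With row vectors the differential at x is v |-> v *m jac F x. *)
Definition jac n m (F : 'rV[R]_n -> 'rV[R]_m) (x : 'rV[R]_n) : 'M[R]_(n, m) :=
  \matrix_(i, j) pderiv i (fun y => F y 0 j) x.

End SmoothFunctions.

Section Manifolds.
Variable R : realType.

(* cinv is the inverse of cfun; its values outside cfun @` cdom, like those   *)
(* of cfun outside cdom, are irrelevant.                                      *)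
Record chart n (T : topologicalType) := Chart {
  cdom : set T ;
  cfun : T -> 'rV[R]_n ;
  cinv : 'rV[R]_n -> T
}.

Definition cimg n (T : topologicalType) (c : chart n T) : set 'rV[R]_n :=
  cfun c @` cdom c.

Definition is_chart n (T : topologicalType) (c : chart n T) : Prop :=
  [/\ open (cdom c), open (cimg c),
      (forall p, cdom c p -> cinv c (cfun c p) = p),
      {within cdom c, continuous (cfun c)} &
      {within cimg c, continuous (cinv c)}].

(* Raw atlas; the axioms of a smooth n-manifold are in smooth_manifold below. *)
Record manifold n := Manifold {
  point :> topologicalType ;
  idx : Type ;
  atlas : idx -> chart n point
}.

Definition overlap n (M : manifold n) (a b : idx M) : set 'rV[R]_n :=
  cfun (atlas a) @` (cdom (atlas a) `&` cdom (atlas b)).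

Definition transition n (M : manifold n) (a b : idx M) : 'rV[R]_n -> 'rV[R]_n :=
  cfun (atlas b) \o cinv (atlas a).

Definition smooth_manifold n (M : manifold n) : Prop :=
  [/\ hausdorff_space M, @second_countable M,
      (forall a : idx M, is_chart (atlas a)),
      (forall p : M, exists a : idx M, cdom (atlas a) p) &
      (forall a b : idx M, smooth_mx_on (overlap a b) (transition a b))].

Definition smooth_function n (M : manifold n) (f : M -> R) : Prop :=
  forall a : idx M, smooth_on (cimg (atlas a)) (f \o cinv (atlas a)).

(* Components X^i = X a x 0 i of a tangent vector field in the chart a, and   *)
(* h_ij = h a x i j of a covariant 2-tensor field, as functions of the        *)
(* coordinates x.                                                             *)
Definition vfield n (M : manifold n) := idx M -> 'rV[R]_n -> 'rV[R]_n.
Definition tensor2 n (M : manifold n) := idx M -> 'rV[R]_n -> 'M[R]_n.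

Definition smooth_vfield n (M : manifold n) (X : vfield M) : Prop :=
  (forall a, smooth_mx_on (cimg (atlas a)) (X a)) /\
  (forall a b x, overlap a b x ->
     X b (transition a b x) = X a x *m jac (transition a b) x).

Definition nowhere_vanishing n (M : manifold n) (X : vfield M) : Prop :=
  forall a x, cimg (atlas a) x -> X a x != 0.

Definition scale_vfield n (M : manifold n) (f : M -> R) (X : vfield M) :
    vfield M :=
  fun a x => f (cinv (atlas a) x) *: X a x.

Definition riemannian_metric n (M : manifold n) (g : tensor2 M) : Prop :=
  [/\ (forall a, smooth_mx_on (cimg (atlas a)) (g a)),
      (forall a b x, overlap a b x ->
         let J := jac (transition a b) x in
         g a x = J *m g b (transition a b x) *m J^T),
      (forall a x, cimg (atlas a) x -> (g a x)^T = g a x) &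
      (forall a x (v : 'rV[R]_n), cimg (atlas a) x -> v != 0 ->
         0 < (v *m g a x *m v^T) 0 0)].

End Manifolds.

(* Classical formulas in one coordinate patch, for a metric with components   *)
(* g x i j; d_i stands for pderiv i.                                          *)
Section LocalGeometry.
Variables (R : realType) (n : nat) (g : 'rV[R]_n -> 'M[R]_n).
Implicit Types (x : 'rV[R]_n) (i j k l m : 'I_n).

Local Notation dg k i j x := (pderiv k (fun y => g y i j) x).

(* Gamma^k_ij *)
Definition christoffel k i j x : R :=
  2^-1 * \sum_l invmx (g x) k l * (dg i j l x + dg j i l x - dg l i j x).

(* R(d_i, d_j) d_k = \sum_l (riemann_up i j k l) d_l, where                   *)
(* R(X, Y) Z = nabla_X nabla_Y Z - nabla_Y nabla_X Z - nabla_[X, Y] Z.        *)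
Definition riemann_up i j k l x : R :=
  pderiv i (christoffel l j k) x - pderiv j (christoffel l i k) x
  + \sum_m (christoffel m j k x * christoffel l i m x
            - christoffel m i k x * christoffel l j m x).

(* R(d_i, d_j, d_k, d_l) = g(R(d_i, d_j) d_k, d_l) *)
Definition riemann i j k l x : R :=
  \sum_m riemann_up i j k m x * g x m l.

(* Ric(Y, Z) = trace (X |-> R(X, Y) Z), which is positive on round spheres. *)
Definition ricci x : 'M[R]_n := \matrix_(j, k) \sum_i riemann_up i j k i x.

Definition scalar_curvature x : R :=
  \sum_j \sum_k invmx (g x) j k * ricci x j k.

(* (L_V g)(d_i, d_j) = V(g_ij) - g([V, d_i], d_j) - g(d_i, [V, d_j]), where   *)
(* [V, d_i] = - \sum_k (d_i V^k) d_k.                                         *)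
Definition lie_derivative (V : 'rV[R]_n -> 'rV[R]_n) x : 'M[R]_n :=
  \matrix_(i, j) \sum_k
    (V x 0 k * dg k i j x
     + pderiv i (fun y => V y 0 k) x * g x k j
     + pderiv j (fun y => V y 0 k) x * g x i k).

End LocalGeometry.

Section RiemannianGeometry.
Variable R : realType.

Definition constant_scalar_curvature n (M : manifold R n) (g : tensor2 M)
    (S : R) : Prop :=
  forall a x, cimg (atlas a) x -> scalar_curvature (g a) x = S.

(* R(X, ., ., .) = 0 *)
Definition curvature_null n (M : manifold R n) (g : tensor2 M)
    (X : vfield M) : Prop :=
  forall a x, cimg (atlas a) x -> forall j k l : 'I_n,
    \sum_i X a x 0 i * riemann (g a) i j k l x = 0.

Definition einstein n (M : manifold R n) (g : tensor2 M) : Prop :=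
  exists c : R, forall a x, cimg (atlas a) x -> ricci (g a) x = c *: g a x.

Definition ricci_soliton n (M : manifold R n) (g : tensor2 M) (V : vfield M)
    (lambda : R) : Prop :=
  [/\ riemannian_metric g, smooth_vfield V &
      forall a x, cimg (atlas a) x ->
        ricci (g a) x + 2^-1 *: lie_derivative (g a) (V a) x
          = (lambda / 2) *: g a x].

Definition shrinking_ricci_soliton n (M : manifold R n) (g : tensor2 M)
    (V : vfield M) (lambda : R) : Prop :=
  ricci_soliton g V lambda /\ 0 < lambda.

Definition coord n (M : manifold R n) (a : idx M) (gamma : R -> M) (k : 'I_n) :
    R -> R :=
  fun t => cfun (atlas a) (gamma t) 0 k.

Definition geodesic n (M : manifold R n) (g : tensor2 M) (gamma : R -> M) :
    Prop :=
  continuous gamma /\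
  forall (a : idx M) t, cdom (atlas a) (gamma t) -> forall k : 'I_n,
    let u := coord a gamma in
    [/\ derivable (u k) t 1, derivable (derive1 (u k)) t 1 &
        derive1n 2 (u k) t +
        \sum_i \sum_j christoffel (g a) k i j (cfun (atlas a) (gamma t))
                      * derive1 (u i) t * derive1 (u j) t = 0].

(* Geodesic completeness: geodesics issue from every point with every initial *)
(* velocity v (given in a chart) and are defined for all times.               *)
Definition complete_metric n (M : manifold R n) (g : tensor2 M) : Prop :=
  forall (p : M) (a : idx M) (v : 'rV[R]_n), cdom (atlas a) p ->
    exists gamma : R -> M,
      [/\ geodesic g gamma, gamma 0 = p &
          forall k : 'I_n, derive1 (coord a gamma k) 0 = v 0 k].

(* Nonempty, path connected, and every loop contracts to its base point. *)
Definition simply_connected n (M : manifold R n) : Prop :=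
  [/\ (exists p : M, True),
      (forall p q : M, exists gamma : R -> M,
         [/\ {within `[0, 1], continuous gamma}, gamma 0 = p & gamma 1 = q]) &
      (forall gamma : R -> M, {within `[0, 1], continuous gamma} ->
         gamma 0 = gamma 1 ->
         exists H : R * R -> M,
           [/\ {within `[0, 1]%classic `*` `[0, 1]%classic, continuous H},
               (forall t, 0 <= t <= 1 -> H (0, t) = gamma t),
               (forall t, 0 <= t <= 1 -> H (1, t) = gamma 0) &
               (forall s, 0 <= s <= 1 ->
                  H (s, 0) = gamma 0 /\ H (s, 1) = gamma 0)])].

Definition coord_map m n (M : manifold R m) (N : manifold R n) (F : M -> N)
    (a : idx M) (b : idx N) : 'rV[R]_m -> 'rV[R]_n :=
  cfun (atlas b) \o F \o cinv (atlas a).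

Definition coord_map_dom m n (M : manifold R m) (N : manifold R n) (F : M -> N)
    (a : idx M) (b : idx N) : set 'rV[R]_m :=
  cfun (atlas a) @` (cdom (atlas a) `&` F @^-1` cdom (atlas b)).

Definition smooth_map m n (M : manifold R m) (N : manifold R n) (F : M -> N) :
    Prop :=
  continuous F /\
  forall a b, smooth_mx_on (coord_map_dom F a b) (coord_map F a b).

(* F is an isometry: a diffeomorphism (with inverse G) such that F^* h = g. *)
Definition isometric n (M : manifold R n) (g : tensor2 M)
    (N : manifold R n) (h : tensor2 N) : Prop :=
  exists (F : M -> N) (G : N -> M),
    [/\ cancel F G, cancel G F, smooth_map F, smooth_map G &
        forall a b x, coord_map_dom F a b x ->
          let J := jac (coord_map F a b) x in
          g a x = J *m h b (coord_map F a b x) *m J^T].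

End RiemannianGeometry.

Section Product.
Variables (R : realType) (m n : nat) (M : manifold R m) (N : manifold R n).

Definition prod_chart (c : chart R m M) (d : chart R n N) :
    chart R (m + n) (M * N)%type :=
  Chart (cdom c `*` cdom d)
        (fun p => row_mx (cfun c p.1) (cfun d p.2))
        (fun x => (cinv c (lsubmx x), cinv d (rsubmx x))).

Definition prod_manifold : manifold R (m + n) :=
  @Manifold R (m + n) (M * N)%type (idx M * idx N)%type
    (fun ab => prod_chart (atlas ab.1) (atlas ab.2)).

Definition prod_metric (g : tensor2 M) (h : tensor2 N) :
    tensor2 prod_manifold :=
  fun ab x => block_mx (g ab.1 (lsubmx x)) 0 0 (h ab.2 (rsubmx x)).

End Product.

Section Models.
Variable R : realType.

Definition line : manifold R 1 :=
  @Manifold R 1 R unit (fun=> Chart setT (fun t => const_mx t) (fun x => x 0 0)).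

Definition line_metric : tensor2 line := fun _ _ => 1%:M.

Definition sqnorm n (x : 'rV[R]_n) : R := (x *m x^T) 0 0.

Definition sphere_set n (r : R) : set 'rV[R]_(n + 1) :=
  [set x | sqnorm x = r ^+ 2].
Arguments sphere_set : clear implicits.

(* Inverse stereographic projection from the pole (0, (-1)^b r) onto the      *)
(* equatorial hyperplane.                                                     *)
Definition stereo_inv n (r : R) (b : bool) (u : 'rV[R]_n) : 'rV[R]_(n + 1) :=
  (sqnorm u + r ^+ 2)^-1 *:
  row_mx ((2 * r ^+ 2) *: u) ((-1) ^+ b * r * (sqnorm u - r ^+ 2))%:M.

Lemma sqnorm_ge0 n (u : 'rV[R]_n) : 0 <= sqnorm u.
Proof.
by rewrite /sqnorm mxE sumr_ge0// => i _; rewrite mxE -expr2 sqr_ge0.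
Qed.

Lemma sqnormZ n (a : R) (u : 'rV[R]_n) : sqnorm (a *: u) = a ^+ 2 * sqnorm u.
Proof. by rewrite /sqnorm linearZ -scalemxAl -scalemxAr scalerA mxE expr2. Qed.

Lemma sqnorm_row_mx n (u : 'rV[R]_n) (z : R) :
  sqnorm (row_mx u z%:M) = sqnorm u + z ^+ 2.
Proof.
rewrite /sqnorm tr_row_mx mul_row_col mxE tr_scalar_mx -scalar_mxM.
by rewrite [X in _ + X]mxE eqxx mulr1n expr2.
Qed.

Lemma stereo_inv_sphere n (r : R) b (u : 'rV[R]_n) :
  sphere_set n r (stereo_inv r b u).
Proof.
rewrite /sphere_set /stereo_inv /= sqnormZ sqnorm_row_mx sqnormZ.
rewrite [((-1) ^+ b * r * _) ^+ 2]exprMn [((-1) ^+ b * r) ^+ 2]exprMn sqrr_sign mul1r.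
have [->|r0] := eqVneq r 0; first by ring.
have s0 : sqnorm u + r ^+ 2 != 0.
  by rewrite gt_eqF// ltr_wpDl ?sqnorm_ge0// exprn_even_gt0.
by field.
Qed.

Definition sphere_chart n (r : R) (b : bool) :
    chart R n (set_type (sphere_set n r)) :=
  Chart
    [set p | rsubmx (set_val p) 0 0 != (-1) ^+ b * r]
    (fun p => (r / (r - (-1) ^+ b * rsubmx (set_val p) 0 0)) *:
              lsubmx (set_val p))
    (fun u => SigSub (mem_set (stereo_inv_sphere r b u))).

(* The round sphere of radius r > 0 in R^(n+1), with the induced metric. *)
Definition sphere n (r : R) : manifold R n :=
  Manifold (@sphere_chart n r).

Definition round_metric n (r : R) : tensor2 (sphere n r) :=
  fun b u => jac (stereo_inv r b) u *m (jac (stereo_inv r b) u)^T.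

End Models.

(* Main.v *)
(* Proof. Put e = k/|k| and K = S/2. In an orthonormal frame (e0, e1, e) the   *)
(* condition R(k, ., ., .) = 0 leaves K (theta^0 wedge theta^1) as the only    *)
(* curvature form. Differentiating the structure equations twice gives         *)
(* (De)^2 = 0, and shows that where De != 0 the unit field e0 spanning the     *)
(* image of De is geodesic. Along its integral curves y = 1/|De| solves        *)
(* y'' = - K y; by completeness y reaches 0, a contradiction. Hence De = 0.    *)
(*                                                                             *)
(* The systems dt = e^flat and Hess u = - K u (g - e^flat e^flat), e(u) = 0    *)
(* are now of Frobenius type and integrable, so that M, being simply           *)
(* connected, carries a solution t and three solutions u_0, u_1, u_2 with      *)
(* \sum u_c^2 = 1/K and g = dt^2 + \sum du_c^2. Then F = (t, u) is a local     *)
(* isometry from M to R x S^2(1/sqrt K) which maps geodesics to geodesics.     *)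
(* Lifting the polar rays from a base point through F yields a continuous      *)
(* section G of F, whose image is open and closed; so F is an isometry. The    *)
(* soliton field is K t e.                                                     *)

Require Import Defs.
From mathcomp Require Import all_boot all_order all_algebra.
From mathcomp Require Import ring lra.
From mathcomp Require Import all_classical all_reals all_analysis.

Set Implicit Arguments.
Unset Strict Implicit.
Unset Printing Implicit Defensive.

Import Order.TTheory GRing.Theory Num.Theory numFieldNormedType.Exports.

Local Open Scope classical_set_scope.
Local Open Scope ring_scope.

(** * Smooth functions *)

(** Write e = k/|k| and K = S/2. Nullity of [k] together with the first Bianchi identity leaves a
    single curvature form K (theta0 wedge theta1), so Ric is K times the metric of the plane
    orthogonal to e ([Om10], [ricci_frame]). Applying d d = 0 to the connection forms
    ([nullity_eqs]) shows that De annihilates e and has trace and determinant zero on that plane,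
    hence squares to zero ([covd_nilpotent]).

    Suppose De is not zero at some point. In a frame whose e0 spans its image, De has one entry b,
    and with a1 the remaining connection coefficient the structure equations give e0(b) = a1 b and
    e0(a1) = a1^2 + K ([e0_b], [e0_a1]). So 1/b solves y'' = -K y along the geodesic tangent to e0
    and would vanish in finite time, although b is finite along a complete geodesic. The predicate
    [kernel_state] states this without frames, so that it passes from frame to frame and from chart
    to chart; [ue_parallel] concludes De = 0.

    With e parallel, the coordinates of the future product satisfy linear systems d_i u = u A_i,
    whose zero-curvature condition is the set of structure equations ([sphere_system_flat],
    [line_system_flat]). Flat systems are solved locally by integrating along rays
    ([radial_expansion], [flat_solution_exists]), and globally on simply connected M by [monodromy].
    The pairing [obata_form] of two solutions is constant, so orthonormal initial data at one point
    give three functions u_c with sum of squares 1/K and with sum of du_c^2 equal to g - dt^2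
    ([orthonormal_states], [developing_exists]). Thus [dmap] = (t, u) is a local isometry to the
    cylinder ([dmap_pullback]).

    It is bijective because geodesics from one base point are sent to all polar rays of the cylinder
    ([developing_lifts]). The end point of a lifted ray depends continuously on the ray
    ([lift_continuous]) and only on the end point of the ray ([lift_fibre]), which yields a
    continuous inverse ([lifted_inverse]); the inverse function theorem makes it smooth
    ([local_diffeo_inverse]).

    Finally, e is parallel, hence Killing, and L_{K t e} g = 2 K e^flat e^flat supplies exactly the
    direction missing from Ric ([soliton_exists]), while Ric(e, .) = 0 with S > 0 excludes an
    Einstein metric ([not_einstein]). *)

Lemma le_rVnorm (R : realType) n (x : 'rV[R]_n) (e : R) :
  0 <= e -> (forall i, `|x 0 i| <= e) -> `|x| <= e.
Proof.
move=> e0 H; rewrite /Num.norm/= mx_normrE.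
apply: (big_ind (fun y => y <= e)) => //.
- by move=> y z; rewrite ge_max => -> ->.
- by move=> [i j] _ /=; rewrite ord1.
Qed.

Lemma rVcoord_le (R : realType) n (x : 'rV[R]_n) i : `|x 0 i| <= `|x|.
Proof.
rewrite [leRHS]/Num.norm/= mx_normrE.
by rewrite (bigD1 (0, i)) //= le_max lexx.
Qed.

(** The increment h = 0 is included and nothing is divided, so derivatives can be handled by plain
    norm estimates. *)
Lemma is_derive_epsP (R : realType) (V : normedModType R) (f : V -> R) x v d :
  is_derive x v f d <->
  forall e : R, 0 < e -> exists2 dl : R, 0 < dl & forall h : R, `|h| < dl ->
     `|f (x + h *: v) - f x - h * d| <= e * `|h|.
Proof.
split.
- case=> fx fd e e0.
  have : (fun h => h^-1 *: ((f \o shift x) (h *: v) - f x)) @ 0^' --> d.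
    by rewrite -fd.
  move/cvgrPdist_le => /(_ _ e0); rewrite near_withinE => /nbhs_ballP[dl /= dl0 H].
  exists dl => // h hdl; have [->|h0] := eqVneq h 0.
    by rewrite scale0r addr0 mul0r subrr subr0 normr0 mulr0.
  have /(_ _ h0) /= := H h _; rewrite /ball/= sub0r normrN => /(_ hdl) /=.
  have h0' : 0 < `|h| by rewrite normr_gt0.
  rewrite -(ler_pM2r h0') -normrM mulrBl /= mulrAC mulVf// mul1r.
  by rewrite [h *: v + x]addrC distrC [d * h]mulrC => /le_trans; apply.
- move=> H.
  have fd : (fun h => h^-1 *: ((f \o shift x) (h *: v) - f x)) @ 0^' --> d.
    apply/cvgrPdist_le => e e0; have [dl dl0 Hd] := H e e0.
    rewrite near_withinE; apply/nbhs_ballP; exists dl => //= h.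
    rewrite /ball/= sub0r normrN => hdl h0; have h0' : 0 < `|h| by rewrite normr_gt0.
    rewrite -(ler_pM2r h0') -normrM mulrBl /= mulrAC mulVf// mul1r.
    by rewrite [h *: v + x]addrC distrC [d * h]mulrC Hd.
  by split; [apply/cvg_ex; exists d|apply: cvg_lim].
Qed.

Lemma continuous_epsP (R : realType) (V W : normedModType R) (f : V -> W) x :
  {for x, continuous f} <->
  forall e : R, 0 < e -> exists2 dl : R, 0 < dl & forall y, `|y - x| < dl ->
     `|f y - f x| <= e.
Proof.
split.
- move=> /cvgrPdist_le H e e0; have /nbhs_ballP[dl /= dl0 Hd] := H e e0.
  exists dl => // y yx; rewrite distrC; apply: Hd.
  by rewrite -ball_normE /ball_/= distrC.
- move=> H; apply/cvgrPdist_le => e e0; have [dl dl0 Hd] := H e e0.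
  apply/nbhs_ballP; exists dl => //= y; rewrite -ball_normE /ball_/= => yx.
  by rewrite distrC Hd// distrC.
Qed.

Lemma open_ball_sub (R : realType) (V : normedModType R) (A : set V) x :
  open A -> A x -> exists2 dl : R, 0 < dl & forall y, `|y - x| < dl -> A y.
Proof.
move=> oA Ax; have /nbhs_ballP[dl /= dl0 Hd] := open_nbhs_nbhs (conj oA Ax).
by exists dl => // y yx; apply: Hd; rewrite -ball_normE /ball_/= distrC.
Qed.

Lemma is_derive_line (R : realType) (V : normedModType R) (f : V -> R) a v t :
  derivable f (a + t *: v) v ->
  is_derive t 1 (fun s : R => f (a + s *: v)) ('D_v f (a + t *: v)).
Proof.
move=> /derivableP/is_derive_epsP H; apply/is_derive_epsP => e e0.
have [dl dl0 Hd] := H e e0; exists dl => // h hd.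
by have := Hd h hd; rewrite scalerDl addrA [h *: 1]mulr1.
Qed.

(** The hypotheses range over |s| <= |t| rather than over the segment from 0 to t, so that both
    signs of t are covered by one statement. *)
Lemma MVT_line (R : realType) (V : normedModType R) (f : V -> R) a v (t c e : R) :
  (forall s : R, `|s| <= `|t| -> derivable f (a + s *: v) v) ->
  (forall s : R, `|s| <= `|t| -> `|'D_v f (a + s *: v) - c| <= e) ->
  `|f (a + t *: v) - f a - t * c| <= e * `|t|.
Proof.
move=> df bd.
pose g s := f (a + s *: v); pose dg s := 'D_v f (a + s *: v).
have dgP (s : R) : `|s| <= `|t| -> is_derive s 1 g (dg s).
  by move=> st; apply: is_derive_line; exact: df.
have gc (s : R) : `|s| <= `|t| -> {for s, continuous g}.
  by move=> /dgP [H _]; apply: differentiable_continuous; exact/derivable1_diffP.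
have g0 : g 0 = f a by rewrite /g scale0r addr0.
rewrite -[f (a + _)]/(g t) -g0.
have key (b1 b2 : R) : b1 <= b2 -> (forall s : R, b1 <= s <= b2 -> `|s| <= `|t|) ->
    exists2 s, `|s| <= `|t| & g b2 - g b1 = dg s * (b2 - b1).
  move=> b12 H; have [||s sb gE] := @MVT_segment R g dg b1 b2 b12.
  - move=> s; rewrite in_itv/= => /andP[s1 s2]; apply: dgP; apply: H.
    by rewrite !ltW.
  - apply: continuous_in_subspaceT => s; rewrite inE/= in_itv/= => sb.
    by apply: gc; exact: H.
  - by exists s => //; apply: H; rewrite in_itv/= in sb.
have [t0|t0] := leP 0 t.
- have [||s st ->] := key 0 t => //.
    by move=> s /andP[s0 st]; rewrite !ger0_norm// (le_trans s0).
  by rewrite subr0 mulrC -mulrBr normrM mulrC ler_wpM2r//; exact: bd.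
- have [||s st E] := key t 0; first exact: ltW.
    by move=> s /andP[s0 st]; rewrite (ler0_norm st) (ltr0_norm t0) lerN2.
  have -> : g t - g 0 - t * c = t * (dg s - c) by rewrite -[g t - g 0]opprB E; ring.
  by rewrite normrM mulrC ler_wpM2r//; exact: bd.
Qed.

Lemma is_derive_lineP (R : realType) (V : normedModType R) (f : V -> R) x v d :
  is_derive x v f d <-> is_derive (0 : R) 1 (fun t : R => f (x + t *: v)) d.
Proof.
by split=> /is_derive_epsP H; apply/is_derive_epsP => e /H[dl dl0 Hd]; exists dl => // h /Hd;
  rewrite scale0r addr0 add0r [h *: 1]mulr1.
Qed.

Lemma is_derive_translate (R : realType) (V : normedModType R) (f : V -> R) x w v d :
  is_derive (x + w) v f d -> is_derive x v (fun y => f (y + w)) d.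
Proof.
move=> /is_derive_epsP H; apply/is_derive_epsP => e /H[dl dl0 Hd]; exists dl => // h /Hd.
by rewrite [x + w + _]addrAC.
Qed.

Lemma is_derive_comp1 (R : realType) (V : normedModType R) (f : V -> R) (g : R -> R) x v a b :
  is_derive x v f a -> is_derive (f x) 1 g b -> is_derive x v (fun y => g (f y)) (b * a).
Proof.
move=> /is_derive_lineP fa gb; apply/is_derive_lineP.
by apply: is_derive1_comp fa; rewrite scale0r addr0.
Qed.

(** A minimum over finitely many radii. Each hypothesis speaks of all h below its radius, so [P k]
    need not be monotone. *)
Lemma common_radius (R : realType) n (P : 'I_n -> R -> Prop) :
  (forall k, exists2 dl : R, 0 < dl & forall h, h < dl -> P k h) ->
  exists2 dl : R, 0 < dl & forall h, h < dl -> forall k, P k h.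
Proof.
move=> H0; have {H0}/choice[dl H] : forall k, exists dl : R, 0 < dl /\ forall h, h < dl -> P k h.
  by move=> k; have [dl] := H0 k; exists dl.
 exists (\big[Order.min/1]_k dl k).
  by apply: lt_bigmin => // k _; have [] := H k.
move=> h hd k; have [_] := H k; apply; apply: lt_le_trans hd _.
exact: bigmin_le_cond.
Qed.

Definition dirderiv (R : realType) n (f : 'rV[R]_n -> R) (x v : 'rV[R]_n) : R :=
  \sum_i v 0 i * pderiv i f x.

(** Both points move. Fixing one of them at x gives Frechet differentiability; the two-point form is
    what the inverse function theorem needs. *)
Definition strictly_differentiable (R : realType) n (f : 'rV[R]_n -> R) x :=
  forall e : R, 0 < e -> exists2 dl : R, 0 < dl &
    forall y z, `|y - x| < dl -> `|z - x| < dl ->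
      `|f z - f y - dirderiv f x (z - y)| <= e * `|z - y|.

(** Pass from y to z by changing one coordinate at a time; on each edge the mean value inequality
    compares the increment with the partial derivative at x. *)
Lemma C1_strict (R : realType) n (A : set 'rV[R]_n) f x :
  open A -> A x ->
  (forall y i, A y -> derivable f y (delta_mx 0 i)) ->
  (forall i, {for x, continuous (pderiv i f)}) ->
  strictly_differentiable f x.
Proof.
move=> oA Ax df cf e e0.
have [d1 d10 Ad] := open_ball_sub oA Ax.
have n0 : 0 < n%:R + 1 :> R by rewrite ltr_wpDl.
have e'0 : 0 < e / (n%:R + 1) by rewrite divr_gt0.
have [d2 d20 d2P] : exists2 d2 : R, 0 < d2 & forall h, h < d2 -> forall i,
    forall y, `|y - x| <= h -> `|pderiv i f y - pderiv i f x| <= e / (n%:R + 1).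
  apply: common_radius => i.
  have /continuous_epsP/(_ _ e'0)[d d0 H] := cf i.
  by exists d => // h hd y yx; apply: H; exact: le_lt_trans hd.
pose d := Num.min d1 d2; have d0 : 0 < d by rewrite lt_min d10.
exists (d / 4); first by rewrite divr_gt0.
move=> y z yx zx.
(* Vertices of the edge path: the first k coordinates are already those of z. *)
pose w (k : nat) : 'rV[R]_n := \row_j (if (j < k)%N then z 0 j else y 0 j).
have w0 : w 0%N = y by apply/rowP => j; rewrite mxE.
have wn : w n = z by apply/rowP => j; rewrite mxE ltn_ord.
have wS (k : 'I_n) : w k.+1 = w k + (z 0 k - y 0 k) *: delta_mx 0 k.
  apply/rowP => j; rewrite !mxE eqxx/= ltnS.
  case: (ltngtP j k) => [jk|kj|/val_inj ->] /=.
  - by have /negPf -> : j != k by [rewrite neq_ltn jk]; rewrite mulr0 addr0.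
  - by have /negPf -> : j != k by [rewrite neq_ltn kj orbT]; rewrite mulr0 addr0.
  - by rewrite eqxx mulr1 addrC subrK.
have -> : f z - f y = \sum_(k < n) (f (w k.+1) - f (w k)).
  by rewrite -wn -w0 -[RHS](big_mkord xpredT (fun k => f (w k.+1) - f (w k))) telescope_sumr.
rewrite /dirderiv -sumrB (le_trans (ler_norm_sum _ _ _))//.
have -> : e * `|z - y| = (n%:R + 1) * (e / (n%:R + 1) * `|z - y|).
  by field; rewrite gt_eqF.
apply: (@le_trans _ _ (\sum_(k < n) (e / (n%:R + 1) * `|z - y|))); last first.
  rewrite sumr_const card_ord -[X in X <= _]mulr_natl ler_wpM2r ?lerDl//.
  by rewrite mulr_ge0// ltW.
apply: ler_sum => k _; rewrite wS.
(* In the sup norm an edge point is off by less than d/4 from y - x and by less than 2 d/4 from s,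
   hence the radius d/4 above. *)
have near_x (s : R) : `|s| <= `|z 0 k - y 0 k| ->
    `|w k + s *: delta_mx 0 k - x| < d.
  move=> sk; apply: (@le_lt_trans _ _ (3 * (d / 4))); last lra.
  apply: le_rVnorm; first by rewrite mulr_ge0// divr_ge0// ltW.
  move=> j; rewrite !mxE eqxx/=.
  have yj : `|y 0 j - x 0 j| < d / 4.
    by apply: le_lt_trans yx; have := rVcoord_le (y - x) j; rewrite !mxE.
  have zj : `|z 0 j - x 0 j| < d / 4.
    by apply: le_lt_trans zx; have := rVcoord_le (z - x) j; rewrite !mxE.
  have zyj : `|z 0 j - y 0 j| < 2 * (d / 4).
    rewrite (_ : _ - _ = (z 0 j - x 0 j) - (y 0 j - x 0 j)); last by ring.
    by rewrite (le_lt_trans (ler_normB _ _))// mulr_natl mulr2n ltrD.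
  have [jk|jk] := eqVneq j k.
    rewrite -jk ltnn mulr1 (_ : _ - _ = (y 0 j - x 0 j) + s); last by ring.
    rewrite (le_trans (ler_normD _ _))//.
    by rewrite -jk in sk; have := le_lt_trans sk zyj; move: yj; lra.
  rewrite mulr0 addr0; case: ifP => _; move: yj zj; lra.
have -> : f (w k + (z 0 k - y 0 k) *: delta_mx 0 k) - f (w k) - (z - y) 0 k * pderiv k f x
   = f (w k + (z 0 k - y 0 k) *: delta_mx 0 k) - f (w k) - (z 0 k - y 0 k) * pderiv k f x.
  by rewrite !mxE.
apply: le_trans (_ : e / (n%:R + 1) * `|z 0 k - y 0 k| <= _).
  apply: MVT_line => s sk.
    apply: df; apply: Ad; apply: lt_le_trans (near_x _ sk) _.
    by rewrite ge_min lexx.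
  apply: d2P (lexx _); apply: lt_le_trans (near_x _ sk) _.
  by rewrite ge_min lexx orbT.
rewrite ler_wpM2l ?(ltW e'0)//.
by have := rVcoord_le (z - y) k; rewrite !mxE.
Qed.

(** The inner map needs only directional derivatives of its coordinates at one point; all uniformity
    comes from strict differentiability of f. The error splits into that of f and that of the linear
    approximation of c. *)
Lemma chain_rule (R : realType) (V : normedModType R) n (f : 'rV[R]_n -> R)
    (c : V -> 'rV[R]_n) (a v : V) (dc : 'rV[R]_n) :
  strictly_differentiable f (c a) ->
  (forall k, is_derive a v (fun t => c t 0 k) (dc 0 k)) ->
  is_derive a v (fun t => f (c t)) (dirderiv f (c a) dc).
Proof.
move=> sf dcP; apply/is_derive_epsP => e e0.
pose D := `|dc| + 1; have D0 : 0 < D by rewrite ltr_wpDl.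
pose G := \sum_i `|pderiv i f (c a)| + 1.
have G0 : 0 < G by rewrite ltr_wpDl// sumr_ge0.
have e10 : 0 < e / 2 / D by rewrite !divr_gt0.
have [d1 d10 sfd] := sf _ e10.
(* The bound 1 gives |c(a + h v) - c(a)| <= D |h|; the other bound controls the second error. *)
pose e2 := Num.min 1 (e / 2 / G).
have e20 : 0 < e2 by rewrite lt_min ltr01 !divr_gt0.
have [d2 d20 d2P] : exists2 d2 : R, 0 < d2 & forall h, h < d2 -> forall k,
    forall t : R, `|t| <= h ->
      `|c (a + t *: v) 0 k - c a 0 k - t * dc 0 k| <= e2 * `|t|.
  apply: common_radius => k.
  have /is_derive_epsP/(_ _ e20)[d d0 H] := dcP k.
  by exists d => // h hd t th; apply: H; exact: le_lt_trans hd.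
exists (Num.min d2 (d1 / D)); first by rewrite lt_min d20 divr_gt0.
move=> h; rewrite lt_min => /andP[hd2 hd1].
have ck k := d2P _ hd2 k h (lexx _).
have cD : `|c (a + h *: v) - c a| <= D * `|h|.
  apply: le_rVnorm; first by rewrite mulr_ge0// ltW.
  move=> k; rewrite !mxE.
  have := ck k; have := ler_wpM2r (normr_ge0 h) (rVcoord_le dc k).
  have e2h : e2 * `|h| <= 1 * `|h| by rewrite ler_wpM2r// ge_min lexx.
  rewrite -normrM mulrC => dch ckh; rewrite /D mulrDl.
  rewrite (_ : _ - _ = (c (a + h *: v) 0 k - c a 0 k - h * dc 0 k) + h * dc 0 k); last by ring.
  rewrite (le_trans (ler_normD _ _))// addrC lerD//.
  exact: le_trans e2h.
have cd1 : `|c (a + h *: v) - c a| < d1.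
  by rewrite (le_lt_trans cD)// mulrC -ltr_pdivlMr.
have := sfd (c a) (c (a + h *: v)); rewrite subrr normr0 => /(_ d10 cd1) K1.
have K2 : `|dirderiv f (c a) (c (a + h *: v) - c a) - h * dirderiv f (c a) dc| <= e / 2 * `|h|.
  rewrite /dirderiv mulr_sumr -sumrB (le_trans (ler_norm_sum _ _ _))//.
  apply: (@le_trans _ _ (\sum_i (e2 * `|h| * `|pderiv i f (c a)|))).
    apply: ler_sum => k _; rewrite mulrA -mulrBl normrM ler_wpM2r//.
    by rewrite !mxE; exact: ck.
  rewrite -mulr_sumr mulrAC ler_wpM2r//.
  apply: (@le_trans _ _ (e / 2 / G * G)); last by rewrite divfK// gt_eqF.
  apply: ler_pM => //; [exact: ltW|by rewrite sumr_ge0|by rewrite ge_min lexx orbT|].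
  by rewrite lerDl.
rewrite (_ : _ - _ - _ = (f (c (a + h *: v)) - f (c a) - dirderiv f (c a) (c (a + h *: v) - c a))
  + (dirderiv f (c a) (c (a + h *: v) - c a) - h * dirderiv f (c a) dc)); last by ring.
rewrite (le_trans (ler_normD _ _))// (_ : e * `|h| = e / 2 / D * (D * `|h|) + e / 2 * `|h|).
  apply: lerD => //; apply: le_trans K1 _; rewrite ler_wpM2l//; exact: ltW.
by rewrite mulrA divfK ?gt_eqF//; field.
Qed.

Lemma strict_continuous (R : realType) n (f : 'rV[R]_n -> R) x :
  strictly_differentiable f x -> {for x, continuous f}.
Proof.
move=> sf; apply/continuous_epsP => e e0.
pose G := \sum_i `|pderiv i f x| + 1.
have G0 : 0 < G by rewrite ltr_wpDl// sumr_ge0.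
have [d1 d10 H] := sf 1 ltr01.
exists (Num.min d1 (e / (1 + G))).
  by rewrite lt_min d10 divr_gt0// addr_gt0.
move=> y; rewrite lt_min => /andP[y1 y2].
have := H x y; rewrite subrr normr0 => /(_ d10 y1) K.
have K2 : `|dirderiv f x (y - x)| <= G * `|y - x|.
  rewrite /dirderiv (le_trans (ler_norm_sum _ _ _))// /G mulrDl mul1r ler_wpDr//.
  rewrite mulr_suml; apply: ler_sum => i _; rewrite normrM mulrC ler_wpM2l//.
  exact: rVcoord_le.
rewrite -(subrK (dirderiv f x (y - x)) (f y - f x)).
rewrite (le_trans (ler_normD _ _))//.
apply: le_trans (lerD K K2) _; rewrite -mulrDl mulrC -ler_pdivlMr; first exact: ltW.
by rewrite addr_gt0.
Qed.

Lemma smooth_on_continuous (R : realType) n (A : set 'rV[R]_n) f x :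
  smooth_on A f -> A x -> {for x, continuous f}.
Proof. by move=> /(_ [::] x) H /H []. Qed.

Lemma smooth_on_derivable (R : realType) n (A : set 'rV[R]_n) f x i :
  smooth_on A f -> A x -> derivable f x (delta_mx 0 i).
Proof. by move=> /(_ [::] x) H /H []. Qed.

Lemma smooth_on_pderiv (R : realType) n (A : set 'rV[R]_n) f i :
  smooth_on A f -> smooth_on A (pderiv i f).
Proof. by move=> H s x Ax; have := H (rcons s i) x Ax; rewrite foldr_rcons. Qed.

Lemma smooth_on_is_derive (R : realType) n (A : set 'rV[R]_n) f x i :
  smooth_on A f -> A x -> is_derive x (delta_mx 0 i) f (pderiv i f x).
Proof. by move=> sf Ax; apply/derivableP; exact: smooth_on_derivable sf Ax. Qed.

Lemma smooth_on_sub (R : realType) n (A B : set 'rV[R]_n) f :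
  A `<=` B -> smooth_on B f -> smooth_on A f.
Proof. by move=> AB H s x /AB; exact: H. Qed.

Lemma smooth_on_strict (R : realType) n (A : set 'rV[R]_n) f x :
  open A -> smooth_on A f -> A x -> strictly_differentiable f x.
Proof.
move=> oA sf Ax; apply: (C1_strict oA Ax) => [y i|i].
  exact: smooth_on_derivable.
exact: smooth_on_continuous (smooth_on_pderiv i sf) Ax.
Qed.

(** * Closure properties of smooth functions *)

Lemma near_open (R : realType) (V : normedModType R) (A : set V) (P : V -> Prop) x :
  open A -> A x -> (forall y, A y -> P y) -> \forall y \near x, P y.
Proof. by move=> oA Ax H; apply: filterS H _; exact: open_nbhs_nbhs. Qed.

Lemma continuous_near_eq (R : realType) (V W : normedModType R) (f g : V -> W) x :
  (\forall y \near x, f y = g y) -> {for x, continuous f} -> {for x, continuous g}.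
Proof.
move=> fg; rewrite /prop_for/continuous_at -(nbhs_singleton fg) => cf.
by apply: cvg_trans cf; exact: near_eq_cvg.
Qed.

(** Coinduction for smoothness: a class of continuous, partially derivable functions that is stable
    under partial derivatives, up to equality on A, contains only smooth functions. *)
Lemma smooth_coind (R : realType) n (A : set 'rV[R]_n) (C : ('rV[R]_n -> R) -> Prop) :
  open A ->
  (forall f x, C f -> A x -> {for x, continuous f}) ->
  (forall f x i, C f -> A x -> derivable f x (delta_mx 0 i)) ->
  (forall f i, C f -> exists2 g, C g & forall x, A x -> pderiv i f x = g x) ->
  forall f, C f -> smooth_on A f.
Proof.
move=> oA Cc Cd Cp f Cf s.
have [g Cg gE] : exists2 g, C g & forall x, A x -> foldr (@pderiv R n) f s x = g x.
  elim: s => [|i s [g Cg gE]] /=; first by exists f.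
  have [g' Cg' g'E] := Cp g i Cg; exists g' => // x Ax; rewrite -g'E//.
  by apply: near_eq_derive; exact: (near_open oA Ax).
move=> x Ax /=; split => [|i].
  apply: (continuous_near_eq _ (Cc _ _ Cg Ax)).
  by apply: (near_open oA Ax) => y Ay; rewrite gE.
apply: (near_eq_derivable _ (Cd _ _ i Cg Ax)).
by apply: (near_open oA Ax) => y Ay; rewrite gE.
Qed.

Opaque smooth_on.

Inductive alg_gen (R : realType) n (B : ('rV[R]_n -> R) -> Prop) :
    ('rV[R]_n -> R) -> Prop :=
  | alg_base f : B f -> alg_gen B f
  | alg_cst c : alg_gen B (fun=> c)
  | alg_add f g : alg_gen B f -> alg_gen B g -> alg_gen B (fun x => f x + g x)
  | alg_mul f g : alg_gen B f -> alg_gen B g -> alg_gen B (fun x => f x * g x).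

Lemma alg_sum (R : realType) n (B : ('rV[R]_n -> R) -> Prop) (I : finType)
    (F : I -> 'rV[R]_n -> R) :
  (forall i, alg_gen B (F i)) -> alg_gen B (fun x => \sum_i F i x).
Proof.
move=> HF; elim: (index_enum _) => [|i s IH].
  by rewrite (_ : (fun x => _) = fun=> 0); [exact: alg_cst|apply/funext => x; rewrite big_nil].
rewrite (_ : (fun x => _) = fun x => F i x + \sum_(i <- s) F i x).
  exact: alg_add.
by apply/funext => x; rewrite big_cons.
Qed.

(** By the Leibniz rule it suffices that derivatives of the generators lie in the algebra they
    generate. Inverses, square roots, composites, inverse maps and solutions of linear systems are
    all proved smooth by a suitable choice of [B]. *)
Lemma smooth_alg (R : realType) n (A : set 'rV[R]_n) (B : ('rV[R]_n -> R) -> Prop) :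
  open A ->
  (forall f x, B f -> A x -> {for x, continuous f}) ->
  (forall f x i, B f -> A x -> derivable f x (delta_mx 0 i)) ->
  (forall f i, B f -> exists2 g, alg_gen B g & forall x, A x -> pderiv i f x = g x) ->
  forall f, alg_gen B f -> smooth_on A f.
Proof.
move=> oA Bc Bd Bp; apply: smooth_coind => //.
- move=> f x; elim=> {f} [f /Bc|c|f g _ IHf _ IHg Ax|f g _ IHf _ IHg Ax]; first exact.
  + by move=> _; exact: cst_continuous.
  + by apply: continuousD; [exact: IHf|exact: IHg].
  + by apply: continuousM; [exact: IHf|exact: IHg].
- move=> f x i; elim=> {f} [f /Bd|c|f g _ IHf _ IHg Ax|f g _ IHf _ IHg Ax]; first exact.
  + by move=> _; exact: derivable_cst.
  + by apply: derivableD; [exact: IHf|exact: IHg].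
  + by apply: derivableM; [exact: IHf|exact: IHg].
- have dv f x i : alg_gen B f -> A x -> derivable f x (delta_mx 0 i).
    elim=> {f} [f /Bd|c|f g _ IHf _ IHg Ax|f g _ IHf _ IHg Ax]; first exact.
    + by move=> _; exact: derivable_cst.
    + by apply: derivableD; [exact: IHf|exact: IHg].
    + by apply: derivableM; [exact: IHf|exact: IHg].
  move=> f i; elim=> {f} [f /Bp//|c|f g Hf [f' Hf' f'E] Hg [g' Hg' g'E]|f g Hf [f' Hf' f'E] Hg [g' Hg' g'E]].
  + by exists (fun=> 0); [exact: alg_cst|move=> x _; exact: derive_cst].
  + exists (fun x => f' x + g' x); first exact: alg_add.
    move=> x Ax; rewrite -f'E// -g'E//; apply: deriveD; exact: dv.
  + exists (fun x => f x * g' x + g x * f' x).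
      by apply: alg_add; apply: alg_mul.
    move=> x Ax; rewrite -f'E// -g'E//; apply: deriveM; exact: dv.
Qed.

Lemma alg_smooth_on (R : realType) n (A : set 'rV[R]_n) f :
  open A -> alg_gen (smooth_on A) f -> smooth_on A f.
Proof.
move=> oA; apply: smooth_alg => // g.
- by move=> x; exact: smooth_on_continuous.
- by move=> x i; exact: smooth_on_derivable.
- move=> i sg; exists (pderiv i g) => //; apply: alg_base; exact: smooth_on_pderiv.
Qed.

Lemma continuous_bigsum (R : realType) (V : normedModType R) m (F : 'I_m -> V -> R) x :
  (forall i, {for x, continuous (F i)}) -> {for x, continuous (fun y => \sum_i F i y)}.
Proof.
move=> H; rewrite (_ : (fun y => _) = (fun y => \sum_(i <- index_enum 'I_m) F i y))//.
elim: (index_enum _) => [|i s IH].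
  rewrite (_ : (fun y => _) = fun=> 0); first exact: cst_continuous.
  by apply/funext => y; rewrite big_nil.
rewrite (_ : (fun y => _) = F i \+ (fun y => \sum_(i <- s) F i y)).
  by apply: continuousD; [exact: H|exact: IH].
by apply/funext => y; rewrite big_cons.
Qed.

Section SmoothOps.
Variables (R : realType) (n : nat) (A : set 'rV[R]_n).
Hypothesis oA : open A.
Implicit Types f g : 'rV[R]_n -> R.

Lemma smooth_onD f g : smooth_on A f -> smooth_on A g ->
  smooth_on A (fun x => f x + g x).
Proof. by move=> sf sg; apply: alg_smooth_on => //; apply: alg_add; apply: alg_base. Qed.

Lemma smooth_onM f g : smooth_on A f -> smooth_on A g ->
  smooth_on A (fun x => f x * g x).
Proof. by move=> sf sg; apply: alg_smooth_on => //; apply: alg_mul; apply: alg_base. Qed.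

Lemma smooth_on_cst c : smooth_on A (fun=> c).
Proof. by apply: alg_smooth_on => //; apply: alg_cst. Qed.

Lemma smooth_onN f : smooth_on A f -> smooth_on A (fun x => - f x).
Proof.
move=> sf; rewrite (_ : (fun x => _) = fun x => -1 * f x).
  exact: smooth_onM (smooth_on_cst _) sf.
by apply/funext => x; rewrite mulN1r.
Qed.

Lemma smooth_onB f g : smooth_on A f -> smooth_on A g ->
  smooth_on A (fun x => f x - g x).
Proof. by move=> sf /smooth_onN; exact: smooth_onD. Qed.

Lemma smooth_on_sum (I : finType) (F : I -> 'rV[R]_n -> R) :
  (forall i, smooth_on A (F i)) -> smooth_on A (fun x => \sum_i F i x).
Proof. by move=> H; apply: alg_smooth_on => //; apply: alg_sum => i; apply: alg_base. Qed.

(** Functions that agree on the open set A with some smooth function form a class to which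
    [smooth_coind] applies. *)
Lemma smooth_on_eq f g : (forall x, A x -> f x = g x) ->
  smooth_on A f -> smooth_on A g.
Proof.
move=> fg sf; pose B h := exists2 k, smooth_on A k & forall x, A x -> h x = k x.
have sim (h k : 'rV[R]_n -> R) x : (forall x, A x -> h x = k x) -> A x -> \forall y \near x, k y = h y.
  by move=> hk Ax; apply: (near_open oA Ax) => y Ay; rewrite hk.
apply: (@smooth_coind _ _ A B) => //.
- move=> h x [k sk hk] Ax; apply: (continuous_near_eq (sim _ _ _ hk Ax)).
  exact: smooth_on_continuous sk Ax.
- move=> h x i [k sk hk] Ax; apply: (near_eq_derivable (sim _ _ _ hk Ax)).
  exact: smooth_on_derivable sk Ax.
- move=> h i [k sk hk]; exists (pderiv i k).
    by exists (pderiv i k); [exact: smooth_on_pderiv|].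
  by move=> x Ax; apply/esym/near_eq_derive; exact: sim.
- by exists f => // x Ax; rewrite fg.
Qed.

Lemma smooth_on_coord k : smooth_on A (fun x => x 0 k).
Proof.
pose B (f : 'rV[R]_n -> R) := f = (fun x => x 0 k).
have Bd x i : is_derive x (delta_mx 0 i) (fun x : 'rV[R]_n => x 0 k) (i == k)%:R.
  apply/is_derive_epsP => e e0; exists 1 => // h _.
  rewrite !mxE eqxx/= [k == i]eq_sym (_ : _ - _ - _ = 0); last by ring.
  by rewrite normr0 mulr_ge0// ltW.
apply: (@smooth_alg _ _ A B) => //; last exact: alg_base.
- by move=> f x -> _; exact: coord_continuous.
- by move=> f x i -> _; have [] := Bd x i.
- move=> f i ->; exists (fun=> (i == k)%:R); first exact: alg_cst.
  by move=> x _; have [] := Bd x i.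
Qed.

(** The derivative of 1/f is -f' (1/f)^2, a polynomial in smooth functions and 1/f itself. *)
Lemma smooth_onV f : (forall x, A x -> f x != 0) -> smooth_on A f ->
  smooth_on A (fun x => (f x)^-1).
Proof.
move=> f0 sf; pose B g := smooth_on A g \/ g = (fun x => (f x)^-1).
apply: (@smooth_alg _ _ A B) => //; last by apply: alg_base; right.
- move=> g x [sg|->] Ax; first exact: smooth_on_continuous sg Ax.
  by apply: continuousV; [exact: f0|exact: smooth_on_continuous sf Ax].
- move=> g x i [sg|->] Ax; first exact: smooth_on_derivable sg Ax.
  by apply: derivableV; [exact: f0|exact: smooth_on_derivable sf Ax].
- move=> g i [sg|->].
    by exists (pderiv i g) => //; apply: alg_base; left; exact: smooth_on_pderiv.
  exists (fun x => - pderiv i f x * ((f x)^-1 * (f x)^-1)).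
    apply: alg_mul; first by apply: alg_base; left; apply/smooth_onN/smooth_on_pderiv.
    by apply: alg_mul; apply: alg_base; right.
  move=> x Ax; rewrite /pderiv deriveV; [|exact: f0|exact: smooth_on_derivable sf Ax].
  by rewrite /GRing.scale/= expr2 invfM; ring.
Qed.

(** Both s = sqrt f and 1/s are taken as generators, since s' = f'/(2 s). *)
Lemma smooth_on_sqrt f : (forall x, A x -> 0 < f x) -> smooth_on A f ->
  smooth_on A (fun x => Num.sqrt (f x)).
Proof.
move=> f0 sf; pose s x := Num.sqrt (f x).
have s0 x : A x -> s x != 0 by move=> Ax; rewrite sqrtr_eq0 -ltNge f0.
pose B g := [\/ smooth_on A g, g = s | g = (fun x => (s x)^-1)].
have sc x : A x -> {for x, continuous s}.
  move=> Ax; apply: continuous_comp; first exact: smooth_on_continuous sf Ax.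
  exact: sqrt_continuous.
have sd x i : A x -> is_derive x (delta_mx 0 i) s ((2 * s x)^-1 * pderiv i f x).
  move=> Ax; apply: is_derive_comp1; first exact: smooth_on_is_derive sf Ax.
  exact: is_derive1_sqrt (f0 _ Ax).
have smB : alg_gen B (fun x => (s x)^-1) by apply: alg_base; apply: Or33.
have smP i : alg_gen B (pderiv i f) by apply: alg_base; apply: Or31; exact: smooth_on_pderiv.
have smD i : alg_gen B (fun x => 2^-1 * (s x)^-1 * pderiv i f x).
  by apply: alg_mul => //; apply: alg_mul => //; exact: alg_cst.
apply: (@smooth_alg _ _ A B) => //; last by apply: alg_base; apply: Or32.
- move=> g x [sg|->|->] Ax; [exact: smooth_on_continuous sg Ax|exact: sc|].
  by apply: continuousV; [exact: s0|exact: sc].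
- move=> g x i [sg|->|->] Ax; [exact: smooth_on_derivable sg Ax|by have [] := sd x i Ax|].
  by apply: derivableV; [exact: s0|have [] := sd x i Ax].
- move=> g i [sg|->|->].
  + by exists (pderiv i g) => //; apply: alg_base; apply: Or31; exact: smooth_on_pderiv.
  + exists (fun x => 2^-1 * (s x)^-1 * pderiv i f x) => // x Ax.
    by have [_] := sd x i Ax; rewrite invfM.
  + exists (fun x => -1 * ((s x)^-1 * (s x)^-1) * (2^-1 * (s x)^-1 * pderiv i f x)).
      by apply: alg_mul => //; apply: alg_mul; [exact: alg_cst|exact: alg_mul].
    move=> x Ax; have [ds dsE] := sd x i Ax.
    rewrite /pderiv deriveV//; last exact: s0.
    by rewrite dsE /pderiv /GRing.scale/= expr2 !invfM; ring.
Qed.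
End SmoothOps.

(** The chain rule writes a derivative of k(Phi) as a sum of products of smooth functions with
    functions of the same form, so these form an admissible set of generators. *)
Lemma smooth_on_comp (R : realType) n m (A : set 'rV[R]_n) (A' : set 'rV[R]_m)
    (Phi : 'rV[R]_n -> 'rV[R]_m) (h : 'rV[R]_m -> R) :
  open A -> open A' -> (forall x, A x -> A' (Phi x)) ->
  (forall j, smooth_on A (fun x => Phi x 0 j)) -> smooth_on A' h ->
  smooth_on A (fun x => h (Phi x)).
Proof.
move=> oA oA' AA' sP sh.
pose B g := smooth_on A g \/ exists2 k, smooth_on A' k & g = (fun x => k (Phi x)).
have der k x i : smooth_on A' k -> A x -> is_derive x (delta_mx 0 i) (fun x => k (Phi x))
    (\sum_j pderiv i (fun x => Phi x 0 j) x * pderiv j k (Phi x)).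
  move=> sk Ax.
  have -> : \sum_j pderiv i (fun x => Phi x 0 j) x * pderiv j k (Phi x) =
     dirderiv k (Phi x) (\row_j pderiv i (fun x => Phi x 0 j) x).
    by apply: eq_bigr => j _; rewrite mxE.
  apply: chain_rule; first exact: smooth_on_strict sk (AA' _ Ax).
  by move=> j; rewrite mxE; exact: smooth_on_is_derive (sP j) Ax.
apply: (@smooth_alg _ _ A B) => //; last by apply: alg_base; right; exists h.
- move=> g x [sg|[k sk ->]] Ax; first exact: smooth_on_continuous sg Ax.
  apply/strict_continuous/(C1_strict oA Ax) => [y i Ay|i].
    by have [] := der k y i sk Ay.
  have e : \forall y \near x, (fun y => \sum_j pderiv i (fun x => Phi x 0 j) y * pderiv j k (Phi y)) y
      = pderiv i (fun x => k (Phi x)) y.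
    by apply: (near_open oA Ax) => y Ay; have [_ <-] := der k y i sk Ay.
  apply: (continuous_near_eq e).
  have PhiC : {for x, continuous Phi}.
    apply/continuous_epsP => eps e0.
    have [d d0 H] : exists2 d : R, 0 < d & forall r, r < d -> forall j y, `|y - x| <= r -> `|Phi y 0 j - Phi x 0 j| <= eps.
      apply: common_radius => j.
      have /continuous_epsP/(_ _ e0)[d d0 H] := smooth_on_continuous (sP j) Ax.
      by exists d => // r rd y yx; apply: H; exact: le_lt_trans rd.
    exists d => // y yx; apply: le_rVnorm; first exact: ltW.
    by move=> j; rewrite !mxE; exact: H yx _ _ (lexx _).
  apply: continuous_bigsum => j; apply: continuousM.
    exact: smooth_on_continuous (smooth_on_pderiv i (sP j)) Ax.
  apply: continuous_comp => //.
  exact: smooth_on_continuous (smooth_on_pderiv j sk) (AA' _ Ax).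
- move=> g x i [sg|[k sk ->]] Ax; first exact: smooth_on_derivable sg Ax.
  by have [] := der k x i sk Ax.
- move=> g i [sg|[k sk ->]].
    by exists (pderiv i g) => //; apply: alg_base; left; exact: smooth_on_pderiv.
  exists (fun x => \sum_j pderiv i (fun x => Phi x 0 j) x * pderiv j k (Phi x)).
    apply: alg_sum => j; apply: alg_mul; apply: alg_base.
      by left; exact: smooth_on_pderiv.
    by right; exists (pderiv j k); [exact: smooth_on_pderiv|].
  by move=> x Ax; have [] := der k x i sk Ax.
Qed.

Lemma delta_norm (R : realType) n (i : 'I_n) : `|delta_mx 0 i : 'rV[R]_n| <= 1.
Proof. by apply: le_rVnorm => // j; rewrite mxE eqxx/=; case: eqP; rewrite ?normr1 ?normr0. Qed.

Lemma dirderiv_delta (R : realType) n (f : 'rV[R]_n -> R) x i h :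
  dirderiv f x (h *: delta_mx 0 i) = h * pderiv i f x.
Proof.
rewrite /dirderiv (bigD1 i)//= big1 ?addr0 => [|j /negPf ji].
  by rewrite !mxE !eqxx mulr1.
by rewrite !mxE ji andbF mulr0 mul0r.
Qed.

(** The second difference of f over a small square is symmetric in the two directions, and divided
    by h^2 it tends to either mixed derivative. *)
Lemma schwarz (R : realType) n (A : set 'rV[R]_n) f x i j :
  open A -> smooth_on A f -> A x ->
  pderiv i (pderiv j f) x = pderiv j (pderiv i f) x.
Proof.
move=> oA sf Ax.
(* The mean value inequality in direction a is applied to the first difference in direction b;
   strict differentiability of [pderiv a f] controls the result. *)
have key (a b : 'I_n) e : 0 < e -> exists2 d : R, 0 < d & forall h, 0 < h < d ->
   `|f (x + h *: delta_mx 0 a + h *: delta_mx 0 b) - f (x + h *: delta_mx 0 a)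
     - f (x + h *: delta_mx 0 b) + f x - h ^+ 2 * pderiv b (pderiv a f) x| <= e * h ^+ 2.
  move=> e0.
  have sa := smooth_on_strict oA (smooth_on_pderiv a sf) Ax.
  have [d1 d10 H1] := sa e e0; have [d2 d20 H2] := open_ball_sub oA Ax.
  pose d := Num.min d1 d2 / 2.
  exists d; first by rewrite divr_gt0// lt_min d10.
  move=> h /andP[h0 hd].
  have small (s : R) (c : 'I_n) y : `|s| <= h -> `|y - x| <= h -> `|y + s *: delta_mx 0 c - x| < Num.min d1 d2.
    move=> sh yh; rewrite addrAC (le_lt_trans (ler_normD _ _))// normrZ.
    have : `|s| * `|delta_mx 0 c : 'rV[R]_n| <= h * 1.
      by apply: ler_pM => //; exact: delta_norm.
    move: hd; rewrite /d; lra.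
  pose k y := f (y + h *: delta_mx 0 b) - f y.
  have xs (s : R) : `|s| <= h -> `|x + s *: delta_mx 0 a - x| <= h.
    move=> sh; rewrite addrAC subrr add0r normrZ -[leRHS]mulr1.
    by apply: ler_pM => //; exact: delta_norm.
  have hh : `|h| <= h by rewrite ger0_norm// ltW.
  have A1 s : `|s| <= h -> A (x + s *: delta_mx 0 a).
    move=> sh; apply: H2.
    by have := small s a x sh; rewrite subrr normr0 => /(_ (ltW h0)); rewrite lt_min => /andP[].
  have A2 s : `|s| <= h -> A (x + s *: delta_mx 0 a + h *: delta_mx 0 b).
    by move=> sh; apply: H2; have := small h b _ hh (xs s sh); rewrite lt_min => /andP[].
  have kd s : `|s| <= h -> is_derive (x + s *: delta_mx 0 a) (delta_mx 0 a) k
      (pderiv a f (x + s *: delta_mx 0 a + h *: delta_mx 0 b) - pderiv a f (x + s *: delta_mx 0 a)).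
    move=> sh; apply: is_deriveB; last exact: smooth_on_is_derive sf (A1 _ sh).
    exact: is_derive_translate (smooth_on_is_derive a sf (A2 s sh)).
  have := @MVT_line R _ k x (delta_mx 0 a) h (h * pderiv b (pderiv a f) x) (e * h).
  rewrite (ger0_norm (ltW h0)) => M.
  rewrite (_ : _ - _ = k (x + h *: delta_mx 0 a) - k x - h * (h * pderiv b (pderiv a f) x)); last first.
    by rewrite /k; ring.
  rewrite (_ : e * h ^+ 2 = e * h * h); last by ring.
  apply: M => s sh; first by have [] := kd s sh.
  have [_ ->] := kd s sh.
  have s1 : `|x + s *: delta_mx 0 a - x| < d1.
    by have := small s a x sh; rewrite subrr normr0 => /(_ (ltW h0)); rewrite lt_min => /andP[].
  have s2 : `|x + s *: delta_mx 0 a + h *: delta_mx 0 b - x| < d1.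
    by have := small h b _ hh (xs s sh); rewrite lt_min => /andP[].
  have := H1 _ _ s1 s2.
  rewrite [x + s *: delta_mx 0 a + _ - (x + _)]addrAC subrr add0r dirderiv_delta.
  move=> /le_trans; apply.
  have hb : `|h *: delta_mx 0 b : 'rV[R]_n| <= h.
    by rewrite normrZ (ger0_norm (ltW h0)) ler_piMr ?(ltW h0)// delta_norm.
  by rewrite ler_wpM2l ?(ltW e0).
apply/eqP; rewrite -subr_eq0 -normr_le0; apply/ler_addgt0Pr => e e0; rewrite add0r.
have e20 : 0 < e / 2 by rewrite divr_gt0.
have [d1 d10 H1] := key j i _ e20; have [d2 d20 H2] := key i j _ e20.
pose h := Num.min d1 d2 / 2.
have hm : 0 < Num.min d1 d2 by rewrite lt_min d10.
have h0 : 0 < h by rewrite divr_gt0.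
have h1 : 0 < h < d1.
  by rewrite h0 (@lt_le_trans _ _ (Num.min d1 d2))// ?ge_min ?lexx// /h; lra.
have h2 : 0 < h < d2.
  by rewrite h0 (@lt_le_trans _ _ (Num.min d1 d2))// ?ge_min ?lexx ?orbT// /h; lra.
have := H1 h h1; have := H2 h h2.
rewrite [x + h *: delta_mx 0 i + h *: delta_mx 0 j]addrAC.
set S1 := f _; set S2 := f _; set S3 := f _; set P1 := pderiv _ _ _; set P2 := pderiv _ _ _.
move=> K2 K1; have hh0 : 0 < h ^+ 2 by rewrite exprn_gt0.
rewrite -(ler_pM2l hh0) -[X in X * _](ger0_norm (ltW hh0)) -normrM.
rewrite (_ : h ^+ 2 * _ = (S1 - S2 - S3 + f x - h ^+ 2 * P1) - (S1 - S3 - S2 + f x - h ^+ 2 * P2)); last by ring.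
apply: le_trans (ler_normB _ _) _; apply: le_trans (lerD K2 K1) _.
by rewrite (_ : _ + _ = h ^+ 2 * e)//; field.
Qed.

(** * Matrix calculus, orthonormal frames and curvature *)

Definition mxpderiv (R : realType) n p q (i : 'I_n) (F : 'rV[R]_n -> 'M[R]_(p, q)) x :=
  \matrix_(a, b) pderiv i (fun y => F y a b) x.

Lemma mxpderivE (R : realType) n p q (i : 'I_n) (F : 'rV[R]_n -> 'M[R]_(p, q)) x a b :
  mxpderiv i F x a b = pderiv i (fun y => F y a b) x.
Proof. by rewrite mxE. Qed.

Section MatrixCalculus.
Variables (R : realType) (n : nat) (A : set 'rV[R]_n).
Hypothesis oA : open A.

Lemma pderiv_eq (f g : 'rV[R]_n -> R) i x : (forall y, A y -> f y = g y) -> A x ->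
  pderiv i f x = pderiv i g x.
Proof. by move=> fg Ax; apply: near_eq_derive; exact: (near_open oA Ax). Qed.

Lemma pderivD (f g : 'rV[R]_n -> R) i x : smooth_on A f -> smooth_on A g -> A x ->
  pderiv i (fun y => f y + g y) x = pderiv i f x + pderiv i g x.
Proof.
move=> sf sg Ax; apply: deriveD; first exact: smooth_on_derivable sf Ax.
exact: smooth_on_derivable sg Ax.
Qed.

Lemma pderivM (f g : 'rV[R]_n -> R) i x : smooth_on A f -> smooth_on A g -> A x ->
  pderiv i (fun y => f y * g y) x = f x * pderiv i g x + g x * pderiv i f x.
Proof.
move=> sf sg Ax; apply: deriveM; first exact: smooth_on_derivable sf Ax.
exact: smooth_on_derivable sg Ax.
Qed.

Lemma pderiv_cst (c : R) i x : pderiv i (fun _ : 'rV[R]_n => c) x = 0.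
Proof. exact: derive_cst. Qed.

Lemma pderivN (f : 'rV[R]_n -> R) i x : smooth_on A f -> A x ->
  pderiv i (fun y => - f y) x = - pderiv i f x.
Proof. by move=> sf Ax; apply: deriveN; exact: smooth_on_derivable sf Ax. Qed.

Lemma pderivB (f g : 'rV[R]_n -> R) i x : smooth_on A f -> smooth_on A g -> A x ->
  pderiv i (fun y => f y - g y) x = pderiv i f x - pderiv i g x.
Proof.
move=> sf sg Ax; apply: deriveB; first exact: smooth_on_derivable sf Ax.
exact: smooth_on_derivable sg Ax.
Qed.

Lemma pderiv_sum m (F : 'I_m -> 'rV[R]_n -> R) i x :
  (forall j, smooth_on A (F j)) -> A x ->
  pderiv i (fun y => \sum_j F j y) x = \sum_j pderiv i (F j) x.
Proof.
move=> sF Ax; rewrite /pderiv -derive_sum; last first.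
  by move=> j; exact: smooth_on_derivable (sF j) Ax.
by congr ('D__ _ _); apply/funext => y; rewrite fct_sumE.
Qed.

Lemma smooth_mxM p q r (F : 'rV[R]_n -> 'M[R]_(p, q)) (G : 'rV[R]_n -> 'M[R]_(q, r)) :
  smooth_mx_on A F -> smooth_mx_on A G -> smooth_mx_on A (fun x => F x *m G x).
Proof.
move=> sF sG i j.
rewrite (_ : (fun x => _) = fun x => \sum_k F x i k * G x k j); last first.
  by apply/funext => x; rewrite mxE.
by apply: smooth_on_sum => // k; apply: smooth_onM.
Qed.

Lemma smooth_mxT p q (F : 'rV[R]_n -> 'M[R]_(p, q)) :
  smooth_mx_on A F -> smooth_mx_on A (fun x => (F x)^T).
Proof.
move=> sF i j; rewrite (_ : (fun x => _) = fun x => F x j i) //.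
by apply/funext => x; rewrite mxE.
Qed.

Lemma smooth_mxD p q (F G : 'rV[R]_n -> 'M[R]_(p, q)) :
  smooth_mx_on A F -> smooth_mx_on A G -> smooth_mx_on A (fun x => F x + G x).
Proof.
move=> sF sG i j; rewrite (_ : (fun x => _) = fun x => F x i j + G x i j).
  exact: smooth_onD.
by apply/funext => x; rewrite mxE.
Qed.

Lemma smooth_mxB p q (F G : 'rV[R]_n -> 'M[R]_(p, q)) :
  smooth_mx_on A F -> smooth_mx_on A G -> smooth_mx_on A (fun x => F x - G x).
Proof.
move=> sF sG i j; rewrite (_ : (fun x => _) = fun x => F x i j - G x i j).
  exact: smooth_onB.
by apply/funext => x; rewrite !mxE.
Qed.

Lemma smooth_mxpderiv p q i (F : 'rV[R]_n -> 'M[R]_(p, q)) :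
  smooth_mx_on A F -> smooth_mx_on A (mxpderiv i F).
Proof.
move=> sF a b; rewrite (_ : (fun x => _) = pderiv i (fun y => F y a b)).
  exact: smooth_on_pderiv.
by apply/funext => x; rewrite mxE.
Qed.

Lemma smooth_on_prod m (F : 'I_m -> 'rV[R]_n -> R) :
  (forall i, smooth_on A (F i)) -> smooth_on A (fun x => \prod_i F i x).
Proof.
move=> H; rewrite (_ : (fun x => _) = (fun x => \prod_(i <- index_enum 'I_m) F i x))//.
elim: (index_enum _) => [|i s IH].
  rewrite (_ : (fun x => _) = fun=> 1); first exact: smooth_on_cst.
  by apply/funext => x; rewrite big_nil.
rewrite (_ : (fun x => _) = fun x => F i x * \prod_(i <- s) F i x).
  exact: smooth_onM (H i) IH.
by apply/funext => x; rewrite big_cons.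
Qed.

Lemma smooth_det m (F : 'rV[R]_n -> 'M[R]_m) :
  smooth_mx_on A F -> smooth_on A (fun x => \det (F x)).
Proof.
move=> sF; rewrite /determinant.
apply: (smooth_on_sum oA) => k; apply: smooth_onM => //; first exact: smooth_on_cst.
by apply: smooth_on_prod => i; exact: sF.
Qed.

(** Cramer's rule: entries of the inverse are cofactors divided by the determinant. *)
Lemma smooth_invmx m (F : 'rV[R]_n -> 'M[R]_m) :
  (forall x, A x -> F x \in unitmx) ->
  smooth_mx_on A F -> smooth_mx_on A (fun x => invmx (F x)).
Proof.
move=> uF sF i j; apply: (@smooth_on_eq _ _ _ oA (fun x => (\det (F x))^-1 * cofactor (F x) j i)).
  by move=> x Ax; rewrite /invmx uF// !mxE.
apply: smooth_onM => //; first apply: smooth_onV => // [x Ax|].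
- by have := uF x Ax; rewrite unitmxE unitfE.
- exact: smooth_det.
- rewrite /cofactor; apply: smooth_onM => //; first exact: smooth_on_cst.
  apply: smooth_det => a b; rewrite (_ : (fun x => _) = fun x => F x (lift j a) (lift i b))//.
  by apply/funext => x; rewrite !mxE.
Qed.

Lemma mxpderivM p q r i (F : 'rV[R]_n -> 'M[R]_(p, q)) (G : 'rV[R]_n -> 'M[R]_(q, r)) x :
  smooth_mx_on A F -> smooth_mx_on A G -> A x ->
  mxpderiv i (fun y => F y *m G y) x = mxpderiv i F x *m G x + F x *m mxpderiv i G x.
Proof.
move=> sF sG Ax; apply/matrixP => a b; rewrite !mxE.
rewrite (_ : (fun y => _) = fun y => \sum_k F y a k * G y k b); last first.
  by apply/funext => y; rewrite mxE.
rewrite pderiv_sum// => [|k]; last exact: smooth_onM.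
rewrite -big_split/=; apply: eq_bigr => k _; rewrite pderivM// !mxE addrC.
by rewrite [G x k b * _]mulrC addrC.
Qed.

Lemma mxpderivB p q i (F G : 'rV[R]_n -> 'M[R]_(p, q)) x :
  smooth_mx_on A F -> smooth_mx_on A G -> A x ->
  mxpderiv i (fun y => F y - G y) x = mxpderiv i F x - mxpderiv i G x.
Proof.
move=> sF sG Ax; apply/matrixP => a b; rewrite !mxE.
rewrite (_ : (fun y => _) = fun y => F y a b - G y a b); last first.
  by apply/funext => y; rewrite !mxE.
by rewrite pderivB.
Qed.

Lemma mxpderiv_eq p q i (F G : 'rV[R]_n -> 'M[R]_(p, q)) x :
  (forall y, A y -> F y = G y) -> A x -> mxpderiv i F x = mxpderiv i G x.
Proof.
move=> FG Ax; apply/matrixP => a b; rewrite !mxE.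
by apply: pderiv_eq => // y Ay; rewrite FG.
Qed.

Lemma mxpderivT p q i (F : 'rV[R]_n -> 'M[R]_(p, q)) x :
  mxpderiv i (fun y => (F y)^T) x = (mxpderiv i F x)^T.
Proof.
apply/matrixP => a b; rewrite !mxE; congr pderiv.
by apply/funext => y; rewrite mxE.
Qed.

Lemma mxpderiv_cst p q i (C : 'M[R]_(p, q)) x : mxpderiv i (fun _ : 'rV[R]_n => C) x = 0.
Proof. by apply/matrixP => a b; rewrite !mxE pderiv_cst. Qed.

Lemma mxschwarz p q i j (F : 'rV[R]_n -> 'M[R]_(p, q)) x :
  smooth_mx_on A F -> A x -> mxpderiv i (mxpderiv j F) x = mxpderiv j (mxpderiv i F) x.
Proof.
move=> sF Ax; apply/matrixP => a b; rewrite [LHS]mxpderivE [RHS]mxpderivE.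
have e k : (fun y => mxpderiv k F y a b) = pderiv k (fun y => F y a b).
  by apply/funext => y; rewrite mxpderivE.
by rewrite (e i) (e j); exact: schwarz (sF a b) Ax.
Qed.
End MatrixCalculus.

(** * Levi-Civita connection and curvature in an orthonormal frame *)

Section Frames.
Variables (R : realType) (n : nat) (A : set 'rV[R]_n) (g : 'rV[R]_n -> 'M[R]_n).
Hypotheses (oA : open A) (sg : smooth_mx_on A g).
Hypothesis symg : forall x, A x -> (g x)^T = g x.
Hypothesis posg : forall x (v : 'rV[R]_n), A x -> v != 0 -> 0 < (v *m g x *m v^T) 0 0.

(** Indexed for row vectors: nabla_i Z has components [mxpderiv i Z + Z *m christoffel_mx i]. *)
Definition christoffel_mx i x : 'M[R]_n := \matrix_(k, l) christoffel g l i k x.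

Lemma metric_unit x : A x -> g x \in unitmx.
Proof.
move=> Ax; rewrite unitmxE unitfE; apply/negP => /det0P[v v0 vg].
by have := posg Ax v0; rewrite vg mul0mx mxE ltxx.
Qed.

Lemma metric_comm x i j : A x -> g x i j = g x j i.
Proof. by move=> Ax; rewrite -[in LHS](symg Ax) mxE. Qed.

Lemma pderiv_metric_comm l i j x : A x ->
  pderiv l (fun y => g y i j) x = pderiv l (fun y => g y j i) x.
Proof. by move=> Ax; apply: (pderiv_eq oA) => // y Ay; rewrite metric_comm. Qed.

Lemma christoffel_sym k i j x : A x -> christoffel g k i j x = christoffel g k j i x.
Proof.
move=> Ax; rewrite /christoffel; congr (_ * _); apply: eq_bigr => l _; congr (_ * _).
by rewrite (pderiv_metric_comm l i j Ax) [X in X - _]addrC.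
Qed.

Lemma smooth_christoffel k i j : smooth_on A (christoffel g k i j).
Proof.
apply: smooth_onM => //; first exact: smooth_on_cst.
apply: smooth_on_sum => // l; apply: smooth_onM => //.
  apply: (smooth_invmx oA _ sg); exact: metric_unit.
by apply: smooth_onB => //; [apply: smooth_onD => //|]; apply: smooth_on_pderiv; exact: sg.
Qed.

Lemma smooth_christoffel_mx i : smooth_mx_on A (christoffel_mx i).
Proof.
move=> k l; rewrite (_ : (fun x => _) = christoffel g l i k).
  exact: smooth_christoffel.
by apply/funext => x; rewrite mxE.
Qed.

(** Lowering the upper index cancels the inverse metric and leaves the Christoffel symbols of the
    first kind. *)
Lemma christoffel_lower i x k m : A x ->
  (christoffel_mx i x *m g x) k m = 2^-1 *
   (pderiv i (fun y => g y k m) x + pderiv k (fun y => g y i m) x - pderiv m (fun y => g y i k) x).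
Proof.
move=> Ax; rewrite mxE /christoffel.
under eq_bigr do rewrite mxE -mulrA mulr_suml.
rewrite -mulr_sumr exchange_big/=; congr (_ * _).
under eq_bigr do under eq_bigr do rewrite mulrAC.
under eq_bigr do rewrite -mulr_suml.
have inv q : \sum_l invmx (g x) l q * g x l m = (q == m)%:R.
  have /matrixP/(_ m q) := mulmxV (metric_unit Ax).
  rewrite !mxE eq_sym => <-; apply: eq_bigr => l _.
  by rewrite mulrC (metric_comm l m Ax).
rewrite (bigD1 m)//= inv eqxx mul1r big1 ?addr0// => q /negPf qm.
by rewrite inv qm mul0r.
Qed.

Lemma metric_compatible i x : A x ->
  mxpderiv i g x = christoffel_mx i x *m g x + g x *m (christoffel_mx i x)^T.
Proof.
move=> Ax; apply/matrixP => k m; rewrite [LHS]mxE.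
rewrite -[in X in _ + X](symg Ax) -trmx_mul [RHS]mxE [X in _ + X]mxE !christoffel_lower//.
rewrite (pderiv_metric_comm i m k Ax).
by field.
Qed.

Variable E : 'rV[R]_n -> 'M[R]_n.
Hypothesis sE : smooth_mx_on A E.
Hypothesis orthoE : forall x, A x -> E x *m g x *m (E x)^T = 1%:M.

(** Rows of [E] are the frame vectors e_a, so column a of [coframe] is the covector g(e_a, .). The
    entry (a, b) of [connection i] is g(nabla_i e_a, e_b). *)
Definition coframe x := g x *m (E x)^T.
Definition connection i x := (mxpderiv i E x + E x *m christoffel_mx i x) *m coframe x.

Lemma coframeE x : coframe x = g x *m (E x)^T. Proof. by []. Qed.
Lemma connectionE i x :
  connection i x = (mxpderiv i E x + E x *m christoffel_mx i x) *m coframe x.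
Proof. by []. Qed.
Lemma frame_coframe x : A x -> E x *m coframe x = 1%:M.
Proof. by move=> Ax; rewrite coframeE mulmxA orthoE. Qed.

Lemma coframe_frame x : A x -> coframe x *m E x = 1%:M.
Proof. by move=> Ax; apply: mulmx1C; exact: frame_coframe. Qed.

Lemma smooth_coframe : smooth_mx_on A coframe.
Proof. exact: (smooth_mxM oA sg (smooth_mxT sE)). Qed.

Lemma smooth_connection i : smooth_mx_on A (connection i).
Proof.
have s1 := smooth_mxM oA sE (smooth_christoffel_mx i).
exact: (smooth_mxM oA (smooth_mxD oA (smooth_mxpderiv i sE) s1) smooth_coframe).
Qed.

Lemma frame_derivative i x : A x ->
  mxpderiv i E x = connection i x *m E x - E x *m christoffel_mx i x.
Proof. by move=> Ax; rewrite connectionE -mulmxA coframe_frame// mulmx1 addrK. Qed.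

(** Obtained by differentiating [coframe *m E = 1], not from the definition of the coframe. *)
Lemma coframe_derivative i x : A x ->
  mxpderiv i coframe x = christoffel_mx i x *m coframe x - coframe x *m connection i x.
Proof.
move=> Ax; have := mxpderivM oA i smooth_coframe sE Ax.
rewrite (mxpderiv_eq oA i coframe_frame Ax) mxpderiv_cst.
move=> /(congr1 (mulmx^~ (coframe x))); rewrite mul0mx mulmxDl -mulmxA frame_coframe// mulmx1.
move/esym/eqP; rewrite addr_eq0 => /eqP ->.
rewrite (frame_derivative _ Ax).
move: (frame_coframe Ax) (coframe_frame Ax).
move: (connection i x) (christoffel_mx i x) (coframe x) (E x) => C G T F e1 e2.
rewrite mulmxBr mulmxBl opprB !mulmxA e2 mul1mx.
by rewrite -(mulmxA _ F) e1 mulmx1.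
Qed.

(** Differentiate E g E^T = 1 and substitute metric compatibility: the Christoffel terms cancel. *)
Lemma connection_antisym i x : A x -> (connection i x)^T = - connection i x.
Proof.
move=> Ax; apply/eqP; rewrite -addr_eq0 addrC; apply/eqP.
have sET := smooth_mxT sE; have sEg := smooth_mxM oA sE sg.
have := mxpderivM oA i sEg sET Ax.
rewrite (mxpderiv_eq oA i orthoE Ax) mxpderiv_cst (mxpderivM oA i sE sg Ax) mxpderivT.
rewrite (frame_derivative _ Ax) (metric_compatible _ Ax) => /esym <-.
move: (orthoE Ax) (symg Ax).
move: (connection i x) (christoffel_mx i x) (g x) (E x) => C G h F e1 e2.
have e3 : F *m (h *m F^T) = 1%:M by rewrite mulmxA.
rewrite [(_ - _)^T]linearB/= !trmx_mul !(mulmxDl, mulmxDr, mulNmx, mulmxN) !mulmxA e1 mul1mx.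
rewrite -[C *m F *m h *m _]mulmxA -[C *m F *m _]mulmxA e3 mulmx1.
move: (F *m G *m h *m F^T) (F *m h *m G^T *m F^T) => P Q.
by rewrite [C - P + _]addrA subrK -addrA [Q + _]addrC subrK.
Qed.

Definition curvature_mx i j x : 'M[R]_n := \matrix_(k, l) riemann_up g i j k l x.

Lemma curvature_mxE i j x : curvature_mx i j x =
  mxpderiv i (christoffel_mx j) x - mxpderiv j (christoffel_mx i) x
  + (christoffel_mx j x *m christoffel_mx i x - christoffel_mx i x *m christoffel_mx j x).
Proof.
apply/matrixP => k l; rewrite !mxE /riemann_up; congr (_ - _ + _).
- by congr pderiv; apply/funext => y; rewrite mxE.
- by congr pderiv; apply/funext => y; rewrite mxE.
- by rewrite -sumrB; apply: eq_bigr => m _; rewrite !mxE.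
Qed.

Lemma curvature_swap i j x : curvature_mx j i x = - curvature_mx i j x.
Proof.
rewrite !curvature_mxE opprD !opprB; congr (_ + _).
Qed.

(** Cartan's second structure equation. It is the equality of mixed partial derivatives of [E],
    expanded twice with [frame_derivative]. *)
Lemma frame_curvature i j x : A x ->
  E x *m curvature_mx i j x *m coframe x =
  mxpderiv i (connection j) x - mxpderiv j (connection i) x
  - (connection i x *m connection j x - connection j x *m connection i x).
Proof.
move=> Ax.
have der a b : mxpderiv a (mxpderiv b E) x =
   mxpderiv a (connection b) x *m E x + connection b x *m mxpderiv a E x
   - (mxpderiv a E x *m christoffel_mx b x + E x *m mxpderiv a (christoffel_mx b) x).
  have sc := smooth_connection b; have sG := smooth_christoffel_mx b.
  rewrite (mxpderiv_eq oA a (frame_derivative b) Ax).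
  rewrite (mxpderivB a (smooth_mxM oA sc sE) (smooth_mxM oA sE sG) Ax).
  by rewrite (mxpderivM oA a sc sE Ax) (mxpderivM oA a sE sG Ax).
have : mxpderiv i (mxpderiv j E) x = mxpderiv j (mxpderiv i E) x by exact: mxschwarz sE Ax.
rewrite !der !(frame_derivative _ Ax) curvature_mxE.
move: (frame_coframe Ax) (coframe_frame Ax).
move: (mxpderiv i (connection j) x) (mxpderiv j (connection i) x) => dij dji.
move: (mxpderiv i (christoffel_mx j) x) (mxpderiv j (christoffel_mx i) x) => gij gji.
move: (connection i x) (connection j x) (christoffel_mx i x) (christoffel_mx j x) => wi wj ci cj.
move: (coframe x) (E x) => T F e1 e2 H.
rewrite -[RHS]mulmx1 -e1 mulmxA; congr (_ *m T).
move: H; rewrite !(mulmxDl, mulmxDr, mulNmx, mulmxN) !mulmxA.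
move=> H; apply/matrixP => a b; move/matrixP: H => /(_ a b).
move: (F *m gij) (F *m gji) (F *m cj *m ci) (F *m ci *m cj) => P1 P2 P3 P4.
move: (dij *m F) (dji *m F) (wi *m wj *m F) (wj *m wi *m F) => P5 P6 P7 P8.
move: (wi *m F *m cj) (wj *m F *m ci) => P9 P10.
by rewrite !mxE => H; lra.
Qed.

(** After using the symmetry of the Christoffel symbols, the cyclic sum cancels term by term. *)
Lemma bianchi1 i j k l x : A x ->
  riemann_up g i j k l x + riemann_up g j k i l x + riemann_up g k i j l x = 0.
Proof.
move=> Ax; rewrite /riemann_up.
have sym a b c y := @christoffel_sym a b c y.
rewrite (pderiv_eq oA i (sym l k j) Ax) (pderiv_eq oA j (sym l i k) Ax) (pderiv_eq oA k (sym l j i) Ax).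
under eq_bigr => m _ do rewrite (sym m j k _ Ax) (sym m i k _ Ax).
under [in X in _ + X + _]eq_bigr => m _ do rewrite (sym m j i _ Ax).
set S1 := \sum_m _; set S2 := \sum_m _; set S3 := \sum_m _.
move: (pderiv i _ x) (pderiv j _ x) (pderiv k _ x) => p1 p2 p3.
have -> : S1 = - (S2 + S3).
  rewrite /S1 /S2 /S3 -big_split/= -sumrN; apply: eq_bigr => m _.
  move: (_ * _) (_ * _) (_ * _) => c1 c2 c3; ring.
ring.
Qed.
End Frames.

(** * Structure equations in dimension three *)

Notation o0 := (@Ordinal 3 0 isT).
Notation o1 := (@Ordinal 3 1 isT).
Notation o2 := (@Ordinal 3 2 isT).

Lemma sum3 (V : nmodType) (F : 'I_3 -> V) : \sum_i F i = F o0 + F o1 + F o2.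
Proof.
rewrite !big_ord_recl big_ord0 addr0 addrA.
by congr (F _ + F _ + F _); apply: val_inj.
Qed.

Lemma all3 (P : 'I_3 -> Prop) : P o0 -> P o1 -> P o2 -> forall i, P i.
Proof.
move=> H0 H1 H2 [[|[|[|//]]] Hi].
- by rewrite (_ : Ordinal Hi = o0)//; exact: val_inj.
- by rewrite (_ : Ordinal Hi = o1)//; exact: val_inj.
- by rewrite (_ : Ordinal Hi = o2)//; exact: val_inj.
Qed.

Lemma sum_delta (R : pzRingType) n (i : 'I_n) (F : 'I_n -> R) :
  \sum_j (i == j)%:R * F j = F i.
Proof.
rewrite (bigD1 i)//= eqxx mul1r big1 ?addr0// => j ji.
by rewrite eq_sym (negPf ji) mul0r.
Qed.

(** Components of the exterior derivative of a 1-form; [wedge] uses the matching normalization, with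
    no factor 1/2. *)
Definition ext (R : realType) (w : 'I_3 -> 'rV[R]_3 -> R) i j x : R :=
  pderiv i (w j) x - pderiv j (w i) x.
Definition wedge (R : realType) (u v : 'I_3 -> 'rV[R]_3 -> R) i j x : R :=
  u i x * v j x - u j x * v i x.

Section Structure.
Variables (R : realType) (A : set 'rV[R]_3).
Variables (e th : 'I_3 -> 'I_3 -> 'rV[R]_3 -> R) (w Gm : 'I_3 -> 'I_3 -> 'I_3 -> 'rV[R]_3 -> R).
Variable Rm : 'I_3 -> 'I_3 -> 'I_3 -> 'I_3 -> 'rV[R]_3 -> R.
Hypothesis oA : open A.
Hypothesis sw : forall a b i, smooth_on A (w a b i).
Hypothesis wN : forall a b i x, A x -> w a b i x = - w b a i x.
Hypothesis dth : forall a i j x, A x ->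
  pderiv i (th a j) x = \sum_l Gm l i j x * th a l x - \sum_b th b j x * w b a i x.
Hypothesis GmC : forall l i j x, A x -> Gm l i j x = Gm l j i x.
Hypothesis dw : forall a b i j x, A x ->
  ext (w a b) i j x = \sum_k \sum_l e a k x * Rm i j k l x * th b l x
   + \sum_c (w a c i x * w c b j x - w a c j x * w c b i x).
Hypothesis dual : forall a b x, A x -> \sum_i e a i x * th b i x = (a == b)%:R.
Hypothesis codual : forall i j x, A x -> \sum_a th a i x * e a j x = (i == j)%:R.
Hypothesis RmN : forall i j k l x, A x -> Rm j i k l x = - Rm i j k l x.
Hypothesis RmB : forall i j k l x, A x -> Rm i j k l x + Rm j k i l x + Rm k i j l x = 0.
Hypothesis null : forall j k l x, A x -> \sum_i e o2 i x * Rm i j k l x = 0.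

Lemma wD a i x : A x -> w a a i x = 0.
Proof. by move=> /(wN a a i) h; lra. Qed.

(** First structure equation: the terms in [Gm] are symmetric in i and j and drop out. *)
Lemma ext_th a i j x : A x ->
  ext (th a) i j x = \sum_b (th b i x * w b a j x - th b j x * w b a i x).
Proof.
move=> Ax; rewrite /ext !dth// sumrB.
under eq_bigr do rewrite GmC//.
set s := \sum_l _; set s1 := \sum_b _; set s2 := \sum_b _.
by move: s s1 s2 => s s1 s2; ring.
Qed.

Lemma ext_th0 i j x : A x -> ext (th o0) i j x =
  - wedge (w o1 o0) (th o1) i j x - wedge (w o2 o0) (th o2) i j x.
Proof. by move=> Ax; rewrite ext_th// sum3 /wedge !(wD o0)//; ring. Qed.

Lemma ext_th1 i j x : A x -> ext (th o1) i j x =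
  wedge (w o1 o0) (th o0) i j x - wedge (w o2 o1) (th o2) i j x.
Proof. by move=> Ax; rewrite ext_th// sum3 /wedge !(wD o1)// !(wN o0 o1)//; ring. Qed.

Definition Om a b i j x : R := \sum_k \sum_l e a k x * Rm i j k l x * th b l x.

(** Antisymmetry of the curvature forms is read off from the structure equation and [wN], so [Rm] is
    only ever used with its last index raised. *)
Lemma OmN i j a b x : A x -> Om a b i j x = - Om b a i j x.
Proof.
move=> Ax; have h c d := @dw c d i j x Ax.
have : ext (w a b) i j x = - ext (w b a) i j x.
  have pd k l : pderiv k (w a b l) x = - pderiv k (w b a l) x.
    rewrite -(pderivN k (@sw b a l) Ax).
    by apply: (pderiv_eq oA) => // y Ay; exact: wN.
  by rewrite /ext !pd; ring.
rewrite !h -!/(Om _ _ _ _ _).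
have -> : \sum_c (w b c i x * w c a j x - w b c j x * w c a i x)
  = - \sum_c (w a c i x * w c b j x - w a c j x * w c b i x).
  rewrite -sumrN; apply: eq_bigr => c _.
  by rewrite (wN b c i Ax) (wN c a j Ax) (wN b c j Ax) (wN c a i Ax); ring.
set s := \sum_c _; move: s (Om a b i j x) (Om b a i j x) => s p q; lra.
Qed.

(** The Bianchi identity moves the null vector from the first slot to the third. *)
Lemma null3 i j l x : A x -> \sum_k e o2 k x * Rm i j k l x = 0.
Proof.
move=> Ax.
have b k : Rm i j k l x = Rm k j i l x - Rm k i j l x.
  have := RmB i j k l Ax; rewrite (RmN k j)//.
  by move: (Rm i j k l x) (Rm k j i l x) (Rm k i j l x) => p q r; lra.
under eq_bigr do rewrite b mulrBr.
by rewrite sumrB !null// subrr.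
Qed.

Lemma Om_row2 i j b x : A x -> Om o2 b i j x = 0.
Proof.
move=> Ax; rewrite /Om exchange_big/= big1// => l _.
by rewrite -mulr_suml null3// mul0r.
Qed.

Lemma Om_null j a b x : A x -> \sum_i e o2 i x * Om a b i j x = 0.
Proof.
move=> Ax; rewrite /Om.
under eq_bigr do rewrite mulr_sumr.
rewrite exchange_big/= big1// => k _.
under eq_bigr do rewrite mulr_sumr.
rewrite exchange_big/= big1// => l _.
under eq_bigr do rewrite mulrA mulrCA.
by rewrite -mulr_suml -mulr_sumr null// mulr0 mul0r.
Qed.

Lemma Om_swap i j a b x : A x -> Om a b j i x = - Om a b i j x.
Proof.
move=> Ax; rewrite /Om -sumrN; apply: eq_bigr => k _; rewrite -sumrN; apply: eq_bigr => l _.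
by rewrite RmN//; ring.
Qed.

(** The sectional curvature of the plane spanned by e0 and e1. *)
Definition curv_coef x : R := \sum_i \sum_j e o0 i x * e o1 j x * Om o1 o0 i j x.

(** In dimension three a 2-form annihilated by e2 is a multiple of theta0 wedge theta1; the proof
    expands it in the coframe. *)
Lemma Om10 i j x : A x -> Om o1 o0 i j x = curv_coef x * wedge (th o0) (th o1) i j x.
Proof.
move=> Ax.
pose W a b := \sum_i \sum_j e a i x * e b j x * Om o1 o0 i j x.
have expand : Om o1 o0 i j x = \sum_a \sum_b th a i x * th b j x * W a b.
  have -> : \sum_a \sum_b th a i x * th b j x * W a b =
     \sum_p \sum_q (\sum_a th a i x * e a p x) * (\sum_b th b j x * e b q x) * Om o1 o0 p q x.
    rewrite /W; under eq_bigr do under eq_bigr do rewrite mulr_sumr.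
    under eq_bigr do rewrite exchange_big/=.
    rewrite exchange_big/=; apply: eq_bigr => p _.
    under eq_bigr do under eq_bigr do rewrite mulr_sumr.
    under eq_bigr do rewrite exchange_big/=.
    rewrite exchange_big/=; apply: eq_bigr => q _.
    rewrite mulr_suml mulr_suml; apply: eq_bigr => a _.
    rewrite -mulrA mulr_suml mulr_sumr; apply: eq_bigr => b _.
    ring.
  under eq_bigr do under eq_bigr do rewrite !codual// -mulrA.
  by under eq_bigr do rewrite -mulr_sumr sum_delta; rewrite sum_delta.
have W2 b : W o2 b = 0.
  rewrite /W exchange_big/= big1// => q _.
  under eq_bigr do rewrite mulrAC.
  by rewrite -mulr_suml Om_null// mul0r.
have Wsw a b : W a b = - W b a.
  rewrite /W exchange_big/= -sumrN; apply: eq_bigr => q _.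
  rewrite -sumrN; apply: eq_bigr => p _; rewrite Om_swap//.
  by rewrite mulrN [e a p x * _]mulrC.
have Wd a : W a a = 0 by have := Wsw a a; move: (W a a) => r; lra.
rewrite expand !sum3 !Wd W2 (Wsw o0 o2) W2 (Wsw o1 o2) !W2 (Wsw o1 o0) /wedge.
rewrite -[W o0 o1]/(curv_coef x); move: (curv_coef x) => c; ring.
Qed.

Lemma RmE i j k l x : A x ->
  Rm i j k l x = \sum_a \sum_b th a k x * Om a b i j x * e b l x.
Proof.
move=> Ax; rewrite /Om.
have -> : \sum_a \sum_b th a k x * (\sum_p \sum_q e a p x * Rm i j p q x * th b q x) * e b l x =
  \sum_p \sum_q (\sum_a th a k x * e a p x) * Rm i j p q x * (\sum_b th b q x * e b l x).
  under eq_bigr do under eq_bigr do rewrite mulr_sumr mulr_suml.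
  under eq_bigr do rewrite exchange_big/=.
  rewrite exchange_big/=; apply: eq_bigr => p _.
  under eq_bigr do under eq_bigr do rewrite mulr_sumr mulr_suml.
  under eq_bigr do rewrite exchange_big/=.
  rewrite exchange_big/=; apply: eq_bigr => q _.
  rewrite -mulrA mulr_suml; apply: eq_bigr => a _.
  rewrite !mulr_sumr; apply: eq_bigr => b _.
  ring.
under eq_bigr do under eq_bigr do rewrite !codual// mulrC [_ == l]eq_sym mulrCA.
by under eq_bigr do rewrite -mulr_sumr sum_delta; rewrite sum_delta.
Qed.

(** Only the curvature forms with indices 0, 1 survive in the expansion [RmE], and contracting with
    dual bases leaves two squares. *)
Lemma ricci_sum j k x : A x -> \sum_i Rm i j k i x =
  curv_coef x * (th o0 j x * th o0 k x + th o1 j x * th o1 k x).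
Proof.
move=> Ax; under eq_bigr do rewrite RmE//.
have D a i : Om a a i j x = 0 by have := OmN i j a a Ax; move: (Om _ _ _ _ _) => r; lra.
have h i : \sum_a \sum_b th a k x * Om a b i j x * e b i x =
   curv_coef x * ((th o1 k x * th o1 j x) * (e o0 i x * th o0 i x)
     - (th o1 k x * th o0 j x) * (e o0 i x * th o1 i x)
     - (th o0 k x * th o1 j x) * (e o1 i x * th o0 i x)
     + (th o0 k x * th o0 j x) * (e o1 i x * th o1 i x)).
  rewrite !sum3 !D !Om_row2// (OmN i j o0 o2)// (OmN i j o1 o2)// !Om_row2//.
  rewrite (OmN i j o0 o1)// Om10// /wedge.
  move: (curv_coef x) => c; ring.
under eq_bigr do rewrite h.
rewrite -mulr_sumr !big_split/= !sumrN -!mulr_sumr !dual//=.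
move: (curv_coef x) => c; ring.
Qed.

Lemma ext_al i j x : A x -> ext (w o1 o0) i j x =
  wedge (w o2 o0) (w o2 o1) i j x + curv_coef x * wedge (th o0) (th o1) i j x.
Proof.
move=> Ax; rewrite dw// -/(Om _ _ _ _ _) Om10// sum3 /wedge !(wD o0)// !(wD o1)// !(wN o1 o2)//.
move: (curv_coef x) => c; ring.
Qed.

Lemma ext_be i j x : A x -> ext (w o2 o0) i j x = - wedge (w o1 o0) (w o2 o1) i j x.
Proof.
by move=> Ax; rewrite dw// -/(Om _ _ _ _ _) Om_row2// sum3 /wedge !(wD o0)// !(wD o2)//; ring.
Qed.

Lemma ext_ga i j x : A x -> ext (w o2 o1) i j x = wedge (w o1 o0) (w o2 o0) i j x.
Proof.
move=> Ax; rewrite dw// -/(Om _ _ _ _ _) Om_row2// sum3 /wedge !(wD o1)// !(wD o2)// !(wN o0 o1)//.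
ring.
Qed.

End Structure.

(** * Exterior calculus of 2-forms in three coordinates *)

Definition ext2 (R : realType) (F : 'I_3 -> 'I_3 -> 'rV[R]_3 -> R) x : R :=
  pderiv o0 (F o1 o2) x + pderiv o1 (F o2 o0) x + pderiv o2 (F o0 o1) x.
(** A 3-form in three variables has one component: [ext2] and [wedge21] are that component of dF and
    of F wedge v, for antisymmetric F. *)
Definition wedge21 (R : realType) (F : 'I_3 -> 'I_3 -> 'rV[R]_3 -> R) (v : 'I_3 -> 'rV[R]_3 -> R) x : R :=
  F o1 o2 x * v o0 x + F o2 o0 x * v o1 x + F o0 o1 x * v o2 x.

Section ExteriorCalculus.
Variables (R : realType) (A : set 'rV[R]_3).
Hypothesis oA : open A.
Implicit Types u v w : 'I_3 -> 'rV[R]_3 -> R.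

Lemma ext2_eq (F G : 'I_3 -> 'I_3 -> 'rV[R]_3 -> R) x :
  (forall i j y, A y -> F i j y = G i j y) -> A x -> ext2 F x = ext2 G x.
Proof.
by move=> FG Ax; rewrite /ext2; congr (_ + _ + _); apply: (pderiv_eq oA) => // y; exact: FG.
Qed.

Lemma ext2_ext w x : (forall i, smooth_on A (w i)) -> A x -> ext2 (ext w) x = 0.
Proof.
move=> sw Ax; rewrite /ext2 /ext.
rewrite !(pderivB _ (smooth_on_pderiv _ (sw _)) (smooth_on_pderiv _ (sw _)) Ax).
rewrite (schwarz o0 o1 oA (sw _) Ax) (schwarz o0 o2 oA (sw _) Ax) (schwarz o1 o2 oA (sw _) Ax).
by move: (pderiv _ _ _) (pderiv _ _ _) (pderiv _ _ _) => p q r; ring.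
Qed.

Lemma smooth_wedge u v i j : (forall i, smooth_on A (u i)) -> (forall i, smooth_on A (v i)) ->
  smooth_on A (wedge u v i j).
Proof.
move=> su sv.
exact: (smooth_onB oA (smooth_onM oA (su i) (sv j)) (smooth_onM oA (su j) (sv i))).
Qed.

Lemma ext2_wedge u v x : (forall i, smooth_on A (u i)) -> (forall i, smooth_on A (v i)) -> A x ->
  ext2 (wedge u v) x = wedge21 (ext u) v x - wedge21 (ext v) u x.
Proof.
move=> su sv Ax; rewrite /ext2 /wedge21 /ext.
have d k i j : pderiv k (wedge u v i j) x = u i x * pderiv k (v j) x + v j x * pderiv k (u i) x
   - (u j x * pderiv k (v i) x + v i x * pderiv k (u j) x).
  rewrite (pderivB _ (smooth_onM oA (su i) (sv j)) (smooth_onM oA (su j) (sv i)) Ax).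
  by rewrite (pderivM _ (su i) (sv j) Ax) (pderivM _ (su j) (sv i) Ax).
rewrite !d.
move: (pderiv o0 (u o1) x) (pderiv o0 (u o2) x) (pderiv o1 (u o0) x) (pderiv o1 (u o2) x) (pderiv o2 (u o0) x) (pderiv o2 (u o1) x) => a1 a2 a3 a4 a5 a6.
move: (pderiv o0 (v o1) x) (pderiv o0 (v o2) x) (pderiv o1 (v o0) x) (pderiv o1 (v o2) x) (pderiv o2 (v o0) x) (pderiv o2 (v o1) x) => b1 b2 b3 b4 b5 b6.
ring.
Qed.

Lemma ext2D (F G : 'I_3 -> 'I_3 -> 'rV[R]_3 -> R) c d x :
  (forall i j, smooth_on A (F i j)) -> (forall i j, smooth_on A (G i j)) -> A x ->
  ext2 (fun i j y => c * F i j y + d * G i j y) x = c * ext2 F x + d * ext2 G x.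
Proof.
move=> sF sG Ax; rewrite /ext2.
have sc c0 := @smooth_on_cst R 3 A oA c0.
have D k i j : pderiv k (fun y => c * F i j y + d * G i j y) x = c * pderiv k (F i j) x + d * pderiv k (G i j) x.
  rewrite (pderivD k (smooth_onM oA (sc c) (sF i j)) (smooth_onM oA (sc d) (sG i j)) Ax).
  by rewrite (pderivM k (sc c) (sF i j) Ax) (pderivM k (sc d) (sG i j) Ax) !pderiv_cst !mulr0 !addr0.
rewrite !D.
move: (pderiv o0 (F _ _) x) (pderiv o1 (F _ _) x) (pderiv o2 (F _ _) x) => f1 f2 f3.
move: (pderiv o0 (G _ _) x) (pderiv o1 (G _ _) x) (pderiv o2 (G _ _) x) => g1 g2 g3.
ring.
Qed.
End ExteriorCalculus.

(** * The covariant derivative of the null field is nilpotent *)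

Section Nilpotence.
Variables (R : realType) (A : set 'rV[R]_3) (K : R).
Variables (e th : 'I_3 -> 'I_3 -> 'rV[R]_3 -> R) (al be ga : 'I_3 -> 'rV[R]_3 -> R).
Hypotheses (oA : open A) (K0 : K != 0).
Hypothesis sth : forall a i, smooth_on A (th a i).
Hypotheses (sal : forall i, smooth_on A (al i)) (sbe : forall i, smooth_on A (be i))
  (sga : forall i, smooth_on A (ga i)).
Hypothesis dual : forall a b x, A x -> \sum_i e a i x * th b i x = (a == b)%:R.
Hypothesis codual : forall i j x, A x -> \sum_a th a i x * e a j x = (i == j)%:R.
Hypothesis dth0 : forall i j x, A x -> ext (th o0) i j x =
  - wedge al (th o1) i j x - wedge be (th o2) i j x.
Hypothesis dth1 : forall i j x, A x -> ext (th o1) i j x =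
  wedge al (th o0) i j x - wedge ga (th o2) i j x.
Hypothesis dth2 : forall i j x, A x -> ext (th o2) i j x =
  wedge be (th o0) i j x + wedge ga (th o1) i j x.
Hypothesis dal : forall i j x, A x -> ext al i j x =
  wedge be ga i j x + K * wedge (th o0) (th o1) i j x.
Hypothesis dbe : forall i j x, A x -> ext be i j x = - wedge al ga i j x.
Hypothesis dga : forall i j x, A x -> ext ga i j x = wedge al be i j x.

Definition comp (u : 'I_3 -> 'rV[R]_3 -> R) a x := \sum_i e a i x * u i x.

Lemma compE u i x : A x -> u i x = \sum_a comp u a x * th a i x.
Proof.
move=> Ax; rewrite /comp; under eq_bigr do rewrite mulr_suml.
rewrite exchange_big/= -[LHS](sum_delta i (fun j => u j x)); apply: eq_bigr => j _.
by rewrite -(codual i j Ax) mulr_suml; apply: eq_bigr => a _; ring.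
Qed.

(** Its product with the determinant of the frame is the determinant of the identity, by
    multiplicativity written out for three rows. *)
Lemma coframe_det_neq0 x : A x -> wedge21 (wedge (th o0) (th o1)) (th o2) x != 0.
Proof.
move=> Ax.
have D a b := dual a b Ax.
have h : wedge21 (wedge (th o0) (th o1)) (th o2) x * wedge21 (wedge (e o0) (e o1)) (e o2) x =
  let m a b := \sum_i e a i x * th b i x in
  m o0 o0 * (m o1 o1 * m o2 o2 - m o1 o2 * m o2 o1)
  - m o0 o1 * (m o1 o0 * m o2 o2 - m o1 o2 * m o2 o0)
  + m o0 o2 * (m o1 o0 * m o2 o1 - m o1 o1 * m o2 o0).
  by rewrite /= !sum3 /wedge21 /wedge; ring.
move: h; rewrite /= !D/= => h; apply/negP => /eqP h0; move: h; rewrite h0; lra.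
Qed.

(** These are d d = 0 for [al], [be] and [ga]. After substituting the structure equations, all terms
    without curvature cancel and a factor K remains. *)
Lemma nullity_eqs x : A x ->
  [/\ wedge21 (wedge be (th o1)) (th o2) x + wedge21 (wedge (th o0) ga) (th o2) x = 0,
      wedge21 (wedge (th o0) (th o1)) ga x = 0 & wedge21 (wedge (th o0) (th o1)) be x = 0].
Proof.
move=> Ax.
have swd u v : (forall i, smooth_on A (u i)) -> (forall i, smooth_on A (v i)) ->
    forall i j, smooth_on A (wedge u v i j) by move=> su sv i j; exact: smooth_wedge.
have E1 : ext2 (fun i j y => 1 * wedge be ga i j y + K * wedge (th o0) (th o1) i j y) x = 0.
  rewrite -[RHS](ext2_ext oA sal Ax); apply: (ext2_eq oA) => // i j y Ay.
  by rewrite dal// mul1r.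
have E2 : ext2 (fun i j y => (-1) * wedge al ga i j y + 0 * wedge al ga i j y) x = 0.
  rewrite -[RHS](ext2_ext oA sbe Ax); apply: (ext2_eq oA) => // i j y Ay.
  by rewrite dbe// mul0r addr0 mulN1r.
have E3 : ext2 (wedge al be) x = 0.
  by rewrite -[RHS](ext2_ext oA sga Ax); apply: (ext2_eq oA) => // i j y Ay; rewrite dga.
move: E1 E2 E3.
rewrite (ext2D oA _ _ (swd _ _ sbe sga) (swd _ _ (sth _) (sth _)) Ax).
rewrite (ext2D oA _ _ (swd _ _ sal sga) (swd _ _ sal sga) Ax).
rewrite (ext2_wedge oA sbe sga Ax) (ext2_wedge oA (sth o0) (sth o1) Ax).
rewrite (ext2_wedge oA sal sga Ax) (ext2_wedge oA sal sbe Ax).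
rewrite /wedge21 !dal// !dbe// !dga// !dth0// !dth1// /wedge.
(* Here nonzero curvature matters: the identities hold multiplied by K. *)
move=> E1 E2 E3; split; apply: (mulfI K0); rewrite mulr0.
- by rewrite -[RHS]E1; ring.
- by rewrite -[RHS]oppr0 -[in RHS]E2; ring.
- by rewrite -[RHS]E3; ring.
Qed.

Lemma wedge21_comp u x : A x -> wedge21 (wedge (th o0) (th o1)) u x =
  comp u o2 x * wedge21 (wedge (th o0) (th o1)) (th o2) x.
Proof. by move=> Ax; rewrite /wedge21 /wedge !(compE u _ Ax) !sum3; ring. Qed.

(** Both components of nabla_{e2} e2 vanish: the integral curves of e2 are geodesics. *)
Lemma comp2_0 x : A x -> comp be o2 x = 0 /\ comp ga o2 x = 0.
Proof.
move=> Ax; have [_ E2 E3] := nullity_eqs Ax; have D := coframe_det_neq0 Ax.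
by split; apply: (mulIf D); rewrite mul0r -wedge21_comp.
Qed.

(** The divergence of e2 is zero. *)
Lemma comp_trace x : A x -> comp ga o1 x = - comp be o0 x.
Proof.
move=> Ax; have [E1 _ _] := nullity_eqs Ax; have D := coframe_det_neq0 Ax.
have [b2 g2] := comp2_0 Ax.
apply/eqP; rewrite -addr_eq0 addrC -(mulIr_eq0 _ (mulIf D)); apply/eqP.
rewrite -[RHS]E1 /wedge21 /wedge !(compE be _ Ax) !(compE ga _ Ax) !sum3 b2 g2; ring.
Qed.

Lemma be_comp i x : A x -> be i x = comp be o0 x * th o0 i x + comp be o1 x * th o1 i x.
Proof. by move=> Ax; rewrite {1}(compE be i Ax) sum3 (comp2_0 Ax).1; ring. Qed.

Lemma ga_comp i x : A x -> ga i x = comp ga o0 x * th o0 i x - comp be o0 x * th o1 i x.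
Proof. by move=> Ax; rewrite {1}(compE ga i Ax) sum3 (comp2_0 Ax).2 comp_trace//; ring. Qed.

(** With trace zero already known, this determinant condition is what makes De square to zero. It
    comes from differentiating the trace condition, viewed as an identity of 2-forms. *)
Lemma comp_det x : A x -> comp be o0 x ^+ 2 + comp be o1 x * comp ga o0 x = 0.
Proof.
move=> Ax; have D := coframe_det_neq0 Ax.
have swd u v : (forall i, smooth_on A (u i)) -> (forall i, smooth_on A (v i)) ->
    forall i j, smooth_on A (wedge u v i j) by move=> su sv i j; exact: smooth_wedge.
(* The 2-form be wedge theta1 + theta0 wedge ga is the trace times theta0 wedge theta1, hence
   identically zero; its exterior derivative is -2 times the determinant times the volume form. *)
have : ext2 (fun i j y => 1 * wedge be (th o1) i j y + 1 * wedge (th o0) ga i j y) x = 0.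
  have <- : ext2 (fun i j y => 0) x = 0 by rewrite /ext2 !pderiv_cst !addr0.
  apply: (ext2_eq oA) => // i j y Ay; rewrite /wedge !be_comp// !ga_comp//; ring.
rewrite (ext2D oA _ _ (swd _ _ sbe (sth _)) (swd _ _ (sth _) sga) Ax).
rewrite (ext2_wedge oA sbe (sth o1) Ax) (ext2_wedge oA (sth o0) sga Ax).
rewrite /wedge21 !dbe// !dga// !dth0// !dth1// /wedge => E.
apply: (mulIf D); rewrite mul0r; apply: (@mulfI _ (2%:R : R)); first by rewrite pnatr_eq0.
rewrite mulr0 -[RHS]oppr0 -[in RHS]E /wedge21 /wedge !be_comp// !ga_comp//; ring.
Qed.
End Nilpotence.

(** * Change of coordinates *)

Lemma pderiv_comp (R : realType) n m (A : set 'rV[R]_n) (B : set 'rV[R]_m)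
    (phi : 'rV[R]_n -> 'rV[R]_m) (f : 'rV[R]_m -> R) i x :
  open A -> open B -> (forall x, A x -> B (phi x)) -> smooth_mx_on A phi -> smooth_on B f ->
  A x -> pderiv i (fun y => f (phi y)) x = \sum_p jac phi x i p * pderiv p f (phi x).
Proof.
move=> oA oB AB sphi sf Ax.
have := @chain_rule R _ m f phi x (delta_mx 0 i) (\row_p jac phi x i p).
case=> [|k|_]; first exact: smooth_on_strict sf (AB _ Ax).
  rewrite !mxE; exact: smooth_on_is_derive (sphi 0 k) Ax.
by move=> E; rewrite /pderiv [LHS]E; apply: eq_bigr => p _; rewrite mxE.
Qed.

Lemma smooth_jac (R : realType) n m (A : set 'rV[R]_n) (phi : 'rV[R]_n -> 'rV[R]_m) :
  open A -> smooth_mx_on A phi -> smooth_mx_on A (jac phi).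
Proof.
move=> oA s i j; rewrite (_ : (fun x => _) = pderiv i (fun y => phi y 0 j)).
  exact: smooth_on_pderiv (s 0 j).
by apply/funext => x; rewrite mxE.
Qed.

Lemma smooth_mx_comp (R : realType) n m p q (A : set 'rV[R]_n) (B : set 'rV[R]_m)
    (phi : 'rV[R]_n -> 'rV[R]_m) (F : 'rV[R]_m -> 'M[R]_(p, q)) :
  open A -> open B -> (forall x, A x -> B (phi x)) -> smooth_mx_on A phi -> smooth_mx_on B F ->
  smooth_mx_on A (fun x => F (phi x)).
Proof.
move=> oA oB AB sphi sF i j.
exact: (smooth_on_comp oA oB AB (sphi 0) (sF i j)).
Qed.

Lemma mxpderiv_comp (R : realType) n m p q (A : set 'rV[R]_n) (B : set 'rV[R]_m)
    (phi : 'rV[R]_n -> 'rV[R]_m) (F : 'rV[R]_m -> 'M[R]_(p, q)) i x :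
  open A -> open B -> (forall x, A x -> B (phi x)) -> smooth_mx_on A phi -> smooth_mx_on B F ->
  A x -> mxpderiv i (fun y => F (phi y)) x = \sum_k jac phi x i k *: mxpderiv k F (phi x).
Proof.
move=> oA oB AB sphi sF Ax; apply/matrixP => a b; rewrite mxpderivE.
rewrite (pderiv_comp i oA oB AB sphi (sF a b) Ax) summxE; apply: eq_bigr => k _.
rewrite [RHS]mxE; congr (_ * _); rewrite [RHS]mxE.
reflexivity.
Qed.

(** The algebra behind uniqueness of the Levi-Civita connection: alternating the two symmetries
    returns Y with the opposite sign. *)
Lemma braid0 (R : realType) n (Y : 'I_n -> 'I_n -> 'I_n -> R) :
  (forall i j k, Y i j k = Y j i k) -> (forall i j k, Y i j k = - Y i k j) ->
  forall i j k, Y i j k = 0.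
Proof.
move=> S N i j k.
have : Y i j k = - Y i j k by rewrite {1}N S N opprK S N S.
move=> h; lra.
Qed.

Section ChangeOfCoordinates.
Variables (R : realType) (n : nat) (A B : set 'rV[R]_n) (phi : 'rV[R]_n -> 'rV[R]_n).
Variables (g h : 'rV[R]_n -> 'M[R]_n).
Hypotheses (oA : open A) (oB : open B) (AB : forall x, A x -> B (phi x)).
Hypotheses (sphi : smooth_mx_on A phi) (sg : smooth_mx_on A g) (sh : smooth_mx_on B h).
Hypothesis symg : forall x, A x -> (g x)^T = g x.
Hypothesis symh : forall x, B x -> (h x)^T = h x.
Hypothesis posg : forall x (v : 'rV[R]_n), A x -> v != 0 -> 0 < (v *m g x *m v^T) 0 0.
Hypothesis posh : forall x (v : 'rV[R]_n), B x -> v != 0 -> 0 < (v *m h x *m v^T) 0 0.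
Hypothesis gE : forall x, A x -> g x = jac phi x *m h (phi x) *m (jac phi x)^T.

Lemma jac_unit x : A x -> jac phi x \in unitmx.
Proof.
move=> Ax; have := metric_unit posg Ax; rewrite gE// unitmx_mul => /andP[].
by rewrite unitmx_mul => /andP[].
Qed.

Definition pulled_christoffel i x : 'M[R]_n :=
  \sum_p jac phi x i p *: christoffel_mx h p (phi x).

(** The connection of h pulled back by phi is torsion free and preserves g, so uniqueness identifies
    it with the connection of g. *)
Lemma christoffel_change i x : A x ->
  mxpderiv i (jac phi) x =
  christoffel_mx g i x *m jac phi x - jac phi x *m pulled_christoffel i x.
Proof.
move=> Ax; have uJ := jac_unit Ax; have Bx := AB Ax.
(* [Bm] is the pulled-back connection, [X] its difference from that of g, and [Y] the difference
   with lowered index, to which [braid0] applies. *)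
pose Bm i := (mxpderiv i (jac phi) x + jac phi x *m pulled_christoffel i x) *m invmx (jac phi x).
pose X i := christoffel_mx g i x - Bm i.
pose Y i j k := (X i *m g x) j k.
have sJ := smooth_jac oA sphi.
have sht := smooth_mx_comp oA oB AB sphi sh.
have dh k : mxpderiv k (fun y => h (phi y)) x =
    pulled_christoffel k x *m h (phi x) + h (phi x) *m (pulled_christoffel k x)^T.
  rewrite (mxpderiv_comp k oA oB AB sphi sh Ax) /pulled_christoffel linear_sum/=.
  rewrite mulmx_suml mulmx_sumr -big_split/=; apply: eq_bigr => p _.
  rewrite (metric_compatible oB symh posh p Bx) linearZ/= -scalemxAl -scalemxAr.
  by rewrite scalerDr.
have dg k : mxpderiv k g x = Bm k *m g x + g x *m (Bm k)^T.
  rewrite (mxpderiv_eq oA k gE Ax).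
  rewrite (mxpderivM oA k (smooth_mxM oA sJ sht) (smooth_mxT sJ) Ax).
  rewrite (mxpderivM oA k sJ sht Ax) mxpderivT dh gE// /Bm.
  move: (mxpderiv k (jac phi) x) (pulled_christoffel k x) (h (phi x)) uJ => D P H.
  move: (jac phi x) => J uJ.
  have e : J^T *m ((D + J *m P) *m invmx J)^T = (D + J *m P)^T by rewrite -trmx_mul mulmxKV.
  rewrite !mulmxA (mulmxKV uJ) -[J *m H *m J^T *m _]mulmxA e.
  rewrite [(D + _)^T]linearD/= trmx_mul !(mulmxDl, mulmxDr) !mulmxA.
  by rewrite -!addrA; congr (_ + (_ + _)); rewrite addrC.
have Y0 : forall i j k, Y i j k = 0.
  apply: braid0 => [a b c|a b c].
  - suff sX l : X a b l = X b a l by rewrite /Y !mxE; apply: eq_bigr => l _; rewrite sX.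
    have eX d f : (X d *m jac phi x) f = (christoffel_mx g d x *m jac phi x
      - (mxpderiv d (jac phi) x + jac phi x *m pulled_christoffel d x)) f.
      by rewrite /X mulmxBl /Bm mulmxKV.
    suff : row b (X a) = row a (X b) by move=> /rowP/(_ l); rewrite !mxE.
    suff : row b (X a *m jac phi x) = row a (X b *m jac phi x).
      by rewrite !row_mul => /(can_inj (mulmxK uJ)).
    apply/rowP => m; rewrite [LHS]mxE [RHS]mxE !eX !mxE; congr (_ - (_ + _)).
    + by apply: eq_bigr => q _; rewrite !mxE (christoffel_sym oA symg _ _ _ Ax).
    + rewrite (_ : (fun y => _) = pderiv b (fun y => phi y 0 m)); last by apply/funext => y; rewrite mxE.
      rewrite [in RHS](_ : (fun y => _) = pderiv a (fun y => phi y 0 m)); last by apply/funext => y; rewrite mxE.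
      exact: schwarz (sphi 0 m) Ax.
    + rewrite /pulled_christoffel.
      under eq_bigr do rewrite summxE mulr_sumr.
      under [RHS]eq_bigr do rewrite summxE mulr_sumr.
      rewrite exchange_big/=; apply: eq_bigr => p _; apply: eq_bigr => q _.
      by rewrite !mxE (christoffel_sym oB symh m p q Bx); ring.
  - have := metric_compatible oA symg posg a Ax; rewrite dg => E.
    have {}E : X a *m g x + g x *m (X a)^T = 0.
      rewrite /X mulmxBl [(_ - _)^T]linearB/= mulmxBr.
      by rewrite addrACA -opprD E subrr.
    have /matrixP/(_ b c) := E; rewrite mxE [in X in _ = X -> _]mxE => /eqP.
    rewrite addr_eq0 => /eqP; rewrite /Y => ->; congr (- _).
    by rewrite -[in LHS](symg Ax) -trmx_mul mxE.
have X0 : X i = 0.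
  have : X i *m g x = 0 by apply/matrixP => j k; rewrite [RHS]mxE; exact: Y0.
  by move=> H; rewrite -[X i](mulmxK (metric_unit posg Ax)) H mul0mx.
have /eqP : X i = 0 := X0; rewrite subr_eq0 => /eqP ->.
by rewrite /Bm mulmxKV// addrK.
Qed.

End ChangeOfCoordinates.

(** * Adapted frames *)

Definition metric_on (R : realType) n (A : set 'rV[R]_n) (g : 'rV[R]_n -> 'M[R]_n) : Prop :=
  [/\ open A, smooth_mx_on A g, forall x, A x -> (g x)^T = g x &
      forall x (v : 'rV[R]_n), A x -> v != 0 -> 0 < (v *m g x *m v^T) 0 0].

Lemma smooth_mx_sub (R : realType) n p q (A B : set 'rV[R]_n) (F : 'rV[R]_n -> 'M[R]_(p, q)) :
  A `<=` B -> smooth_mx_on B F -> smooth_mx_on A F.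
Proof. by move=> AB sF i j; exact: smooth_on_sub (sF i j). Qed.

Lemma metric_on_sub (R : realType) n (A B : set 'rV[R]_n) g :
  open A -> A `<=` B -> metric_on B g -> metric_on A g.
Proof.
move=> oA AB [_ sg symg posg]; split=> //.
- exact: smooth_mx_sub sg.
- by move=> x /AB; exact: symg.
- by move=> x v /AB; exact: posg.
Qed.

Definition ip (R : realType) n (g : 'rV[R]_n -> 'M[R]_n) x (u v : 'rV[R]_n) : R :=
  (u *m g x *m v^T) 0 0.

(** Row i is nabla_i Z, so as an operator on row vectors the matrix sends v to nabla_v Z. *)
Definition covd (R : realType) n (g : 'rV[R]_n -> 'M[R]_n) (Z : 'rV[R]_n -> 'rV[R]_n) x : 'M[R]_n :=
  \matrix_(i, l) (mxpderiv i Z x + Z x *m christoffel_mx g i x) 0 l.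

Lemma row_covd (R : realType) n (g : 'rV[R]_n -> 'M[R]_n) Z x i :
  row i (covd g Z x) = mxpderiv i Z x + Z x *m christoffel_mx g i x.
Proof. by apply/rowP => l; rewrite [LHS]mxE [LHS]mxE. Qed.

(** The squared norm |nabla Z|^2 with respect to g, a scalar independent of the chart by
    [covd_norm_change]. *)
Definition covd_norm (R : realType) n (g : 'rV[R]_n -> 'M[R]_n) Z x : R :=
  \tr (invmx (g x) *m covd g Z x *m g x *m (covd g Z x)^T).

Lemma covd_change (R : realType) n (A B : set 'rV[R]_n) (phi : 'rV[R]_n -> 'rV[R]_n) g h
    (Z Z' : 'rV[R]_n -> 'rV[R]_n) x :
  metric_on A g -> metric_on B h -> (forall x, A x -> B (phi x)) -> smooth_mx_on A phi ->
  (forall x, A x -> g x = jac phi x *m h (phi x) *m (jac phi x)^T) ->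
  smooth_mx_on A Z -> smooth_mx_on B Z' ->
  (forall x, A x -> Z' (phi x) = Z x *m jac phi x) -> A x ->
  covd g Z x *m jac phi x = jac phi x *m covd h Z' (phi x).
Proof.
move=> [oA sg symg posg] [oB sh symh posh] AB sphi gE sZ sZ' ZE Ax.
apply/row_matrixP => i; rewrite !row_mul row_covd.
have sJ := smooth_jac oA sphi.
have := mxpderivM oA i sZ sJ Ax.
rewrite -(mxpderiv_eq oA i ZE Ax) (mxpderiv_comp i oA oB AB sphi sZ' Ax).
rewrite (christoffel_change oA oB AB sphi sh symg symh posg posh gE i Ax).
rewrite mulmxBr !mulmxA -ZE// => E.
have {}E : \sum_k jac phi x i k *: mxpderiv k Z' (phi x) + Z' (phi x) *m pulled_christoffel phi h i x =
   (mxpderiv i Z x + Z x *m christoffel_mx g i x) *m jac phi x.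
  by rewrite E mulmxDl addrA subrK.
rewrite -E /pulled_christoffel mulmx_sumr -big_split/=.
rewrite mulmx_sum_row; apply: eq_bigr => p _.
by rewrite row_covd scalerDr -scalemxAr [X in _ = X *: _ + _]mxE [X in _ = _ + X *: _]mxE.
Qed.

Lemma covd_norm_change (R : realType) n (A B : set 'rV[R]_n) (phi : 'rV[R]_n -> 'rV[R]_n) g h
    (Z Z' : 'rV[R]_n -> 'rV[R]_n) x :
  metric_on A g -> metric_on B h -> (forall x, A x -> B (phi x)) -> smooth_mx_on A phi ->
  (forall x, A x -> g x = jac phi x *m h (phi x) *m (jac phi x)^T) ->
  smooth_mx_on A Z -> smooth_mx_on B Z' ->
  (forall x, A x -> Z' (phi x) = Z x *m jac phi x) -> A x ->
  covd_norm g Z x = covd_norm h Z' (phi x).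
Proof.
move=> mA mB AB sphi gE sZ sZ' ZE Ax.
have := covd_change mA mB AB sphi gE sZ sZ' ZE Ax.
have [oA sg symg posg] := mA; have [oB sh symh posh] := mB.
have uJ := jac_unit posg gE Ax; have uh := metric_unit posh (AB _ Ax).
rewrite /covd_norm (gE _ Ax).
move: (covd g Z x) (covd h Z' (phi x)) (h (phi x)) uh (jac phi x) uJ => C C' H uH J uJ E.
have {E} : C = J *m C' *m invmx J by rewrite -E mulmxK.
have := mulmxV uJ; have := mulVmx uJ; move: (invmx J) => Ji e1 e2 ->.
have e3 : J^T *m Ji^T = 1%:M by rewrite -trmx_mul e1 trmx1.
have e4 := mulmxV uH.
have iv : invmx (J *m H *m J^T) = Ji^T *m invmx H *m Ji.
  have e : (J *m H *m J^T) *m (Ji^T *m invmx H *m Ji) = 1%:M.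
    rewrite !mulmxA -(mulmxA _ J^T) e3 mulmx1 -(mulmxA _ H) e4 mulmx1.
    exact: e2.
  have uG : J *m H *m J^T \in unitmx by case/mulmx1_unit: e.
  by rewrite -[RHS](mulKmx uG) e mulmx1.
rewrite iv !trmx_mul !mulmxA.
rewrite -(mulmxA _ Ji J) e1 mulmx1 -(mulmxA _ Ji J) e1 mulmx1 -(mulmxA _ J^T) e3 mulmx1.
by rewrite -!mulmxA mxtrace_mulC -!mulmxA e3 mulmx1.
Qed.

Lemma open_nonzero (R : realType) n (A : set 'rV[R]_n) (f : 'rV[R]_n -> R) :
  open A -> (forall x, A x -> {for x, continuous f}) -> open [set x | A x /\ f x != 0].
Proof.
move=> oA cf; rewrite openE => x [Ax fx].
apply: filterS2 (open_nbhs_nbhs (conj oA Ax)) _ => [y Ay fy|]; first by split; [exact: Ay|exact: fy].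
apply: (cf x Ax [set y | y != 0]); apply: open_nbhs_nbhs; split => //; exact: open_neq.
Qed.

(** * Gram-Schmidt frames with prescribed vectors *)

Section FrameExistence.
Variables (R : realType) (A : set 'rV[R]_3) (g : 'rV[R]_3 -> 'M[R]_3).
Hypothesis mg : metric_on A g.

Lemma smooth_ip (B : set 'rV[R]_3) u v : open B -> B `<=` A -> smooth_mx_on B u -> smooth_mx_on B v ->
  smooth_on B (fun x => ip g x (u x) (v x)).
Proof.
move=> oB BA su sv; have [_ sg _ _] := mg.
exact: (smooth_mxM oB (smooth_mxM oB su (smooth_mx_sub BA sg)) (smooth_mxT sv)).
Qed.

Lemma ipC x u v : A x -> ip g x u v = ip g x v u.
Proof.
move=> Ax; have [_ _ symg _] := mg; rewrite /ip.
rewrite -[in LHS](trmxK (u *m _ *m _)) [LHS]mxE !trmx_mul trmxK symg//.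
by rewrite mulmxA.
Qed.

Lemma ipBl x u v w : ip g x (u - v) w = ip g x u w - ip g x v w.
Proof. by rewrite /ip !mulmxBl mxE [X in _ + X]mxE. Qed.

Lemma ipZl x a u w : ip g x (a *: u) w = a * ip g x u w.
Proof. by rewrite /ip -!scalemxAl mxE. Qed.

Lemma ipZr x a u w : ip g x u (a *: w) = a * ip g x u w.
Proof. by rewrite /ip linearZ/= -scalemxAr mxE. Qed.

Lemma ip_gt0 x u : A x -> u != 0 -> 0 < ip g x u u.
Proof. by have [_ _ _ posg] := mg => Ax u0; exact: posg. Qed.

Lemma ip0l x u : ip g x 0 u = 0.
Proof. by rewrite /ip !mul0mx mxE. Qed.

Lemma ip_eq0 x u : A x -> (ip g x u u == 0) = (u == 0).
Proof.
move=> Ax; apply/idP/idP => [|/eqP ->]; last by rewrite ip0l.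
by apply: contraTT => /(ip_gt0 Ax) h; rewrite gt_eqF.
Qed.

Lemma ip_row x (F : 'M[R]_3) a b : ip g x (row a F) (row b F) = (F *m g x *m F^T) a b.
Proof.
rewrite /ip -row_mul [LHS]mxE [RHS]mxE; apply: eq_bigr => k _.
by rewrite [row a _ _ _]mxE [(row b _)^T _ _]mxE [row b _ _ _]mxE [F^T _ _]mxE.
Qed.

Definition unit_field (Z : 'rV[R]_3 -> 'rV[R]_3) x := (Num.sqrt (ip g x (Z x) (Z x)))^-1 *: Z x.

Lemma unit_field_ip Z x : A x -> Z x != 0 -> ip g x (unit_field Z x) (unit_field Z x) = 1.
Proof.
move=> Ax Z0; rewrite ipZl ipZr mulrA -expr2 exprVn sqr_sqrtr ?ltW ?ip_gt0//.
by rewrite mulVf// ip_eq0.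
Qed.

Lemma smooth_scale (B : set 'rV[R]_3) (f : 'rV[R]_3 -> R) (Z : 'rV[R]_3 -> 'rV[R]_3) :
  open B -> smooth_on B f -> smooth_mx_on B Z -> smooth_mx_on B (fun x => f x *: Z x).
Proof.
move=> oB sf sZ i j; rewrite (_ : (fun x => _) = fun x => f x * Z x i j).
  exact: (smooth_onM oB sf (sZ i j)).
by apply/funext => x; rewrite mxE.
Qed.

Lemma smooth_unit_field (B : set 'rV[R]_3) Z : open B -> B `<=` A -> smooth_mx_on B Z ->
  (forall x, B x -> Z x != 0) -> smooth_mx_on B (unit_field Z).
Proof.
move=> oB BA sZ Z0; have pos x : B x -> 0 < ip g x (Z x) (Z x).
  by move=> Bx; apply: ip_gt0; [exact: BA|exact: Z0].
apply: (smooth_scale oB _ sZ); apply: (smooth_onV oB).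
  by move=> x Bx; rewrite sqrtr_eq0 -ltNge pos.
exact: (smooth_on_sqrt oB pos (smooth_ip oB BA sZ sZ)).
Qed.

Definition reject (e Z : 'rV[R]_3 -> 'rV[R]_3) x := Z x - ip g x (Z x) (e x) *: e x.

Lemma smooth_reject (B : set 'rV[R]_3) e Z : open B -> B `<=` A -> smooth_mx_on B e ->
  smooth_mx_on B Z -> smooth_mx_on B (reject e Z).
Proof.
move=> oB BA se sZ; apply: (smooth_mxB oB sZ).
exact: (smooth_scale oB (smooth_ip oB BA sZ se) se).
Qed.

Lemma reject_ip e Z x : ip g x (e x) (e x) = 1 -> ip g x (reject e Z x) (e x) = 0.
Proof. by move=> e1; rewrite ipBl ipZl e1 mulr1 subrr. Qed.

Lemma reject2_ip x c e f : ip g x e e = 1 -> ip g x f f = 1 -> ip g x e f = 0 -> ip g x f e = 0 ->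
  ip g x (c - ip g x c e *: e - ip g x c f *: f) e = 0 /\
  ip g x (c - ip g x c e *: e - ip g x c f *: f) f = 0.
Proof. by move=> ee ff ef fe; rewrite !ipBl !ipZl ee ff ef fe; split; ring. Qed.

(** Otherwise every coordinate vector would be a multiple of e and the identity matrix, of trace 3,
    would have trace g(e, e) = 1. *)
Lemma exists_reject1 x e : A x -> ip g x e e = 1 ->
  exists i, delta_mx 0 i - ip g x (delta_mx 0 i) e *: e != 0.
Proof.
move=> Ax e1; apply: contrapT => /forallNP H.
have E i : delta_mx 0 i = ip g x (delta_mx 0 i) e *: e.
  by apply/eqP; rewrite -subr_eq0; apply: contraT => /(H i).
have : \tr (1%:M : 'M[R]_3) = \tr (g x *m e^T *m e).
  congr (\tr _); apply/row_matrixP => i; rewrite row1 !row_mul [LHS]E.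
  rewrite [X in X *m e](_ : _ = (ip g x (delta_mx 0 i) e)%:M); first by rewrite mul_scalar_mx.
  by rewrite rowE [LHS]mx11_scalar.
rewrite mxtrace1 mxtrace_mulC mulmxA /mxtrace big_ord_recl big_ord0 addr0 -/(ip g x e e) e1.
by move=> h; lra.
Qed.

(** The same trace count: two unit vectors can account for only 2 of the trace 3. *)
Lemma exists_reject2 x e f : A x -> ip g x e e = 1 -> ip g x f f = 1 ->
  exists i, delta_mx 0 i - ip g x (delta_mx 0 i) e *: e - ip g x (delta_mx 0 i) f *: f != 0.
Proof.
move=> Ax e1 f1; apply: contrapT => /forallNP H.
have E i : delta_mx 0 i = ip g x (delta_mx 0 i) e *: e + ip g x (delta_mx 0 i) f *: f.
  by apply/eqP; rewrite -subr_eq0 opprD addrA; apply: contraT => /(H i).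
have rk u i : row i (g x *m u^T *m u) = ip g x (delta_mx 0 i) u *: u.
  rewrite !row_mul [X in X *m u](_ : _ = (ip g x (delta_mx 0 i) u)%:M); first by rewrite mul_scalar_mx.
  by rewrite rowE [LHS]mx11_scalar.
have : \tr (1%:M : 'M[R]_3) = \tr (g x *m e^T *m e + g x *m f^T *m f).
  congr (\tr _); apply/row_matrixP => i; rewrite row1 linearD/= !rk; exact: E.
have tr u : \tr (g x *m u^T *m u) = ip g x u u.
  by rewrite mxtrace_mulC mulmxA /mxtrace big_ord_recl big_ord0 addr0.
by rewrite mxtrace1 mxtraceD !tr e1 f1 => h; lra.
Qed.

(** Two of the three directions are prescribed: e2 along [Y], later the null field, and e0 along the
    part of [X] orthogonal to it, later the image of De. The third comes from a coordinate vector;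
    the domain shrinks at each normalization to keep the vector nonzero. *)
Lemma frame_existence (x0 : 'rV[R]_3) (X Y : 'rV[R]_3 -> 'rV[R]_3) :
  A x0 -> smooth_mx_on A X -> smooth_mx_on A Y -> Y x0 != 0 ->
  reject (unit_field Y) X x0 != 0 ->
  exists B E, [/\ open B, B x0, B `<=` A, smooth_mx_on B E &
    [/\ forall x, B x -> Y x != 0,
        forall x, B x -> reject (unit_field Y) X x != 0,
        forall x, B x -> E x *m g x *m (E x)^T = 1%:M,
        forall x, row o2 (E x) = unit_field Y x &
        forall x, row o0 (E x) = unit_field (reject (unit_field Y) X) x]].
Proof.
move=> Ax0 sX sY Y0 X0.
have [oA sg symg posg] := mg.
have nz (B : set 'rV[R]_3) (Z : 'rV[R]_3 -> 'rV[R]_3) : open B -> B `<=` A -> smooth_mx_on B Z -> B x0 -> Z x0 != 0 ->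
   exists C, [/\ open C, C x0, C `<=` B & forall x, C x -> Z x != 0].
  move=> oB BA sZ Bx0 Z0; exists [set x | B x /\ ip g x (Z x) (Z x) != 0]; split.
  - apply: open_nonzero => // x Bx; exact: smooth_on_continuous (smooth_ip oB BA sZ sZ) Bx.
  - by split => //; rewrite ip_eq0//; exact: BA.
  - by move=> x [].
  - by move=> x [Bx]; rewrite ip_eq0//; exact: BA.
have [B1 [oB1 B1x B1A Y1]] := nz A Y oA (@subset_refl _ A) sY Ax0 Y0.
have se2 := smooth_unit_field oB1 B1A (smooth_mx_sub B1A sY) Y1.
set e2 := unit_field Y in X0 se2 *.
have sX' := smooth_reject oB1 B1A se2 (smooth_mx_sub B1A sX).
have [B2 [oB2 B2x B2B X2]] := nz B1 _ oB1 B1A sX' B1x X0.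
have B2A := subset_trans B2B B1A.
have se0 := smooth_unit_field oB2 B2A (smooth_mx_sub B2B sX') X2.
set e0 := unit_field (reject e2 X) in se0 *.
have e22 x : B2 x -> ip g x (e2 x) (e2 x) = 1.
  by move=> Bx; apply: unit_field_ip; [exact: B2A|apply: Y1; exact: B2B].
have e00 x : B2 x -> ip g x (e0 x) (e0 x) = 1.
  by move=> Bx; apply: unit_field_ip; [exact: B2A|exact: X2].
have e02 x : B2 x -> ip g x (e0 x) (e2 x) = 0.
  by move=> Bx; rewrite ipZl reject_ip ?mulr0// e22.
have [i ei] := exists_reject2 Ax0 (e00 _ B2x) (e22 _ B2x).
pose Z x := delta_mx 0 i - ip g x (delta_mx 0 i) (e0 x) *: e0 x - ip g x (delta_mx 0 i) (e2 x) *: e2 x.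
have sd : smooth_mx_on B2 (fun _ => delta_mx 0 i : 'rV[R]_3).
  by move=> a b; exact: smooth_on_cst.
have se2' := smooth_mx_sub B2B se2.
have sZ : smooth_mx_on B2 Z.
  apply: (smooth_mxB oB2); last exact: (smooth_scale oB2 (smooth_ip oB2 B2A sd se2') se2').
  exact: (smooth_mxB oB2 sd (smooth_scale oB2 (smooth_ip oB2 B2A sd se0) se0)).
have [B3 [oB3 B3x B3B Z3]] := nz B2 Z oB2 B2A sZ B2x ei.
have B3A := subset_trans B3B B2A.
have se1 := smooth_unit_field oB3 B3A (smooth_mx_sub B3B sZ) Z3.
set e1 := unit_field Z in se1.
have e11 x : B3 x -> ip g x (e1 x) (e1 x) = 1.
  by move=> Bx; apply: unit_field_ip; [exact: B3A|exact: Z3].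
have e20 x : B2 x -> ip g x (e2 x) (e0 x) = 0 by move=> Bx; rewrite ipC ?e02//; exact: B2A.
have e10 x : B3 x -> ip g x (e1 x) (e0 x) = 0.
  move=> Bx; have B2x' := B3B _ Bx.
  have [r0 _] := reject2_ip (delta_mx 0 i) (e00 _ B2x') (e22 _ B2x') (e02 _ B2x') (e20 _ B2x').
  by rewrite [LHS]ipZl r0 mulr0.
have e12 x : B3 x -> ip g x (e1 x) (e2 x) = 0.
  move=> Bx; have B2x' := B3B _ Bx.
  have [_ r0] := reject2_ip (delta_mx 0 i) (e00 _ B2x') (e22 _ B2x') (e02 _ B2x') (e20 _ B2x').
  by rewrite [LHS]ipZl r0 mulr0.
pose E x : 'M[R]_3 := \matrix_(a, l) (if a == o0 then e0 x else if a == o1 then e1 x else e2 x) 0 l.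
have rE x a : row a (E x) = if a == o0 then e0 x else if a == o1 then e1 x else e2 x.
  by apply/rowP => l; rewrite !mxE.
exists B3, E; split => //.
- apply: all3 => l.
  + rewrite (_ : (fun x => _) = fun x => e0 x 0 l); last by apply/funext => x; rewrite mxE.
    exact: smooth_on_sub B3B (se0 0 l).
  + rewrite (_ : (fun x => _) = fun x => e1 x 0 l); last by apply/funext => x; rewrite mxE.
    exact: se1.
  + rewrite (_ : (fun x => _) = fun x => e2 x 0 l); last by apply/funext => x; rewrite mxE.
    exact: smooth_on_sub B3B (se2' 0 l).
- split.
  + by move=> x Bx; apply: Y1; apply: B2B; exact: B3B.
  + by move=> x Bx; apply: X2; exact: B3B.
  + move=> x Bx; apply/matrixP => a b.
    have Bx2 := B3B _ Bx; have Ax := B3A _ Bx.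
    rewrite -ip_row !rE mxE; move: a b; apply: all3; apply: all3 => /=;
      rewrite ?e00 ?e11 ?e22 ?e02 ?e20 ?e10 ?e12 //.
    * by rewrite ipC// e10.
    * by rewrite ipC// e12.
  + by move=> x; rewrite rE.
  + by move=> x; rewrite rE.
Qed.

End FrameExistence.

(** * Structure equations of a metric with null field *)

Section LocalStructure.
Variables (R : realType) (A : set 'rV[R]_3) (g E : 'rV[R]_3 -> 'M[R]_3) (K : R).
Hypotheses (mg : metric_on A g) (sE : smooth_mx_on A E) (K0 : K != 0).
Hypothesis orthoE : forall x, A x -> E x *m g x *m (E x)^T = 1%:M.
Hypothesis null : forall x j k l, A x -> \sum_i E x o2 i * riemann g i j k l x = 0.
Hypothesis scal : forall x, A x -> scalar_curvature g x = 2 * K.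

(* nabla_(d_i) e_a = \sum_b (cn a b i) e_b, where e_a is the row a of E. *)
Definition fr a i x : R := E x a i.
Definition cf a i x : R := coframe g E x i a.
Definition cn a b i x : R := connection g E i x a b.

Let oA : open A. Proof. by case: mg. Qed.
Let sg : smooth_mx_on A g. Proof. by case: mg. Qed.
Let symg x : A x -> (g x)^T = g x. Proof. by case: mg => _ _ h _; exact: h. Qed.
Let posg x (v : 'rV[R]_3) : A x -> v != 0 -> 0 < (v *m g x *m v^T) 0 0.
Proof. by case: mg => _ _ _ h; exact: h. Qed.

Lemma fr_dual a b x : A x -> \sum_i fr a i x * cf b i x = (a == b)%:R.
Proof.
move=> Ax; have /matrixP/(_ a b) := frame_coframe orthoE Ax.
by rewrite [LHS]mxE [RHS]mxE.
Qed.

Lemma fr_codual i j x : A x -> \sum_a cf a i x * fr a j x = (i == j)%:R.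
Proof.
move=> Ax; have /matrixP/(_ i j) := coframe_frame orthoE Ax.
by rewrite [LHS]mxE [RHS]mxE.
Qed.

Lemma smooth_fr a i : smooth_on A (fr a i). Proof. exact: sE. Qed.

Lemma smooth_cf a i : smooth_on A (cf a i).
Proof. exact: (smooth_coframe oA sg sE). Qed.

Lemma smooth_cn a b i : smooth_on A (cn a b i).
Proof. exact: (smooth_connection oA sg posg sE). Qed.

Lemma cnN a b i x : A x -> cn a b i x = - cn b a i x.
Proof.
move=> Ax; have /matrixP/(_ b a) := connection_antisym oA sg symg posg sE orthoE i Ax.
by rewrite [LHS]mxE [RHS]mxE.
Qed.

Lemma cf_partial a i j x : A x -> pderiv i (cf a j) x =
  \sum_l christoffel g l i j x * cf a l x - \sum_b cf b j x * cn b a i x.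
Proof.
move=> Ax; have /matrixP/(_ j a) := coframe_derivative oA sg sE orthoE i Ax.
rewrite [LHS]mxE => E1; rewrite [LHS]E1 [LHS]mxE [X in X + _]mxE [X in _ + X]mxE [X in - X]mxE.
by congr (_ - _); apply: eq_bigr => l _; rewrite mxE.
Qed.

Lemma ext_cn_mx a b i j x : ext (cn a b) i j x =
  mxpderiv i (connection g E j) x a b - mxpderiv j (connection g E i) x a b.
Proof.
by rewrite /ext /cn; congr (_ - _); rewrite [RHS]mxpderivE.
Qed.

Lemma ext_cn a b i j x : A x ->
  ext (cn a b) i j x = \sum_k \sum_l fr a k x * riemann_up g i j k l x * cf b l x
   + \sum_c (cn a c i x * cn c b j x - cn a c j x * cn c b i x).
Proof.
move=> Ax.
have gen (P Q X Y F G F' G' : 'M[R]_3) : P *m Q = X - Y - (F *m G - F' *m G') ->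
    X a b - Y a b = \sum_l P a l * Q l b + \sum_c (F a c * G c b - F' a c * G' c b).
  move=> h; have : (P *m Q) a b = \sum_l P a l * Q l b by rewrite mxE.
  by move=> <-; rewrite h !mxE -sumrB subrK.
have := gen _ _ _ _ _ _ _ _ (frame_curvature oA sg posg sE orthoE i j Ax).
move=> h; apply: (etrans (ext_cn_mx a b i j x)); apply: (etrans h) => {h}.
congr (_ + _); rewrite exchange_big/=; apply: eq_bigr => l _.
by rewrite mxE mulr_suml; apply: eq_bigr => k _; rewrite mxE.
Qed.

(** Invertibility of g turns nullity of the lowered curvature tensor into nullity of
    [riemann_up]. *)
Lemma null_up j k l x : A x -> \sum_i fr o2 i x * riemann_up g i j k l x = 0.
Proof.
move=> Ax; pose v : 'rV[R]_3 := \row_m \sum_i E x o2 i * riemann_up g i j k m x.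
have v0 : v *m g x = 0.
  apply/rowP => m; rewrite [RHS]mxE -(null j k m Ax) mxE /riemann.
  under eq_bigr do rewrite mxE mulr_suml.
  rewrite exchange_big/=; apply: eq_bigr => i _; rewrite mulr_sumr.
  by apply: eq_bigr => p _; rewrite mulrA.
have : v = 0 by rewrite -[v](mulmxK (metric_unit posg Ax)) v0 mul0mx.
by move=> /rowP/(_ l); rewrite [LHS]mxE [RHS]mxE.
Qed.

Lemma riemann_upN i j k l x : A x -> riemann_up g j i k l x = - riemann_up g i j k l x.
Proof.
move=> _; have /matrixP/(_ k l) := curvature_swap g i j x.
by rewrite [LHS]mxE [RHS]mxE [X in - X]mxE.
Qed.

Let bianchi i j k l x (Ax : A x) := bianchi1 oA symg i j k l Ax.
Let chrS l i j x (Ax : A x) := christoffel_sym oA symg l i j Ax.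
Let rho := curv_coef fr cf (riemann_up g).

Lemma ricci_frame_aux j k x : A x -> ricci g x j k = rho x * (cf o0 j x * cf o0 k x + cf o1 j x * cf o1 k x).
Proof.
move=> Ax; rewrite mxE.
exact: (ricci_sum oA smooth_cn cnN ext_cn fr_dual fr_codual riemann_upN bianchi null_up j k Ax).
Qed.

(** Tracing the Ricci formula counts each of theta0, theta1 once, so the scalar curvature is twice
    the curvature coefficient. *)
Lemma rhoE x : A x -> rho x = K.
Proof.
move=> Ax; have := scal Ax; rewrite /scalar_curvature.
under eq_bigr do under eq_bigr do rewrite ricci_frame_aux// mulrCA.
under eq_bigr do rewrite -mulr_sumr.
rewrite -mulr_sumr.
have invE : invmx (g x) = (E x)^T *m E x.
  have e := orthoE Ax; have ug := metric_unit posg Ax.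
  have : (E x)^T *m (E x *m g x) = 1%:M by apply: mulmx1C.
  by rewrite mulmxA => h; rewrite -[LHS]mul1mx -h mulmxK.
have key a : \sum_j \sum_k invmx (g x) j k * (cf a j x * cf a k x) = 1.
  rewrite invE.
  have -> : \sum_j \sum_k ((E x)^T *m E x) j k * (cf a j x * cf a k x) =
     \sum_b (\sum_j fr b j x * cf a j x) * (\sum_k fr b k x * cf a k x).
    under eq_bigr do under eq_bigr do rewrite mxE mulr_suml.
    under eq_bigr do rewrite exchange_big/=.
    rewrite exchange_big/=; apply: eq_bigr => b _.
    rewrite mulr_suml; apply: eq_bigr => j _; rewrite mulr_sumr; apply: eq_bigr => k _.
    by rewrite mxE /fr; ring.
  under eq_bigr do rewrite !fr_dual//.
  rewrite (bigD1 a)//= eqxx mulr1 big1 ?addr0// => b /negPf ->.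
  by rewrite mulr0.
have -> : \sum_j \sum_k invmx (g x) j k * (cf o0 j x * cf o0 k x + cf o1 j x * cf o1 k x) = 2.
  rewrite -[RHS]/(1 + 1) -{1}(key o0) -(key o1) -big_split/=; apply: eq_bigr => j _.
  by rewrite -big_split/=; apply: eq_bigr => k _; rewrite mulrDr.
by move: (rho x) => r h; lra.
Qed.

Lemma ricci_frame j k x : A x -> ricci g x j k = K * (cf o0 j x * cf o0 k x + cf o1 j x * cf o1 k x).
Proof. by move=> Ax; rewrite ricci_frame_aux// rhoE. Qed.

Lemma dcf0 i j x : A x -> ext (cf o0) i j x =
  - wedge (cn o1 o0) (cf o1) i j x - wedge (cn o2 o0) (cf o2) i j x.
Proof. exact: (ext_th0 cnN cf_partial chrS). Qed.

Lemma dcf1 i j x : A x -> ext (cf o1) i j x =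
  wedge (cn o1 o0) (cf o0) i j x - wedge (cn o2 o1) (cf o2) i j x.
Proof. exact: (ext_th1 cnN cf_partial chrS). Qed.

Lemma dcn10 i j x : A x -> ext (cn o1 o0) i j x =
  wedge (cn o2 o0) (cn o2 o1) i j x + K * wedge (cf o0) (cf o1) i j x.
Proof.
move=> Ax; rewrite -(rhoE Ax).
exact: (ext_al cnN ext_cn fr_codual riemann_upN null_up i j Ax).
Qed.

Lemma dcn20 i j x : A x -> ext (cn o2 o0) i j x = - wedge (cn o1 o0) (cn o2 o1) i j x.
Proof. exact: (ext_be cnN ext_cn riemann_upN bianchi null_up). Qed.

Lemma dcn21 i j x : A x -> ext (cn o2 o1) i j x = wedge (cn o1 o0) (cn o2 o0) i j x.
Proof. exact: (ext_ga cnN ext_cn riemann_upN bianchi null_up). Qed.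

(** In the frame, De sends e0 to b0 e0 + c0 e1, e1 to b1 e0 - b0 e1, and e2 to 0; see [cn20E] and
    [cn21E]. *)
Definition b0 := comp fr (cn o2 o0) o0.
Definition b1 := comp fr (cn o2 o0) o1.
Definition c0 := comp fr (cn o2 o1) o0.

Lemma cn20E i x : A x -> cn o2 o0 i x = b0 x * cf o0 i x + b1 x * cf o1 i x.
Proof.
exact: (be_comp oA K0 smooth_cf (smooth_cn _ _) (smooth_cn _ _) (smooth_cn _ _)
  fr_dual fr_codual dcf0 dcf1 dcn10 dcn20 dcn21).
Qed.

Lemma cn21E i x : A x -> cn o2 o1 i x = c0 x * cf o0 i x - b0 x * cf o1 i x.
Proof.
exact: (ga_comp oA K0 smooth_cf (smooth_cn _ _) (smooth_cn _ _) (smooth_cn _ _)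
  fr_dual fr_codual dcf0 dcf1 dcn10 dcn20 dcn21).
Qed.

Lemma det0 x : A x -> b0 x ^+ 2 + b1 x * c0 x = 0.
Proof.
exact: (comp_det oA K0 smooth_cf (smooth_cn _ _) (smooth_cn _ _) (smooth_cn _ _)
  fr_dual fr_codual dcf0 dcf1 dcn10 dcn20 dcn21).
Qed.

Variable e2 : 'rV[R]_3 -> 'rV[R]_3.
Hypothesis rowE : forall x, A x -> row o2 (E x) = e2 x.

Lemma covd_frame i l x : A x ->
  covd g e2 x i l = cn o2 o0 i x * fr o0 l x + cn o2 o1 i x * fr o1 l x.
Proof.
move=> Ax.
have cn22 : cn o2 o2 i x = 0 by have := cnN o2 o2 i Ax; move: (cn _ _ _ _) => c h; lra.
have -> : cn o2 o0 i x * fr o0 l x + cn o2 o1 i x * fr o1 l x = (connection g E i x *m E x) o2 l.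
  by rewrite mxE sum3 -/(cn o2 o0 i x) -/(cn o2 o1 i x) -/(cn o2 o2 i x) cn22 mul0r addr0.
have fd := frame_derivative orthoE i Ax.
have -> : connection g E i x *m E x = mxpderiv i E x + E x *m christoffel_mx g i x by rewrite fd subrK.
rewrite [LHS]mxE [LHS]mxE [RHS]mxE; congr (_ + _).
  rewrite !mxpderivE; apply: (pderiv_eq oA) => // y Ay.
  by rewrite -rowE// mxE.
by rewrite -rowE// -row_mul mxE.
Qed.

(** On the span of e0 and e1 this is Cayley-Hamilton for a matrix of trace and determinant zero. *)
Lemma covd_nilpotent x : A x -> covd g e2 x *m covd g e2 x = 0.
Proof.
move=> Ax; apply/matrixP => i m; rewrite [LHS]mxE [RHS]mxE.
under eq_bigr do rewrite !covd_frame//.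
have D a b := fr_dual a b Ax.
have s0 (u v : R) (c d : R) : \sum_l (u * fr o0 l x + v * fr o1 l x) * (c * cf o0 l x + d * cf o1 l x)
   = u * c + v * d.
  have -> : \sum_l (u * fr o0 l x + v * fr o1 l x) * (c * cf o0 l x + d * cf o1 l x) =
    u * c * (\sum_l fr o0 l x * cf o0 l x) + u * d * (\sum_l fr o0 l x * cf o1 l x)
    + v * c * (\sum_l fr o1 l x * cf o0 l x) + v * d * (\sum_l fr o1 l x * cf o1 l x).
    by rewrite !mulr_sumr -!big_split/=; apply: eq_bigr => l _; ring.
  by rewrite !D/=; ring.
have -> : \sum_j (cn o2 o0 i x * fr o0 j x + cn o2 o1 i x * fr o1 j x) *
   (cn o2 o0 j x * fr o0 m x + cn o2 o1 j x * fr o1 m x) =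
   (\sum_l (cn o2 o0 i x * fr o0 l x + cn o2 o1 i x * fr o1 l x) * (b0 x * cf o0 l x + b1 x * cf o1 l x)) * fr o0 m x
   + (\sum_l (cn o2 o0 i x * fr o0 l x + cn o2 o1 i x * fr o1 l x) * (c0 x * cf o0 l x + (- b0 x) * cf o1 l x)) * fr o1 m x.
  rewrite !mulr_suml -big_split/=; apply: eq_bigr => l _.
  by rewrite (cn20E l Ax) (cn21E l Ax); ring.
rewrite !s0 (cn20E i Ax) (cn21E i Ax); have := det0 Ax.
move: (b0 x) (b1 x) (c0 x) (fr o0 m x) (fr o1 m x) (cf o0 i x) (cf o1 i x) => p q r s t u v h.
rewrite (_ : _ + _ = (p ^+ 2 + q * r) * (u * s + v * t)); last by ring.
by rewrite h mul0r.
Qed.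

(** In an orthonormal frame the norm is the sum of squares of all entries, here b0, b1, c0 and
    -b0. *)
Lemma covd_norm_frame x : A x ->
  covd_norm g e2 x = 2 * b0 x ^+ 2 + b1 x ^+ 2 + c0 x ^+ 2.
Proof.
move=> Ax; have e := orthoE Ax; have ug := metric_unit posg Ax.
have invE : invmx (g x) = (E x)^T *m E x.
  have : (E x)^T *m (E x *m g x) = 1%:M by apply: mulmx1C.
  by rewrite mulmxA => h; rewrite -[LHS]mul1mx -h mulmxK.
pose C := E x *m covd g e2 x *m coframe g E x.
have gE : g x = coframe g E x *m (coframe g E x)^T.
  rewrite /coframe trmx_mul trmxK symg// !mulmxA -(mulmxA (g x)) -invE mulmxV//.
  by rewrite mul1mx.
have -> : covd_norm g e2 x = \tr (C *m C^T).
  rewrite /covd_norm {2}gE invE /C !trmx_mul.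
  rewrite -(mulmxA (E x)^T) -(mulmxA (E x)^T) -(mulmxA (E x)^T) mxtrace_mulC.
  by rewrite !mulmxA.
have CE a b : C a b = comp fr (cn o2 b) a x.
  rewrite /C -mulmxA mxE /comp; apply: eq_bigr => i _; congr (_ * _).
  rewrite mxE; under eq_bigr do rewrite covd_frame//.
  have -> : \sum_j (cn o2 o0 i x * fr o0 j x + cn o2 o1 i x * fr o1 j x) * coframe g E x j b =
     cn o2 o0 i x * (\sum_j fr o0 j x * cf b j x) + cn o2 o1 i x * (\sum_j fr o1 j x * cf b j x).
    by rewrite !mulr_sumr -big_split/=; apply: eq_bigr => j _; rewrite /cf; ring.
  rewrite !fr_dual//; have cn22 : cn o2 o2 i x = 0.
    by have := cnN o2 o2 i Ax; move: (cn _ _ _ _) => c h; lra.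
  by move: b; apply: all3; rewrite ?cn22 /=; ring.
have cp b (u v : R) a : (forall i, cn o2 b i x = u * cf o0 i x + v * cf o1 i x) ->
    comp fr (cn o2 b) a x = u * (a == o0)%:R + v * (a == o1)%:R.
  move=> h; rewrite /comp; under eq_bigr do rewrite h.
  rewrite -(fr_dual a o0 Ax) -(fr_dual a o1 Ax) !mulr_sumr -big_split/=.
  by apply: eq_bigr => i _; ring.
have h0 a := cp o0 _ _ a (fun i => cn20E i Ax).
have h1 a : comp fr (cn o2 o1) a x = c0 x * (a == o0)%:R + (- b0 x) * (a == o1)%:R.
  by apply: cp => i; rewrite (cn21E i Ax) mulNr.
have h2 a : comp fr (cn o2 o2) a x = 0.
  rewrite (cp o2 0 0) ?mul0r ?addr0// => i; rewrite !mul0r addr0.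
  by have := cnN o2 o2 i Ax; move: (cn _ _ _ _) => c h; lra.
have trE : \tr (C *m C^T) = \sum_a \sum_b C a b ^+ 2.
  rewrite /mxtrace; apply: eq_bigr => a _; rewrite mxE; apply: eq_bigr => b _.
  by rewrite [C^T _ _]mxE expr2.
rewrite trE; under eq_bigr do under eq_bigr do rewrite CE.
rewrite !sum3 !h0 !h1 !h2 /=.
by move: (b0 x) (b1 x) (c0 x) => p q r; ring.
Qed.

End LocalStructure.

(** * Parallelism of the unit field: ordinary differential equations along geodesics *)

Lemma is_derive_cast (R : realType) (V : normedModType R) (f : V -> R) (x v : V) (d d' : R) :
  is_derive x v f d -> d = d' -> is_derive x v f d'.
Proof. by move=> h <-. Qed.

Lemma is_derive_sumR (R : realType) (V : normedModType R) m (F : 'I_m -> V -> R) (d : 'I_m -> R) x v :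
  (forall i, is_derive x v (F i) (d i)) -> is_derive x v (fun t => \sum_i F i t) (\sum_i d i).
Proof.
move=> H; have := is_derive_sum H.
by rewrite (_ : \sum_i F i = fun t => \sum_i F i t)//; apply/funext => t; rewrite fct_sumE.
Qed.

Lemma is_derive_mulR (R : realType) (V : normedModType R) (f g : V -> R) df dg x v :
  is_derive x v f df -> is_derive x v g dg ->
  is_derive x v (fun t => f t * g t) (f x * dg + g x * df).
Proof. by move=> hf hg; exact: is_deriveM. Qed.

Lemma is_derive_addR (R : realType) (V : normedModType R) (f g : V -> R) df dg x v :
  is_derive x v f df -> is_derive x v g dg -> is_derive x v (fun t => f t + g t) (df + dg).
Proof. by move=> hf hg; exact: is_deriveD. Qed.

Lemma is_derive_cstR (R : realType) (V : normedModType R) (c : R) x (v : V) :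
  is_derive x v (fun=> c) 0.
Proof. exact: is_derive_cst. Qed.

Lemma is_derive_continuous (R : realType) (f : R -> R) (d x : R) : is_derive x 1 f d -> {for x, continuous f}.
Proof. by case=> h _; apply: differentiable_continuous; exact/derivable1_diffP. Qed.

Lemma derive_le0_le (R : realType) (f df : R -> R) (a b : R) : a <= b ->
  (forall s, a <= s <= b -> is_derive s 1 f (df s)) ->
  (forall s, a <= s <= b -> df s <= 0) -> f b <= f a.
Proof.
move=> ab fd le; have [||c] := @MVT_segment R f df a b ab.
- by move=> s; rewrite in_itv/= => /andP[s1 s2]; apply: fd; rewrite !ltW.
- apply: continuous_in_subspaceT => s; rewrite inE/= in_itv/= => sb.
  exact: is_derive_continuous (fd s sb).
- rewrite in_itv/= => cab E; rewrite -subr_le0 E mulr_le0_ge0 ?subr_ge0//.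
  exact: le.
Qed.

Lemma derive0_eq (R : realType) (f : R -> R) (s0 r : R) :
  (forall s, `|s - s0| < r -> is_derive s 1 f 0) ->
  forall s, `|s - s0| < r -> f s = f s0.
Proof.
move=> fd s sr.
have key a b : a <= b -> (forall t, a <= t <= b -> `|t - s0| < r) -> f a = f b.
  move=> ab H; apply/eqP; rewrite eq_le; apply/andP; split.
    rewrite -lerN2; apply: (@derive_le0_le R (fun t => - f t) (fun=> 0) a b ab) => // t tab.
    have := is_deriveN (fd t (H t tab)); rewrite oppr0; exact.
  by apply: (@derive_le0_le R f (fun=> 0) a b ab) => // t tab; exact: fd (H t tab).
have [s0s|ss0] := leP s0 s.
  apply/esym/key => // t /andP[t1 t2]; rewrite ger0_norm ?subr_ge0//.
  by apply: le_lt_trans sr; rewrite (ger0_norm (_ : 0 <= s - s0)) ?subr_ge0// lerB.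
apply: key (ltW ss0) _ => t /andP[t1 t2]; rewrite ler0_norm ?subr_le0//.
by apply: le_lt_trans sr; rewrite (ltr0_norm (_ : s - s0 < 0)) ?subr_lt0// lerN2 lerB.
Qed.

(** Gronwall: y^2 e^{q s} is nonincreasing to the right of s0 for q = -2 [Mc] and nondecreasing to
    its left for q = 2 [Mc], and it vanishes at s0. *)
Lemma linear_ode_zero (R : realType) (y c : R -> R) (s0 r Mc : R) :
  (forall s, `|s - s0| < r -> is_derive s 1 y (c s * y s)) ->
  (forall s, `|s - s0| < r -> `|c s| <= Mc) -> y s0 = 0 ->
  forall s, `|s - s0| < r -> y s = 0.
Proof.
move=> yd cb y0 s sr.
pose f (q : R) (t : R) := y t * y t * expR (q * t).
have fd q t : `|t - s0| < r -> is_derive t 1 (f q) ((2 * c t + q) * (y t * y t * expR (q * t))).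
  move=> tr; have d1 := is_derive_mulR (yd t tr) (yd t tr).
  have d2 : is_derive t 1 (fun t => expR (q * t)) (expR (q * t) * q).
    apply: (@is_derive_comp1 R R (fun t => q * t) expR t 1 q (expR (q * t))).
      have := is_derive_mulR (is_derive_cstR q t (1 : R)) (is_derive_id t (1 : R)).
      by rewrite mulr1 mulr0 addr0.
  by apply: (is_derive_cast (is_derive_mulR d1 d2)); ring.
have pos q t : 0 <= y t * y t * expR (q * t) by rewrite mulr_ge0 ?expR_ge0// -expr2 sqr_ge0.
have fin q : f q s <= 0 -> y s = 0.
  rewrite /f pmulr_lle0 ?expR_gt0// -expr2 => h; apply/eqP; rewrite -sqrf_eq0.
  by rewrite eq_le h sqr_ge0.
have f0 q : f q s0 = 0 by rewrite /f y0 !mul0r.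
have [s0s|ss0] := leP s0 s.
  have H t : s0 <= t <= s -> `|t - s0| < r.
    move=> /andP[t1 t2]; rewrite ger0_norm ?subr_ge0//.
    by apply: le_lt_trans sr; rewrite (ger0_norm (_ : 0 <= s - s0)) ?subr_ge0// lerB.
  apply: (fin (- (2 * Mc))); rewrite -(f0 (- (2 * Mc))).
  apply: (@derive_le0_le R (f (- (2 * Mc))) _ s0 s s0s (fun t h => fd _ t (H t h))) => t /H tr.
  rewrite mulr_le0_ge0//; have := cb t tr; rewrite ler_norml => /andP[_ h]; lra.
have H t : s <= t <= s0 -> `|t - s0| < r.
  move=> /andP[t1 t2]; rewrite ler0_norm ?subr_le0//.
  by apply: le_lt_trans sr; rewrite (ltr0_norm (_ : s - s0 < 0)) ?subr_lt0// lerN2 lerB.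
apply: (fin (2 * Mc)); rewrite -(f0 (2 * Mc)) -lerN2.
apply: (@derive_le0_le R (fun t => - f (2 * Mc) t) (fun t => - ((2 * c t + 2 * Mc) * (y t * y t * expR (2 * Mc * t)))) s s0 (ltW ss0)) => [t /H tr|t /H tr].
  exact: is_deriveN (fd _ t tr).
rewrite oppr_le0 mulr_ge0//; have := cb t tr; rewrite ler_norml => /andP[h _]; lra.
Qed.

(** Connectedness of a segment: a locally constant predicate is constant. This replaces explicit
    suprema wherever something is continued along a path. *)
Lemma interval_induction (R : realType) (P : R -> Prop) (a b : R) : a <= b -> P a ->
  (forall s, a <= s <= b -> exists2 e : R, 0 < e &
     forall t, a <= t <= b -> `|t - s| < e -> (P t <-> P s)) -> P b.
Proof.
move=> ab Pa H.
(* An open set of R that meets [a, b] in the points satisfying Q, when Q is open relative to the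
   segment. *)
pose U (Q : R -> Prop) : set R := [set s | exists s0 e : R,
  [/\ a <= s0 <= b, Q s0, (forall t, a <= t <= b -> `|t - s0| < e -> Q t) & `|s - s0| < e]].
have oU Q : open (U Q).
  rewrite openE => s [s0 [e [s0ab Qs0 He se]]].
  apply/nbhs_ballP; exists (e - `|s - s0|) => /=; first by rewrite subr_gt0.
  move=> t; rewrite /ball/= => ts; exists s0, e; split => //.
  have -> : t - s0 = (t - s) + (s - s0) by rewrite addrA subrK.
  by rewrite (le_lt_trans (ler_normD _ _))// -ltrBrDr distrC.
have inU (Q : R -> Prop) : (forall s, a <= s <= b -> Q s -> exists2 e : R, 0 < e &
     forall t, a <= t <= b -> `|t - s| < e -> Q t) -> forall s, a <= s <= b -> (Q s <-> U Q s).
  move=> HQ s sab; split=> [Qs|[s0 [e [_ _ He se]]]]; last exact: He.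
  have [e e0 He] := HQ s sab Qs; exists s, e; split => //.
  by rewrite subrr normr0.
have iP := inU P; have iN := inU (fun s => ~ P s).
have {}iP : forall s, a <= s <= b -> (P s <-> U P s).
  by apply: iP => s sab Ps; have [e e0 He] := H s sab; exists e => // t tab te; apply/He.
have {}iN : forall s, a <= s <= b -> (~ P s <-> U (fun s => ~ P s) s).
  by apply: iN => s sab Ps; have [e e0 He] := H s sab; exists e => // t tab te; rewrite He.
have E := @segment_connected R a b (`[a, b] `&` U P).
have : `[a, b] `&` U P = `[a, b]%classic.
  apply: E.
  - exists a; split; first by rewrite /= in_itv/= lexx.
    by apply/iP => //; rewrite lexx.
  - by exists (U P).
  - exists (~` U (fun s => ~ P s)); first by rewrite closedC.
    apply/seteqP; split=> s [sab h]; split=> //; rewrite /= in_itv/= in sab.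
      by move/(iN s sab); apply; exact/(iP s sab).
    by apply/(iP s sab); apply: contrapT => /(iN s sab).
move/seteqP => [_ /(_ b)]; rewrite /= in_itv/= ab lexx => /(_ isT)[_ h].
by apply/iP => //; rewrite lexx ab.
Qed.

(** * Geodesics seen in a moving frame *)

Section CurveInFrame.
Variables (R : realType) (A : set 'rV[R]_3).
Variables (th : 'I_3 -> 'I_3 -> 'rV[R]_3 -> R) (w Gm : 'I_3 -> 'I_3 -> 'I_3 -> 'rV[R]_3 -> R).
Hypothesis oA : open A.
Hypothesis sth : forall a i, smooth_on A (th a i).
Hypothesis dth : forall a i j x, A x ->
  pderiv i (th a j) x = \sum_l Gm l i j x * th a l x - \sum_b th b j x * w b a i x.
Variables (c v : R -> 'rV[R]_3) (s : R).
Hypothesis Ac : A (c s).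
Hypothesis dc : forall k, is_derive s 1 (fun t => c t 0 k) (v s 0 k).
Hypothesis dv : forall k, is_derive s 1 (fun t => v t 0 k)
  (- \sum_i \sum_j Gm k i j (c s) * v s 0 i * v s 0 j).

Lemma is_derive_along (f : 'rV[R]_3 -> R) : smooth_on A f ->
  is_derive s 1 (fun t => f (c t)) (dirderiv f (c s) (v s)).
Proof. by move=> sf; apply: chain_rule => //; exact: smooth_on_strict sf Ac. Qed.

(** The Christoffel terms of the geodesic equation cancel those in the derivative of the coframe;
    only connection forms remain. *)
Lemma frame_velocity_derive a :
  is_derive s 1 (fun t => \sum_i th a i (c t) * v t 0 i)
    (- \sum_b (\sum_i th b i (c s) * v s 0 i) * (\sum_l v s 0 l * w b a l (c s))).
Proof.
apply: is_derive_cast (is_derive_sumR (fun i => is_derive_mulR (is_derive_along (sth a i)) (dv i))) _.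
rewrite big_split/= /dirderiv.
under [X in _ + X]eq_bigr do under eq_bigr do rewrite dth//.
rewrite !sum3; ring.
Qed.
End CurveInFrame.

(** * The Riccati equation where De is nonzero and e0 spans its image *)

Section AdaptedFrame.
Variables (R : realType) (A : set 'rV[R]_3) (K : R).
Variables (e th : 'I_3 -> 'I_3 -> 'rV[R]_3 -> R) (w Gm : 'I_3 -> 'I_3 -> 'I_3 -> 'rV[R]_3 -> R).
Variable b : 'rV[R]_3 -> R.
Hypothesis oA : open A.
Hypothesis sth : forall a i, smooth_on A (th a i).
Hypothesis se : forall a i, smooth_on A (e a i).
Hypothesis sw : forall a b i, smooth_on A (w a b i).
Hypothesis sb : smooth_on A b.
Hypothesis wN : forall a b i x, A x -> w a b i x = - w b a i x.
Hypothesis dual : forall a b x, A x -> \sum_i e a i x * th b i x = (a == b)%:R.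
Hypothesis codual : forall i j x, A x -> \sum_a th a i x * e a j x = (i == j)%:R.
Hypothesis dth : forall a i j x, A x ->
  pderiv i (th a j) x = \sum_l Gm l i j x * th a l x - \sum_b th b j x * w b a i x.
Hypothesis dth1 : forall i j x, A x -> ext (th o1) i j x =
  wedge (w o1 o0) (th o0) i j x - wedge (w o2 o1) (th o2) i j x.
Hypothesis dal : forall i j x, A x -> ext (w o1 o0) i j x =
  wedge (w o2 o0) (w o2 o1) i j x + K * wedge (th o0) (th o1) i j x.
Hypothesis dbe : forall i j x, A x -> ext (w o2 o0) i j x = - wedge (w o1 o0) (w o2 o1) i j x.
Hypothesis dga : forall i j x, A x -> ext (w o2 o1) i j x = wedge (w o1 o0) (w o2 o0) i j x.
Hypothesis beE : forall i x, A x -> w o2 o0 i x = b x * th o1 i x.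
Hypothesis gaE : forall i x, A x -> w o2 o1 i x = 0.
Hypothesis b0 : forall x, A x -> b x != 0.

Definition a1 := comp e (w o1 o0) o1.

Lemma smooth_a1 : smooth_on A a1.
Proof. by apply: (smooth_on_sum oA) => i; exact: (smooth_onM oA (se _ _) (sw _ _ _)). Qed.

Lemma contract_wedge (u v : 'I_3 -> 'rV[R]_3 -> R) p q x :
  \sum_i \sum_j e p i x * e q j x * wedge u v i j x =
  comp e u p x * comp e v q x - comp e u q x * comp e v p x.
Proof. by rewrite /comp !sum3 /wedge; ring. Qed.

Lemma comp_th a p x : A x -> comp e (th a) p x = (p == a)%:R.
Proof. exact: dual. Qed.

(** Since [ga] vanishes, so does d ga = al wedge be; as [be] is a nonzero multiple of theta1, so is
    [al], up to a possibly zero factor. In particular nabla_{e0} e0 = 0. *)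
Lemma alE i x : A x -> w o1 o0 i x = a1 x * th o1 i x.
Proof.
move=> Ax.
have Z k j : wedge (w o1 o0) (w o2 o0) k j x = 0.
  rewrite -dga// /ext.
  by rewrite !(pderiv_eq oA _ (gaE _) Ax) !pderiv_cst subrr.
have W q : comp e (w o2 o0) q x = b x * (q == o1)%:R.
  rewrite -(dual q o1 Ax) /comp mulr_sumr; apply: eq_bigr => k _.
  by rewrite beE//; ring.
have C p : p != o1 -> comp e (w o1 o0) p x = 0.
  move=> p1; have := contract_wedge (w o1 o0) (w o2 o0) p o1 x.
  rewrite !W (negPf p1) eqxx/= mulr0 mulr0 subr0 mulr1 big1 => [/esym/eqP|k _].
    by rewrite mulf_eq0 (negPf (b0 Ax)) orbF => /eqP.
  by rewrite big1// => j _; rewrite Z mulr0.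
by rewrite (compE codual _ _ Ax) sum3 (C o0)// (C o2)// -/(a1 x) !mul0r add0r addr0.
Qed.

(** Evaluates d(f theta1) on (e0, e1). Used for [be] = b theta1 and [al] = a1 theta1, it turns the
    structure equations into ordinary differential equations. *)
Lemma contract_form (f : 'rV[R]_3 -> R) x : smooth_on A f -> A x ->
  \sum_i \sum_j e o0 i x * e o1 j x * ext (fun i y => f y * th o1 i y) i j x =
  \sum_i e o0 i x * pderiv i f x - f x * a1 x.
Proof.
move=> sf Ax.
have E i j : ext (fun i y => f y * th o1 i y) i j x =
   wedge (fun i => pderiv i f) (th o1) i j x + f x * (a1 x * wedge (th o1) (th o0) i j x).
  have := dth1 i j Ax; rewrite /ext /wedge !alE// !gaE// => h.
  rewrite !(pderivM _ sf (sth _ _) Ax).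
  move: h; move: (pderiv i (th o1 j) x) (pderiv j (th o1 i) x) => p q h.
  rewrite (_ : p = q + (a1 x * th o1 i x * th o0 j x - a1 x * th o1 j x * th o0 i x)); first ring.
  by rewrite -[p](subrK q) h; ring.
under eq_bigr do under eq_bigr do rewrite E.
have -> : \sum_i \sum_j e o0 i x * e o1 j x * (wedge (fun i => pderiv i f) (th o1) i j x +
      f x * (a1 x * wedge (th o1) (th o0) i j x)) =
   (\sum_i \sum_j e o0 i x * e o1 j x * wedge (fun i => pderiv i f) (th o1) i j x) +
   f x * a1 x * (\sum_i \sum_j e o0 i x * e o1 j x * wedge (th o1) (th o0) i j x).
  rewrite mulr_sumr -big_split/=; apply: eq_bigr => i _.
  by rewrite mulr_sumr -big_split/=; apply: eq_bigr => j _; ring.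
rewrite !contract_wedge !comp_th//= /comp.
by ring.
Qed.

Lemma e0_b x : A x -> \sum_i e o0 i x * pderiv i b x = b x * a1 x.
Proof.
move=> Ax; apply/eqP; rewrite -subr_eq0 -(contract_form sb Ax); apply/eqP.
apply: big1 => i _; apply: big1 => j _.
have -> : ext (fun i y => b y * th o1 i y) i j x = ext (w o2 o0) i j x.
  by rewrite /ext; congr (_ - _); apply: (pderiv_eq oA) => // y Ay; rewrite beE.
by rewrite dbe// /wedge !gaE//; ring.
Qed.

(** A Riccati equation. Together with [e0_b] it linearizes: y = 1/b satisfies y' = -a1 y and y'' =
    -K y along e0. *)
Lemma e0_a1 x : A x -> \sum_i e o0 i x * pderiv i a1 x = a1 x ^+ 2 + K.
Proof.
move=> Ax; have := contract_form smooth_a1 Ax.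
have -> : \sum_i \sum_j e o0 i x * e o1 j x * ext (fun i y => a1 y * th o1 i y) i j x = K.
  have E i j : ext (fun i y => a1 y * th o1 i y) i j x = K * wedge (th o0) (th o1) i j x.
    have -> : ext (fun i y => a1 y * th o1 i y) i j x = ext (w o1 o0) i j x.
      by rewrite /ext; congr (_ - _); apply: (pderiv_eq oA) => // y Ay; rewrite alE.
    by rewrite dal// /wedge !gaE//; ring.
  under eq_bigr do under eq_bigr do rewrite E mulrCA.
  under eq_bigr do rewrite -mulr_sumr.
  by rewrite -mulr_sumr contract_wedge !comp_th//=; ring.
by move=> h; rewrite [in RHS]h expr2 addrC subrK.
Qed.

Lemma dirderiv_e0 f x (v : 'rV[R]_3) : A x ->
  \sum_i th o1 i x * v 0 i = 0 -> \sum_i th o2 i x * v 0 i = 0 ->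
  dirderiv f x v = (\sum_i th o0 i x * v 0 i) * \sum_i e o0 i x * pderiv i f x.
Proof.
move=> Ax T1 T2.
have vE i : v 0 i = (\sum_i th o0 i x * v 0 i) * e o0 i x.
  have : v 0 i = \sum_a (\sum_i th a i x * v 0 i) * e a i x.
    under eq_bigr do rewrite mulr_suml.
    rewrite exchange_big/= -[LHS](sum_delta i (fun j => v 0 j)); apply: eq_bigr => j _.
    rewrite eq_sym -(codual j i Ax) mulr_suml; apply: eq_bigr => a _; ring.
  by move=> ->; rewrite sum3 T1 T2 !mul0r !addr0.
by rewrite /dirderiv mulr_sumr; apply: eq_bigr => i _; rewrite vE mulrA.
Qed.

Variables (c v : R -> 'rV[R]_3) (s0 r : R).
Hypothesis r0 : 0 < r.
Hypothesis Ac : forall s, `|s - s0| < r -> A (c s).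
Hypothesis dc : forall s k, `|s - s0| < r -> is_derive s 1 (fun t => c t 0 k) (v s 0 k).
Hypothesis dv : forall s k, `|s - s0| < r -> is_derive s 1 (fun t => v t 0 k)
  (- \sum_i \sum_j Gm k i j (c s) * v s 0 i * v s 0 j).
Variables (eta deta : R -> R).
Hypothesis deta1 : forall s : R, is_derive s 1 eta (deta s).
Hypothesis deta2 : forall s : R, is_derive s 1 deta (- K * eta s).

Definition Tv a s := \sum_i th a i (c s) * v s 0 i.

Hypotheses (T10 : Tv o1 s0 = 0) (T20 : Tv o2 s0 = 0) (T00 : Tv o0 s0 ^+ 2 = 1).
Hypothesis bH : b (c s0) ^+ 2 * eta s0 ^+ 2 = 1.
Hypothesis DH : deta s0 + Tv o0 s0 * a1 (c s0) * eta s0 = 0.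

Lemma local_bound (f : R -> R) : {for s0, continuous f} ->
  exists2 d : R, 0 < d & forall s, `|s - s0| < d -> `|f s| <= `|f s0| + 1.
Proof.
move=> /continuous_epsP/(_ _ ltr01)[d d0 H]; exists d => // s /H h.
by rewrite -[f s](subrK (f s0)) addrC (le_trans (ler_normD _ _))// lerD2l.
Qed.

(** Each equation persists because its defect is constant or solves a homogeneous linear equation
    with bounded coefficient. The squares allow the velocity to be e0 or -e0 and b to have either
    sign. *)
Lemma adapted_propagate : exists2 r' : R, 0 < r' & forall s, `|s - s0| < r' ->
  [/\ Tv o1 s = 0, Tv o2 s = 0, Tv o0 s ^+ 2 = 1, b (c s) ^+ 2 * eta s ^+ 2 = 1
    & deta s + Tv o0 s * a1 (c s) * eta s = 0].
Proof.
have s0r : `|s0 - s0| < r by rewrite subrr normr0.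
have Td a s : `|s - s0| < r -> is_derive s 1 (Tv a)
    (- \sum_b Tv b s * (\sum_l v s 0 l * w b a l (c s))).
  by move=> sr; exact: (frame_velocity_derive oA sth dth (Ac sr) (fun k => dc k sr) (fun k => dv k sr)).
have wv s : `|s - s0| < r ->
   [/\ \sum_l v s 0 l * w o1 o0 l (c s) = a1 (c s) * Tv o1 s,
       \sum_l v s 0 l * w o2 o0 l (c s) = b (c s) * Tv o1 s
     & \sum_l v s 0 l * w o2 o1 l (c s) = 0].
  move=> sr; have Ax := Ac sr; rewrite /Tv !mulr_sumr; split.
  - by apply: eq_bigr => l _; rewrite alE//; ring.
  - by apply: eq_bigr => l _; rewrite beE//; ring.
  - by apply: big1 => l _; rewrite gaE// mulr0.
have wvN p q s : `|s - s0| < r ->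
   \sum_l v s 0 l * w p q l (c s) = - \sum_l v s 0 l * w q p l (c s).
  by move=> sr; rewrite -sumrN; apply: eq_bigr => l _; rewrite (wN p q l (Ac sr)) mulrN.
have wvD p s : `|s - s0| < r -> \sum_l v s 0 l * w p p l (c s) = 0.
  by move=> sr; have := wvN p p s sr; set z := \sum_l _; move: z => z h; lra.
have T1d s : `|s - s0| < r -> is_derive s 1 (Tv o1) (Tv o0 s * a1 (c s) * Tv o1 s).
  move=> sr; have [h1 h2 h3] := wv s sr; apply: is_derive_cast (Td o1 s sr) _.
  by rewrite sum3 wvD// h3 (wvN o0 o1)// h1; ring.
have a1c : {for s0, continuous (fun s => Tv o0 s * a1 (c s))}.
  have := is_derive_mulR (Td o0 s0 s0r) (is_derive_along oA (Ac s0r) (fun k => dc k s0r) smooth_a1).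
  exact: is_derive_continuous.
have [d d0 dB] := local_bound a1c.
pose r' := Num.min d r; have r'0 : 0 < r' by rewrite lt_min d0.
have rr s : `|s - s0| < r' -> `|s - s0| < r by rewrite lt_min => /andP[].
have rd s : `|s - s0| < r' -> `|s - s0| < d by rewrite lt_min => /andP[].
have T1 s : `|s - s0| < r' -> Tv o1 s = 0.
  apply: (linear_ode_zero (c := fun s => Tv o0 s * a1 (c s)) _ (fun t ht => dB t (rd t ht)) T10).
  by move=> t /rr; exact: T1d.
have T2 s : `|s - s0| < r' -> Tv o2 s = 0.
  rewrite -T20; apply: derive0_eq => t tr; have [h1 h2 h3] := wv t (rr t tr).
  apply: is_derive_cast (Td o2 t (rr t tr)) _.
  by rewrite sum3 wvD ?rr// (wvN o0 o2) ?rr// (wvN o1 o2) ?rr// h2 h3 T1//; ring.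
have T0 s : `|s - s0| < r' -> Tv o0 s = Tv o0 s0.
  apply: derive0_eq => t tr; have [h1 h2 h3] := wv t (rr t tr).
  apply: is_derive_cast (Td o0 t (rr t tr)) _.
  by rewrite sum3 wvD ?rr// h1 h2 T1//; ring.
have dirE f s : `|s - s0| < r' -> dirderiv f (c s) (v s) = Tv o0 s * \sum_i e o0 i (c s) * pderiv i f (c s).
  by move=> sr; apply: dirderiv_e0; [exact: Ac (rr s sr)|exact: T1|exact: T2].
pose D s := deta s + Tv o0 s * a1 (c s) * eta s.
(* The terms with K cancel between the Jacobi equation for [eta] and the Riccati equation for
   [a1]. *)
have Dd s : `|s - s0| < r' -> is_derive s 1 D (Tv o0 s * a1 (c s) * D s).
  move=> sr; have Ax := Ac (rr s sr).
  have h0 : is_derive s 1 (Tv o0) 0.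
    have [h1 h2 h3] := wv s (rr s sr); apply: is_derive_cast (Td o0 s (rr s sr)) _.
    by rewrite sum3 wvD ?rr// h1 h2 T1//; ring.
  have ha := is_derive_along oA Ax (fun k => dc k (rr s sr)) smooth_a1.
  apply: is_derive_cast (is_derive_addR (deta2 s) (is_derive_mulR (is_derive_mulR h0 ha) (deta1 s))) _.
  rewrite dirE// e0_a1// /D; have : Tv o0 s ^+ 2 = 1 by rewrite T0.
  move: (Tv o0 s) (a1 (c s)) (eta s) (deta s) => t a n m h.
  have -> : - K * n + (t * a * m + n * (t * (t * (a ^+ 2 + K)) + a * 0)) =
     t ^+ 2 * (a ^+ 2 + K) * n - K * n + t * a * m by ring.
  have -> : t * a * (m + t * a * n) = t ^+ 2 * a ^+ 2 * n + t * a * m by ring.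
  by rewrite h; ring.
have D0 s : `|s - s0| < r' -> D s = 0.
  exact: (linear_ode_zero (c := fun s => Tv o0 s * a1 (c s)) Dd (fun t ht => dB t (rd t ht)) DH).
exists r' => // s sr; split => //; [exact: T1|exact: T2|by rewrite T0| |exact: D0].
rewrite -bH -!exprMn; congr (_ ^+ 2).
(* The derivative of b eta is b times the defect [D], which has just been shown to vanish. *)
apply: (@derive0_eq R (fun s => b (c s) * eta s) s0 r') => // t tr; have At := Ac (rr t tr).
have hb := is_derive_along oA At (fun k => dc k (rr t tr)) sb.
apply: is_derive_cast (is_derive_mulR hb (deta1 t)) _.
rewrite dirE// e0_b//; have := D0 t tr; rewrite /D.
move: (Tv o0 t) (a1 (c t)) (eta t) (deta t) (b (c t)) => q a n m bb h.
by rewrite (_ : _ + _ = bb * (m + q * a * n)); [rewrite h mulr0|ring].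
Qed.
End AdaptedFrame.

Definition null_geometry (R : realType) (A : set 'rV[R]_3) g (k : 'rV[R]_3 -> 'rV[R]_3) (K : R) : Prop :=
  [/\ metric_on A g, smooth_mx_on A k, (forall x, A x -> k x != 0),
      (forall x j l m, A x -> \sum_i k x 0 i * riemann g i j l m x = 0) &
      (forall x, A x -> scalar_curvature g x = 2 * K)].

Definition adapted_frame (R : realType) (B : set 'rV[R]_3) g E (k : 'rV[R]_3 -> 'rV[R]_3) (K : R) : Prop :=
  [/\ metric_on B g, smooth_mx_on B E &
  [/\ (forall x, B x -> E x *m g x *m (E x)^T = 1%:M),
      (forall x j l m, B x -> \sum_i E x o2 i * riemann g i j l m x = 0),
      (forall x, B x -> scalar_curvature g x = 2 * K) &
      (forall x, B x -> row o2 (E x) = unit_field g k x)]].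

(** * The kernel state and its local propagation *)

Section KernelGeodesic.
Variables (R : realType) (A : set 'rV[R]_3) (g : 'rV[R]_3 -> 'M[R]_3) (k : 'rV[R]_3 -> 'rV[R]_3).
Variable K : R.
Hypotheses (K0 : K != 0) (ng : null_geometry A g k K).
Local Notation e := (unit_field g k).
Local Notation De := (covd g e).
Local Notation N := (covd_norm g e).

Let mg : metric_on A g. Proof. by case: ng. Qed.
Let oA : open A. Proof. by case: mg. Qed.

Lemma adapted_frame_at x0 X : A x0 -> smooth_mx_on A X -> reject g e X x0 != 0 ->
  exists B E, [/\ open B, B x0, B `<=` A, adapted_frame B g E k K &
     (forall x, B x -> reject g e X x != 0) /\
     forall x, row o0 (E x) = unit_field g (reject g e X) x].
Proof.
move=> Ax0 sX X0; have [_ sk k0 nl sc] := ng.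
have [B [E [oB Bx BA sE [kB XB oE r2 r0]]]] := frame_existence mg Ax0 sX sk (k0 _ Ax0) X0.
exists B, E; split; [exact: oB|exact: Bx|exact: BA| |by split].
split; [exact: metric_on_sub mg|exact: sE|].
split; [exact: oE| |by move=> x /BA; exact: sc|by move=> x _; exact: r2].
move=> x j l m Bx'.
rewrite (eq_bigr (fun i => (Num.sqrt (ip g x (k x) (k x)))^-1 * (k x 0 i * riemann g i j l m x))).
  by rewrite -mulr_sumr nl ?mulr0//; exact: BA.
move=> i _; have /rowP/(_ i) := r2 x; rewrite mxE => ->.
by rewrite {1}/unit_field mxE -mulrA.
Qed.

Lemma adapted_frame_exists x0 : A x0 ->
  exists B E, [/\ open B, B x0, B `<=` A & adapted_frame B g E k K].
Proof.
move=> Ax0; have [_ sk k0 _ _] := ng.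
have [i ei] := exists_reject1 Ax0 (unit_field_ip mg Ax0 (k0 _ Ax0)).
have sX : smooth_mx_on A (fun=> delta_mx 0 i : 'rV[R]_3) by move=> a b; exact: smooth_on_cst.
by have [B [E [oB Bx BA F _]]] := adapted_frame_at Ax0 sX ei; exists B, E.
Qed.

Lemma smooth_e : smooth_mx_on A e.
Proof. by have [_ sk k0 _ _] := ng; exact: (smooth_unit_field mg oA (@subset_refl _ A) sk k0). Qed.

Lemma smooth_covd : smooth_mx_on A De.
Proof.
move=> i l; have [_ sg _ posg] := mg.
rewrite (_ : (fun x => _) = fun x => (mxpderiv i e x + e x *m christoffel_mx g i x) 0 l).
  apply: (smooth_mxD oA (smooth_mxpderiv i smooth_e)).
  exact: (smooth_mxM oA smooth_e (smooth_christoffel_mx oA sg posg i)).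
by apply/funext => x; rewrite mxE.
Qed.

Lemma smooth_N : smooth_on A N.
Proof.
have [_ sg _ posg] := mg.
have si := smooth_invmx oA (fun x Ax => metric_unit posg Ax) sg.
have s := smooth_mxM oA (smooth_mxM oA (smooth_mxM oA si smooth_covd) sg) (smooth_mxT smooth_covd).
rewrite (_ : N = fun x => \sum_i (invmx (g x) *m De x *m g x *m (De x)^T) i i)//.
by apply: (smooth_on_sum oA) => i; exact: s.
Qed.

Lemma covd_sq x : A x -> De x *m De x = 0.
Proof.
move=> Ax; have [B [E [oB Bx BA [mB sE [oE nl sc r2]]]]] := adapted_frame_exists Ax.
exact: (covd_nilpotent mB sE K0 oE nl sc r2 Bx).
Qed.

Lemma ip_frame B E x v a : metric_on B g -> B x ->
  ip g x v (row a (E x)) = \sum_i cf g E a i x * v 0 i.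
Proof.
move=> mB Bx; rewrite /ip tr_row.
rewrite -mulmxA mxE; apply: eq_bigr => i _; rewrite mulrC; congr (_ * _).
by rewrite /cf /coframe !mxE; apply: eq_bigr => j _; rewrite !mxE.
Qed.

Lemma covd_perp x i : A x -> ip g x (row i (De x)) (e x) = 0.
Proof.
move=> Ax; have [B [E [oB Bx BA [mB sE [oE nl sc r2]]]]] := adapted_frame_exists Ax.
rewrite -(r2 _ Bx) (ip_frame E _ _ mB Bx).
rewrite (eq_bigr (fun l => cn g E o2 o0 i x * (fr E o0 l x * cf g E o2 l x)
   + cn g E o2 o1 i x * (fr E o1 l x * cf g E o2 l x))).
  by rewrite big_split/= -!mulr_sumr !(fr_dual oE _ _ Bx)/= !mulr0 addr0.
by move=> l _; rewrite mxE (covd_frame mB sE oE r2 i l Bx); ring.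
Qed.

Lemma N_eq0 x : A x -> N x = 0 -> De x = 0.
Proof.
move=> Ax; have [B [E [oB Bx BA [mB sE [oE nl sc r2]]]]] := adapted_frame_exists Ax.
rewrite (covd_norm_frame mB sE K0 oE nl sc r2 Bx) => h.
have sq (q : R) : 0 <= q ^+ 2 := sqr_ge0 q.
have [h0 [h1 h2]] : b0 g E x ^+ 2 = 0 /\ b1 g E x ^+ 2 = 0 /\ c0 g E x ^+ 2 = 0.
  have := sq (b0 g E x); have := sq (b1 g E x); have := sq (c0 g E x); move: h.
  by move: (b0 g E x ^+ 2) (b1 g E x ^+ 2) (c0 g E x ^+ 2) => p q r *; split; [|split]; lra.
move: h0 h1 h2 => /eqP; rewrite sqrf_eq0 => /eqP h0 /eqP; rewrite sqrf_eq0 => /eqP h1.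
move=> /eqP; rewrite sqrf_eq0 => /eqP h2.
apply/matrixP => i l; rewrite (covd_frame mB sE oE r2 i l Bx).
rewrite (cn20E mB sE K0 oE nl sc i Bx) (cn21E mB sE K0 oE nl sc i Bx) h0 h1 h2.
by rewrite mxE; ring.
Qed.

(* The state carried along the geodesic issuing from a point where De != 0 in *)
(* the direction of the kernel of De: N ^ (-1/2) agrees to first order with   *)
(* the solution eta of the Jacobi equation.                                   *)
Definition kernel_state x (v : 'rV[R]_3) (h dh : R) : Prop :=
  [/\ N x * h ^+ 2 = 1, dirderiv N x v * h ^+ 2 + 2 * N x * h * dh = 0,
      v *m De x = 0, ip g x v (e x) = 0 & ip g x v v = 1].

(** The condition N h^2 = 1 forces De to be nonzero, which supplies an adapted frame; there the
    state becomes the hypotheses of [adapted_propagate], with N = b1^2. *)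
Lemma kernel_state_propagate (c v : R -> 'rV[R]_3) (s0 r : R) (eta deta : R -> R) :
  0 < r -> (forall s, `|s - s0| < r -> A (c s)) ->
  (forall s k, `|s - s0| < r -> is_derive s 1 (fun t : R => c t 0 k) (v s 0 k)) ->
  (forall s k, `|s - s0| < r -> is_derive s 1 (fun t : R => v t 0 k)
    (- \sum_i \sum_j christoffel g k i j (c s) * v s 0 i * v s 0 j)) ->
  (forall s : R, is_derive s 1 eta (deta s)) ->
  (forall s : R, is_derive s 1 deta (- K * eta s)) ->
  kernel_state (c s0) (v s0) (eta s0) (deta s0) ->
  exists2 r' : R, 0 < r' & forall s, `|s - s0| < r' -> kernel_state (c s) (v s) (eta s) (deta s).
Proof.
move=> r0 Ac dc dv de1 de2 [H1 H2 H3 H4 H5].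
have Ax0 : A (c s0) by apply: Ac; rewrite subrr normr0.
have [i Xi] : exists i, row i (De (c s0)) != 0.
  apply: contrapT => /forallNP Hn.
  have D0 : De (c s0) = 0.
    apply/row_matrixP => i; rewrite row0; apply/eqP; apply: contraT => /(Hn i).
    by [].
  by move: H1; rewrite /covd_norm D0 mulmx0 !mul0mx mxtrace0 mul0r => h; lra.
(* A nonzero row of De spans its image, and it is already orthogonal to e by [covd_perp]. *)
pose X x := row i (De x).
have sX : smooth_mx_on A X.
  move=> a b; rewrite (_ : (fun x => _) = fun x => De x i b); first exact: smooth_covd.
  by apply/funext => x; rewrite mxE.
have rX x : A x -> reject g e X x = X x.
  by move=> Ax; rewrite /reject (covd_perp i Ax) scale0r subr0.
have X0 : reject g e X (c s0) != 0 by rewrite rX.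
have [B [E [oB Bx BA [mB sE [oE nl sc r2]] [XB rE]]]] := adapted_frame_at Ax0 sX X0.
have D a b x (bx : B x) := fr_dual oE a b bx.
(* The image of De lies in its kernel, so nabla_{e0} e = b0 e0 + c0 e1 vanishes. *)
have kerX x : B x -> b0 g E x = 0 /\ c0 g E x = 0.
  move=> bx; have ax := BA _ bx.
  have Z l : b0 g E x * fr E o0 l x + c0 g E x * fr E o1 l x = 0.
    have : row o0 (E x) *m De x = 0.
      rewrite rE /unit_field -scalemxAl rX// /X -row_mul covd_sq// row0.
      by rewrite scaler0.
    move=> /rowP/(_ l); rewrite [LHS]mxE [RHS]mxE => <-.
    rewrite /b0 /c0 /comp !mulr_suml -big_split/=; apply: eq_bigr => j _.
    by rewrite (covd_frame mB sE oE r2 j l bx) mxE; rewrite /fr; ring.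
  have C a : \sum_l (b0 g E x * fr E o0 l x + c0 g E x * fr E o1 l x) * cf g E a l x =
      b0 g E x * (o0 == a)%:R + c0 g E x * (o1 == a)%:R.
    rewrite -(D o0 a _ bx) -(D o1 a _ bx) !mulr_sumr -big_split/=.
    by apply: eq_bigr => l _; ring.
  have C0 a : \sum_l (b0 g E x * fr E o0 l x + c0 g E x * fr E o1 l x) * cf g E a l x = 0.
    by apply: big1 => l _; rewrite Z mul0r.
  by split; [have := C o0|have := C o1]; rewrite C0 /= !mulr0 mulr1 ?addr0 ?add0r.
have beE j x : B x -> cn g E o2 o0 j x = b1 g E x * cf g E o1 j x.
  by move=> bx; rewrite (cn20E mB sE K0 oE nl sc j bx) (kerX _ bx).1 mul0r add0r.
have gaE j x : B x -> cn g E o2 o1 j x = 0.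
  by move=> bx; rewrite (cn21E mB sE K0 oE nl sc j bx) (kerX _ bx).1 (kerX _ bx).2 !mul0r subr0.
have DeE x j l : B x -> De x j l = b1 g E x * cf g E o1 j x * fr E o0 l x.
  by move=> bx; rewrite (covd_frame mB sE oE r2 j l bx) beE// gaE// mul0r addr0.
have b10 x : B x -> b1 g E x != 0.
  move=> bx; apply/eqP => bz; have := XB _ bx; rewrite rX; last exact: BA.
  by case/negP; apply/eqP/rowP => l; rewrite [LHS]mxE [RHS]mxE DeE// bz !mul0r.
have NE x : B x -> N x = b1 g E x ^+ 2.
  move=> bx; rewrite (covd_norm_frame mB sE K0 oE nl sc r2 bx) (kerX _ bx).1 (kerX _ bx).2.
  by rewrite expr0n/= mulr0 add0r addr0.
have sb1 : smooth_on B (b1 g E).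
  apply: (smooth_on_sum oB) => j; exact: (smooth_onM oB (smooth_fr sE _ _) (smooth_cn mB sE _ _ _)).
have se0b := e0_b oB (smooth_cf mB sE) sb1 (fr_dual oE) (fr_codual oE) (dcf1 mB sE oE)
   (dcn20 mB sE oE nl) (dcn21 mB sE oE nl) beE gaE b10.
have dirN x (w : 'rV[R]_3) : B x -> \sum_j cf g E o1 j x * w 0 j = 0 -> \sum_j cf g E o2 j x * w 0 j = 0 ->
   dirderiv N x w = 2 * b1 g E x ^+ 2 * (\sum_j cf g E o0 j x * w 0 j) * a1 (fr E) (cn g E) x.
  move=> bx w1 w2.
  rewrite (dirderiv_e0 (fr_codual oE) N bx w1 w2).
  have -> : \sum_j fr E o0 j x * pderiv j N x = 2 * b1 g E x * (b1 g E x * a1 (fr E) (cn g E) x).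
    rewrite -se0b// mulr_sumr; apply: eq_bigr => j _; rewrite (pderiv_eq oB j NE bx).
    rewrite (_ : (fun y => _) = fun y => b1 g E y * b1 g E y); last by apply/funext => y; rewrite expr2.
    by rewrite (pderivM j sb1 sb1 bx); ring.
  ring.
have ipE x (w : 'rV[R]_3) a : B x -> ip g x w (row a (E x)) = \sum_j cf g E a j x * w 0 j.
  exact: ip_frame.
have wDe x (w : 'rV[R]_3) l : B x -> (w *m De x) 0 l = b1 g E x * (\sum_j cf g E o1 j x * w 0 j) * fr E o0 l x.
  move=> bx; rewrite mxE mulr_sumr mulr_suml; apply: eq_bigr => j _.
  by rewrite DeE//; ring.
have ipvv x (w : 'rV[R]_3) : B x -> ip g x w w = \sum_a (\sum_j cf g E a j x * w 0 j) ^+ 2.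
  move=> bx.
  have wE : w = \sum_a (\sum_j cf g E a j x * w 0 j) *: row a (E x).
    apply/rowP => l; rewrite summxE.
    rewrite (eq_bigr (fun a => (\sum_j cf g E a j x * w 0 j) * fr E a l x)); last first.
      by move=> a _; rewrite mxE mxE.
    under eq_bigr do rewrite mulr_suml.
    rewrite exchange_big/= -[LHS](sum_delta l (fun j => w 0 j)); apply: eq_bigr => j _.
    rewrite eq_sym -(fr_codual oE j l bx) mulr_suml; apply: eq_bigr => a _; ring.
  rewrite {2}wE /ip linear_sum/= mulmx_sumr summxE; apply: eq_bigr => a _.
  by rewrite linearZ/= -scalemxAr mxE -/(ip g x w (row a (E x))) ipE// expr2.
have [rB rB0 rBP] : exists2 q : R, 0 < q & forall s, `|s - s0| < q -> B (c s).
  have [d d0 Bd] := open_ball_sub oB Bx.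
  have [q q0 Hq] : exists2 q : R, 0 < q & forall h, h < q -> forall k, forall s, `|s - s0| <= h -> `|c s 0 k - c s0 0 k| <= d / 2.
    apply: common_radius => j.
    have s0r : `|s0 - s0| < r by rewrite subrr normr0.
    have d20 : 0 < d / 2 by rewrite divr_gt0.
    have /continuous_epsP/(_ _ d20)[q q0 Hq] := is_derive_continuous (dc s0 j s0r).
    by exists q => // h hq s sh; apply: Hq; exact: le_lt_trans hq.
  exists q => // s sq; apply: Bd; apply: (@le_lt_trans _ _ (d / 2)); last by lra.
  apply: le_rVnorm; first by rewrite divr_ge0// ltW.
  by move=> j; rewrite !mxE; exact: (Hq _ sq j s (lexx _)).
pose q := Num.min rB r; have q0 : 0 < q by rewrite lt_min rB0.
have qB s : `|s - s0| < q -> B (c s) by rewrite lt_min => /andP[/rBP].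
have qr s : `|s - s0| < q -> `|s - s0| < r by rewrite lt_min => /andP[].
have T20 : Tv (cf g E) c v o2 s0 = 0 by rewrite /Tv -ipE// r2.
(* The kernel condition on the velocity says b1 times its e1-component is zero, and b1 is not
   zero. *)
have T10 : Tv (cf g E) c v o1 s0 = 0.
  have Z l : (v s0 *m De (c s0)) 0 l = 0 by rewrite H3 mxE.
  have : \sum_l (v s0 *m De (c s0)) 0 l * cf g E o0 l (c s0) = 0 by apply: big1 => l _; rewrite Z mul0r.
  rewrite (eq_bigr (fun l => b1 g E (c s0) * Tv (cf g E) c v o1 s0 * (fr E o0 l (c s0) * cf g E o0 l (c s0)))).
    by rewrite -mulr_sumr D//= mulr1 => /eqP; rewrite mulf_eq0 (negPf (b10 _ Bx)) => /eqP.
  by move=> l _; rewrite wDe//; rewrite /Tv; ring.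
have T00 : Tv (cf g E) c v o0 s0 ^+ 2 = 1.
  rewrite -H5 ipvv// sum3 -/(Tv (cf g E) c v o0 s0) -/(Tv (cf g E) c v o1 s0) -/(Tv (cf g E) c v o2 s0).
  by rewrite T10 T20 expr0n/= !addr0.
have bH : b1 g E (c s0) ^+ 2 * eta s0 ^+ 2 = 1 by rewrite -NE.
have eta0 : eta s0 != 0.
  by apply/eqP => h; move: bH; rewrite h expr0n/= mulr0 => bH; lra.
have DH : deta s0 + Tv (cf g E) c v o0 s0 * a1 (fr E) (cn g E) (c s0) * eta s0 = 0.
  have := H2; rewrite (dirN _ _ Bx T10 T20) NE// -/(Tv (cf g E) c v o0 s0).
  have := b10 _ Bx; move: (b1 g E (c s0)) (Tv _ _ _ _ _) (a1 _ _ _) (eta s0) (deta s0) eta0 => bb t a n m n0 bb0.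
  have -> : 2 * bb ^+ 2 * t * a * n ^+ 2 + 2 * bb ^+ 2 * n * m = (2 * bb ^+ 2 * n) * (m + t * a * n) by ring.
  have z : 2 * bb ^+ 2 * n != 0 by rewrite !mulf_neq0 ?expf_neq0 ?pnatr_eq0.
  by move=> /eqP; rewrite mulf_eq0 (negPf z) => /eqP.
have [r' r'0 P] := adapted_propagate oB (smooth_cf mB sE) (smooth_fr sE) (smooth_cn mB sE) sb1
  (cnN mB sE oE) (fr_dual oE) (fr_codual oE) (cf_partial mB sE oE) (dcf1 mB sE oE)
  (dcn10 mB sE oE nl sc) (dcn20 mB sE oE nl) (dcn21 mB sE oE nl) beE gaE b10 q0 qB
  (fun s j h => dc s j (qr s h)) (fun s j h => dv s j (qr s h)) de1 de2 T10 T20 T00 bH DH.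
exists (Num.min r' q); first by rewrite lt_min r'0.
move=> s; rewrite lt_min => /andP[sr' sq]; have bx := qB _ sq.
have [P1 P2 P3 P4 P5] := P s sr'; split.
- by rewrite NE.
- rewrite (dirN _ _ bx P1 P2) NE// -/(Tv (cf g E) c v o0 s).
  move: P5; move: (b1 g E (c s)) (Tv _ _ _ _ _) (a1 _ _ _) (eta s) (deta s) => bb t a n m h.
  have -> : 2 * bb ^+ 2 * t * a * n ^+ 2 + 2 * bb ^+ 2 * n * m = (2 * bb ^+ 2 * n) * (m + t * a * n) by ring.
  by rewrite h mulr0.
- by apply/rowP => l; rewrite wDe// -/(Tv (cf g E) c v o1 s) P1 mulr0 mul0r mxE.
- by rewrite -(r2 _ bx) ipE.
- by rewrite ipvv// sum3 -/(Tv (cf g E) c v o0 s) -/(Tv (cf g E) c v o1 s) -/(Tv (cf g E) c v o2 s) P1 P2 P3 expr0n/= !addr0.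
Qed.
End KernelGeodesic.

(** * Curves and tensor fields in an atlas *)

Lemma preimage_open (T S : topologicalType) (A : set T) (B : set S) (f : T -> S) :
  open A -> open B -> (forall x, A x -> {for x, continuous f}) -> open [set x | A x /\ B (f x)].
Proof.
move=> oA oB cf; rewrite openE => x [Ax Bx].
have n1 : nbhs x A by exact: open_nbhs_nbhs.
have n2 : nbhs x (f @^-1` B) by apply: (cf x Ax); exact: open_nbhs_nbhs.
by apply: filterS2 n1 n2 => y; split.
Qed.

Section ChartTopology.
Variables (R : realType) (n : nat) (T : topologicalType) (c : chart R n T).
Hypothesis cc : is_chart c.

Lemma is_chart_cfun_continuous p : cdom c p -> {for p, continuous (cfun c)}.
Proof.
move=> cp; case: cc => od _ _ h _.
by move: h; rewrite (continuous_open_subspace _ od) => /(_ p (mem_set cp)).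
Qed.

Lemma is_chart_cinv_continuous x : cimg c x -> {for x, continuous (cinv c)}.
Proof.
move=> cx; case: cc => _ od _ _ h.
by move: h; rewrite (continuous_open_subspace _ od) => /(_ x (mem_set cx)).
Qed.

Lemma is_chart_cinv_cdom x : cimg c x -> cdom c (cinv c x).
Proof. by case=> p cp <-; case: cc => _ _ -> . Qed.

Lemma is_chart_cinvK x : cimg c x -> cfun c (cinv c x) = x.
Proof. by case=> p cp <-; case: cc => _ _ -> . Qed.

Lemma is_chart_image_open (U : set T) : open U -> open [set x | cimg c x /\ U (cinv c x)].
Proof.
move=> oU; rewrite openE => x [cx Ux]; have [_ oi _ _ _] := cc.
have n1 : nbhs x (cimg c) by exact: open_nbhs_nbhs.
have n2 : nbhs x (cinv c @^-1` U).
  by apply: (is_chart_cinv_continuous cx); exact: open_nbhs_nbhs.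
by apply: filterS2 n1 n2 => y; split.
Qed.

Lemma is_chart_preimage_open (V : set 'rV[R]_n) : open V -> open [set q | cdom c q /\ V (cfun c q)].
Proof.
by move=> oV; have [oc _ _ _ _] := cc; apply: (preimage_open oc oV) => q; exact: is_chart_cfun_continuous.
Qed.
End ChartTopology.

Section Atlas.
Variables (R : realType) (n : nat) (M : manifold R n).
Hypothesis sM : smooth_manifold M.
Implicit Types (a b : idx M) (p : M).

Let chM a : is_chart (atlas a). Proof. by case: sM => _ _ h _ _; exact: h. Qed.

Lemma cdom_open a : open (cdom (atlas a)). Proof. by case: (chM a). Qed.
Lemma cimg_open a : open (cimg (atlas a)). Proof. by case: (chM a). Qed.
Lemma cfunK a p : cdom (atlas a) p -> cinv (atlas a) (cfun (atlas a) p) = p.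
Proof. by case: (chM a) => _ _ h _ _; exact: h. Qed.
Lemma cimg_cfun a p : cdom (atlas a) p -> cimg (atlas a) (cfun (atlas a) p).
Proof. by move=> ap; exists p. Qed.
Lemma cinv_cdom a x : cimg (atlas a) x -> cdom (atlas a) (cinv (atlas a) x).
Proof. exact: is_chart_cinv_cdom. Qed.
Lemma cinvK a x : cimg (atlas a) x -> cfun (atlas a) (cinv (atlas a) x) = x.
Proof. exact: is_chart_cinvK. Qed.

Lemma cfun_continuous a p : cdom (atlas a) p -> {for p, continuous (cfun (atlas a))}.
Proof. exact: is_chart_cfun_continuous. Qed.

Lemma cinv_continuous a x : cimg (atlas a) x -> {for x, continuous (cinv (atlas a))}.
Proof. exact: is_chart_cinv_continuous. Qed.

Lemma chart_at p : exists a, cdom (atlas a) p.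
Proof. by case: sM => _ _ _ h _; exact: h. Qed.

Lemma overlapE a b : overlap a b = [set x | cimg (atlas a) x /\ cdom (atlas b) (cinv (atlas a) x)].
Proof.
apply/seteqP; split=> x.
  by case=> p [ap bp] <-; split; [exists p|rewrite cfunK].
by case=> ax bx; exists (cinv (atlas a) x); [split=> //; exact: cinv_cdom|exact: cinvK].
Qed.

Lemma overlap_open a b : open (overlap a b).
Proof. by rewrite overlapE; apply: is_chart_image_open => //; exact: cdom_open. Qed.

Lemma overlap_cimg a b : overlap a b `<=` cimg (atlas a).
Proof. by rewrite overlapE => x []. Qed.

Lemma overlap_cfun a b p : cdom (atlas a) p -> cdom (atlas b) p -> overlap a b (cfun (atlas a) p).
Proof. by move=> ap bp; exists p. Qed.

Lemma transition_cfun a b p : cdom (atlas a) p -> transition a b (cfun (atlas a) p) = cfun (atlas b) p.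
Proof. by move=> ap; rewrite /transition/= cfunK. Qed.

Lemma transition_cimg a b x : overlap a b x -> cimg (atlas b) (transition a b x).
Proof. by case=> p [ap bp] <-; rewrite transition_cfun//; exact: cimg_cfun. Qed.

Lemma smooth_transition a b : smooth_mx_on (overlap a b) (transition a b).
Proof. by case: sM => _ _ _ _; exact. Qed.

Lemma cinv_transition a b x : overlap a b x -> cinv (atlas b) (transition a b x) = cinv (atlas a) x.
Proof. by case=> p [ap bp] <-; rewrite transition_cfun// !cfunK. Qed.

Section Curves.
Variable c : R -> M.

Definition chart_curve a s := cfun (atlas a) (c s).
Definition velocity a s : 'rV[R]_n := \row_k derive1 (Defs.coord a c k) s.

Hypothesis cc : continuous c.

Lemma curve_stays (U : set M) s0 : open U -> U (c s0) ->
  exists2 r : R, 0 < r & forall s, `|s - s0| < r -> U (c s).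
Proof.
move=> oU Us; have : nbhs s0 (c @^-1` U) by apply: cc; exact: open_nbhs_nbhs.
move=> /nbhs_ballP[r /= r0 H]; exists r => // s sr; apply: H.
by rewrite -ball_normE /ball_/= distrC.
Qed.

Definition C1_at s := forall a, cdom (atlas a) (c s) -> forall k,
  is_derive s 1 (fun t => chart_curve a t 0 k) (velocity a s 0 k).

Lemma velocity_change a b s : C1_at s -> cdom (atlas a) (c s) -> cdom (atlas b) (c s) ->
  velocity b s = velocity a s *m jac (transition a b) (chart_curve a s).
Proof.
move=> C1 as_ bs_; apply/rowP => l.
have o := overlap_cfun as_ bs_.
have D := chain_rule (smooth_on_strict (@overlap_open a b) (smooth_transition 0 l) o) (C1 a as_).
have near_s : \forall t \near s, transition a b (chart_curve a t) 0 l = chart_curve b t 0 l.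
  have [r r0 H] := curve_stays (@cdom_open a) as_.
  apply/nbhs_ballP; exists r => // t; rewrite -ball_normE /ball_/= distrC => /H at_.
  by rewrite /chart_curve transition_cfun.
have D' := C1 b bs_ l.
have E := @near_eq_derive R R^o R^o _ _ s 1 near_s.
have [_ e1] := D; have [_ e2] := D'.
have -> : velocity b s 0 l = dirderiv (fun x => transition a b x 0 l) (chart_curve a s) (velocity a s).
  exact: (etrans (esym e2) (etrans (esym E) e1)).
by rewrite [RHS]mxE /dirderiv; apply: eq_bigr => i _; rewrite [jac _ _ _ _]mxE.
Qed.

End Curves.
End Atlas.
Arguments cdom_open {R n M} sM a.
Arguments cimg_open {R n M} sM a.
Arguments overlap_open {R n M} sM a b.
Arguments overlap_cimg {R n M} sM a b.
Arguments smooth_transition {R n M} sM a b.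
Arguments transition_cimg {R n M} sM a b.

Lemma ip_change (R : realType) n (g h : 'rV[R]_n -> 'M[R]_n) x y (J : 'M[R]_n) u v :
  g x = J *m h y *m J^T -> ip g x u v = ip h y (u *m J) (v *m J).
Proof. by move=> gE; rewrite /ip gE trmx_mul !mulmxA. Qed.

Lemma dirderiv_comp (R : realType) n m (A : set 'rV[R]_n) (B : set 'rV[R]_m)
    (phi : 'rV[R]_n -> 'rV[R]_m) (f : 'rV[R]_n -> R) (h : 'rV[R]_m -> R) x v :
  open A -> open B -> (forall x, A x -> B (phi x)) -> smooth_mx_on A phi -> smooth_on B h ->
  (forall x, A x -> f x = h (phi x)) -> A x ->
  dirderiv f x v = dirderiv h (phi x) (v *m jac phi x).
Proof.
move=> oA oB AB sphi sh fh Ax; rewrite /dirderiv.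
under eq_bigr do rewrite (pderiv_eq oA _ fh Ax) (pderiv_comp _ oA oB AB sphi sh Ax) mulr_sumr.
rewrite exchange_big/=; apply: eq_bigr => p _; rewrite mxE mulr_suml.
by apply: eq_bigr => i _; rewrite mulrA.
Qed.

Lemma null_geometry_sub (R : realType) (A B : set 'rV[R]_3) g k (K : R) :
  open A -> A `<=` B -> null_geometry B g k K -> null_geometry A g k K.
Proof.
move=> oA AB [h1 h2 h3 h4 h5]; split.
- exact: metric_on_sub oA AB h1.
- exact: smooth_mx_sub AB h2.
- by move=> x /AB; exact: h3.
- by move=> x j l m /AB; exact: h4.
- by move=> x /AB; exact: h5.
Qed.

(** * Continuation of the kernel state along a global geodesic *)

Section KernelStateChange.
Variables (R : realType) (A B : set 'rV[R]_3) (phi : 'rV[R]_3 -> 'rV[R]_3).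
Variables (g h : 'rV[R]_3 -> 'M[R]_3) (k l : 'rV[R]_3 -> 'rV[R]_3) (K : R).
Hypotheses (ngA : null_geometry A g k K) (ngB : null_geometry B h l K).
Hypotheses (AB : forall x, A x -> B (phi x)) (sphi : smooth_mx_on A phi).
Hypothesis gE : forall x, A x -> g x = jac phi x *m h (phi x) *m (jac phi x)^T.
Hypothesis kE : forall x, A x -> l (phi x) = k x *m jac phi x.

Let mA : metric_on A g. Proof. by case: ngA. Qed.
Let mB : metric_on B h. Proof. by case: ngB. Qed.

Lemma unit_field_change x : A x -> unit_field h l (phi x) = unit_field g k x *m jac phi x.
Proof.
by move=> Ax; rewrite /unit_field (kE Ax) (ip_change _ _ (gE Ax)) scalemxAl.
Qed.

Lemma unit_field_covd_change x : A x ->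
  covd g (unit_field g k) x *m jac phi x = jac phi x *m covd h (unit_field h l) (phi x).
Proof.
exact: (covd_change mA mB AB sphi gE (smooth_e ngA) (smooth_e ngB) unit_field_change).
Qed.

Lemma unit_field_norm_change x : A x ->
  covd_norm g (unit_field g k) x = covd_norm h (unit_field h l) (phi x).
Proof.
exact: (covd_norm_change mA mB AB sphi gE (smooth_e ngA) (smooth_e ngB) unit_field_change).
Qed.

(** Every clause is built from tensors, and so is invariant under a change of chart. *)
Lemma kernel_state_comp x v y dy : A x -> kernel_state g k x v y dy ->
  kernel_state h l (phi x) (v *m jac phi x) y dy.
Proof.
move=> Ax [h1 h2 h3 h4 h5].
have [oA _ _ _] := mA; have [oB _ _ _] := mB.
have NE := unit_field_norm_change Ax.
have dN := dirderiv_comp v oA oB AB sphi (smooth_N ngB) unit_field_norm_change Ax.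
split.
- by rewrite -NE.
- by rewrite -dN -NE.
- by rewrite -mulmxA -(unit_field_covd_change Ax) mulmxA h3 mul0mx.
- by rewrite (unit_field_change Ax) -(ip_change _ _ (gE Ax)).
- by rewrite -(ip_change _ _ (gE Ax)).
Qed.
End KernelStateChange.

Section NullManifold.
Variables (R : realType) (M : manifold R 3) (g : tensor2 M) (K : R) (k : vfield M).
Hypotheses (sM : smooth_manifold M) (rg : riemannian_metric g) (sk : smooth_vfield k).
Hypotheses (nk : nowhere_vanishing k) (ck : curvature_null g k).
Hypotheses (scalK : constant_scalar_curvature g (2 * K)) (Kpos : 0 < K).
Implicit Types (a b : idx M) (p : M).

Let K0 : K != 0. Proof. exact: lt0r_neq0. Qed.

Lemma chart_metric a : metric_on (cimg (atlas a)) (g a).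
Proof. by case: rg => h1 _ h3 h4; split; [exact: cimg_open|exact: h1|exact: h3|exact: h4]. Qed.
Arguments chart_metric : clear implicits.

Lemma chart_geometry a : null_geometry (cimg (atlas a)) (g a) (k a) K.
Proof.
case: sk => h1 _; split; [exact: chart_metric|exact: h1|exact: nk| |exact: scalK].
by move=> x j l m ax; exact: ck.
Qed.
Arguments chart_geometry : clear implicits.

Lemma metric_change a b x : overlap a b x ->
  g a x = jac (transition a b) x *m g b (transition a b x) *m (jac (transition a b) x)^T.
Proof. by case: rg => _ h _ _; exact: h. Qed.

Definition ue a := unit_field (g a) (k a).

Lemma smooth_ue a : smooth_mx_on (cimg (atlas a)) (ue a).
Proof. exact: smooth_e (chart_geometry a). Qed.
Arguments smooth_ue : clear implicits.

Lemma null_geometry_overlap a b : null_geometry (overlap a b) (g a) (k a) K.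
Proof. exact: null_geometry_sub (overlap_open sM a b) (overlap_cimg sM a b) (chart_geometry a). Qed.

Lemma kernel_state_change a b x v h dh : overlap a b x ->
  kernel_state (g a) (k a) x v h dh ->
  kernel_state (g b) (k b) (transition a b x) (v *m jac (transition a b) x) h dh.
Proof.
exact: (kernel_state_comp (null_geometry_overlap a b) (chart_geometry b) (transition_cimg sM a b)
  (smooth_transition sM a b) (@metric_change a b) (@sk.2 a b)).
Qed.

Section Geodesic.
Variable c : R -> M.
Hypothesis gc : geodesic g c.

Lemma geodesic_C1 s : C1_at c s.
Proof.
move=> a ac l; have [_ /(_ a s ac l)[d1 _ _]] := gc.
rewrite mxE derive1E; exact/derivableP.
Qed.

Lemma geodesic_velocity s a l : cdom (atlas a) (c s) -> is_derive s 1 (fun t => velocity c a t 0 l)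
  (- \sum_i \sum_j christoffel (g a) l i j (chart_curve c a s) * velocity c a s 0 i * velocity c a s 0 j).
Proof.
move=> ac; have [_ /(_ a s ac l)[_ d2 eq0]] := gc.
rewrite (_ : (fun t => _) = derive1 (Defs.coord a c l)); last by apply/funext => t; rewrite mxE.
have -> : - (\sum_i \sum_j christoffel (g a) l i j (chart_curve c a s) * velocity c a s 0 i * velocity c a s 0 j)
   = derive1n 2 (Defs.coord a c l) s.
  apply/eqP; rewrite eq_sym -addr_eq0; apply/eqP; rewrite -[RHS]eq0; congr (_ + _).
  by apply: eq_bigr => i _; apply: eq_bigr => j _; rewrite !mxE.
by rewrite /derive1n/= derive1E; exact/derivableP.
Qed.

Variables (eta deta : R -> R).
Hypothesis deta1 : forall s : R, is_derive s 1 eta (deta s).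
Hypothesis deta2 : forall s : R, is_derive s 1 deta (- K * eta s).

Definition kernel_along s := exists a, cdom (atlas a) (c s) /\
  kernel_state (g a) (k a) (chart_curve c a s) (velocity c a s) (eta s) (deta s).

Lemma kernel_along_chart s a : cdom (atlas a) (c s) -> kernel_along s ->
  kernel_state (g a) (k a) (chart_curve c a s) (velocity c a s) (eta s) (deta s).
Proof.
move=> ac [b [bc H]]; have o := overlap_cfun bc ac.
have := kernel_state_change o H.
by rewrite transition_cfun// -(velocity_change sM gc.1 (@geodesic_C1 s) bc ac).
Qed.

(** Closedness: in one chart the clauses are equations between continuous functions of s, so they
    survive limits. *)
Lemma kernel_state_continuous s0 a : cdom (atlas a) (c s0) ->
  (forall e : R, 0 < e -> exists2 s, `|s - s0| < e & kernel_along s) -> kernel_along s0.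
Proof.
move=> ac H.
have [r r0 st] := curve_stays gc.1 (cdom_open sM a) ac.
have ax := cimg_cfun ac.
have vel l : {for s0, continuous (fun t => velocity c a t 0 l)}.
  exact: is_derive_continuous (geodesic_velocity l ac).
have along f : smooth_on (cimg (atlas a)) f -> {for s0, continuous (fun t => f (chart_curve c a t))}.
  move=> sf; apply: is_derive_continuous.
  exact: (is_derive_along (cimg_open sM a) ax (geodesic_C1 ac) sf).
have ec : {for s0, continuous eta} by exact: is_derive_continuous (deta1 s0).
have dec : {for s0, continuous deta} by exact: is_derive_continuous (deta2 s0).
have clos (F : R -> R) (d : R) : {for s0, continuous F} ->
    (forall s, kernel_along s -> cdom (atlas a) (c s) -> F s = d) -> F s0 = d.
  move=> /continuous_epsP cF HF; apply/eqP; rewrite -subr_eq0 -normr_le0.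
  apply/ler_addgt0Pr => e e0; rewrite add0r; have [dl dl0 Hd] := cF e e0.
  have [|s] := H (Num.min dl r); first by rewrite lt_min dl0.
  rewrite lt_min => /andP[s1 s2] ks.
  by rewrite distrC -(HF s ks (st s s2)); exact: Hd.
exists a; split=> //.
have ng := chart_geometry a.
have sN := smooth_N ng; have sD := smooth_covd ng; have [[oA sg _ _] _ _ _ _] := ng.
have se := smooth_ue a.
have ipc (Z : R -> 'rV[R]_3) : (forall l, {for s0, continuous (fun t => Z t 0 l)}) ->
    {for s0, continuous (fun t => ip (g a) (chart_curve c a t) (velocity c a t) (Z t))}.
  move=> cZ; rewrite (_ : (fun t => _) = fun t => \sum_i (\sum_j velocity c a t 0 j * g a (chart_curve c a t) j i) * Z t 0 i).
    apply: continuous_bigsum => i; apply: continuousM; last exact: cZ.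
    apply: continuous_bigsum => j; apply: continuousM; [exact: vel|].
    exact: (along _ (sg j i)).
  by apply/funext => t; rewrite /ip mxE; apply: eq_bigr => i _; rewrite !mxE.
split.
- apply: (clos (fun s => covd_norm (g a) (ue a) (chart_curve c a s) * eta s ^+ 2)).
    apply: continuousM; first exact: along.
    exact: (continuousM ec ec).
  by move=> s ks ac'; have [] := kernel_along_chart ac' ks.
- apply: (clos (fun s => dirderiv (covd_norm (g a) (ue a)) (chart_curve c a s) (velocity c a s) * eta s ^+ 2 +
       2 * covd_norm (g a) (ue a) (chart_curve c a s) * eta s * deta s)).
    apply: continuousD.
      apply: continuousM; last exact: (continuousM ec ec).
      apply: continuous_bigsum => i; apply: continuousM; first exact: vel.
      by apply: along; exact: smooth_on_pderiv.
    apply: continuousM => //; apply: continuousM => //; apply: continuousM; first exact: cst_continuous.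
    exact: along.
  by move=> s ks ac'; have [] := kernel_along_chart ac' ks.
- apply/rowP => l; rewrite [RHS]mxE.
  apply: (clos (fun s => (velocity c a s *m covd (g a) (ue a) (chart_curve c a s)) 0 l)).
    rewrite (_ : (fun t => _) = fun t => \sum_i velocity c a t 0 i * covd (g a) (ue a) (chart_curve c a t) i l).
      by apply: continuous_bigsum => i; apply: continuousM; [exact: vel|exact: (along _ (sD i l))].
    by apply/funext => t; rewrite mxE.
  by move=> s ks ac'; have [_ _ -> _ _] := kernel_along_chart ac' ks; rewrite mxE.
- apply: (clos (fun s => ip (g a) (chart_curve c a s) (velocity c a s) (ue a (chart_curve c a s)))).
    by apply: ipc => l; exact: (along _ (se 0 l)).
  by move=> s ks ac'; have [] := kernel_along_chart ac' ks.
- apply: (clos (fun s => ip (g a) (chart_curve c a s) (velocity c a s) (velocity c a s))).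
    exact: ipc.
  by move=> s ks ac'; have [] := kernel_along_chart ac' ks.
Qed.

Lemma kernel_along_open s0 : kernel_along s0 ->
  exists2 e : R, 0 < e & forall s, `|s - s0| < e -> kernel_along s.
Proof.
move=> [a [ac H]]; have [r r0 st] := curve_stays gc.1 (cdom_open sM a) ac.
have [r' r'0 P] := @kernel_state_propagate _ _ _ _ _ K0 (chart_geometry a) (chart_curve c a) (velocity c a) s0 r eta deta r0
  (fun s h => cimg_cfun (st s h)) (fun s l h => geodesic_C1 (st s h) l) (fun s l h => geodesic_velocity l (st s h))
  deta1 deta2 H.
exists (Num.min r' r); first by rewrite lt_min r'0.
by move=> s; rewrite lt_min => /andP[s1 s2]; exists a; split; [exact: st|exact: P].
Qed.

(** The set of good times is open by [kernel_along_open] and closed by [kernel_state_continuous]. *)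
Lemma kernel_along_all s1 : 0 <= s1 -> kernel_along 0 -> kernel_along s1.
Proof.
move=> s10 H0; apply: (interval_induction s10 H0) => s _.
have [ks|nks] := pselect (kernel_along s).
  have [e e0 H] := kernel_along_open ks; exists e; first exact: e0.
  by move=> t _ te; split=> _; [exact: ks|exact: H].
have [a ac] := chart_at sM (c s).
have [e e0 H] : exists2 e : R, 0 < e & forall t, `|t - s| < e -> ~ kernel_along t.
  apply: contrapT => C; apply: nks; apply: (kernel_state_continuous ac) => e e0.
  apply: contrapT => D; apply: C; exists e => // t te kt; apply: D; by exists t.
exists e; first exact: e0.
by move=> t _ te; split=> [kt|ks]; [case: (H t te kt)|case: (nks ks)].
Qed.

Lemma eta_nonzero s1 : 0 <= s1 -> kernel_along 0 -> eta s1 != 0.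
Proof.
move=> s10 /(kernel_along_all s10)[a [ac [h _ _ _ _]]]; apply/eqP => e0.
by move: h; rewrite e0 expr0n/= mulr0 => /eqP; rewrite eq_sym oner_eq0.
Qed.
End Geodesic.
End NullManifold.

(** * Contradiction with the zeros of the oscillator equation *)

Definition harmonic (R : realType) (w p q : R) (s : R) : R := p * cos (w * s) + q * sin (w * s).

Lemma is_derive_harmonic (R : realType) (w p q s : R) :
  is_derive s 1 (harmonic w p q) (harmonic w (w * q) (- (w * p)) s).
Proof.
have l : is_derive s 1 (fun t : R => w * t) w.
  by apply: is_derive_cast (is_derive_mulR (is_derive_cstR w s 1) (is_derive_id s 1)) _; rewrite mulr0 addr0 mulr1.
have dc : is_derive s 1 (fun t : R => cos (w * t)) (- sin (w * s) * w).
  by apply: is_derive_comp1; exact: is_derive_cos.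
have ds : is_derive s 1 (fun t : R => sin (w * t)) (cos (w * s) * w).
  by apply: is_derive_comp1; exact: is_derive_sin.
apply: is_derive_cast (is_derive_addR (is_derive_mulR (is_derive_cstR p s 1) dc) (is_derive_mulR (is_derive_cstR q s 1) ds)) _.
by rewrite /harmonic; ring.
Qed.

Lemma harmonic2 (R : realType) (w p q s : R) :
  harmonic w (w * (- (w * p))) (- (w * (w * q))) s = - (w ^+ 2) * harmonic w p q s.
Proof. by rewrite /harmonic; ring. Qed.

(** After half a period the value p > 0 has become -p. *)
Lemma harmonic_zero (R : realType) (w p q : R) : 0 < w -> 0 < p ->
  exists2 s, 0 <= s & harmonic w p q s = 0.
Proof.
move=> w0 p0; have wn0 := lt0r_neq0 w0.
have pw : 0 <= pi / w by rewrite divr_ge0 ?pi_ge0 // ltW.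
have h0 : harmonic w p q 0 = p by rewrite /harmonic mulr0 cos0 sin0 mulr0 addr0 mulr1.
have h1 : harmonic w p q (pi / w) = - p.
  by rewrite /harmonic [w * _]mulrC divfK // cospi sinpi mulr0 addr0 mulrN1.
have [||c] := @IVT R (harmonic w p q) 0 (pi / w) 0 pw.
- apply: continuous_subspaceT => s; exact: is_derive_continuous (is_derive_harmonic w p q s).
- rewrite h0 h1 ge_min le_max (ltW p0) oppr_le0 (ltW p0); by rewrite orbT.
- by rewrite in_itv/= => /andP[c0 _] hc; exists c.
Qed.

Lemma unit_field_covd_norm_gt0 (R : realType) (A : set 'rV[R]_3) g k (K : R) x :
  K != 0 -> null_geometry A g k K -> A x -> covd g (unit_field g k) x != 0 ->
  0 < covd_norm g (unit_field g k) x.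
Proof.
move=> K0 ng Ax De0; rewrite lt_def; apply/andP; split.
  by apply: contraNneq De0 => /(N_eq0 K0 ng Ax) ->.
have [B [E [oB Bx BA [mB sE [oE nl sc r2]]]]] := adapted_frame_exists ng Ax.
rewrite (covd_norm_frame mB sE K0 oE nl sc r2 Bx).
apply: addr_ge0; last exact: sqr_ge0.
apply: addr_ge0; last exact: sqr_ge0.
by apply: mulr_ge0; [exact: ler0n|exact: sqr_ge0].
Qed.

(** A normalized nonzero row of De serves as velocity: it lies in the kernel because De squares to
    zero. *)
Lemma kernel_initial (R : realType) (A : set 'rV[R]_3) g k (K w : R) x :
  0 < w -> K != 0 -> null_geometry A g k K -> A x -> covd g (unit_field g k) x != 0 ->
  exists v p q, 0 < p /\ kernel_state g k x v (harmonic w p q 0) (harmonic w (w * q) (- (w * p)) 0).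
Proof.
move=> w0 K0 ng Ax De0; have mg : metric_on A g by case: ng.
have N0 := unit_field_covd_norm_gt0 K0 ng Ax De0.
have [i ri] : exists i, row i (covd g (unit_field g k) x) != 0.
  apply: contrapT => /forallNP H; case/negP: De0; apply/eqP/row_matrixP => i.
  by rewrite row0; apply/eqP; apply: contraT => /(H i).
pose u := row i (covd g (unit_field g k) x).
have u0 : 0 < ip g x u u by exact: (ip_gt0 mg Ax ri).
pose n := Num.sqrt (ip g x u u).
have n0 : n != 0 by rewrite sqrtr_eq0 -ltNge.
have n2 : n ^+ 2 = ip g x u u by rewrite sqr_sqrtr// ltW.
pose v := n^-1 *: u.
pose N := covd_norm g (unit_field g k) x.
pose dN := dirderiv (covd_norm g (unit_field g k)) x v.
pose p := (Num.sqrt N)^-1.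
have p0 : 0 < p by rewrite invr_gt0 sqrtr_gt0.
have pN : N * p ^+ 2 = 1.
  by rewrite exprVn sqr_sqrtr ?(ltW N0)// mulfV// lt0r_neq0.
(* The last witness solves the first-order condition dN p^2 + 2 N p (w q) = 0 for q. *)
exists v, p, (- (dN * p) / (2 * N * w)); split=> //.
have nN : N != 0 := lt0r_neq0 N0.
have nw : w != 0 := lt0r_neq0 w0.
split.
- by rewrite /harmonic mulr0 cos0 sin0 mulr0 addr0 mulr1.
- rewrite /harmonic mulr0 cos0 sin0 !mulr0 !addr0 !mulr1 -/N -/dN.
  by field; rewrite nw nN.
- by rewrite /v -scalemxAl /u -row_mul (covd_sq K0 ng Ax) row0 scaler0.
- by rewrite /v ipZl /u (covd_perp ng i Ax) mulr0.
- by rewrite /v ipZl ipZr -n2; field.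
Qed.

Section ParallelField.
Variables (R : realType) (M : manifold R 3) (g : tensor2 M) (K : R) (k : vfield M).
Hypotheses (sM : smooth_manifold M) (rg : riemannian_metric g) (sk : smooth_vfield k).
Hypotheses (nk : nowhere_vanishing k) (ck : curvature_null g k).
Hypotheses (scalK : constant_scalar_curvature g (2 * K)) (Kpos : 0 < K).
Hypothesis cg : complete_metric g.

(** Completeness lets the geodesic reach the zero of [eta], where N eta^2 = 1 is impossible. *)
Theorem ue_parallel a x : cimg (atlas a) x -> covd (g a) (ue g k a) x = 0.
Proof.
move=> ax; apply/eqP; apply: contraT => De0.
have w0 : 0 < Num.sqrt K by rewrite sqrtr_gt0.
have w2 : Num.sqrt K ^+ 2 = K by rewrite sqr_sqrtr// ltW.
have K0 := lt0r_neq0 Kpos.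
have ng := chart_geometry sM rg sk nk ck scalK.
have [v [p [q [p0 H]]]] := kernel_initial w0 K0 (ng a) ax De0.
have [c [gc c0 cv]] := cg v (cinv_cdom sM ax).
have [s s0 hs] := harmonic_zero q w0 p0.
have d2 (t : R) : is_derive t 1 (harmonic (Num.sqrt K) (Num.sqrt K * q) (- (Num.sqrt K * p)))
    (- K * harmonic (Num.sqrt K) p q t).
  by apply: is_derive_cast (is_derive_harmonic _ _ _ t) _; rewrite harmonic2 w2.
have ka : kernel_along g k c (harmonic (Num.sqrt K) p q)
   (harmonic (Num.sqrt K) (Num.sqrt K * q) (- (Num.sqrt K * p))) 0.
  have ac : cdom (atlas a) (c 0) by rewrite c0; exact: cinv_cdom.
  exists a; split; first exact: ac.
  have -> : chart_curve c a 0 = x by rewrite /chart_curve c0 cinvK.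
  by have -> : velocity c a 0 = v by apply/rowP => l; rewrite mxE cv.
have := eta_nonzero sM rg sk nk ck scalK Kpos gc (is_derive_harmonic _ _ _) d2 s0 ka.
by rewrite hs eqxx.
Qed.
End ParallelField.

(** * Linear ordinary differential equations *)

(** The intervals of radius 2V/2^n around u_n are nested; the limit is the supremum of their left
    ends. The explicit rate serves as uniform convergence later. *)
Lemma nested_limit (R : realType) (u : nat -> R) (V : R) :
  (forall n, `|u n.+1 - u n| <= V / 2 ^+ n) ->
  exists L, forall n, `|L - u n| <= 2 * V / 2 ^+ n.
Proof.
move=> H; pose r n := 2 * V / 2 ^+ n.
have rS n : r n = r n.+1 + V / 2 ^+ n.
  by rewrite /r exprS invfM; set p := (2 ^+ n)^-1; lra.
have V0 : 0 <= V by have := H 0%N; rewrite expr0 divr1; apply: le_trans.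
have r0 n : 0 <= r n by rewrite /r divr_ge0 ?mulr_ge0 // exprn_ge0.
have step n : u n - r n <= u n.+1 - r n.+1 /\ u n.+1 + r n.+1 <= u n + r n.
  by have := H n; rewrite ler_norml => /andP[]; have := rS n; move: (V / _) (r n) (r n.+1) => *; split; lra.
have mono n p : u n - r n <= u (n + p)%N - r (n + p)%N /\ u (n + p)%N + r (n + p)%N <= u n + r n.
  elim: p => [|p [I1 I2]]; first by rewrite addn0.
  by have [S1 S2] := step (n + p)%N; rewrite addnS; split; [exact: le_trans S1|exact: le_trans I2].
have nest n m : u n - r n <= u m + r m.
  have [M1 _] := mono n m; have [_ M2] := mono m n; rewrite addnC in M2.
  by have := r0 (n + m)%N; lra.
pose E : set R := [set x | exists n, x = u n - r n].
have supE : has_sup E.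
  split; first by exists (u 0%N - r 0%N), 0%N.
  by exists (u 0%N + r 0%N) => x [n ->].
exists (sup E) => n; rewrite ler_norml -/(r n); apply/andP; split.
  have : u n - r n <= sup E by apply: ub_le_sup; [case: supE|exists n].
  lra.
have : sup E <= u n + r n by apply: ge_sup; [case: supE|move=> x [m ->]].
lra.
Qed.

(** The bound 3/2 exceeds 1, so that solutions are differentiable at the final time 1. *)
Definition clamp (R : realType) (s : R) : R :=
  if s < - (3 / 2) then - (3 / 2) else if 3 / 2 < s then 3 / 2 else s.

Lemma clamp_bound (R : realType) (s : R) : `|clamp s| <= 3 / 2.
Proof.
rewrite /clamp ler_norml; case: (ltP s (- (3 / 2))) => h1; [|case: (ltP (3 / 2) s) => h2];
  by apply/andP; split; lra.
Qed.

Lemma clamp_id (R : realType) (s : R) : `|s| <= 3 / 2 -> clamp s = s.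
Proof. by rewrite /clamp ler_norml => /andP[h1 h2]; rewrite !ltNge h1 h2. Qed.

Lemma clamp_lip (R : realType) (s t : R) : `|clamp s - clamp t| <= `|s - t|.
Proof.
rewrite ler_norml; have := ler_norm (s - t); have := ler_norm (t - s); rewrite [`|t - s|]distrC.
move: `|s - t| => d; rewrite /clamp.
case: (ltP s (- (3 / 2))) => ?; case: (ltP t (- (3 / 2))) => ?;
  case: (ltP (3 / 2) s) => ?; case: (ltP (3 / 2) t) => ? *; by apply/andP; split; lra.
Qed.

Lemma clamp_continuous (R : realType) : continuous (@clamp R).
Proof.
move=> s; apply/continuous_epsP => e e0; exists e => // t te.
exact: le_trans (clamp_lip _ _) (ltW te).
Qed.

Section Primitive.
Variable R : realType.
Implicit Types f g : R -> R.

(** Starting at -3 puts all values of [clamp] in the interior of [-3, 3], where the fundamental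
    theorem of calculus applies. *)
Definition prim0 f (x : R) : R :=
  (\int[@lebesgue_measure R]_(t in [set` `[(-3)%R, x]%R]) (f t))%R.
(* Constant outside [-3/2, 3/2], so that the Picard iterates are bounded. *)
Definition prim f (s : R) := prim0 f (clamp s) - prim0 f 0.

Lemma is_derive_prim0 f (s : R) : continuous f -> `|s| < 3 -> is_derive s 1 (prim0 f) (f s).
Proof.
rewrite ltr_norml => cf /andP[s1 s2].
have fi : (@lebesgue_measure R).-integrable `[(-3)%R, 3%R] (EFin \o f).
  by apply: continuous_compact_integrable; [exact: segment_compact|exact: continuous_subspaceT].
have [d e] := continuous_FTC1_closed s2 fi s1 (cf s).
by rewrite -e derive1E; exact/derivableP.
Qed.

Lemma is_derive_prim f (s : R) : continuous f -> `|s| < 3 / 2 -> is_derive s 1 (prim f) (f s).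
Proof.
move=> cf s3.
have [d e] : is_derive s 1 (fun x => prim0 f x - prim0 f 0) (f s).
  apply: is_derive_cast (is_derive_addR (is_derive_prim0 cf _) (is_derive_cstR (- prim0 f 0) s 1)) _; last by rewrite addr0.
  by apply: lt_trans s3 _; lra.
have nr : \forall t \near s, prim0 f t - prim0 f 0 = prim f t.
  have r0 : 0 < 3 / 2 - `|s| by lra.
  apply/nbhs_ballP; exists (3 / 2 - `|s|) => // t; rewrite -ball_normE /ball_/= => ts.
  rewrite /prim clamp_id//; have := ler_normD (t - s) s; rewrite subrK => h.
  by apply: le_trans h _; rewrite distrC; lra.
split; first exact: near_eq_derivable nr d.
by rewrite -e; apply: esym; exact: near_eq_derive nr.
Qed.

Lemma prim_at0 f : prim f 0 = 0.
Proof. by rewrite /prim clamp_id ?subrr// normr0; lra. Qed.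

Lemma prim_continuous f : continuous f -> continuous (prim f).
Proof.
move=> cf s.
have c0 : {for clamp s, continuous (prim0 f)}.
  apply: (is_derive_continuous (is_derive_prim0 cf _)).
  by apply: le_lt_trans (clamp_bound s) _; lra.
have c1 : {for s, continuous (fun t : R => prim0 f (clamp t))}.
  by apply: continuous_comp; [exact: clamp_continuous|exact: c0].
exact: (continuousD c1 (@cst_continuous _ _ (- prim0 f 0) s)).
Qed.

Lemma clamp_MVT (F f : R -> R) C : 0 <= C -> (forall x : R, `|x| <= 3 / 2 -> is_derive x 1 F (f x)) ->
  (forall s, `|f s| <= C) -> forall s, `|F (clamp s) - F 0| <= 2 * C.
Proof.
move=> C0 D fC s; have tb := clamp_bound s; move: (clamp s) tb => t tb.
have := @MVT_line R R^o F 0 1 t 0 C; rewrite add0r !mulr0 subr0 [t *: 1]mulr1 => H.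
apply: le_trans (H _ _) _.
- by move=> x xt; rewrite add0r [x *: 1]mulr1; have [] := D x (le_trans xt tb).
- by move=> x xt; rewrite add0r [x *: 1]mulr1; have [_ ->] := D x (le_trans xt tb); rewrite subr0; exact: fC.
- by rewrite mulrC ler_wpM2r//; lra.
Qed.

Lemma prim_bound f C : 0 <= C -> continuous f -> (forall s, `|f s| <= C) -> forall s, `|prim f s| <= 2 * C.
Proof.
move=> C0 cf fC; apply: (clamp_MVT C0 _ fC) => x x3.
by apply: is_derive_prim0 => //; lra.
Qed.

Lemma prim_dist f g C : 0 <= C -> continuous f -> continuous g -> (forall s, `|f s - g s| <= C) ->
  forall s, `|prim f s - prim g s| <= 2 * C.
Proof.
move=> C0 cf cg fg s.
have D (x : R) : `|x| <= 3 / 2 -> is_derive x 1 (fun x => prim0 f x - prim0 g x) (f x - g x).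
  move=> x3; have x3' : `|x| < 3 by lra.
  exact: (is_derive_addR (is_derive_prim0 cf x3') (is_deriveN (is_derive_prim0 cg x3'))).
have := clamp_MVT C0 D fg s.
by rewrite /prim (_ : _ - _ - _ = prim0 f (clamp s) - prim0 f 0 - (prim0 g (clamp s) - prim0 g 0)); last ring.
Qed.
End Primitive.

Lemma continuous_bigsumR (R : realType) (V : normedModType R) m (F : 'I_m -> V -> R) :
  (forall i, continuous (F i)) -> continuous (fun y => \sum_i F i y).
Proof. by move=> H x; apply: continuous_bigsum => i; exact: H. Qed.

Lemma mulmx_contract (R : realType) m (y : 'rV[R]_m) (b : 'M[R]_m) (c D : R) l :
  \sum_j `|b j l| <= c -> (forall j, `|y 0 j| <= D) -> `|(y *m b) 0 l| <= c * D.
Proof.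
move=> bc yD; rewrite mxE (le_trans (ler_norm_sum _ _ _))//.
have [m0|m0] := posnP m.
  have c0 : 0 <= c by apply: le_trans bc; rewrite sumr_ge0.
  move: y b l bc yD; rewrite m0 => y b [].
  by [].
have D0 : 0 <= D by apply: le_trans (normr_ge0 _) (yD (Ordinal m0)).
apply: (@le_trans _ _ (\sum_j (`|b j l| * D))).
  by apply: ler_sum => j _; rewrite normrM mulrC ler_wpM2l.
by rewrite -mulr_suml ler_wpM2r.
Qed.

Lemma mulmx_contractB (R : realType) m (y z : 'rV[R]_m) (b : 'M[R]_m) (c D : R) l :
  \sum_j `|b j l| <= c -> (forall j, `|y 0 j - z 0 j| <= D) ->
  `|(y *m b) 0 l - (z *m b) 0 l| <= c * D.
Proof.
move=> bc yz; have -> : (y *m b) 0 l - (z *m b) 0 l = ((y - z) *m b) 0 l.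
  by rewrite mulmxBl [RHS]mxE [X in _ = _ + X]mxE.
by apply: mulmx_contract => // j; rewrite mxE [X in _ + X]mxE.
Qed.

Section LinearODE.
Variables (R : realType) (m : nat) (b : R -> 'M[R]_m).
Hypothesis cb : forall i j, continuous (fun s : R => b s i j).
Hypothesis bsmall : forall s l, \sum_j `|b s j l| <= 4^-1.

Fixpoint picard (v : 'rV[R]_m) n (s : R) : 'rV[R]_m :=
  if n is n'.+1 then \row_l (v 0 l + prim (fun t => (picard v n' t *m b t) 0 l) s) else v.

Let mul_continuous (y : R -> 'rV[R]_m) : (forall l, continuous (fun s : R => y s 0 l)) ->
  forall l, continuous (fun s : R => (y s *m b s) 0 l).
Proof.
move=> cy l; rewrite (_ : (fun s => _) = fun s => \sum_j y s 0 j * b s j l).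
  by apply: continuous_bigsumR => j s; apply: continuousM; [exact: cy|exact: cb].
by apply/funext => s; rewrite mxE.
Qed.

Lemma picard_continuous v n l : continuous (fun s : R => picard v n s 0 l).
Proof.
elim: n l => [|n IH] l; first by move=> s; exact: cst_continuous.
rewrite (_ : (fun s => _) = fun s => v 0 l + prim (fun t => (picard v n t *m b t) 0 l) s).
  move=> s; apply: continuousD; first exact: cst_continuous.
  exact: (prim_continuous (@mul_continuous (picard v n) IH l)).
by apply/funext => s; rewrite /= mxE.
Qed.

(** Multiplication by [b] contributes a factor 1/4 and integration at most 2, so each Picard step
    contracts by 1/2. *)
Lemma picard_step v n l s : `|picard v n.+1 s 0 l - picard v n s 0 l| <= `|v| / 2 ^+ n.
Proof.
elim: n l s => [|n IH] l s.
  rewrite /= mxE addrC addKr expr0 divr1.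
  have V0 : 0 <= 4^-1 * `|v| by rewrite mulr_ge0.
  have cv : continuous (fun t : R => (v *m b t) 0 l).
    by apply: (mul_continuous (y := fun=> v)) => j t; exact: cst_continuous.
  have H t : `|(v *m b t) 0 l| <= 4^-1 * `|v|.
    by apply: mulmx_contract; [exact: bsmall|move=> j; exact: rVcoord_le].
  have := prim_bound V0 cv H s; have := normr_ge0 v; rewrite mulrA; lra.
rewrite [picard v n.+2]/= [picard v n.+1]/= !mxE.
rewrite (_ : _ + _ - _ = prim (fun t => (picard v n.+1 t *m b t) 0 l) s - prim (fun t => (picard v n t *m b t) 0 l) s); last by rewrite /= ; ring.
have C0 : 0 <= 4^-1 * (`|v| / 2 ^+ n) by rewrite mulr_ge0// divr_ge0// exprn_ge0.
have := prim_dist C0 (@mul_continuous (picard v n.+1) (@picard_continuous v n.+1) l) (@mul_continuous (picard v n) (@picard_continuous v n) l).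
move=> H; apply: le_trans (H _ s) _.
  move=> t; apply: mulmx_contractB; first exact: bsmall.
  by move=> j; exact: IH.
rewrite exprS invfM; have := normr_ge0 v; set q := (2 ^+ n)^-1; lra.
Qed.

Lemma linear_ode_exists (v : 'rV[R]_m) : exists y : R -> 'rV[R]_m,
  [/\ y 0 = v, forall s l, `|y s 0 l| <= 3 * `|v|, forall l, continuous (fun s : R => y s 0 l) &
   forall (s : R) l, `|s| < 3 / 2 -> is_derive s 1 (fun t : R => y t 0 l) ((y s *m b s) 0 l)].
Proof.
have /choice[y0 Hy0] : forall sl : R * 'I_m, exists L, forall n, `|L - picard v n sl.1 0 sl.2| <= 2 * `|v| / 2 ^+ n.
  by move=> [s l]; apply: nested_limit => n; exact: picard_step.
pose y s : 'rV[R]_m := \row_l y0 (s, l).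
have H s l n : `|y s 0 l - picard v n s 0 l| <= 2 * `|v| / 2 ^+ n by rewrite mxE; exact: Hy0 (s, l) n.
have small (e : R) : 0 < e -> exists n, 2 * `|v| / 2 ^+ n <= e.
  move=> e0; exists (Num.Def.archi_bound (2 * `|v| / e)).
  have h : 2 * `|v| / e < (Num.Def.archi_bound (2 * `|v| / e))%:R.
    by apply: archi_boundP; rewrite divr_ge0 ?mulr_ge0 // ltW.
  move: (Num.Def.archi_bound _) h => N h.
  have p0 : 0 < 2 ^+ N :> R by rewrite exprn_gt0.
  have h2 : 2 * `|v| < N%:R * e by rewrite -ltr_pdivrMr.
  rewrite ler_pdivrMr //; apply: le_trans (ltW h2) _; rewrite mulrC ler_wpM2l ?(ltW e0)//.
  by rewrite -natrX ler_nat; apply: ltnW; exact: ltn_expl.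
have cy l : continuous (fun s : R => y s 0 l).
  move=> s; apply/continuous_epsP => e e0; have e3 : 0 < e / 3 by lra.
  have [n hn] := small _ e3.
  have /continuous_epsP/(_ _ e3)[d d0 Hd] := @picard_continuous v n l s.
  exists d => // t td; have := Hd t td; have := H t l n; have := H s l n.
  rewrite !ler_norml => /andP[? ?] /andP[? ?] /andP[? ?]; apply/andP; split; lra.
have yE s l : y s 0 l = v 0 l + prim (fun t => (y t *m b t) 0 l) s.
  apply/eqP; rewrite -subr_eq0 -normr_le0; apply/ler_addgt0Pr => e e0; rewrite add0r.
  have e2 : 0 < e / 2 by lra.
  have [n hn] := small _ e2.
  have C0 : 0 <= 4^-1 * (2 * `|v| / 2 ^+ n) by rewrite mulr_ge0// divr_ge0// ?mulr_ge0 // exprn_ge0.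
  have K := prim_dist C0 (@mul_continuous y cy l) (@mul_continuous (picard v n) (@picard_continuous v n) l).
  have {}K : `|prim (fun t => (y t *m b t) 0 l) s - prim (fun t => (picard v n t *m b t) 0 l) s| <= 2 * (4^-1 * (2 * `|v| / 2 ^+ n)).
    apply: K => t; apply: mulmx_contractB; first exact: bsmall.
    by move=> j; exact: H.
  have := H s l n.+1; rewrite [picard _ _ _]/= [X in _ - X]mxE.
  rewrite exprS invfM mulrA => G.
  move: K G hn; rewrite !ler_norml; set q := (2 ^+ n)^-1; move: (prim _ s) (prim _ s) => a c.
  by move=> /andP[? ?] /andP[? ?] ?; apply/andP; split; lra.
exists y; split.
- by apply/rowP => l; rewrite yE prim_at0 addr0.
- move=> s l; have := H s l 0%N; rewrite /= expr0 divr1.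
  have := rVcoord_le v l; have := ler_normD (y s 0 l - v 0 l) (v 0 l); rewrite subrK; lra.
- exact: cy.
- move=> s l s3; rewrite (_ : (fun t => _) = fun t => v 0 l + prim (fun t => (y t *m b t) 0 l) t).
    apply: is_derive_cast (is_derive_addR (is_derive_cstR _ _ _) (is_derive_prim (@mul_continuous y cy l) s3)) _.
    by rewrite add0r.
  by apply/funext => t; rewrite yE.
Qed.

(** At the maximum of |z| on [-1, 1], the mean value inequality gives |z| <= |z|/4 + eta. *)
Lemma linear_ode_bound (z r : R -> 'rV[R]_m) (eta : R) : 0 <= eta -> z 0 = 0 ->
  (forall (s : R) l, `|s| <= 1 -> is_derive s 1 (fun t : R => z t 0 l) ((z s *m b s + r s) 0 l)) ->
  (forall s l, `|s| <= 1 -> `|r s 0 l| <= eta) ->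
  forall s, `|s| <= 1 -> `|z s| <= 2 * eta.
Proof.
move=> eta0 z0 dz rb.
have n01 : -1 <= 1 :> R by lra.
have cz : {within `[(-1 : R), 1%R], continuous (fun t : R => `|z t| : R)}.
  apply: continuous_in_subspaceT => t; rewrite inE/= in_itv/= -ler_norml => t01.
  apply: continuous_comp; last exact: norm_continuous.
  apply/continuous_epsP => e e0.
  have [d d0 H] : exists2 d : R, 0 < d & forall r, r < d -> forall j u, `|u - t| <= r -> `|z u 0 j - z t 0 j| <= e.
    apply: common_radius => j.
    have /continuous_epsP/(_ _ e0)[d d0 H] := is_derive_continuous (dz t j t01).
    by exists d => // q qd u uq; apply: H; exact: le_lt_trans qd.
  exists d => // u ut; apply: le_rVnorm; first exact: ltW.
  by move=> j; rewrite !mxE; exact: H ut _ _ (lexx _).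
have [c c01 cmax] := EVT_max n01 cz; rewrite in_itv/= -ler_norml in c01.
have zc t : `|t| <= 1 -> `|z t| <= `|z c| by move=> h; apply: cmax; rewrite in_itv/= -ler_norml.
have key t : `|t| <= 1 -> `|z t| <= 4^-1 * `|z c| + eta.
  move=> t1; have D0 : 0 <= 4^-1 * `|z c| + eta by rewrite addr_ge0// mulr_ge0.
  apply: le_rVnorm => // l; have := @MVT_line R R^o (fun t => z t 0 l) 0 1 t 0 (4^-1 * `|z c| + eta).
  rewrite add0r !mulr0 subr0 [t *: 1]mulr1 z0 mxE subr0 => M.
  apply: le_trans (M _ _) _.
  - by move=> x xt; rewrite add0r [x *: 1]mulr1; have [] := dz x l (le_trans xt t1).
  - move=> x xt; rewrite add0r [x *: 1]mulr1; have x1 := le_trans xt t1; have [_ ->] := dz x l x1.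
    rewrite subr0 mxE (le_trans (ler_normD _ _))// lerD ?rb//.
    by apply: mulmx_contract => // j; apply: le_trans (zc x x1); exact: rVcoord_le.
  - by rewrite ler_piMr.
move=> s s1; have := key c c01; have := zc s s1; have := normr_ge0 (z c); lra.
Qed.
End LinearODE.

(** * Flat linear systems of partial differential equations *)

Lemma sum_cst (R : realType) n (c : R) : \sum_(i < n) c = n%:R * c.
Proof. by rewrite sumr_const card_ord mulr_natl. Qed.

Definition nball (R : realType) n (x0 : 'rV[R]_n) (r : R) : set 'rV[R]_n := [set y | `|y - x0| < r].

Lemma nball_open (R : realType) n (x0 : 'rV[R]_n) (r : R) : open (nball x0 r).
Proof.
have [r0|r0] := ltP 0 r; last first.
  rewrite (_ : nball x0 r = set0); first exact: open0.
  by apply/seteqP; split=> // y; rewrite /nball/= => /lt_le_trans/(_ r0); rewrite normr_lt0.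
rewrite (_ : nball x0 r = ball x0 r); first exact: ball_open.
by rewrite -ball_normE; apply/seteqP; split=> y; rewrite /nball/= distrC.
Qed.

Lemma nball_center (R : realType) n (x0 : 'rV[R]_n) (r : R) : 0 < r -> nball x0 r x0.
Proof. by rewrite /nball/= subrr normr0. Qed.

Lemma open_nball (R : realType) n (A : set 'rV[R]_n) x : open A -> A x ->
  exists2 d : R, 0 < d & nball x d `<=` A.
Proof. by move=> oA Ax; have [d d0 H] := open_ball_sub oA Ax; exists d. Qed.

Lemma nball_le (R : realType) n (x0 : 'rV[R]_n) (r r' : R) : r <= r' -> nball x0 r `<=` nball x0 r'.
Proof. by move=> rr y; rewrite /nball/= => /lt_le_trans; exact. Qed.

Lemma nball_segment (R : realType) n (x0 : 'rV[R]_n) (r : R) p q (s : R) :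
  nball x0 r p -> nball x0 r q -> 0 <= s <= 1 -> nball x0 r (p + s *: (q - p)).
Proof.
rewrite /nball/= => pr qr /andP[s0 s1].
have -> : p + s *: (q - p) - x0 = (1 - s) *: (p - x0) + s *: (q - x0).
  by apply/rowP => j; rewrite !mxE; ring.
apply: le_lt_trans (ler_normD _ _) _; rewrite !normrZ (ger0_norm s0) ger0_norm ?subr_ge0//.
have [->|sn] := eqVneq s 0; first by rewrite subr0 mul1r mul0r addr0.
have sp : 0 < s by rewrite lt_def sn.
have h1 : (1 - s) * `|p - x0| <= (1 - s) * r by rewrite ler_wpM2l ?subr_ge0// ltW.
have h2 : s * `|q - x0| < s * r by rewrite ltr_pM2l.
by lra.
Qed.

Section Dirderiv.
Variables (R : realType) (n : nat) (A : set 'rV[R]_n) (f : 'rV[R]_n -> R).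
Hypotheses (oA : open A) (sf : smooth_on A f).

Lemma is_derive_dirderiv x v : A x -> is_derive x v f (dirderiv f x v).
Proof.
move=> Ax; apply: (chain_rule (c := id) (smooth_on_strict oA sf Ax)) => k.
apply/is_derive_epsP => e e0; exists 1 => // h _.
rewrite !mxE (_ : _ - _ - _ = 0); last by ring.
by rewrite normr0 mulr_ge0// ltW.
Qed.

Lemma dirderiv_le x v c : (forall i, `|pderiv i f x| <= c) -> `|dirderiv f x v| <= n%:R * c * `|v|.
Proof.
move=> H; rewrite (le_trans (ler_norm_sum _ _ _))//.
apply: (@le_trans _ _ (\sum_(i < n) (c * `|v|))); last by rewrite sum_cst mulrA.
apply: ler_sum => i _; rewrite normrM mulrC; apply: ler_pM => //; exact: rVcoord_le.
Qed.

Lemma local_lipschitz x0 : A x0 -> exists r C : R, [/\ 0 < r, 0 <= C, nball x0 r `<=` A,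
  forall y, nball x0 r y -> `|f y| <= C &
  forall y z, nball x0 r y -> nball x0 r z -> `|f z - f y| <= C * `|z - y|].
Proof.
move=> Ax; have [d1 d10 H1] := smooth_on_strict oA sf Ax ltr01.
have [d2 d20 H2] := open_nball oA Ax.
pose G := n%:R * (\sum_i `|pderiv i f x0|).
have G0 : 0 <= G by rewrite mulr_ge0// sumr_ge0.
have lip y z : nball x0 d1 y -> nball x0 d1 z -> `|f z - f y| <= (1 + G) * `|z - y|.
  move=> yd zd; have := H1 _ _ yd zd.
  have : `|dirderiv f x0 (z - y)| <= G * `|z - y|.
    apply: dirderiv_le => i; rewrite (bigD1 i)//= lerDl sumr_ge0//.
  have := ler_normD (f z - f y - dirderiv f x0 (z - y)) (dirderiv f x0 (z - y)).
  rewrite subrK; lra.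
pose r := Num.min d1 d2; have r0 : 0 < r by rewrite lt_min d10.
exists r, (1 + G + `|f x0| + (1 + G) * r).
have rd1 y : nball x0 r y -> nball x0 d1 y by apply: nball_le; rewrite ge_min lexx.
have rd2 y : nball x0 r y -> nball x0 d2 y by apply: nball_le; rewrite ge_min lexx orbT.
have Gr : 0 <= (1 + G) * r by rewrite mulr_ge0 ?addr_ge0// ltW.
split=> //.
- by rewrite !addr_ge0.
- by move=> y /rd2/H2.
- move=> y yr; have := lip _ _ (nball_center x0 d10) (rd1 y yr).
  have : (1 + G) * `|y - x0| <= (1 + G) * r by rewrite ler_wpM2l ?addr_ge0//; exact: ltW.
  have := ler_normD (f y - f x0) (f x0); rewrite subrK; have := G0; lra.
- move=> y z yr zr; have := lip _ _ (rd1 y yr) (rd1 z zr).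
  have : 0 <= (`|f x0| + (1 + G) * r) * `|z - y| by rewrite mulr_ge0// addr_ge0.
  lra.
Qed.
End Dirderiv.

(** One constant for size, Lipschitz constant and quadratic remainder, uniformly in both points of
    the ball. *)
Definition taylor_bound (R : realType) n (f : 'rV[R]_n -> R) x0 (r C : R) : Prop :=
  [/\ forall y, nball x0 r y -> `|f y| <= C,
      forall y z, nball x0 r y -> nball x0 r z -> `|f z - f y| <= C * `|z - y| &
      forall y z, nball x0 r y -> nball x0 r z ->
        `|f z - f y - dirderiv f y (z - y)| <= C * `|z - y| ^+ 2].

Lemma taylor_bound_mono (R : realType) n (f : 'rV[R]_n -> R) x0 (r r' C C' : R) :
  r' <= r -> C <= C' -> taylor_bound f x0 r C -> taylor_bound f x0 r' C'.
Proof.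
move=> rr CC [h1 h2 h3]; have s := nball_le (x0 := x0) rr; split.
- by move=> y /s/h1 h; exact: le_trans CC.
- by move=> y z /s ys /s zs; apply: le_trans (h2 y z ys zs) _; rewrite ler_wpM2r.
- by move=> y z /s ys /s zs; apply: le_trans (h3 y z ys zs) _; rewrite ler_wpM2r// exprn_ge0.
Qed.

Lemma common_taylor_bound (R : realType) n (I : finType) (F : I -> 'rV[R]_n -> R) x0 :
  (forall i, exists r C, 0 < r /\ taylor_bound (F i) x0 r C) ->
  exists r C, [/\ 0 < r, 0 <= C & forall i, taylor_bound (F i) x0 r C].
Proof.
move=> H.
have [r0 /choice[C0 H0]] : exists r0 : I -> R, forall i, exists C, 0 < r0 i /\ taylor_bound (F i) x0 (r0 i) C.
  by have /choice[r0] := H; exists r0.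
exists (\big[Order.min/1]_i r0 i), (\big[Order.max/0]_i C0 i); split.
- by apply: lt_bigmin => // i _; have [] := H0 i.
- exact: bigmax_ge_id.
- move=> i; have [_] := H0 i; apply: taylor_bound_mono; first exact: bigmin_le_cond.
  exact: le_bigmax_cond.
Qed.

(** Partial derivatives are locally Lipschitz, and the mean value inequality along a segment
    converts this into a quadratic remainder. *)
Lemma taylor_bound_exists (R : realType) n (A : set 'rV[R]_n) (f : 'rV[R]_n -> R) x0 :
  open A -> smooth_on A f -> A x0 -> exists r C, 0 < r /\ taylor_bound f x0 r C.
Proof.
move=> oA sf Ax.
have /choice[d Hd] : forall i : 'I_n, exists d : R, 0 < d /\ exists C, 0 <= C /\ forall y z, nball x0 d y -> nball x0 d z ->
    `|pderiv i f z - pderiv i f y| <= C * `|z - y|.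
  move=> i; have [d [C [d0 C0 _ _ H]]] := local_lipschitz oA (smooth_on_pderiv i sf) Ax.
  by exists d; split=> //; exists C.
have /choice[C HC] : forall i, exists C, 0 <= C /\ forall y z, nball x0 (d i) y -> nball x0 (d i) z ->
    `|pderiv i f z - pderiv i f y| <= C * `|z - y|.
  by move=> i; have [] := Hd i.
have [r1 [C1 [r10 C10 rA b1 l1]]] := local_lipschitz oA sf Ax.
pose r2 := \big[Order.min/r1]_i d i.
have r20 : 0 < r2 by apply: lt_bigmin => // i _; have [] := Hd i.
have r21 : r2 <= r1 by exact: bigmin_le_id.
pose C2 := \sum_i C i.
have C20 : 0 <= C2 by apply: sumr_ge0 => i _; have [] := HC i.
have l2 i y z : nball x0 r2 y -> nball x0 r2 z -> `|pderiv i f z - pderiv i f y| <= C2 * `|z - y|.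
  have s : nball x0 r2 `<=` nball x0 (d i) by apply: nball_le; exact: bigmin_le_cond.
  move=> /s yd /s zd; have [_ H] := HC i; apply: le_trans (H y z yd zd) _.
  rewrite ler_wpM2r// /C2 (bigD1 i)//= lerDl sumr_ge0// => j _; have [] := HC j; by [].
(* The mean value lemma also uses the segment prolonged backwards, whose points lie within 3 r of
   x0. *)
pose r := r2 / 3; have r0 : 0 < r by rewrite divr_gt0.
have s1 : nball x0 r `<=` nball x0 r1 by apply: nball_le; rewrite /r; lra.
exists r, (C1 + n%:R * C2); split=> //; split.
- by move=> y /s1/b1 h; apply: le_trans h _; rewrite lerDl mulr_ge0.
- move=> y z /s1 ys /s1 zs; apply: le_trans (l1 y z ys zs) _.
  by rewrite ler_wpM2r// lerDl mulr_ge0.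
- move=> y z yr zr.
  have line (s : R) : `|s| <= `|1 : R| -> nball x0 r2 (y + s *: (z - y)).
    rewrite normr1 => s1'; rewrite /nball/=.
    have -> : y + s *: (z - y) - x0 = (y - x0) + s *: ((z - x0) - (y - x0)).
      by apply/rowP => j; rewrite !mxE; ring.
    apply: le_lt_trans (ler_normD _ _) _; rewrite normrZ.
    have h := ler_normB (z - x0) (y - x0).
    have : `|s| * `|z - x0 - (y - x0)| <= 1 * (`|z - x0| + `|y - x0|) by apply: ler_pM.
    move: yr zr; rewrite /nball/= /r; lra.
  have yr2 : nball x0 r2 y by have := line 0; rewrite scale0r addr0; apply; rewrite normr0.
  have := @MVT_line R _ f y (z - y) 1 (dirderiv f y (z - y)) (n%:R * (C2 * `|z - y|) * `|z - y|).
  have -> : y + 1 *: (z - y) = z by rewrite scale1r addrC subrK.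
  rewrite mul1r => M; rewrite normr1 mulr1 in M.
  apply: le_trans (M _ _) _.
  + move=> s; rewrite ?normr1 => hs.
    have As : A (y + s *: (z - y)).
      by apply: rA; apply: (nball_le r21); apply: line; rewrite normr1.
    by have [] := is_derive_dirderiv oA sf (z - y) As.
  + move=> s; rewrite ?normr1 => hs.
    have ls : nball x0 r2 (y + s *: (z - y)) by apply: line; rewrite normr1.
    have As : A (y + s *: (z - y)) by apply: rA; apply: (nball_le r21).
    have [_ ->] := is_derive_dirderiv oA sf (z - y) As.
    rewrite /dirderiv -sumrB (le_trans (ler_norm_sum _ _ _))//.
    apply: (@le_trans _ _ (\sum_(i < n) (C2 * `|z - y| * `|z - y|))); last first.
      by rewrite sum_cst !mulrA.
    apply: ler_sum => i _; rewrite -mulrBr normrM mulrC; apply: ler_pM => //.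
      apply: le_trans (l2 i _ _ yr2 ls) _; rewrite addrC addKr normrZ.
      by rewrite ler_wpM2l// ler_piMl.
    exact: rVcoord_le.
  + rewrite -!mulrA -expr2 mulrA ler_wpM2r ?exprn_ge0//; lra.
Qed.

Definition mxbound (R : realType) p q (X : 'M[R]_(p, q)) (c : R) := forall a b, `|X a b| <= c.

Section MxBound.
Variable R : realType.

Lemma mxboundD p q (X Y : 'M[R]_(p, q)) c d : mxbound X c -> mxbound Y d -> mxbound (X + Y) (c + d).
Proof. by move=> hX hY a b; rewrite mxE (le_trans (ler_normD _ _))// lerD. Qed.

Lemma mxboundZ p q (X : 'M[R]_(p, q)) s t c : `|s| <= t -> mxbound X c -> mxbound (s *: X) (t * c).
Proof. by move=> hs hX a b; rewrite mxE normrM ler_pM. Qed.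

Lemma mxboundM p q r (X : 'M[R]_(p, q)) (Y : 'M[R]_(q, r)) c d :
  mxbound X c -> mxbound Y d -> mxbound (X *m Y) (q%:R * (c * d)).
Proof.
move=> hX hY a b; rewrite mxE (le_trans (ler_norm_sum _ _ _))//.
apply: (@le_trans _ _ (\sum_(j < q) (c * d))); last by rewrite sum_cst.
by apply: ler_sum => j _; rewrite normrM ler_pM.
Qed.

Lemma mxbound_sum p q k (F : 'I_k -> 'M[R]_(p, q)) c :
  (forall i, mxbound (F i) c) -> mxbound (\sum_i F i) (k%:R * c).
Proof.
move=> H a b; rewrite summxE (le_trans (ler_norm_sum _ _ _))//.
apply: (@le_trans _ _ (\sum_(j < k) c)); last by rewrite sum_cst.
by apply: ler_sum => j _; exact: H.
Qed.

Lemma mxbound_le p q (X : 'M[R]_(p, q)) c d : c <= d -> mxbound X c -> mxbound X d.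
Proof. by move=> cd hX a b; exact: le_trans cd. Qed.
End MxBound.

(* With A1 - A0 = s h.D + eps, flatness leaves only quadratic terms. *)
Lemma flat_remainder (R : realType) n m (A0 A1 : 'I_n -> 'M[R]_m) (D : 'I_n -> 'I_n -> 'M[R]_m)
    (X h : 'I_n -> R) (s : R) :
  (forall i j, D j i - D i j = A0 i *m A0 j - A0 j *m A0 i) ->
  let bx := \sum_j X j *: A0 j in let by_ := \sum_j (X j + h j) *: A1 j in
  let a := \sum_i h i *: A0 i in let da := \sum_i h i *: (\sum_j X j *: D j i) in
  by_ - bx - a - s *: da + s *: (a *m by_ - bx *m a) =
  \sum_j X j *: (A1 j - A0 j - s *: \sum_i h i *: D i j) + \sum_j h j *: (A1 j - A0 j)
    + s *: (a *m (by_ - bx)).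
Proof.
move=> flat bx by_ a da.
have E1 : \sum_j X j *: (\sum_i h i *: D i j) = \sum_j \sum_i (X j * h i) *: D i j.
  by apply: eq_bigr => j _; rewrite scaler_sumr; apply: eq_bigr => i _; rewrite scalerA.
have E2 : da = \sum_j \sum_i (X j * h i) *: D j i.
  rewrite /da exchange_big/=; apply: eq_bigr => i _; rewrite scaler_sumr.
  by apply: eq_bigr => j _; rewrite scalerA mulrC.
have E3 : bx *m a = \sum_j \sum_i (X j * h i) *: (A0 j *m A0 i).
  rewrite /bx mulmx_suml; apply: eq_bigr => j _; rewrite /a mulmx_sumr; apply: eq_bigr => i _.
  by rewrite -scalemxAl -scalemxAr scalerA.
have E4 : a *m bx = \sum_j \sum_i (X j * h i) *: (A0 i *m A0 j).
  rewrite /a mulmx_suml exchange_big/=; apply: eq_bigr => i _; rewrite mulmx_sumr; apply: eq_bigr => j _.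
  by rewrite -scalemxAl -scalemxAr scalerA mulrC.
have E : \sum_j X j *: (\sum_i h i *: D i j) - da = bx *m a - a *m bx.
  rewrite E1 E2 E3 E4 -!sumrB; apply: eq_bigr => j _; rewrite -!sumrB; apply: eq_bigr => i _.
  by rewrite -!scalerBr flat.
have byE : by_ = \sum_j X j *: A1 j + \sum_j h j *: A1 j.
  by rewrite -big_split; apply: eq_bigr => j _; rewrite scalerDl.
under [X in _ = X + _ + _]eq_bigr do rewrite scalerBr scalerBr [X _ *: (s *: _)]scalerA [X _ * s]mulrC -scalerA.
under [X in _ = _ + X + _]eq_bigr do rewrite scalerBr.
rewrite !sumrB -/a -/bx -scaler_sumr.
have -> : \sum_j X j *: (\sum_i h i *: D i j) = da + (bx *m a - a *m bx).
  by rewrite -E addrC subrK.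
rewrite mulmxBr !scalerDr !scalerN.
rewrite {1}byE.
clear E E1 E2 E3 E4 byE flat; clearbody by_ da bx a.
move: (s *: da) (s *: (a *m by_)) (s *: (bx *m a)) (s *: (a *m bx)) (\sum_j X j *: A1 j) (\sum_j h j *: A1 j) => *.
by apply/matrixP => p q; rewrite !mxE; ring.
Qed.

Section FlatSystem.
Variables (R : realType) (n m : nat) (A : 'I_n -> 'rV[R]_n -> 'M[R]_m) (B : set 'rV[R]_n).
Hypotheses (oB : open B) (sA : forall i, smooth_mx_on B (A i)).
Hypothesis flat : forall i j x, B x ->
  mxpderiv j (A i) x - mxpderiv i (A j) x = A i x *m A j x - A j x *m A i x.

Section Radial.
Variables (x0 : 'rV[R]_n) (r C : R).
Hypotheses (r0 : 0 < r) (C0 : 0 <= C) (rB : nball x0 (2 * r) `<=` B).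
Hypothesis tay : forall i a b, taylor_bound (fun x => A i x a b) x0 (2 * r) C.
Hypothesis rC : m%:R * (n%:R * (r * C)) <= 4^-1.

(** Along the ray s -> x0 + s (x - x0), the system d_i u = u A_i becomes the ordinary equation with
    this coefficient. *)
Definition radial x (s : R) : 'M[R]_m := \sum_j (x - x0) 0 j *: A j (x0 + clamp s *: (x - x0)).

(** Times up to 3/2 leave the ball of radius r but not the one of radius 2 r. *)
Lemma ray_in x (s : R) : nball x0 r x -> `|s| <= 3 / 2 -> nball x0 (2 * r) (x0 + s *: (x - x0)).
Proof.
rewrite /nball/= addrAC subrr add0r normrZ => xr s3.
apply: (@le_lt_trans _ _ (3 / 2 * r)); last by move: r0; lra.
by apply: ler_pM => //; exact: ltW.
Qed.

Lemma radial_continuous x i j : nball x0 r x -> continuous (fun s : R => radial x s i j).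
Proof.
move=> xr; rewrite (_ : (fun s => _) = fun s => \sum_p (x - x0) 0 p * A p (x0 + clamp s *: (x - x0)) i j).
  apply: continuous_bigsumR => p s; apply: continuousM; first exact: cst_continuous.
  have c1 : {for clamp s, continuous (fun t : R => A p (x0 + t *: (x - x0)) i j)}.
    apply: (is_derive_continuous (d := dirderiv (fun y => A p y i j) (x0 + clamp s *: (x - x0)) (x - x0))).
    have Bs : B (x0 + clamp s *: (x - x0)) by apply: rB; exact: ray_in xr (clamp_bound s).
    have [d e] := is_derive_dirderiv oB (@sA p i j) (x - x0) Bs.
    by rewrite -e; exact: is_derive_line.
  exact: (@continuous_comp R R R (@clamp R) (fun t : R => A p (x0 + t *: (x - x0)) i j) s (@clamp_continuous R s) c1).
by apply/funext => s; rewrite summxE; apply: eq_bigr => p _; rewrite mxE.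
Qed.

Lemma radial_small x s l : nball x0 r x -> \sum_j `|radial x s j l| <= 4^-1.
Proof.
move=> xr; apply: le_trans rC.
apply: (@le_trans _ _ (\sum_(j < m) (n%:R * (r * C)))); last by rewrite sum_cst.
apply: ler_sum => j _; apply: (mxbound_sum (fun p => _)) => p.
apply: mxboundZ; first by apply: le_trans (rVcoord_le _ _) _; exact: ltW.
by move=> a b; have [h _ _] := tay p a b; apply: h; exact: ray_in xr (clamp_bound s).
Qed.

Lemma radial_solution (v : 'rV[R]_m) : exists W : 'rV[R]_n -> R -> 'rV[R]_m, forall x, nball x0 r x ->
  [/\ W x 0 = v, forall s l, `|W x s 0 l| <= 3 * `|v| &
   forall (s : R) l, `|s| < 3 / 2 -> is_derive s 1 (fun t : R => W x t 0 l) ((W x s *m radial x s) 0 l)].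
Proof.
suff /choice[W HW] : forall x, exists y : R -> 'rV[R]_m, nball x0 r x ->
    [/\ y 0 = v, forall s l, `|y s 0 l| <= 3 * `|v| &
   forall (s : R) l, `|s| < 3 / 2 -> is_derive s 1 (fun t : R => y t 0 l) ((y s *m radial x s) 0 l)].
  by exists W.
move=> x; have [xr|nxr] := pselect (nball x0 r x); last by exists (fun=> v).
have [y [h1 h2 _ h3]] := linear_ode_exists (fun i j => @radial_continuous x i j xr) (fun s l => @radial_small x s l xr) v.
by exists y.
Qed.

(** The heart of the Frobenius theorem: the value at time 1 of the radial solution has differential
    W . sum h_i A_i, with quadratic error. Flatness enters through [flat_remainder]. *)
Lemma radial_expansion (v : 'rV[R]_m) W :
  (forall x, nball x0 r x -> [/\ W x 0 = v, forall s l, `|W x s 0 l| <= 3 * `|v| &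
   forall (s : R) l, `|s| < 3 / 2 -> is_derive s 1 (fun t : R => W x t 0 l) ((W x s *m radial x s) 0 l)]) ->
  exists2 C', 0 <= C' & forall x h, nball x0 r x -> nball x0 r (x + h) ->
    `|W (x + h) 1 - W x 1 - W x 1 *m \sum_i h 0 i *: A i x| <= C' * `|h| ^+ 2.
Proof.
move=> HW.
pose C1 := n%:R * (r * C) + n%:R * C + m%:R * (n%:R * C * (n%:R * (r * C) + n%:R * C)).
have C10 : 0 <= C1 by rewrite /C1 !addr_ge0 ?mulr_ge0 ?addr_ge0 ?mulr_ge0 // ltW.
have n0 k : 0 <= k%:R :> R := ler0n _ _.
pose C2 := m%:R * (3 * `|v| * C1); have C20 : 0 <= C2 by rewrite !mulr_ge0.
exists (2 * C2); first by rewrite mulr_ge0.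
move=> x h xr yr; set y := x + h in yr *.
have [Wx0 Wxb Wxd] := HW _ xr; have [Wy0 _ Wyd] := HW _ yr.
pose X j := (x - x0) 0 j; pose H j := h 0 j.
pose xs (s : R) := x0 + s *: (x - x0); pose ys (s : R) := x0 + s *: (y - x0).
have xyE s : ys s - xs s = s *: h by apply/rowP => j; rewrite !mxE; ring.
pose a s := \sum_i H i *: A i (xs s).
pose da s := \sum_i H i *: (\sum_j X j *: mxpderiv j (A i) (xs s)).
(* The defect of the expected first variation. It solves the radial equation of y with inhomogeneity
   [rr], shown below to be of order |h|^2, and starts at 0; hence Z(1) is of order |h|^2. *)
pose Z s : 'rV[R]_m := W y s - W x s - s *: (W x s *m a s).
pose rem s := radial y s - radial x s - a s - s *: da s + s *: (a s *m radial y s - radial x s *m a s).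
pose rr s := W x s *m rem s.
have s32 (s : R) : `|s| <= 1 -> `|s| <= 3 / 2 /\ `|s| < 3 / 2 by move=> ?; split; lra.
have Bx s : `|s| <= 1 -> nball x0 (2 * r) (xs s) by move=> /s32[h1 _]; exact: ray_in.
have By s : `|s| <= 1 -> nball x0 (2 * r) (ys s) by move=> /s32[h1 _]; exact: ray_in.
have Ad i p q (s : R) : `|s| <= 1 -> is_derive s 1 (fun t : R => A i (xs t) p q) ((\sum_j X j *: mxpderiv j (A i) (xs s)) p q).
  move=> s1; have Bs := rB (Bx s s1).
  have [d e] := is_derive_dirderiv oB (@sA i p q) (x - x0) Bs.
  apply: is_derive_cast (is_derive_line d) _.
  by rewrite -/(xs s) e summxE; apply: eq_bigr => j _; rewrite [RHS]mxE mxpderivE.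
have ad p q (s : R) : `|s| <= 1 -> is_derive s 1 (fun t : R => a t p q) (da s p q).
  move=> s1; rewrite (_ : (fun t => _) = fun t => \sum_i H i * A i (xs t) p q); last first.
    by apply/funext => t; rewrite summxE; apply: eq_bigr => i _; rewrite mxE.
  apply: is_derive_cast (is_derive_sumR (fun i => is_derive_mulR (is_derive_cstR (H i) s 1) (Ad i p q s s1))) _.
  by rewrite summxE; apply: eq_bigr => i _; rewrite mulr0 addr0 [RHS]mxE.
have Zd (s : R) l : `|s| <= 1 -> is_derive s 1 (fun t : R => Z t 0 l) ((Z s *m radial y s + rr s) 0 l).
  move=> s1; have [_ s2] := s32 s s1.
  rewrite (_ : (fun t => _) = fun t => W y t 0 l + - W x t 0 l + - (t * \sum_j W x t 0 j * a t j l)); last first.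
    by apply/funext => t; rewrite !mxE.
  apply: is_derive_cast (is_derive_addR (is_derive_addR (Wyd s l s2) (is_deriveN (Wxd s l s2)))
    (is_deriveN (is_derive_mulR (is_derive_id s 1) (is_derive_sumR (fun j => is_derive_mulR (Wxd s j s2) (ad j l s s1)))))) _.
  rewrite big_split/=.
  have -> : \sum_j W x s 0 j * da s j l = (W x s *m da s) 0 l by rewrite mxE.
  have -> : \sum_j a s j l * (W x s *m radial x s) 0 j = (W x s *m radial x s *m a s) 0 l.
    by rewrite [RHS]mxE; apply: eq_bigr => j _; rewrite mulrC.
  have -> : \sum_j W x s 0 j * a s j l = (W x s *m a s) 0 l by rewrite mxE.
  have -> : Z s *m radial y s + rr s = W y s *m radial y s - W x s *m radial x s - W x s *m a s
      - s *: (W x s *m radial x s *m a s + W x s *m da s).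
    rewrite /Z /rr /rem; rewrite !(mulmxBl, mulmxDr, mulmxBr) -!scalemxAl -!scalemxAr !(mulmxBl, mulmxDr, mulmxBr) !mulmxN -!scalemxAr !mulmxA.
    move: (W x s *m radial x s *m a s) (W x s *m a s *m radial y s) (W y s *m radial y s) (W x s *m radial y s) (W x s *m radial x s) (W x s *m a s) (W x s *m da s) => *.
    by apply/matrixP => p q; rewrite !mxE; ring.
  by rewrite !mxE; ring.
have normX j : `|X j| <= r by apply: le_trans (rVcoord_le _ _) _; exact: ltW.
have normH j : `|H j| <= `|h| by exact: rVcoord_le.
have radE z s : `|s| <= 1 -> radial z s = \sum_j (z - x0) 0 j *: A j (x0 + s *: (z - x0)).
  by move=> /s32[h1 _]; rewrite /radial clamp_id.
have rb s l : `|s| <= 1 -> `|rr s 0 l| <= C2 * `|h| ^+ 2.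
  move=> s1.
  have -> : C2 * `|h| ^+ 2 = m%:R * (3 * `|v| * (C1 * `|h| ^+ 2)) by rewrite /C2; ring.
  apply: (mxboundM (X := W x s) (Y := rem s)); first by move=> p q; rewrite ord1; exact: Wxb.
  have fl := flat_remainder (D := fun i j => mxpderiv i (A j) (xs s)) (fun j => A j (ys s)) X H s (fun i j => @flat i j (xs s) (rB (Bx s s1))).
  have bE : \sum_j (X j + H j) *: A j (ys s) = radial y s.
    by rewrite radE//; apply: eq_bigr => j _; congr (_ *: _); rewrite /X /H !mxE; ring.
  have bE' : \sum_j X j *: A j (xs s) = radial x s by rewrite radE.
  rewrite /= bE bE' -/(a s) -/(da s) -/(rem s) in fl; rewrite {}fl.
  have d1 j : mxbound (A j (ys s) - A j (xs s)) (C * `|h|).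
    move=> p q; have [_ H1 _] := tay j p q; have := H1 _ _ (Bx s s1) (By s s1).
    have -> : (A j (ys s) - A j (xs s)) p q = A j (ys s) p q - A j (xs s) p q by rewrite !mxE.
    rewrite xyE normrZ => /le_trans; apply; rewrite ler_wpM2l//.
    by rewrite ler_piMl.
  have d2 j : mxbound (A j (ys s) - A j (xs s) - s *: \sum_i H i *: mxpderiv i (A j) (xs s)) (C * `|h| ^+ 2).
    move=> p q; have [_ _ H1] := tay j p q; have := H1 _ _ (Bx s s1) (By s s1).
    rewrite xyE normrZ => H2.
    rewrite (_ : fun_of_matrix _ p q = A j (ys s) p q - A j (xs s) p q - dirderiv (fun x => A j x p q) (xs s) (s *: h)).
      apply: le_trans H2 _; rewrite ler_wpM2l// exprMn ler_piMl ?exprn_ge0//.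
      by rewrite exprn_ile1.
    rewrite !mxE summxE; congr (_ - _); rewrite mulr_sumr; apply: eq_bigr => i _.
    by rewrite !mxE mulrA.
  have d3 : mxbound (a s) (n%:R * (`|h| * C)).
    apply: mxbound_sum => i; apply: mxboundZ => //.
    by move=> p q; have [H1 _ _] := tay i p q; apply: H1; exact: Bx.
  have d4 : mxbound (radial y s - radial x s) (n%:R * (r * (C * `|h|)) + n%:R * (`|h| * C)).
    rewrite -bE -bE' -sumrB.
    under eq_bigr do rewrite scalerDl addrAC -scalerBr.
    rewrite big_split/=; apply: mxboundD; apply: mxbound_sum => j; apply: mxboundZ => //.
    by move=> p q; have [H1 _ _] := tay j p q; apply: H1; exact: By.
  apply: (mxbound_le (c := n%:R * (r * (C * `|h| ^+ 2)) + n%:R * (`|h| * (C * `|h|)) +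
     1 * (m%:R * (n%:R * (`|h| * C) * (n%:R * (r * (C * `|h|)) + n%:R * (`|h| * C)))))).
    by rewrite /C1 le_eqVlt; apply/orP; left; apply/eqP; ring.
  apply: mxboundD; first apply: mxboundD.
  - by apply: mxbound_sum => j; apply: mxboundZ => //; exact: d2.
  - by apply: mxbound_sum => j; apply: mxboundZ => //; exact: d1.
  - by apply: mxboundZ => //; exact: mxboundM.
have Z0 : Z 0 = 0 by rewrite /Z Wx0 Wy0 subrr scale0r subr0.
have e0 : 0 <= C2 * `|h| ^+ 2 by rewrite mulr_ge0// exprn_ge0.
have n1 : `|1 : R| <= 1 by rewrite normr1.
have x1 : xs 1 = x by rewrite /xs scale1r addrC subrK.
have := linear_ode_bound (fun s l => @radial_small y s l yr) e0 Z0 Zd rb n1.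
rewrite mulrA; have -> : Z 1 = W y 1 - W x 1 - W x 1 *m \sum_i h 0 i *: A i x; last exact.
by rewrite /Z scale1r /a x1.
Qed.
End Radial.

(** The solution is W(x, 1). The expansion gives its partial derivatives, and smoothness follows at
    once since these are polynomials in u and the coefficients. *)
Lemma flat_solution_exists x0 : B x0 -> exists2 r : R, 0 < r & nball x0 r `<=` B /\
  forall v : 'rV[R]_m, exists u : 'rV[R]_n -> 'rV[R]_m, [/\ u x0 = v, smooth_mx_on (nball x0 r) u &
    forall i x, nball x0 r x -> mxpderiv i u x = u x *m A i x].
Proof.
move=> Bx0.
have [r1 [C [r10 C0 tay]]] := @common_taylor_bound R n ('I_n * 'I_m * 'I_m)%type
  (fun p x => A p.1.1 x p.1.2 p.2) x0 (fun p => taylor_bound_exists oB (@sA p.1.1 p.1.2 p.2) Bx0).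
have [r2 r20 r2B] := open_nball oB Bx0.
pose D := m%:R * (n%:R * C); have D0 : 0 <= D by rewrite !mulr_ge0.
(* The last bound makes D r <= 1/4, the contraction condition of the Picard iteration. *)
pose r := Num.min (Num.min r1 r2 / 2) (4^-1 / (D + 1)).
have r0 : 0 < r by rewrite lt_min !divr_gt0 ?lt_min ?r10//; lra.
have rr1 : 2 * r <= r1 /\ 2 * r <= r2.
  have : r <= Num.min r1 r2 / 2 by rewrite ge_min lexx.
  have : Num.min r1 r2 <= r1 by rewrite ge_min lexx.
  have : Num.min r1 r2 <= r2 by rewrite ge_min lexx orbT.
  by split; lra.
have rB : nball x0 (2 * r) `<=` B by apply: subset_trans r2B; apply: nball_le; case: rr1.
have tay' i a b : taylor_bound (fun x => A i x a b) x0 (2 * r) C.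
  exact: (taylor_bound_mono rr1.1 (lexx C) (tay (i, a, b))).
have rC : m%:R * (n%:R * (r * C)) <= 4^-1.
  rewrite (_ : _ * _ = D * r); last by rewrite /D; ring.
  have : D * r <= D * (4^-1 / (D + 1)) by rewrite ler_wpM2l// ge_min lexx orbT.
  move/le_trans; apply; rewrite mulrA ler_pdivrMr; last lra.
  by lra.
exists r => //; split.
  by apply: subset_trans rB; apply: nball_le; lra.
move=> v.
have [W HW] := radial_solution r0 rB tay' rC v.
have [C' C'0 exW] := radial_expansion r0 C0 rB tay' rC HW.
pose u x := W x 1.
have onB x : nball x0 r x -> B x by move=> xr; apply: rB; apply: nball_le xr; lra.
have uder i x l : nball x0 r x -> is_derive x (delta_mx 0 i) (fun y => u y 0 l) ((u x *m A i x) 0 l).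
  move=> xr; apply/is_derive_epsP => e e0.
  have [d d0 Hd] := open_ball_sub (@nball_open R n x0 r) xr.
  exists (Num.min d (e / (C' + 1))); first by rewrite lt_min d0 divr_gt0//; lra.
  move=> h; rewrite lt_min => /andP[hd he].
  have dh : `|h *: delta_mx 0 i : 'rV[R]_n| <= `|h| by rewrite normrZ ler_piMr// delta_norm.
  have yr : nball x0 r (x + h *: delta_mx 0 i).
    by apply: Hd; rewrite addrC addKr; exact: le_lt_trans hd.
  have := exW _ _ xr yr => H.
  have E : \sum_k (h *: delta_mx 0 i : 'rV[R]_n) 0 k *: A k x = h *: A i x.
    rewrite (bigD1 i)//= big1 ?addr0 => [|k /negPf ki]; first by rewrite !mxE !eqxx mulr1.
    by rewrite !mxE ki andbF mulr0 scale0r.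
  rewrite E -scalemxAr in H.
  have K := rVcoord_le (W (x + h *: delta_mx 0 i) 1 - W x 1 - h *: (W x 1 *m A i x)) l.
  have -> : u (x + h *: delta_mx 0 i) 0 l - u x 0 l - h * (u x *m A i x) 0 l =
     (W (x + h *: delta_mx 0 i) 1 - W x 1 - h *: (W x 1 *m A i x)) 0 l.
    rewrite /u; move: (W (x + _) 1) (W x 1) (W x 1 *m A i x) => a b c; by rewrite !mxE.
  apply: le_trans K _; apply: le_trans H _.
  have hh : C' * `|h *: delta_mx 0 i : 'rV[R]_n| ^+ 2 <= C' * (`|h| * `|h|).
    by rewrite ler_wpM2l// expr2 ler_pM.
  apply: le_trans hh _; rewrite mulrA ler_wpM2r//.
  have : `|h| * (C' + 1) < e by rewrite -ltr_pdivlMr//; lra.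
  have := normr_ge0 h; lra.
have ucont x l : nball x0 r x -> {for x, continuous (fun y => u y 0 l)}.
  move=> xr; apply/continuous_epsP => e e0.
  have [d d0 Hd] := open_ball_sub (@nball_open R n x0 r) xr.
  pose G := m%:R * (`|u x| * (n%:R * C)); have G0 : 0 <= G by rewrite !mulr_ge0.
  exists (Num.min (Num.min d 1) (e / (C' + G + 1))).
    by rewrite !lt_min d0 ltr01 divr_gt0// -addrA ltr_wpDl// ltr_wpDl.
  move=> y; rewrite !lt_min => /andP[/andP[yd y1] ye].
  pose h := y - x; have yE : y = x + h by rewrite addrC subrK.
  have yr : nball x0 r (x + h) by rewrite -yE; exact: Hd.
  have H := exW _ _ xr yr.
  have K := rVcoord_le (W (x + h) 1 - W x 1 - W x 1 *m \sum_i h 0 i *: A i x) l.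
  have b2 : `|(W x 1 *m \sum_i h 0 i *: A i x) 0 l| <= m%:R * (`|u x| * (n%:R * (`|h| * C))).
    apply: mxboundM; first by move=> p q; rewrite ord1; exact: rVcoord_le.
    apply: mxbound_sum => i; apply: mxboundZ; first exact: rVcoord_le.
    move=> p q; have [H1 _ _] := tay' i p q; apply: H1.
    by apply: nball_le xr; lra.
  have E : (W (x + h) 1 - W x 1 - W x 1 *m \sum_i h 0 i *: A i x) 0 l =
      u y 0 l - u x 0 l - (W x 1 *m \sum_i h 0 i *: A i x) 0 l.
    rewrite yE /u; move: (W (x + _) 1) (W x 1) (W x 1 *m _) => a b c; by rewrite !mxE.
  rewrite E in K; have := ler_normD (u y 0 l - u x 0 l - (W x 1 *m \sum_i h 0 i *: A i x) 0 l)
     ((W x 1 *m \sum_i h 0 i *: A i x) 0 l); rewrite subrK => T.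
  apply: le_trans T _; apply: le_trans (lerD (le_trans K H) b2) _.
  have -> : m%:R * (`|u x| * (n%:R * (`|h| * C))) = G * `|h| by rewrite /G; ring.
  have hh : C' * `|h| ^+ 2 <= C' * `|h|.
    by rewrite ler_wpM2l// expr2 ler_piMl// ltW.
  have : `|h| * (C' + G + 1) < e by rewrite -ltr_pdivlMr//; lra.
  have := normr_ge0 h; lra.
exists u; split.
- have [h0 _ h2] := HW _ (nball_center x0 r0); rewrite /u -h0; apply/rowP => l.
  apply: (@derive0_eq R (fun t => W x0 t 0 l) 0 (3 / 2)) => [s|]; last by rewrite subr0 normr1; lra.
  rewrite subr0 => s3; apply: is_derive_cast (h2 s l s3) _.
  rewrite /radial big1 ?mulmx0 ?mxE// => j _.
  by rewrite subrr mxE scale0r.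
- move=> z l; rewrite {z}ord1.
  (* Generators: smooth functions and the components of u. The system itself expresses the
     derivatives of the latter. *)
  pose Q (f : 'rV[R]_n -> R) := smooth_on (nball x0 r) f \/ exists l, f = fun y => u y 0 l.
  apply: (@smooth_alg _ _ (nball x0 r) Q); last by apply: alg_base; right; exists l.
  + exact: nball_open.
  + move=> f x [sf|[l' ->]] xr; [exact: smooth_on_continuous sf xr|exact: ucont].
  + move=> f x i [sf|[l' ->]] xr; [exact: smooth_on_derivable sf xr|by have [] := uder i x l' xr].
  + move=> f i [sf|[l' ->]].
      by exists (pderiv i f) => //; apply: alg_base; left; exact: smooth_on_pderiv.
    exists (fun x => \sum_j u x 0 j * A i x j l').
      apply: alg_sum => j; apply: alg_mul; apply: alg_base; first by right; exists j.
      left; exact: (smooth_on_sub onB (@sA i j l')).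
    by move=> x xr; have [_ h] := uder i x l' xr; rewrite /pderiv h mxE.
- by move=> i x xr; apply/rowP => l; rewrite mxE; have [_ <-] := uder i x l xr.
Qed.

(** A fundamental matrix: its rows solve the system with the standard basis as initial values, on
    the open set where its determinant does not vanish. *)
Lemma flat_fundamental x0 : B x0 -> exists2 V : set 'rV[R]_n, [/\ open V, V x0 & V `<=` B] &
  exists U : 'rV[R]_n -> 'M[R]_m, [/\ smooth_mx_on V U, forall x, V x -> U x \in unitmx &
    forall i x, V x -> mxpderiv i U x = U x *m A i x].
Proof.
move=> Bx0; have [r r0 [rB H]] := flat_solution_exists Bx0.
have /choice[u Hu] : forall a : 'I_m, exists u : 'rV[R]_n -> 'rV[R]_m, [/\ u x0 = delta_mx 0 a, smooth_mx_on (nball x0 r) u &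
    forall i x, nball x0 r x -> mxpderiv i u x = u x *m A i x] by move=> a; exact: H.
pose U x : 'M[R]_m := \matrix_(a, b) u a x 0 b.
have sU : smooth_mx_on (nball x0 r) U.
  move=> a b; have [_ s _] := Hu a.
  rewrite (_ : (fun x => _) = fun x => u a x 0 b); first exact: s.
  by apply/funext => x; rewrite mxE.
have oN := @nball_open R n x0 r.
exists [set x | nball x0 r x /\ \det (U x) != 0].
  split.
  - by apply: (open_nonzero oN) => x xr; exact: (smooth_on_continuous (smooth_det oN sU) xr).
  - split; first exact: nball_center.
    have -> : U x0 = 1%:M.
      by apply/matrixP => a b; rewrite !mxE; have [-> _ _] := Hu a; rewrite mxE eqxx/= eq_sym.
    by rewrite det1 oner_eq0.
  - by move=> x [/rB].
exists U; split.
- by apply: smooth_mx_sub sU => x [].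
- by move=> x [_ h]; rewrite unitmxE unitfE.
- move=> i x [xr _]; apply/matrixP => a b; rewrite mxE mxE.
  have [_ _ /(_ i x xr)/rowP/(_ b)] := Hu a; rewrite mxE mxE => e.
  rewrite (_ : (fun y => _) = fun y => u a y 0 b); last by apply/funext => y; rewrite mxE.
  by rewrite e; apply: eq_bigr => j _; rewrite [U _ _ _]mxE.
Qed.

(** Variation of constants: every solution is a constant row times the fundamental matrix, which
    gives both uniqueness and extension. *)
Lemma flat_quotient_derivative (V N : set 'rV[R]_n) (U : 'rV[R]_n -> 'M[R]_m) (u : 'rV[R]_n -> 'rV[R]_m) i x :
  open V -> open N -> N `<=` V ->
  smooth_mx_on V U -> (forall x, V x -> U x \in unitmx) ->
  (forall i x, V x -> mxpderiv i U x = U x *m A i x) ->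
  smooth_mx_on N u -> (forall i x, N x -> mxpderiv i u x = u x *m A i x) -> N x ->
  mxpderiv i (fun y => u y *m invmx (U y)) x = 0.
Proof.
move=> oV oN NV sU uU dU su du Nx; have Vx := NV _ Nx.
have sI := smooth_invmx oV uU sU; have sIN := smooth_mx_sub NV sI.
have dI : mxpderiv i (fun y => invmx (U y)) x = - (A i x *m invmx (U x)).
  have : mxpderiv i (fun y => U y *m invmx (U y)) x = 0.
    by rewrite (mxpderiv_eq oV i (fun y Vy => mulmxV (uU y Vy)) Vx) mxpderiv_cst.
  rewrite (mxpderivM oV i sU sI Vx) dU// => /(congr1 (mulmx (invmx (U x)))).
  rewrite mulmx0 mulmxDr !mulmxA mulVmx ?uU// !mul1mx => /eqP.
  by rewrite addrC addr_eq0 => /eqP.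
rewrite (mxpderivM oN i su sIN Nx) dI du//.
by rewrite mulmxN mulmxA subrr.
Qed.

End FlatSystem.

(** * Monodromy *)

(** Unlike [interval_induction], it transports P between any two times in either order; negating P
    handles the backward direction. *)
Lemma locally_constant_iff (R : realType) (P : R -> Prop) (a b : R) :
  (forall s, a <= s <= b -> exists2 e : R, 0 < e &
     forall t, a <= t <= b -> `|t - s| < e -> (P t <-> P s)) ->
  forall s t, a <= s <= b -> a <= t <= b -> P s -> P t.
Proof.
move=> H.
have key (Q : R -> Prop) : (forall s, a <= s <= b -> exists2 e : R, 0 < e &
     forall t, a <= t <= b -> `|t - s| < e -> (Q t <-> Q s)) ->
    forall s t, a <= s <= b -> a <= t <= b -> s <= t -> Q s -> Q t.
  move=> HQ s t /andP[as_ sb] /andP[at_ tb] st Qs; apply: (interval_induction st Qs) => u /andP[su ut].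
  have [|e e0 He] := HQ u; first by rewrite (le_trans as_ su) (le_trans ut tb).
  exists e => // w /andP[sw wt]; apply: He.
  by rewrite (le_trans as_ sw) (le_trans wt tb).
move=> s t sab tab Ps; have [st|/ltW ts] := leP s t; first exact: (key P H s t).
apply: contrapT => nPt; have := key (fun s => ~ P s) _ t s tab sab ts nPt; apply => // u uab.
have [e e0 He] := H u uab; exists e => // w wab wu; have [h1 h2] := He w wab wu.
by split=> n h; apply: n; [exact: h2|exact: h1].
Qed.

Lemma within_comp_continuous (T S X : topologicalType) (A : set S) (f : S -> X) (h : T -> S) :
  {within A, continuous f} -> continuous h -> (forall t, A (h t)) -> continuous (f \o h).
Proof.
move=> /subspace_continuousP cf ch hA t U fU.
have := cf _ (hA t) U fU; rewrite /nbhs/= /within/= => H.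
have : nbhs t (h @^-1` [set y | A y -> U (f y)]) by exact: ch.
by apply: filterS => s; apply; exact: hA.
Qed.

Definition clamp01 (R : realType) (s : R) : R := if s < 0 then 0 else if 1 < s then 1 else s.

Lemma clamp01_in (R : realType) (s : R) : 0 <= clamp01 s <= 1.
Proof. by rewrite /clamp01; case: (ltP s 0) => h; [|case: (ltP 1 s) => h1]; apply/andP; split; lra. Qed.

Lemma clamp01_id (R : realType) (s : R) : 0 <= s <= 1 -> clamp01 s = s.
Proof. by move=> /andP[h1 h2]; rewrite /clamp01 !ltNge h1 h2. Qed.

Lemma clamp01_continuous (R : realType) : continuous (@clamp01 R).
Proof.
move=> s; apply/continuous_epsP => e e0; exists e => // t te; apply: le_trans (ltW te).
rewrite ler_norml; have := ler_norm (t - s); have := ler_norm (s - t); rewrite [`|s - t|]distrC.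
move: `|t - s| => d; rewrite /clamp01.
case: (ltP s 0) => ?; case: (ltP t 0) => ?; case: (ltP 1 s) => ?; case: (ltP 1 t) => ? *;
  by apply/andP; split; lra.
Qed.

Lemma nbhs_ballR (R : realType) (s : R) (A : set R) :
  nbhs s A -> exists2 e : R, 0 < e & forall t, `|t - s| < e -> A t.
Proof.
move=> /nbhs_ballP[e /= e0 H]; exists e => // t ts; apply: H.
by rewrite -ball_normE /ball_/= distrC.
Qed.

Lemma nbhs_pairR (R : realType) (s t : R) (A : set (R * R)) :
  nbhs (s, t) A -> exists2 e : R, 0 < e & forall u v, `|u - s| < e -> `|v - t| < e -> A (u, v).
Proof.
move=> [[A1 A2] /= [/nbhs_ballR[e1 e10 H1] /nbhs_ballR[e2 e20 H2]] H].
exists (Num.min e1 e2); first by rewrite lt_min e10.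
move=> u v; rewrite !lt_min => /andP[u1 _] /andP[_ v2]; apply: H; split; [exact: H1|exact: H2].
Qed.

Lemma nbhs_Rball (R : realType) (s e : R) (A : set R) : 0 < e ->
  (forall t, `|t - s| < e -> A t) -> nbhs s A.
Proof.
move=> e0 H; apply/nbhs_ballP; exists e => // t.
by rewrite -ball_normE /ball_/= distrC; exact: H.
Qed.

Lemma continuous_slice2 (R : realType) (T : topologicalType) (H : R * R -> T) (s : R) :
  continuous H -> continuous (fun t : R => H (s, t)).
Proof.
move=> cH t U nU; have [e e0 He] := nbhs_pairR (cH (s, t) U nU).
by apply: (nbhs_Rball e0) => v vt; apply: He => //; rewrite subrr normr0.
Qed.

Lemma continuous_slice1 (R : realType) (T : topologicalType) (H : R * R -> T) (t : R) :
  continuous H -> continuous (fun s : R => H (s, t)).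
Proof.
move=> cH s U nU; have [e e0 He] := nbhs_pairR (cH (s, t) U nU).
by apply: (nbhs_Rball e0) => v vt; apply: He => //; rewrite subrr normr0.
Qed.

Lemma glue_continuous (R : realType) (T : topologicalType) (f g : R -> T) (a : R) :
  continuous f -> continuous g -> f a = g a -> continuous (fun s => if s <= a then f s else g s).
Proof.
move=> cf cg fga s U /= nU.
have fS : s <= a -> nbhs s (f @^-1` U) by move=> sa; apply: cf; move: nU; rewrite sa.
have gS : a <= s -> nbhs s (g @^-1` U).
  move=> sa; apply: cg; move: nU; case: ifP => // sa'.
  by have -> : s = a by [apply/eqP; rewrite eq_le sa' sa]; rewrite fga.
have [sa|sa|sa] := ltgtP s a.
- have [e e0 H] := nbhs_ballR (fS (ltW sa)).
  apply/nbhs_ballP; exists (Num.min e (a - s)); first by rewrite /= lt_min e0 subr_gt0.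
  move=> t; rewrite -ball_normE /ball_/= lt_min distrC => /andP[te ta].
  have := ler_norm (t - s) => tn; have -> : t <= a by lra.
  exact: H.
- have [e e0 H] := nbhs_ballR (gS (ltW sa)).
  apply/nbhs_ballP; exists (Num.min e (s - a)); first by rewrite /= lt_min e0 subr_gt0.
  move=> t; rewrite -ball_normE /ball_/= lt_min => /andP[te ta].
  have := ler_norm (s - t) => tn; have -> : (t <= a) = false by apply/negbTE; rewrite -ltNge; lra.
  by apply: H; rewrite distrC.
- have n1 : nbhs s (f @^-1` U) by apply: fS; rewrite sa.
  have n2 : nbhs s (g @^-1` U) by apply: gS; rewrite sa.
  by apply: filterS2 n1 n2 => t h1 h2 /=; case: ifP.
Qed.

(** * Continuation of germs along paths *)

Section Continuation.
Variables (R : realType) (M : topologicalType) (Y : Type).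
Implicit Types (f F G : M -> Y) (p q : M) (U : set M).

Definition germ f F p := \forall q \near p, f q = F q.

Lemma germ_refl f p : germ f f p. Proof. exact: nearW. Qed.
Lemma germ_sym f F p : germ f F p -> germ F f p. Proof. by apply: filterS => q ->. Qed.
Lemma germ_trans f F G p : germ f F p -> germ F G p -> germ f G p.
Proof. by apply: filterS2 => q -> ->. Qed.
Lemma germ_near f F p : germ f F p -> \forall q \near p, germ f F q.
Proof. by move=> H; exact: nbhs_interior. Qed.

Variable sol : (M -> Y) -> M -> Prop.

(* On a good set every germ of a solution extends to a unique solution. *)
Definition good U := [/\ open U,
  (forall f q, U q -> sol f q -> exists2 F, (forall r, U r -> sol F r) & germ F f q),
  (forall F G q r, (forall r, U r -> sol F r) -> (forall r, U r -> sol G r) -> U q -> U r -> germ F G q -> germ F G r) &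
  (forall q r, U q -> U r -> exists c : R -> M,
    [/\ continuous c, c 0 = q, c 1 = r & forall s, 0 <= s <= 1 -> U (c s)])].

Hypothesis sol_germ : forall f F p, germ f F p -> sol f p -> sol F p.
Hypothesis good_exists : forall p, exists2 U, good U & U p.

(** A path of germs over c: [phi s] matters only near c(s), and nearby members have the same germ at
    the later point. *)
Definition continuation (c : R -> M) (b : R) (phi : R -> M -> Y) :=
  forall s, 0 <= s <= b -> sol (phi s) (c s) /\ exists2 e : R, 0 < e &
    forall t, 0 <= t <= b -> `|t - s| < e -> germ (phi t) (phi s) (c t).

Lemma path_near (c : R -> M) U s : continuous c -> open U -> U (c s) ->
  exists2 e : R, 0 < e & forall t, `|t - s| < e -> U (c t).
Proof.
by move=> cc oU Us; apply: (nbhs_ballR (A := c @^-1` U)); apply: cc; exact: open_nbhs_nbhs.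
Qed.

Lemma path_germ (c : R -> M) f F s : continuous c -> germ f F (c s) ->
  exists2 e : R, 0 < e & forall t, `|t - s| < e -> germ f F (c t).
Proof. by move=> cc H; apply: nbhs_ballR; apply: cc; exact: germ_near. Qed.

Lemma continuation_le c b b' phi : b' <= b -> continuation c b phi -> continuation c b' phi.
Proof.
move=> bb H s /andP[s0 sb]; have [|h [e e0 He]] := H s; first by rewrite s0 (le_trans sb bb).
split=> //; exists e => // t /andP[t0 tb]; apply: He; by rewrite t0 (le_trans tb bb).
Qed.

(** Extendability up to time b is a locally constant property of b: within a good set the germ
    reached extends to one solution, which is used from then on. *)
Lemma continuation_exists c f b : continuous c -> 0 <= b -> sol f (c 0) ->
  exists2 phi, continuation c b phi & phi 0 = f.
Proof.
move=> cc b0 f0; apply: (interval_induction (P := fun b => exists2 phi, continuation c b phi & phi 0 = f) b0).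
  exists (fun=> f) => // s /andP[s0 s0']; have -> : s = 0 by apply/eqP; rewrite eq_le s0 s0'.
  by split=> //; exists 1 => // t _ _; exact: germ_refl.
move=> s /andP[s0 _]; have [U [oU ext _ _] Us] := good_exists (c s).
have [e e0 He] := path_near cc oU Us.
have step t t' : 0 <= t -> `|t - s| < e -> `|t' - s| < e ->
    (exists2 phi, continuation c t phi & phi 0 = f) -> (exists2 phi, continuation c t' phi & phi 0 = f).
  move=> t0 te te' [phi ph ph0]; have [tt|tt] := leP t' t.
    by exists phi => //; exact: continuation_le tt ph.
  have [|st _] := ph t; first by rewrite t0 lexx.
  have [F sF gF] := ext _ _ (He t te) st.
  exists (fun r => if r <= t then phi r else F); last by rewrite t0.
  move=> r /andP[r0 rt'].
  have inU w : t < w -> w <= t' -> U (c w).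
    move=> w1 w2; apply: He; move: te te'; rewrite !ltr_norml => /andP[? ?] /andP[? ?].
    by apply/andP; split; lra.
  have [rt|rt|rt] := ltgtP r t.
  - have [|sr [d d0 Hd]] := ph r; first by rewrite r0 ltW.
    split=> //; exists (Num.min d (t - r)); first by rewrite lt_min d0 subr_gt0.
    move=> w /andP[w0 wt']; rewrite lt_min => /andP[wd wt]; have := ler_norm (w - r) => wn.
    have wt0 : w <= t by lra.
    by rewrite wt0; apply: Hd => //; rewrite w0.
  - split; first by apply: sF; exact: inU.
    exists (r - t); first by rewrite subr_gt0.
    move=> w _; rewrite distrC => wr; have := ler_norm (r - w) => wn.
    have -> : (w <= t) = false by apply/negbTE; rewrite -ltNge; lra.
    exact: germ_refl.
  - rewrite rt; split=> //.
    have [|_ [d d0 Hd]] := ph t; first by rewrite t0 lexx.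
    have [d' d'0 Hd'] := path_germ cc gF.
    exists (Num.min d d'); first by rewrite lt_min d0.
    move=> w /andP[w0 wt']; rewrite lt_min => /andP[wd wd']; case: (leP w t) => wt; last exact: Hd'.
    by apply: Hd => //; rewrite w0.
exists e => // t /andP[t0 _] te.
have ss : `|s - s| < e by rewrite subrr normr0.
by split; exact: step.
Qed.

Lemma continuation_unique c b phi psi : continuous c -> 0 <= b ->
  continuation c b phi -> continuation c b psi -> germ (phi 0) (psi 0) (c 0) ->
  germ (phi b) (psi b) (c b).
Proof.
move=> cc b0 hp hq g0.
apply: (interval_induction (P := fun s => germ (phi s) (psi s) (c s)) b0 g0) => s sb.
have [sp [e1 e10 H1]] := hp s sb; have [sq [e2 e20 H2]] := hq s sb.
have [U [oU ext uni _] Us] := good_exists (c s).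
have [e3 e30 H3] := path_near cc oU Us.
have [F sF gF] := ext _ _ Us sp; have [G sG gG] := ext _ _ Us sq.
have [e4 e40 H4] := path_germ cc gF; have [e5 e50 H5] := path_germ cc gG.
exists (Num.min (Num.min e1 e2) (Num.min e3 (Num.min e4 e5))).
  by rewrite !lt_min e10 e20 e30 e40.
move=> t tb; rewrite !lt_min => /andP[/andP[t1 t2] /andP[t3 /andP[t4 t5]]].
have Ut := H3 t t3; have F1 := H4 t t4; have G1 := H5 t t5.
have p1 := H1 t tb t1; have q1 := H2 t tb t2.
split=> K.
- have FG : germ F G (c t).
    exact: germ_trans (germ_trans F1 (germ_trans (germ_sym p1) (germ_trans K q1))) (germ_sym G1).
  exact: germ_trans (germ_sym gF) (germ_trans (uni F G _ _ sF sG Ut Us FG) gG).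
- have FG : germ F G (c s) by exact: germ_trans gF (germ_trans K (germ_sym gG)).
  have := uni F G _ _ sF sG Us Ut FG => L.
  exact: germ_trans p1 (germ_trans (germ_sym F1) (germ_trans L (germ_trans G1 (germ_sym q1)))).
Qed.

(** While the path stays in a good set, the continued germ stays equal to a single solution on that
    set. *)
Lemma continuation_in_good c b phi U F lo hi : continuous c -> continuation c b phi -> good U ->
  (forall s, lo <= s <= hi -> U (c s)) -> 0 <= lo -> hi <= b ->
  (forall r, U r -> sol F r) ->
  forall s t, lo <= s <= hi -> lo <= t <= hi -> germ (phi s) F (c s) -> germ (phi t) F (c t).
Proof.
move=> cc hp [oU ext uni _] inU lo0 hib sF; apply: locally_constant_iff => s /andP[ls sh].
have sb : 0 <= s <= b by rewrite (le_trans lo0 ls) (le_trans sh hib).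
have Us : U (c s) by apply: inU; rewrite ls.
have [sp [e1 e10 H1]] := hp s sb.
have [G sG gG] := ext _ _ Us sp; have [e2 e20 H2] := path_germ cc gG.
exists (Num.min e1 e2); first by rewrite lt_min e10.
move=> t /andP[lt_ th]; rewrite lt_min => /andP[t1 t2].
have tb : 0 <= t <= b by rewrite (le_trans lo0 lt_) (le_trans th hib).
have Ut : U (c t) by apply: inU; rewrite lt_.
have p1 := H1 t tb t1; have G1 := H2 t t2.
split=> K.
- have GF : germ G F (c t) by exact: germ_trans G1 (germ_trans (germ_sym p1) K).
  exact: germ_trans (germ_sym gG) (uni G F _ _ sG sF Ut Us GF).
- have GF : germ G F (c s) by exact: germ_trans gG K.
  exact: germ_trans p1 (germ_trans (germ_sym G1) (uni G F _ _ sG sF Us Ut GF)).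
Qed.

(** For s near s0 the germs along the two paths agree up to every time t, by induction on t through
    good boxes; so the final germ is locally constant in s. *)
Lemma continuation_homotopy (H : R * R -> M) f p q (phi : R -> R -> M -> Y) :
  continuous H -> (forall s, H (s, 0) = p) -> (forall s, H (s, 1) = q) ->
  (forall s, continuation (fun t => H (s, t)) 1 (phi s)) -> (forall s, phi s 0 = f) ->
  germ (phi 0 1) (phi 1 1) q.
Proof.
move=> cH H0 H1 hp p0.
have cs s : continuous (fun t => H (s, t)) := @continuous_slice2 R M H s cH.
have ct t : continuous (fun s => H (s, t)) := @continuous_slice1 R M H t cH.
have b01 : 0 <= 1 :> R by [].
have loc s0 : exists2 d : R, 0 < d & forall s, `|s - s0| < d -> germ (phi s 1) (phi s0 1) q.
  suff : exists2 d : R, 0 < d & forall s, `|s - s0| < d -> germ (phi s 1) (phi s0 1) (H (s, 1)).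
    by move=> [d d0 Hd]; exists d => // s /Hd; rewrite H1.
  apply: (interval_induction (P := fun t => exists2 d : R, 0 < d & forall s, `|s - s0| < d ->
      germ (phi s t) (phi s0 t) (H (s, t))) b01).
    by exists 1 => // s _; rewrite !p0; exact: germ_refl.
  move=> t0 t01; have [U gU Ut] := good_exists (H (s0, t0)); have [oU ext uni _] := gU.
  have [e e0 box] : exists2 e : R, 0 < e & forall u v, `|u - s0| < e -> `|v - t0| < e -> U (H (u, v)).
    by apply: nbhs_pairR (H @^-1` U) _; apply: cH; exact: open_nbhs_nbhs.
  have step t t' : 0 <= t <= 1 -> 0 <= t' <= 1 -> `|t - t0| < e -> `|t' - t0| < e ->
      (exists2 d : R, 0 < d & forall s, `|s - s0| < d -> germ (phi s t) (phi s0 t) (H (s, t))) ->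
      (exists2 d : R, 0 < d & forall s, `|s - s0| < d -> germ (phi s t') (phi s0 t') (H (s, t'))).
    move=> tb tb' te te' [d d0 Hd].
    have n0 : `|s0 - s0| < e by rewrite subrr normr0.
    have [st _] := hp s0 t tb.
    have [F sF gF] := ext _ _ (box s0 t n0 te) st.
    pose lo := Num.min t t'; pose hi := Num.max t t'.
    have lohi w : lo <= w <= hi -> `|w - t0| < e.
      rewrite /lo /hi; move: te te'; rewrite !ltr_norml => /andP[? ?] /andP[? ?].
      by case: (leP t t') => ? /andP[? ?]; apply/andP; split; lra.
    have tl : lo <= t <= hi by rewrite /lo /hi ge_min le_max lexx.
    have tl' : lo <= t' <= hi by rewrite /lo /hi ge_min le_max lexx !orbT.
    have lo0 : 0 <= lo by rewrite le_min; case/andP: tb => ->; case/andP: tb' => ->.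
    have hi1 : hi <= 1 by rewrite ge_max; case/andP: tb => _ ->; case/andP: tb' => _ ->.
    have move_ s : `|s - s0| < e -> germ (phi s t) F (H (s, t)) -> germ (phi s t') F (H (s, t')).
      move=> se; apply: (continuation_in_good (cs s) (hp s) gU _ lo0 hi1 sF tl tl').
      by move=> w /lohi; exact: box.
    have g0 := move_ s0 n0 (germ_sym gF).
    have [e1 e10 E1] := path_germ (ct t) gF.
    have [e2 e20 E2] := path_germ (ct t') g0.
    exists (Num.min (Num.min d e) (Num.min e1 e2)); first by rewrite !lt_min d0 e0 e10.
    move=> s; rewrite !lt_min => /andP[/andP[sd se] /andP[s1 s2]].
    have K : germ (phi s t) F (H (s, t)) by exact: germ_trans (Hd s sd) (germ_sym (E1 s s1)).
    exact: germ_trans (move_ s se K) (germ_sym (E2 s s2)).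
  have n0 : `|t0 - t0| < e by rewrite subrr normr0.
  by exists e => // t tb te; split; exact: step.
apply: (interval_induction (P := fun s => germ (phi 0 1) (phi s 1) q) b01); first exact: germ_refl.
move=> s _; have [d d0 Hd] := loc s; exists d => // t _ td; have K := Hd t td.
by split=> L; [exact: germ_trans L K|exact: germ_trans L (germ_sym K)].
Qed.

Hypothesis paths : forall p q, exists c : R -> M, [/\ continuous c, c 0 = p & c 1 = q].
Hypothesis loops : forall c : R -> M, continuous c -> c 0 = c 1 ->
  exists H : R * R -> M, [/\ continuous H, (forall t, 0 <= t <= 1 -> H (0, t) = c t),
    (forall t, H (1, t) = c 0), (forall s, H (s, 0) = c 0) & forall s, H (s, 1) = c 0].

Lemma continuation_loop (c : R -> M) phi f : continuous c -> c 0 = c 1 -> sol f (c 0) ->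
  continuation c 1 phi -> germ (phi 0) f (c 0) -> germ (phi 1) f (c 0).
Proof.
move=> cc c01 sf hp gp; have [H [cH Hc H1 h0 h1]] := loops cc c01.
have cs s : continuous (fun t => H (s, t)) := @continuous_slice2 R M H s cH.
have /choice[psi Hpsi] : forall s, exists psi, continuation (fun t => H (s, t)) 1 psi /\ psi 0 = f.
  move=> s; have [|psi a b] := continuation_exists (b := 1) (cs s) ler01 (f := f).
    by rewrite h0.
  by exists psi.
have K := continuation_homotopy cH h0 h1 (fun s => (Hpsi s).1) (fun s => (Hpsi s).2).
have b01 : 0 <= 1 :> R by [].
have K0 : germ (phi 1) (psi 0 1) (c 0).
  rewrite -(h1 0).
  apply: (continuation_unique (cs 0) b01) (Hpsi 0).1 _.
    move=> s sb; rewrite Hc//; have [h [e e0 He]] := hp s sb; split=> //; exists e => // t tb te.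
    by rewrite Hc//; exact: He.
  by rewrite (Hpsi 0).2 h0.
have K1 : germ (psi 1 1) f (c 0).
  rewrite -(H1 1); have [[hs _] p0] := (Hpsi 1, Hpsi 1).
  apply: (continuation_unique (cs 1) b01 (Hpsi 1).1 (psi := fun=> f)) => //.
    by move=> s sb; rewrite H1; split=> //; exists 1 => // t _ _; exact: germ_refl.
  by rewrite (Hpsi 1).2; exact: germ_refl.
exact: germ_trans K0 (germ_trans K K1).
Qed.

Lemma continuation_affine c b phi (u v : R) : continuation c b phi ->
  (forall s, 0 <= s <= 1 -> 0 <= u + v * s <= b) ->
  continuation (fun s => c (u + v * s)) 1 (fun s => phi (u + v * s)).
Proof.
move=> hp uv s s1; have [h [e e0 He]] := hp _ (uv s s1); split=> //.
exists (e / (`|v| + 1)); first by rewrite divr_gt0// ltr_wpDl.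
move=> t t1 ts; apply: He; first exact: uv.
rewrite (_ : _ - _ = v * (t - s)); last by ring.
rewrite normrM; move: ts; rewrite ltr_pdivlMr ?ltr_wpDl// => ts.
have := normr_ge0 (t - s); nra.
Qed.

(** The value at p is that of the germ continued along a chosen path to p. Independence of the
    choice is tested on the loop formed by two chosen paths and a short arc in a good set. *)
Theorem monodromy f p0 : sol f p0 -> exists2 F, (forall p, sol F p) & germ F f p0.
Proof.
move=> sf; have b01 : 0 <= 1 :> R by [].
have /choice[cp Hcp] := paths p0.
have /choice[ph Hph] : forall p, exists phi, continuation (cp p) 1 phi /\ phi 0 = f.
  move=> p; have [cc c0 _] := Hcp p; have [|phi a b] := continuation_exists (b := 1) cc b01 (f := f).
    by rewrite c0.
  by exists phi.
pose F p := ph p 1 p.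
have sp p : sol (ph p 1) p.
  have [_ _ c1] := Hcp p; have [|h _] := (Hph p).1 1; first by rewrite b01 lexx.
  by rewrite c1 in h.
have key p : germ F (ph p 1) p.
  have [U gU Up] := good_exists p; have [oU ext uni pth] := gU.
  have [G sG gG] := ext _ _ Up (sp p).
  suff H : forall q, U q -> F q = G q.
    have nU : \forall q \near p, U q by exact: open_nbhs_nbhs.
    by apply: filterS2 nU gG => q Uq <-; exact: H.
  move=> q Uq; have [s [cs s0 s1 Us]] := pth _ _ Up Uq.
  have [c1 c10 c11] := Hcp p; have [c2 c20 c21] := Hcp q.
  (* The loop runs, in thirds of the unit interval, along the path to p, the arc from p to q, and
     the reversed path from q. *)
  pose l2 (r : R) := if r <= 2 / 3 then s (-1 + 3 * r) else cp q (3 + (- 3) * r).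
  pose l (r : R) := if r <= 1 / 3 then cp p (0 + 3 * r) else l2 r.
  have aff (u v : R) : continuous (fun r : R => u + v * r).
    move=> r; apply: continuousD; first exact: cst_continuous.
    by apply: continuousM; [exact: cst_continuous|exact: cvg_id].
  have affc (u v : R) (c : R -> M) : continuous c -> continuous (fun r : R => c (u + v * r)).
    by move=> cc r; apply: (@continuous_comp _ _ _ (fun r : R => u + v * r) c); [exact: aff|exact: cc].
  have cl2 : continuous l2.
    apply: glue_continuous; [exact: affc|exact: affc|].
    by rewrite (_ : -1 + 3 * (2 / 3) = 1); [rewrite s1 (_ : 3 + _ = 1) ?c21//; field|field].
  have cl : continuous l.
    apply: glue_continuous; [exact: affc|exact: cl2|].
    rewrite /l2 (_ : 1 / 3 <= 2 / 3 :> R); last lra.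
    by rewrite (_ : 0 + 3 * (1 / 3) = 1); [rewrite c11 (_ : -1 + _ = 0) ?s0//; field|field].
  have lp r : 0 <= r <= 1 -> l (0 + 1 / 3 * r) = cp p r.
    move=> /andP[r0 r1]; rewrite /l (_ : 0 + 1 / 3 * r <= 1 / 3); last lra.
    by congr (cp p _); field.
  have ls r : 0 <= r <= 1 -> l (1 / 3 + 1 / 3 * r) = s r.
    move=> /andP[r0 r1]; rewrite /l /l2; case: (leP _ (1 / 3)) => h.
      have -> : r = 0 by lra.
      by rewrite s0 (_ : 0 + _ = 1) ?c11//; field.
    rewrite (_ : 1 / 3 + 1 / 3 * r <= 2 / 3); last lra.
    by congr (s _); field.
  have lq r : 0 <= r <= 1 -> l (1 + - (1 / 3) * r) = cp q r.
    move=> /andP[r0 r1]; rewrite /l /l2 (_ : (1 + - (1 / 3) * r <= 1 / 3) = false); last first.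
      by apply/negbTE; rewrite -ltNge; lra.
    case: (leP _ (2 / 3)) => h.
      have -> : r = 1 by lra.
      by rewrite c21 (_ : -1 + _ = 1) ?s1//; field.
    by congr (cp q _); field.
  have z01 : 0 <= (0 : R) <= 1 by rewrite lexx b01.
  have o01 : 0 <= (1 : R) <= 1 by rewrite lexx b01.
  have l0 : l 0 = p0 by have := lp 0 z01; rewrite mulr0 addr0 c10.
  have l1 : l 1 = p0 by have := lq 0 z01; rewrite mulr0 addr0 c20.
  have [|phi hphi phi0] := continuation_exists (b := 1) cl b01 (f := f); first by rewrite l0.
  have loop : germ (phi 1) f p0.
    by rewrite -l0; apply: (continuation_loop cl); rewrite ?l0 ?l1// phi0; exact: germ_refl.
  have congr_cont (c c' : R -> M) psi : (forall r, 0 <= r <= 1 -> c r = c' r) ->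
      continuation c 1 psi -> continuation c' 1 psi.
    move=> cc hp r r1; rewrite -cc//; have [h [e e0 He]] := hp r r1; split=> //; exists e => // t t1 te.
    by rewrite -cc//; exact: He.
  have h1 : continuation (cp p) 1 (fun r => phi (0 + 1 / 3 * r)).
    apply: (congr_cont _ _ _ lp); apply: (continuation_affine hphi) => r /andP[? ?].
    by apply/andP; split; lra.
  have h2 : continuation s 1 (fun r => phi (1 / 3 + 1 / 3 * r)).
    apply: (congr_cont _ _ _ ls); apply: (continuation_affine hphi) => r /andP[? ?].
    by apply/andP; split; lra.
  have h3 : continuation (cp q) 1 (fun r => phi (1 + - (1 / 3) * r)).
    apply: (congr_cont _ _ _ lq); apply: (continuation_affine hphi) => r /andP[? ?].
    by apply/andP; split; lra.
  have k1 : germ (phi (1 / 3)) (ph p 1) p.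
    have := continuation_unique c1 b01 h1 (Hph p).1; rewrite mulr0 addr0 phi0 (Hph p).2 c11.
    by rewrite (_ : 0 + 1 / 3 * 1 = 1 / 3); [apply; exact: germ_refl|field].
  have k2 : germ (phi (2 / 3)) G q.
    have := continuation_in_good cs h2 gU Us (lexx 0) (lexx 1) sG z01 o01.
    rewrite mulr0 addr0 s0 s1 (_ : 1 / 3 + 1 / 3 * 1 = 2 / 3); last by field.
    by apply; exact: germ_trans k1 (germ_sym gG).
  have k3 : germ (phi (2 / 3)) (ph q 1) q.
    have := continuation_unique c2 b01 h3 (Hph q).1; rewrite mulr0 addr0 (Hph q).2 c20 c21.
    by rewrite (_ : 1 + - (1 / 3) * 1 = 2 / 3); [apply|field].
  exact: (nbhs_singleton (germ_trans (germ_sym k3) k2)).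
exists F; first by move=> p; exact: sol_germ (germ_sym (key p)) (sp p).
have [c1 c10 c11] := Hcp p0.
have K := continuation_loop c1 (etrans c10 (esym c11)) (f := f) _ (Hph p0).1.
rewrite c10 (Hph p0).2 in K.
exact: germ_trans (key p0) (K sf (germ_refl f p0)).
Qed.
End Continuation.

(** * The coordinate systems of the product *)

Lemma mxsubE (V : zmodType) p q (A B : 'M[V]_(p, q)) i j : (A - B) i j = A i j - B i j.
Proof. by rewrite !mxE. Qed.

Section ParallelFrame.
Variables (R : realType) (A : set 'rV[R]_3) (K : R).
Variables (e th : 'I_3 -> 'I_3 -> 'rV[R]_3 -> R) (w : 'I_3 -> 'rV[R]_3 -> R).
Variable Gm : 'I_3 -> 'I_3 -> 'I_3 -> 'rV[R]_3 -> R.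
Hypothesis oA : open A.
Hypothesis sth : forall a i, smooth_on A (th a i).
Hypothesis se : forall a i, smooth_on A (e a i).
Hypothesis sw : forall i, smooth_on A (w i).
Hypothesis dual : forall a b x, A x -> \sum_i e a i x * th b i x = (a == b)%:R.
Hypothesis dth0 : forall i j x, A x -> pderiv i (th o0 j) x = \sum_l Gm l i j x * th o0 l x - th o1 j x * w i x.
Hypothesis dth1 : forall i j x, A x -> pderiv i (th o1 j) x = \sum_l Gm l i j x * th o1 l x + th o0 j x * w i x.
Hypothesis dth2 : forall i j x, A x -> pderiv i (th o2 j) x = \sum_l Gm l i j x * th o2 l x.
Hypothesis GmC : forall l i j x, A x -> Gm l i j x = Gm l j i x.
Hypothesis dw : forall i j x, A x -> ext w i j x = K * wedge (th o0) (th o1) i j x.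

(* Rows of states are (u, e0 u, e1 u) for the sphere coordinates u, and (t, 1) *)
(* for the line coordinate t.                                                 *)
Definition sphere_system i x : 'M[R]_3 := \matrix_(a, b)
  match val a, val b with
  | 0%N, 1%N => - K * th o0 i x | 0%N, 2%N => - K * th o1 i x
  | 1%N, 0%N => th o0 i x | 1%N, 2%N => w i x
  | 2%N, 0%N => th o1 i x | 2%N, 1%N => - w i x
  | _, _ => 0 end.

Definition line_system i x : 'M[R]_2 := \matrix_(a, b)
  match val a, val b with 1%N, 0%N => th o2 i x | _, _ => 0 end.

Lemma smooth_sphere_system i : smooth_mx_on A (sphere_system i).
Proof.
move=> a b; rewrite (_ : (fun x => _) = fun x => match val a, val b with
  | 0%N, 1%N => - K * th o0 i x | 0%N, 2%N => - K * th o1 i x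
  | 1%N, 0%N => th o0 i x | 1%N, 2%N => w i x
  | 2%N, 0%N => th o1 i x | 2%N, 1%N => - w i x
  | _, _ => 0 end); last by apply/funext => x; rewrite mxE.
have s0 := smooth_on_cst oA (0 : R); have sK := smooth_on_cst oA (- K).
case: (val a) => [|[|[|?]]]; case: (val b) => [|[|[|?]]]; [exact: s0|exact: (smooth_onM oA sK (sth o0 i))
 |exact: (smooth_onM oA sK (sth o1 i))|exact: s0|exact: (sth o0 i)|exact: s0|exact: (sw i)|exact: s0
 |exact: (sth o1 i)|exact: (smooth_onN oA (sw i))|exact: s0|exact: s0|exact: s0|exact: s0|exact: s0|exact: s0].
Qed.

Lemma smooth_line_system i : smooth_mx_on A (line_system i).
Proof.
move=> a b; rewrite (_ : (fun x => _) = fun x => match val a, val b with 1%N, 0%N => th o2 i x | _, _ => 0 end).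
  have s0 := smooth_on_cst oA (0 : R).
  by case: (val a) => [|[|?]]; case: (val b) => [|?]; [exact: s0|exact: s0|exact: (sth o2 i)|exact: s0|exact: s0|exact: s0].
by apply/funext => x; rewrite mxE.
Qed.

Lemma ext0E i j x : A x -> ext (th o0) i j x = - wedge w (th o1) i j x.
Proof.
move=> Ax; rewrite /ext !dth0//; under eq_bigr do rewrite GmC//.
by rewrite /wedge; move: (\sum_l _) => s; ring.
Qed.

Lemma ext1E i j x : A x -> ext (th o1) i j x = wedge w (th o0) i j x.
Proof.
move=> Ax; rewrite /ext !dth1//; under eq_bigr do rewrite GmC//.
by rewrite /wedge; move: (\sum_l _) => s; ring.
Qed.

Lemma ext2E i j x : A x -> ext (th o2) i j x = 0.
Proof. by move=> Ax; rewrite /ext !dth2//; under eq_bigr do rewrite GmC//; rewrite subrr. Qed.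

Lemma pderiv_entry p q (F : 'rV[R]_3 -> 'M[R]_(p, q)) (f : 'rV[R]_3 -> R) i x a b :
  (forall y, F y a b = f y) -> mxpderiv i F x a b = pderiv i f x.
Proof. by move=> H; rewrite mxE; congr (pderiv _ _ _); apply/funext. Qed.

(** Entry by entry, flatness reads d theta0 = -w wedge theta1, d theta1 = w wedge theta0 and dw = K
    theta0 wedge theta1. *)
Lemma sphere_system_flat i j x : A x ->
  mxpderiv j (sphere_system i) x - mxpderiv i (sphere_system j) x =
  sphere_system i x *m sphere_system j x - sphere_system j x *m sphere_system i x.
Proof.
move=> Ax; have E0 := ext0E i j Ax; have E1 := ext1E i j Ax; have Ew := dw i j Ax.
rewrite /ext /wedge in E0 E1 Ew.
have D p q (f : 'I_3 -> 'rV[R]_3 -> R) : (forall i y, sphere_system i y p q = f i y) ->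
    (mxpderiv j (sphere_system i) x - mxpderiv i (sphere_system j) x) p q = pderiv j (f i) x - pderiv i (f j) x.
  by move=> H; rewrite mxsubE !(pderiv_entry _ _ (H _)).
have Z p q : (forall i y, sphere_system i y p q = 0) ->
    (mxpderiv j (sphere_system i) x - mxpderiv i (sphere_system j) x) p q = 0.
  by move=> H; rewrite (D p q (fun _ _ => 0) H) !pderiv_cst subrr.
have cK a k l : pderiv k (fun y => - K * th a l y) x = - K * pderiv k (th a l) x.
  by rewrite (pderivM k (smooth_on_cst oA (- K)) (sth a l) Ax) pderiv_cst mulr0 addr0.
apply/matrixP => p q; rewrite [RHS]mxsubE [X in _ = _ - X]mxE [X in _ = X - _]mxE !sum3.
move: p q; apply: all3; apply: all3; rewrite ?[in RHS]mxE /=.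
- by rewrite Z => [|? ?]; rewrite ?mxE//=; ring.
- rewrite (D _ _ (fun i y => - K * th o0 i y)) => [|? ?]; last by rewrite mxE.
  rewrite !cK (_ : - K * pderiv j (th o0 i) x - - K * pderiv i (th o0 j) x =
    K * (pderiv i (th o0 j) x - pderiv j (th o0 i) x)); last by ring.
  by rewrite E0; ring.
- rewrite (D _ _ (fun i y => - K * th o1 i y)) => [|? ?]; last by rewrite mxE.
  rewrite !cK (_ : - K * pderiv j (th o1 i) x - - K * pderiv i (th o1 j) x =
    K * (pderiv i (th o1 j) x - pderiv j (th o1 i) x)); last by ring.
  by rewrite E1; ring.
- rewrite (D _ _ (th o0)) => [|? ?]; last by rewrite mxE.
  by rewrite -opprB E0; ring.
- by rewrite Z => [|? ?]; rewrite ?mxE//=; ring.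
- rewrite (D _ _ w) => [|? ?]; last by rewrite mxE.
  by rewrite -opprB Ew; ring.
- rewrite (D _ _ (th o1)) => [|? ?]; last by rewrite mxE.
  by rewrite -opprB E1; ring.
- rewrite (D _ _ (fun i y => - w i y)) => [|? ?]; last by rewrite mxE.
  rewrite !(pderivN _ (sw _) Ax) (_ : - pderiv j (w i) x - - pderiv i (w j) x = pderiv i (w j) x - pderiv j (w i) x); last by ring.
  by rewrite Ew; ring.
- by rewrite Z => [|? ?]; rewrite ?mxE//=; ring.
Qed.

Lemma line_system_flat i j x : A x ->
  mxpderiv j (line_system i) x - mxpderiv i (line_system j) x =
  line_system i x *m line_system j x - line_system j x *m line_system i x.
Proof.
move=> Ax; have E2 := ext2E i j Ax; rewrite /ext in E2.
have mul0 k l : line_system k x *m line_system l x = 0.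
  apply/matrixP => p q; rewrite !mxE !big_ord_recl big_ord0 !mxE /=.
  by case: (val p) => [|[|?]]; case: (val q) => [|?]; rewrite ?mulr0 ?mul0r ?addr0.
rewrite !mul0 subrr; apply/matrixP => p q; rewrite mxsubE [RHS]mxE.
have ent (k l : 'I_3) : mxpderiv k (line_system l) x p q =
    match val p, val q with 1%N, 0%N => pderiv k (th o2 l) x | _, _ => 0 end.
  rewrite (pderiv_entry k x (f := fun y => match val p, val q with 1%N, 0%N => th o2 l y | _, _ => 0 end)).
    by case: (val p) => [|[|?]]; case: (val q) => [|?]; rewrite ?pderiv_cst.
  by move=> y; rewrite mxE.
rewrite !ent; case: (val p) => [|[|?]]; case: (val q) => [|?]; rewrite ?subrr//.
by rewrite -opprB E2 oppr0.
Qed.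

Variable N : set 'rV[R]_3.
Hypotheses (oN : open N) (NA : N `<=` A).

(** The Obata equation Hess u = -K u (g - theta2^2), satisfied by linear functions restricted to a
    sphere of curvature K. *)
Definition hessian_eq (u : 'rV[R]_3 -> R) := forall i j x, N x ->
  pderiv i (pderiv j u) x = \sum_l Gm l i j x * pderiv l u x
    - K * u x * (th o0 i x * th o0 j x + th o1 i x * th o1 j x).

Definition frame_deriv (u : 'rV[R]_3 -> R) a x := \sum_i e a i x * pderiv i u x.

Definition sphere_state (u : 'rV[R]_3 -> R) x : 'rV[R]_3 :=
  \row_b (match val b with 0%N => u x | 1%N => frame_deriv u o0 x | _ => frame_deriv u o1 x end).

Lemma smooth_frame_deriv u a : smooth_on N u -> smooth_on N (frame_deriv u a).
Proof.
move=> su; apply: (smooth_on_sum oN) => i; apply: (smooth_onM oN); last exact: smooth_on_pderiv.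
exact: smooth_on_sub NA (se a i).
Qed.

Lemma smooth_sphere_state u : smooth_on N u -> smooth_mx_on N (sphere_state u).
Proof.
move=> su z b; rewrite (_ : (fun x => _) = fun x => match val b with 0%N => u x | 1%N => frame_deriv u o0 x | _ => frame_deriv u o1 x end).
  by case: (val b) => [|[|?]]; [exact: su|exact: (smooth_frame_deriv o0 su)|exact: (smooth_frame_deriv o1 su)].
by apply/funext => x; rewrite mxE.
Qed.

(** Contracting the Hessian equation with the frame isolates the derivatives of e0(u) and e1(u);
    [sphere_state_hessian] is the converse. *)
Lemma sphere_state_deriv u : smooth_on N u -> hessian_eq u ->
  (forall i x, N x -> pderiv i u x = frame_deriv u o0 x * th o0 i x + frame_deriv u o1 x * th o1 i x) ->
  forall i x, N x -> mxpderiv i (sphere_state u) x = sphere_state u x *m sphere_system i x.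
Proof.
move=> su hu du i x Nx; have Ax := NA Nx.
have sp := smooth_frame_deriv o0 su; have sq := smooth_frame_deriv o1 su.
have sN a k : smooth_on N (th a k) by exact: smooth_on_sub NA (sth a k).
pose p := frame_deriv u o0; pose q := frame_deriv u o1.
have dd j : pderiv i p x * th o0 j x + pderiv i q x * th o1 j x =
    - K * u x * (th o0 i x * th o0 j x + th o1 i x * th o1 j x) + p x * w i x * th o1 j x - q x * w i x * th o0 j x.
  have := hu i j x Nx; rewrite (pderiv_eq oN i (du j) Nx).
  rewrite (pderivD i (smooth_onM oN sp (sN o0 j)) (smooth_onM oN sq (sN o1 j)) Nx).
  rewrite (pderivM i sp (sN o0 j) Nx) (pderivM i sq (sN o1 j) Nx) dth0// dth1//.
  have -> : \sum_l Gm l i j x * pderiv l u x =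
      p x * (\sum_l Gm l i j x * th o0 l x) + q x * (\sum_l Gm l i j x * th o1 l x).
    by rewrite !mulr_sumr -big_split; apply: eq_bigr => l _ /=; rewrite du// /p /q; ring.
  rewrite -/p -/q.
  move: (\sum_l _) (\sum_l _) (pderiv i p x) (pderiv i q x) => s1 s2 dp dq H.
  by apply/eqP; rewrite -subr_eq0; apply/eqP; move/eqP: H; rewrite -subr_eq0 => /eqP H; rewrite -[RHS]H; ring.
have con a : \sum_j e a j x * (pderiv i p x * th o0 j x + pderiv i q x * th o1 j x) =
    pderiv i p x * (a == o0)%:R + pderiv i q x * (a == o1)%:R.
  rewrite -(dual a o0 Ax) -(dual a o1 Ax) !mulr_sumr -big_split; apply: eq_bigr => j _ /=; ring.
have con' a : \sum_j e a j x * (pderiv i p x * th o0 j x + pderiv i q x * th o1 j x) =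
    (- K * u x * th o0 i x - q x * w i x) * (a == o0)%:R + (- K * u x * th o1 i x + p x * w i x) * (a == o1)%:R.
  rewrite -(dual a o0 Ax) -(dual a o1 Ax) !mulr_sumr -big_split; apply: eq_bigr => j _ /=.
  by rewrite dd; ring.
have dp : pderiv i p x = - K * u x * th o0 i x - q x * w i x.
  by have := con o0; rewrite con' /= !mulr1 !mulr0 !addr0.
have dq : pderiv i q x = - K * u x * th o1 i x + p x * w i x.
  by have := con o1; rewrite con' /= !mulr1 !mulr0 !add0r.
apply/rowP => b; rewrite [RHS]mxE sum3; move: b; apply: all3; rewrite ![in RHS]mxE /= -/p -/q.
- by rewrite (pderiv_entry i x (f := u)) => [|y]; rewrite ?mxE// du// -/p -/q; ring.
- by rewrite (pderiv_entry i x (f := p)) => [|y]; rewrite ?mxE// dp; ring.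
- by rewrite (pderiv_entry i x (f := q)) => [|y]; rewrite ?mxE// dq; ring.
Qed.

Lemma sphere_state_hessian (s : 'rV[R]_3 -> 'rV[R]_3) : smooth_mx_on N s ->
  (forall i x, N x -> mxpderiv i s x = s x *m sphere_system i x) ->
  [/\ hessian_eq (fun x => s x 0 o0), forall x, N x -> frame_deriv (fun x => s x 0 o0) o2 x = 0 &
   forall x, N x -> sphere_state (fun x => s x 0 o0) x = s x].
Proof.
move=> ss ds.
have d0 i x : N x -> pderiv i (fun x => s x 0 o0) x = s x 0 o1 * th o0 i x + s x 0 o2 * th o1 i x.
  move=> Nx; have /rowP/(_ o0) := ds i x Nx; rewrite mxE => ->.
  by rewrite [LHS]mxE sum3 !mxE /=; ring.
have d1 i x : N x -> pderiv i (fun x => s x 0 o1) x = - K * s x 0 o0 * th o0 i x - s x 0 o2 * w i x.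
  move=> Nx; have /rowP/(_ o1) := ds i x Nx; rewrite mxE => ->.
  by rewrite [LHS]mxE sum3 !mxE /=; ring.
have d2 i x : N x -> pderiv i (fun x => s x 0 o2) x = - K * s x 0 o0 * th o1 i x + s x 0 o1 * w i x.
  move=> Nx; have /rowP/(_ o2) := ds i x Nx; rewrite mxE => ->.
  by rewrite [LHS]mxE sum3 !mxE /=; ring.
have fd a x : N x -> frame_deriv (fun x => s x 0 o0) a x = s x 0 o1 * (a == o0)%:R + s x 0 o2 * (a == o1)%:R.
  move=> Nx; rewrite -(dual a o0 (NA Nx)) -(dual a o1 (NA Nx)) !mulr_sumr -big_split; apply: eq_bigr => j _ /=.
  by rewrite d0//; ring.
split.
- move=> i j x Nx; have Ax := NA Nx.
  have sN a k : smooth_on N (th a k) by exact: smooth_on_sub NA (sth a k).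
  rewrite (pderiv_eq oN i (d0 j) Nx).
  rewrite (pderivD i (smooth_onM oN (ss 0 o1) (sN o0 j)) (smooth_onM oN (ss 0 o2) (sN o1 j)) Nx).
  rewrite (pderivM i (ss 0 o1) (sN o0 j) Nx) (pderivM i (ss 0 o2) (sN o1 j) Nx) dth0// dth1// d1// d2//.
  under [in RHS]eq_bigr do rewrite d0// mulrDr.
  rewrite big_split/=.
  have -> : \sum_l Gm l i j x * (s x 0 o1 * th o0 l x) = s x 0 o1 * \sum_l Gm l i j x * th o0 l x.
    by rewrite mulr_sumr; apply: eq_bigr => l _; ring.
  have -> : \sum_l Gm l i j x * (s x 0 o2 * th o1 l x) = s x 0 o2 * \sum_l Gm l i j x * th o1 l x.
    by rewrite mulr_sumr; apply: eq_bigr => l _; ring.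
  ring.
- by move=> x Nx; rewrite fd//= !mulr0 addr0.
- move=> x Nx; apply/rowP; apply: all3; rewrite mxE//= fd//= ?mulr1 ?mulr0 ?addr0 ?add0r//.
Qed.
End ParallelFrame.

(** * Local solutions independently of frames and charts *)

Definition grad (R : realType) n (u : 'rV[R]_n -> R) x : 'cV[R]_n := \col_j pderiv j u x.
Definition lower (R : realType) n (g : 'rV[R]_n -> 'M[R]_n) (e : 'rV[R]_n -> 'rV[R]_n) x : 'cV[R]_n :=
  g x *m (e x)^T.
(** For a unit field e this is the metric restricted to the plane orthogonal to e, extended by zero
    on e. *)
Definition hmet (R : realType) n (g : 'rV[R]_n -> 'M[R]_n) (e : 'rV[R]_n -> 'rV[R]_n) x : 'M[R]_n :=
  g x - lower g e x *m (lower g e x)^T.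

(* t is a coordinate of the line factor, u a linear coordinate of the sphere  *)
(* factor: dt is dual to e, and u satisfies the Obata equation along e^perp.  *)
Definition local_sol (R : realType) n (A : set 'rV[R]_n) (g : 'rV[R]_n -> 'M[R]_n)
    (e : 'rV[R]_n -> 'rV[R]_n) (K : R) (t u : 'rV[R]_n -> R) : Prop :=
  [/\ smooth_on A t, smooth_on A u, forall x, A x -> grad t x = lower g e x,
      forall x, A x -> e x *m grad u x = 0 &
      forall i x, A x -> mxpderiv i (grad u) x =
        christoffel_mx g i x *m grad u x - (K * u x) *: col i (hmet g e x)].

Lemma local_sol_sub (R : realType) n (A B : set 'rV[R]_n) g e (K : R) t u :
  A `<=` B -> local_sol B g e K t u -> local_sol A g e K t u.
Proof.
move=> AB [h1 h2 h3 h4 h5]; split.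
- exact: smooth_on_sub AB h1.
- exact: smooth_on_sub AB h2.
- by move=> x /AB; exact: h3.
- by move=> x /AB; exact: h4.
- by move=> i x /AB; exact: h5.
Qed.

Lemma smooth_on_local (R : realType) n (A : set 'rV[R]_n) f :
  (forall x, A x -> exists2 B, smooth_on B f & B x) -> smooth_on A f.
Proof. by move=> H s x Ax; have [B sf Bx] := H x Ax; exact: sf. Qed.

Lemma local_sol_local (R : realType) n (A : set 'rV[R]_n) g e (K : R) t u :
  (forall x, A x -> exists2 B, local_sol B g e K t u & B x) -> local_sol A g e K t u.
Proof.
move=> H; split.
- by apply: smooth_on_local => x /H[B [h _ _ _ _] Bx]; exists B.
- by apply: smooth_on_local => x /H[B [_ h _ _ _] Bx]; exists B.
- by move=> x /H[B [_ _ h _ _] Bx]; exact: h.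
- by move=> x /H[B [_ _ _ h _] Bx]; exact: h.
- by move=> i x /H[B [_ _ _ _ h] Bx]; exact: h.
Qed.

Section PullBack.
Variables (R : realType) (n : nat) (A B : set 'rV[R]_n) (phi : 'rV[R]_n -> 'rV[R]_n).
Variables (g h : 'rV[R]_n -> 'M[R]_n) (e f : 'rV[R]_n -> 'rV[R]_n) (K : R).
Hypotheses (mA : metric_on A g) (mB : metric_on B h).
Hypotheses (AB : forall x, A x -> B (phi x)) (sphi : smooth_mx_on A phi).
Hypothesis gE : forall x, A x -> g x = jac phi x *m h (phi x) *m (jac phi x)^T.
Hypothesis eE : forall x, A x -> f (phi x) = e x *m jac phi x.

Let oA : open A. Proof. by case: mA. Qed.
Let oB : open B. Proof. by case: mB. Qed.

Lemma grad_comp u x : smooth_on B u -> A x -> grad (fun y => u (phi y)) x = jac phi x *m grad u (phi x).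
Proof.
move=> su Ax; apply/colP => i; rewrite [LHS]mxE [RHS]mxE (pderiv_comp i oA oB AB sphi su Ax).
by apply: eq_bigr => p _; rewrite [grad _ _ _ _]mxE.
Qed.

Lemma lower_comp x : A x -> lower g e x = jac phi x *m lower h f (phi x).
Proof. by move=> Ax; rewrite /lower gE// eE// trmx_mul !mulmxA. Qed.

Lemma hmet_comp x : A x -> hmet g e x = jac phi x *m hmet h f (phi x) *m (jac phi x)^T.
Proof.
move=> Ax; rewrite /hmet lower_comp// {1}gE// trmx_mul mulmxBr mulmxBl.
by rewrite !mulmxA.
Qed.

Lemma smooth_grad (C : set 'rV[R]_n) u : smooth_on C u -> smooth_mx_on C (grad u).
Proof.
move=> su i z; rewrite (_ : (fun x => _) = pderiv i u); first exact: smooth_on_pderiv.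
by apply/funext => x; rewrite mxE.
Qed.

(** The second derivatives of the chart change that appear in the Hessian are exactly the
    inhomogeneous part of [christoffel_change]. *)
Lemma local_sol_comp t u : local_sol B h f K t u ->
  local_sol A g e K (fun x => t (phi x)) (fun x => u (phi x)).
Proof.
case=> st su gt eu hu; split.
- exact: (smooth_on_comp oA oB AB (sphi 0) st).
- exact: (smooth_on_comp oA oB AB (sphi 0) su).
- by move=> x Ax; rewrite grad_comp// gt ?lower_comp//; exact: AB.
- by move=> x Ax; rewrite grad_comp// mulmxA -eE// eu//; exact: AB.
move=> i x Ax; have Bx := AB Ax.
have sG := smooth_grad su; have sJ := smooth_jac oA sphi.
have sGp : smooth_mx_on A (fun y => grad u (phi y)) := smooth_mx_comp oA oB AB sphi sG.
have [_ sg symg posg] := mA; have [_ sh symh posh] := mB.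
rewrite (mxpderiv_eq oA i (fun y Ay => grad_comp su Ay) Ax) (mxpderivM oA i sJ sGp Ax).
rewrite (christoffel_change oA oB AB sphi sh symg symh posg posh gE i Ax).
rewrite (mxpderiv_comp i oA oB AB sphi sG Ax) grad_comp//.
have -> : \sum_k jac phi x i k *: mxpderiv k (grad u) (phi x) =
    pulled_christoffel phi h i x *m grad u (phi x) - (K * u (phi x)) *: (hmet h f (phi x) *m (row i (jac phi x))^T).
  rewrite /pulled_christoffel mulmx_suml.
  under eq_bigr do rewrite hu// scalerBr scalemxAl.
  rewrite sumrB; congr (_ - _).
  under eq_bigr do rewrite scalerA mulrC -scalerA.
  rewrite -scaler_sumr; congr (_ *: _).
  apply/colP => l; rewrite [RHS]mxE summxE; apply: eq_bigr => j _.
  by rewrite !mxE mulrC.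
rewrite mulmxBr mulmxBl -!mulmxA -scalemxAr.
have -> : col i (hmet g e x) = jac phi x *m (hmet h f (phi x) *m (row i (jac phi x))^T).
  by rewrite hmet_comp// colE -!mulmxA; congr (_ *m (_ *m _)); rewrite rowE trmx_mul trmx_delta.
by rewrite addrA subrK.
Qed.
End PullBack.

(** * Local solutions as solutions of the flat systems *)

Section FrameForm.
Variables (R : realType) (B : set 'rV[R]_3) (g E : 'rV[R]_3 -> 'M[R]_3) (k : 'rV[R]_3 -> 'rV[R]_3) (K : R).
Hypotheses (aE : adapted_frame B g E k K) (K0 : K != 0).
Local Notation e := (unit_field g k).
Hypothesis par : forall x, B x -> covd g e x = 0.

Let mB : metric_on B g. Proof. by case: aE. Qed.
Let oB : open B. Proof. by case: mB. Qed.
Let sE : smooth_mx_on B E. Proof. by case: aE. Qed.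
Let oE x : B x -> E x *m g x *m (E x)^T = 1%:M. Proof. by case: aE => _ _ [h _ _ _]; exact: h. Qed.
Let nl x j l m : B x -> \sum_i E x o2 i * riemann g i j l m x = 0.
Proof. by case: aE => _ _ [_ h _ _]; exact: h. Qed.
Let sc x : B x -> scalar_curvature g x = 2 * K. Proof. by case: aE => _ _ [_ _ h _]; exact: h. Qed.
Let r2 x : B x -> row o2 (E x) = e x. Proof. by case: aE => _ _ [_ _ _ h]; exact: h. Qed.

(** Parallelism of e kills the connection forms linking e2 to the plane, leaving only [cn o1 o0]. *)
Lemma cn2_0 i x : B x -> cn g E o2 o0 i x = 0 /\ cn g E o2 o1 i x = 0.
Proof.
move=> Bx.
have Z l : cn g E o2 o0 i x * fr E o0 l x + cn g E o2 o1 i x * fr E o1 l x = 0.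
  by rewrite -(covd_frame mB sE oE r2 i l Bx) par// mxE.
have C a : cn g E o2 o0 i x * (o0 == a)%:R + cn g E o2 o1 i x * (o1 == a)%:R = 0.
  rewrite -(fr_dual oE o0 a Bx) -(fr_dual oE o1 a Bx) !mulr_sumr -big_split/=.
  by apply: big1 => l _; rewrite !mulrA -mulrDl Z mul0r.
by split; [have := C o0|have := C o1]; rewrite /= !mulr0 mulr1 ?addr0 ?add0r.
Qed.

Let cnn a i x : B x -> cn g E a a i x = 0.
Proof. by move=> Bx; have := cnN mB sE oE a a i Bx; lra. Qed.

Lemma frame_d0 i j x : B x -> pderiv i (cf g E o0 j) x =
  \sum_l christoffel g l i j x * cf g E o0 l x - cf g E o1 j x * cn g E o1 o0 i x.
Proof.
move=> Bx; rewrite (cf_partial mB sE oE o0 i j Bx) [X in _ - X]sum3 (cnn o0)//.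
by have [-> _] := cn2_0 i Bx; ring.
Qed.

Lemma frame_d1 i j x : B x -> pderiv i (cf g E o1 j) x =
  \sum_l christoffel g l i j x * cf g E o1 l x + cf g E o0 j x * cn g E o1 o0 i x.
Proof.
move=> Bx; rewrite (cf_partial mB sE oE o1 i j Bx) [X in _ - X]sum3 (cnn o1)// (cnN mB sE oE o0 o1)//.
by have [_ ->] := cn2_0 i Bx; ring.
Qed.

Lemma frame_d2 i j x : B x -> pderiv i (cf g E o2 j) x = \sum_l christoffel g l i j x * cf g E o2 l x.
Proof.
move=> Bx; rewrite (cf_partial mB sE oE o2 i j Bx) [X in _ - X]sum3 (cnn o2)// (cnN mB sE oE o0 o2)// (cnN mB sE oE o1 o2)//.
by have [-> ->] := cn2_0 i Bx; ring.
Qed.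

Lemma frame_dw i j x : B x -> ext (cn g E o1 o0) i j x = K * wedge (cf g E o0) (cf g E o1) i j x.
Proof.
move=> Bx; apply: etrans (dcn10 mB sE oE nl sc i j Bx) _.
have := (cn2_0 i Bx).1; have := (cn2_0 j Bx).1; rewrite {1}/wedge.
move: (cn g E o2 o0 j x) (cn g E o2 o0 i x) (cn g E o2 o1 j x) (cn g E o2 o1 i x) => a b c d -> ->.
by move: (K * _) => w; ring.
Qed.

Let GC l i j x : B x -> christoffel g l i j x = christoffel g l j i x.
Proof. by case: mB => o _ sy _; exact: christoffel_sym. Qed.

Lemma metric_cf i j x : B x -> g x i j = \sum_a cf g E a i x * cf g E a j x.
Proof.
move=> Bx; have CE : coframe g E x *m (E x *m g x) = g x by rewrite mulmxA (coframe_frame oE Bx) mul1mx.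
have Eg : E x *m g x = (coframe g E x)^T.
  by rewrite /coframe trmx_mul trmxK; case: mB => _ _ -> .
by rewrite -{1}CE Eg mxE; apply: eq_bigr => a _; rewrite [_^T _ _]mxE.
Qed.

Lemma lower_cf i x : B x -> lower g e x i 0 = cf g E o2 i x.
Proof. by move=> Bx; rewrite /lower -r2// /cf /coframe !mxE; apply: eq_bigr => j _; rewrite !mxE. Qed.

Lemma hmet_cf i j x : B x -> hmet g e x i j = cf g E o0 i x * cf g E o0 j x + cf g E o1 i x * cf g E o1 j x.
Proof.
move=> Bx; rewrite mxsubE metric_cf// sum3 [X in _ - X]mxE big_ord1 [_^T _ _]mxE !lower_cf//.
by ring.
Qed.

Variable N : set 'rV[R]_3.
Hypotheses (oN : open N) (NB : N `<=` B).

Local Notation fderiv := (frame_deriv (fr E)).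
Local Notation ssys := (sphere_system K (cf g E) (cn g E o1 o0)).
Local Notation lsys := (line_system (cf g E)).
Local Notation sstate := (sphere_state (fr E)).

(** The constant second entry makes the inhomogeneous equation dt = theta2 linear. *)
Definition line_state (t : 'rV[R]_3 -> R) x : 'rV[R]_2 := \row_b (if val b == 0%N then t x else 1).

Lemma pderiv_frame u i x : B x -> pderiv i u x = \sum_a fderiv u a x * cf g E a i x.
Proof.
move=> Bx; rewrite /frame_deriv; under eq_bigr do rewrite mulr_suml.
rewrite exchange_big/= -[LHS](sum_delta i (fun j => pderiv j u x)); apply: eq_bigr => j _.
by rewrite -(fr_codual oE i j Bx) mulr_suml; apply: eq_bigr => a _; ring.
Qed.

Lemma local_sol_states t u : local_sol N g e K t u ->
  [/\ smooth_mx_on N (sstate u), (forall i x, N x -> mxpderiv i (sstate u) x = sstate u x *m ssys i x),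
      smooth_mx_on N (line_state t) & (forall i x, N x -> mxpderiv i (line_state t) x = line_state t x *m lsys i x)].
Proof.
case=> st su gt eu hu.
have u2 x : N x -> fderiv u o2 x = 0.
  move=> Nx; have /matrixP/(_ 0 0) := eu x Nx; rewrite [RHS]mxE => <-; rewrite mxE.
  by apply: eq_bigr => i _; rewrite -(r2 (NB Nx)) !mxE.
split.
- exact: (smooth_sphere_state (smooth_fr sE) oN NB su).
- apply: (sphere_state_deriv (smooth_cf mB sE) (smooth_fr sE) (fr_dual oE) frame_d0 frame_d1 oN NB su).
    move=> i j x Nx; have /colP/(_ j) := hu i x Nx.
    rewrite mxE (_ : (fun y => _) = pderiv j u); last by apply/funext => y; rewrite mxE.
    move=> ->; rewrite mxsubE [X in X - _]mxE [X in _ - X]mxE [X in _ - _ * X]mxE (hmet_cf _ _ (NB Nx)).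
    congr (_ - _ * _); last by ring.
    by apply: eq_bigr => l _; rewrite [grad _ _ _ _]mxE [christoffel_mx _ _ _ _ _]mxE.
  by move=> i x Nx; rewrite (pderiv_frame u i (NB Nx)) sum3 u2// mul0r addr0.
- move=> z b; rewrite (_ : (fun x => _) = if val b == 0%N then t else fun=> 1).
    by case: ifP => _; [exact: st|exact: smooth_on_cst].
  by apply/funext => x; rewrite mxE; case: ifP.
- move=> i x Nx; apply/rowP => b; rewrite mxE (_ : (fun y => _) = if val b == 0%N then t else fun=> 1); last first.
    by apply/funext => y; rewrite mxE; case: ifP.
  rewrite [RHS]mxE !big_ord_recl big_ord0 !mxE /=.
  have /colP/(_ i) := gt x Nx; rewrite mxE (lower_cf _ (NB Nx)) => ti.
  by case: (val b) => [|?] /=; rewrite ?ti ?pderiv_cst; ring.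
Qed.

Lemma states_local_sol (s : 'rV[R]_3 -> 'rV[R]_3) (l : 'rV[R]_3 -> 'rV[R]_2) :
  smooth_mx_on N s -> (forall i x, N x -> mxpderiv i s x = s x *m ssys i x) ->
  smooth_mx_on N l -> (forall i x, N x -> mxpderiv i l x = l x *m lsys i x) ->
  (forall x, N x -> l x 0 1 = 1) ->
  local_sol N g e K (fun x => l x 0 0) (fun x => s x 0 o0) /\
  (forall x, N x -> sstate (fun x => s x 0 o0) x = s x).
Proof.
move=> ss ds sl dl l1.
have [hs f2 st] := sphere_state_hessian (smooth_cf mB sE) (fr_dual oE) frame_d0 frame_d1 oN NB ss ds.
split; last exact: st.
split; [exact: sl|exact: ss| | |].
- move=> x Nx; apply/colP => i; rewrite mxE (lower_cf _ (NB Nx)).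
  have /rowP/(_ 0) := dl i x Nx; rewrite mxE => ->.
  rewrite mxE !big_ord_recl big_ord0 !mxE /= mulr0 add0r addr0.
  by rewrite (_ : lift ord0 ord0 = 1) ?l1 ?mul1r//; exact: val_inj.
- move=> x Nx; apply/matrixP => a b; rewrite [RHS]mxE !ord1 -(f2 x Nx) mxE.
  by apply: eq_bigr => i _; rewrite -(r2 (NB Nx)) !mxE.
- move=> i x Nx; apply/colP => j; rewrite mxE (_ : (fun y => _) = pderiv j (fun x => s x 0 o0)); last first.
    by apply/funext => y; rewrite mxE.
  rewrite (hs i j x Nx) mxsubE [X in _ = X - _]mxE [X in _ = _ - X]mxE [X in _ = _ - _ * X]mxE (hmet_cf _ _ (NB Nx)).
  congr (_ - _ * _); last by ring.
  by apply: eq_bigr => m _; rewrite [grad _ _ _ _]mxE [christoffel_mx _ _ _ _ _]mxE.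
Qed.
End FrameForm.

Lemma const_on_nball (R : realType) n (x0 : 'rV[R]_n) (r : R) (f : 'rV[R]_n -> R) :
  0 < r -> smooth_on (nball x0 r) f -> (forall i x, nball x0 r x -> pderiv i f x = 0) ->
  forall x, nball x0 r x -> f x = f x0.
Proof.
move=> r0 sf df x xr.
have ray (s : R) : `|s| <= `|1 : R| -> nball x0 r (x0 + s *: (x - x0)).
  rewrite normr1 /nball/= addrAC subrr add0r normrZ => s1.
  by apply: le_lt_trans xr; rewrite ler_piMl.
have D (s : R) : `|s| <= `|1 : R| -> is_derive (x0 + s *: (x - x0)) (x - x0) f 0.
  move=> s1; apply: is_derive_cast (is_derive_dirderiv (@nball_open R n x0 r) sf (x - x0) (ray s s1)) _.
  by apply: big1 => i _; rewrite df ?mulr0//; exact: ray.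
have := @MVT_line R _ f x0 (x - x0) 1 0 0; rewrite mulr0 subr0 mul0r scale1r.
have -> : x0 + (x - x0) = x by rewrite addrC subrK.
move=> M; apply/eqP; rewrite -subr_eq0 -normr_le0; apply: M => s s1.
  by have [] := D s s1.
by have [_ ->] := D s s1; rewrite subr0 normr0.
Qed.

Lemma const_mx_on_nball (R : realType) n p q (x0 : 'rV[R]_n) (r : R) (F : 'rV[R]_n -> 'M[R]_(p, q)) :
  0 < r -> smooth_mx_on (nball x0 r) F -> (forall i x, nball x0 r x -> mxpderiv i F x = 0) ->
  forall x, nball x0 r x -> F x = F x0.
Proof.
move=> r0 sF dF x xr; apply/matrixP => a b.
apply: (@const_on_nball R n x0 r (fun x => F x a b) r0 (sF a b) _ x xr) => i y yr.
by rewrite -mxpderivE dF// mxE.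
Qed.

Lemma flat_quotient_const (R : realType) n m (A : 'I_n -> 'rV[R]_n -> 'M[R]_m)
    (V : set 'rV[R]_n) (U : 'rV[R]_n -> 'M[R]_m) (u : 'rV[R]_n -> 'rV[R]_m) q (d : R) :
  0 < d -> open V -> nball q d `<=` V -> smooth_mx_on V U -> (forall x, V x -> U x \in unitmx) ->
  (forall i x, V x -> mxpderiv i U x = U x *m A i x) ->
  smooth_mx_on (nball q d) u -> (forall i x, nball q d x -> mxpderiv i u x = u x *m A i x) ->
  forall x, nball q d x -> u x = u q *m invmx (U q) *m U x.
Proof.
move=> d0 oV NV sU uU dU su du x xd.
have oN := @nball_open R n q d.
have sQ : smooth_mx_on (nball q d) (fun y => u y *m invmx (U y)).
  exact: (smooth_mxM oN su (smooth_mx_sub NV (smooth_invmx oV uU sU))).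
have dQ i y : nball q d y -> mxpderiv i (fun y => u y *m invmx (U y)) y = 0.
  by move=> yd; exact: (flat_quotient_derivative i oV oN NV sU uU dU su du yd).
by rewrite -(const_mx_on_nball d0 sQ dQ xd) mulmxKV// uU//; exact: NV.
Qed.

Lemma flat_left_mul (R : realType) n m (A : 'I_n -> 'rV[R]_n -> 'M[R]_m)
    (V : set 'rV[R]_n) (U : 'rV[R]_n -> 'M[R]_m) (c : 'rV[R]_m) :
  open V -> smooth_mx_on V U -> (forall i x, V x -> mxpderiv i U x = U x *m A i x) ->
  smooth_mx_on V (fun x => c *m U x) /\
  forall i x, V x -> mxpderiv i (fun x => c *m U x) x = c *m U x *m A i x.
Proof.
move=> oV sU dU; have sc : smooth_mx_on V (fun _ => c) by move=> a b; exact: smooth_on_cst.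
split; first exact: (smooth_mxM oV sc sU).
by move=> i x Vx; rewrite (mxpderivM oV i sc sU Vx) mxpderiv_cst mul0mx add0r dU// mulmxA.
Qed.

Section ChartExtension.
Variables (R : realType) (A : set 'rV[R]_3) (g : 'rV[R]_3 -> 'M[R]_3) (k : 'rV[R]_3 -> 'rV[R]_3) (K : R).
Hypotheses (ng : null_geometry A g k K) (K0 : K != 0).
Local Notation e := (unit_field g k).
Hypothesis par : forall x, A x -> covd g e x = 0.

(** On a small ball every germ of a solution extends, uniquely, and arbitrary initial data
    compatible with e(u) = 0 are realized: all three follow by writing states as constant rows times
    fundamental matrices. *)
Theorem chart_extension x0 : A x0 -> exists2 r : R, 0 < r & [/\ nball x0 r `<=` A,
  forall B q t u, open B -> B q -> nball x0 r q -> local_sol B g e K t u ->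
    exists t' u', local_sol (nball x0 r) g e K t' u' /\
      exists2 d : R, 0 < d & forall y, nball q d y -> t' y = t y /\ u' y = u y,
  forall q (d : R) t u t' u', local_sol (nball x0 r) g e K t u -> local_sol (nball x0 r) g e K t' u' ->
    nball x0 r q -> 0 < d -> (forall y, nball q d y -> t y = t' y /\ u y = u' y) ->
    forall y, nball x0 r y -> t y = t' y /\ u y = u' y &
  forall t0 u0 (eta : 'cV[R]_3), e x0 *m eta = 0 -> exists t u,
    [/\ local_sol (nball x0 r) g e K t u, t x0 = t0, u x0 = u0 & grad u x0 = eta]].
Proof.
move=> Ax0; have [B [E [oB Bx BA aE]]] := adapted_frame_exists ng Ax0.
have parB x : B x -> covd g e x = 0 by move=> /BA; exact: par.
have [mB sE [oE nl sc r2]] := aE.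
have [_ _ symB _] := mB.
pose ss := sphere_system K (cf g E) (cn g E o1 o0); pose ls := line_system (cf g E).
have sss i : smooth_mx_on B (ss i) := smooth_sphere_system K oB (smooth_cf mB sE) (smooth_cn mB sE o1 o0) i.
have sls i : smooth_mx_on B (ls i) := smooth_line_system oB (smooth_cf mB sE) i.
have GC l i j x (bx : B x) := christoffel_sym oB symB l i j bx.
have fss := sphere_system_flat oB (smooth_cf mB sE) (smooth_cn mB sE o1 o0)
  (frame_d0 aE parB) (frame_d1 aE parB) GC (frame_dw aE parB).
have fls := line_system_flat (frame_d2 aE parB) GC.
have [V1 [oV1 V1x V1B] [U1 [sU1 uU1 dU1]]] := flat_fundamental oB sss fss Bx.
have [V2 [oV2 V2x V2B] [U2 [sU2 uU2 dU2]]] := flat_fundamental oB sls fls Bx.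
have [r1 r10 H1] := open_nball oV1 V1x; have [r2' r20 H2] := open_nball oV2 V2x.
pose r := Num.min r1 r2'; have r0 : 0 < r by rewrite lt_min r10.
have rV1 : nball x0 r `<=` V1 by apply: subset_trans H1; apply: nball_le; rewrite ge_min lexx.
have rV2 : nball x0 r `<=` V2 by apply: subset_trans H2; apply: nball_le; rewrite ge_min lexx orbT.
have rB : nball x0 r `<=` B := subset_trans rV1 V1B.
have oN := @nball_open R 3 x0 r.
have l01 (y : 'rV[R]_3) t : line_state t y 0 1 = 1 by rewrite mxE.
have l00 (y : 'rV[R]_3) t : line_state t y 0 0 = t y by rewrite mxE.
have s00 (y : 'rV[R]_3) u : sphere_state (fr E) u y 0 o0 = u y by rewrite mxE.
have quot q (d : R) t u : 0 < d -> nball q d `<=` nball x0 r -> local_sol (nball q d) g e K t u ->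
   forall y, nball q d y ->
   sphere_state (fr E) u y = sphere_state (fr E) u q *m invmx (U1 q) *m U1 y /\
   line_state t y = line_state t q *m invmx (U2 q) *m U2 y.
  move=> d0 qN so y yd.
  have qB : nball q d `<=` B := subset_trans qN rB.
  have [a1 a2 a3 a4] := local_sol_states aE parB (@nball_open R 3 q d) qB so.
  split.
  - exact: (flat_quotient_const d0 oV1 (subset_trans qN rV1) sU1 uU1 dU1 a1 a2).
  - exact: (flat_quotient_const d0 oV2 (subset_trans qN rV2) sU2 uU2 dU2 a3 a4).
have build (c1 : 'rV[R]_3) (c2 : 'rV[R]_2) q : nball x0 r q -> (c2 *m U2 q) 0 1 = 1 ->
    local_sol (nball x0 r) g e K (fun x => (c2 *m U2 x) 0 0) (fun x => (c1 *m U1 x) 0 o0) /\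
    forall x, nball x0 r x -> sphere_state (fr E) (fun x => (c1 *m U1 x) 0 o0) x = c1 *m U1 x.
  move=> xq c21.
  have [b1 b2] := flat_left_mul c1 oV1 sU1 dU1; have [b3 b4] := flat_left_mul c2 oV2 sU2 dU2.
  apply: (states_local_sol aE parB oN rB (smooth_mx_sub rV1 b1) (fun i x h => b2 i x (rV1 x h))
    (l := fun x => c2 *m U2 x) (smooth_mx_sub rV2 b3) (fun i x h => b4 i x (rV2 x h))).
  (* The second column of the line system is zero, so the entry required to be 1 is constant. *)
  have z i x : nball x0 r x -> pderiv i (fun x => (c2 *m U2 x) 0 1) x = 0.
    move=> xr; rewrite -mxpderivE (b4 i x (rV2 x xr)) mxE !big_ord_recl big_ord0 [ls _ _ _ _]mxE [ls _ _ _ _]mxE /=.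
    by rewrite !mulr0 !addr0.
  have s2 : smooth_on (nball x0 r) (fun x => (c2 *m U2 x) 0 1) by exact: smooth_on_sub rV2 (b3 0 1).
  by move=> x xr; rewrite (const_on_nball r0 s2 z xr) -(const_on_nball r0 s2 z xq).
have kU1 q (v : 'rV[R]_3) : nball x0 r q -> v *m invmx (U1 q) *m U1 q = v.
  by move=> /rV1 h; rewrite mulmxKV// uU1.
have kU2 q (v : 'rV[R]_2) : nball x0 r q -> v *m invmx (U2 q) *m U2 q = v.
  by move=> /rV2 h; rewrite mulmxKV// uU2.
exists r => //; split.
- exact: subset_trans rB BA.
- move=> C q t u oC Cq xq so.
  have [d1 d10 D1] := open_nball oC Cq; have [d2 d20 D2] := open_nball oN xq.
  pose d := Num.min d1 d2; have d0 : 0 < d by rewrite lt_min d10.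
  have dC : nball q d `<=` C by apply: subset_trans D1; apply: nball_le; rewrite ge_min lexx.
  have dN : nball q d `<=` nball x0 r by apply: subset_trans D2; apply: nball_le; rewrite ge_min lexx orbT.
  have Q := quot q d t u d0 dN (local_sol_sub dC so).
  pose c1 := sphere_state (fr E) u q *m invmx (U1 q); pose c2 := line_state t q *m invmx (U2 q).
  have [so' _] := build c1 c2 q xq (etrans (congr1 (fun v : 'rV[R]_2 => v 0 1) (kU2 q _ xq)) (l01 q t)).
  exists (fun x => (c2 *m U2 x) 0 0), (fun x => (c1 *m U1 x) 0 o0); split=> //.
  by exists d => // y yd; have [e1 e2] := Q y yd; rewrite /c1 /c2 -e1 -e2 l00 s00.
- move=> q d t u t' u' so so' xq d0 agree y yr.
  have Q := quot x0 r t u r0 (@subset_refl _ _) so; have Q' := quot x0 r t' u' r0 (@subset_refl _ _) so'.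
  have oq := @nball_open R 3 q d; have qq := nball_center q d0.
  (* Agreement of u and u' near q gives agreement of their derivatives, hence of the whole state at
     q. *)
  have sq : sphere_state (fr E) u q = sphere_state (fr E) u' q.
    have fe a : frame_deriv (fr E) u a q = frame_deriv (fr E) u' a q.
      by apply: eq_bigr => i _; rewrite (pderiv_eq oq i (fun z zd => (agree z zd).2) qq).
    by apply/rowP => b; rewrite !mxE !fe (agree q qq).2.
  have lq : line_state t q = line_state t' q by apply/rowP => b; rewrite !mxE (agree q qq).1.
  have [q1 q2] := Q q xq; have [q1' q2'] := Q' q xq.
  have [y1 y2] := Q y yr; have [y1' y2'] := Q' y yr.
  have can m (U : 'rV[R]_3 -> 'M[R]_m) (v w : 'rV[R]_m) : U q \in unitmx -> v *m U q = w *m U q -> v = w.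
    by move=> uU h; rewrite -[v](mulmxK uU) h mulmxK.
  have E1 : sphere_state (fr E) u x0 *m invmx (U1 x0) = sphere_state (fr E) u' x0 *m invmx (U1 x0).
    by apply: (can _ U1); [apply: uU1; exact: rV1|rewrite -q1 -q1'].
  have E2 : line_state t x0 *m invmx (U2 x0) = line_state t' x0 *m invmx (U2 x0).
    by apply: (can _ U2); [apply: uU2; exact: rV2|rewrite -q2 -q2'].
  by rewrite -(l00 y t) -(l00 y t') -(s00 y u) -(s00 y u') y2 y2' y1 y1' E1 E2.
- move=> t0 u0 eta e_eta; have xx := nball_center x0 r0.
  pose s0 : 'rV[R]_3 := \row_b (match val b with 0%N => u0 | 1%N => \sum_i fr E o0 i x0 * eta i 0 | _ => \sum_i fr E o1 i x0 * eta i 0 end).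
  pose l0 : 'rV[R]_2 := \row_b (if val b == 0%N then t0 else 1).
  have [|so st] := build (s0 *m invmx (U1 x0)) (l0 *m invmx (U2 x0)) x0 xx; first by rewrite kU2// mxE.
  exists (fun x => (l0 *m invmx (U2 x0) *m U2 x) 0 0), (fun x => (s0 *m invmx (U1 x0) *m U1 x) 0 o0).
  split=> //; [by rewrite kU2// mxE|by rewrite kU1// mxE|].
  have := st x0 xx; rewrite kU1//; move: so; set u := (fun x => (s0 *m invmx (U1 x0) *m U1 x) 0 o0).
  move=> [_ _ _ eu _] S0; have bx := rB _ xx.
  have F a : frame_deriv (fr E) u a x0 = \sum_i fr E a i x0 * eta i 0.
    move: a; apply: all3.
    - by have /rowP/(_ o1) := S0; rewrite !mxE.
    - by have /rowP/(_ o2) := S0; rewrite !mxE.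
    - have /matrixP/(_ 0 0) := eu x0 xx; rewrite -r2// mxE [RHS]mxE => h1.
      have /matrixP/(_ 0 0) := e_eta; rewrite -r2// mxE [RHS]mxE => h2.
      transitivity (0 : R); [rewrite -[RHS]h1 /frame_deriv|rewrite -[LHS]h2];
        by apply: eq_bigr => i _; rewrite !mxE.
  apply/colP => i; rewrite mxE (pderiv_frame aE u i bx).
  under eq_bigr do rewrite F mulr_suml.
  rewrite exchange_big/= -[RHS](sum_delta i (fun j => eta j 0)); apply: eq_bigr => j _.
  by rewrite -(fr_codual oE i j bx) mulr_suml; apply: eq_bigr => a _; ring.
Qed.
End ChartExtension.

Lemma rV_continuous (R : realType) (T : topologicalType) n (f : T -> 'rV[R]_n) x :
  (forall l, {for x, continuous (fun y => f y 0 l)}) -> {for x, continuous f}.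
Proof.
move=> H; apply/cvgrPdist_le => e e0.
have N : \forall y \near x, forall l, `|f x 0 l - f y 0 l| <= e.
  by apply: filter_forall => l; move: (H l) => /cvgrPdist_le/(_ _ e0).
apply: filterS N => y Hy; apply: le_rVnorm; first exact: ltW.
by move=> l; rewrite mxsubE.
Qed.

Lemma local_sol_eq (R : realType) n (A : set 'rV[R]_n) g e (K : R) t u t' u' : open A ->
  (forall x, A x -> t x = t' x /\ u x = u' x) -> local_sol A g e K t u -> local_sol A g e K t' u'.
Proof.
move=> oA H [h1 h2 h3 h4 h5].
have tt x : A x -> t x = t' x by move=> /H[].
have uu x : A x -> u x = u' x by move=> /H[].
have gt x : A x -> grad t x = grad t' x.
  by move=> Ax; apply/colP => i; rewrite !mxE (pderiv_eq oA i tt Ax).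
have gu x : A x -> grad u x = grad u' x.
  by move=> Ax; apply/colP => i; rewrite !mxE (pderiv_eq oA i uu Ax).
split.
- exact: smooth_on_eq oA _ _ tt h1.
- exact: smooth_on_eq oA _ _ uu h2.
- by move=> x Ax; rewrite -gt// h3.
- by move=> x Ax; rewrite -gu// h4.
- by move=> i x Ax; rewrite -(mxpderiv_eq oA i gu Ax) h5// gu// uu.
Qed.

(** * Global solutions on a simply connected manifold *)

Section GlobalSolutions.
Variables (R : realType) (M : manifold R 3) (g : tensor2 M) (K : R) (k : vfield M).
Hypotheses (sM : smooth_manifold M) (rg : riemannian_metric g) (sk : smooth_vfield k).
Hypotheses (nk : nowhere_vanishing k) (ck : curvature_null g k).
Hypotheses (scalK : constant_scalar_curvature g (2 * K)) (Kpos : 0 < K).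
Hypothesis cg : complete_metric g.
Implicit Types (a b : idx M) (p q : M) (f F : M -> R * R).

Let K0 : K != 0. Proof. exact: lt0r_neq0. Qed.
Let ng a : null_geometry (cimg (atlas a)) (g a) (k a) K := chart_geometry sM rg sk nk ck scalK a.
Let par a x : cimg (atlas a) x -> covd (g a) (ue g k a) x = 0.
Proof. exact: (ue_parallel sM rg sk nk ck scalK Kpos cg). Qed.

Lemma chart_preimage_open a (V : set 'rV[R]_3) : open V ->
  open [set q | cdom (atlas a) q /\ V (cfun (atlas a) q)].
Proof. by case: sM => _ _ ch _ _; exact: is_chart_preimage_open. Qed.

Definition chart_sol a (B : set 'rV[R]_3) f :=
  local_sol B (g a) (ue g k a) K (fun x => (f (cinv (atlas a) x)).1) (fun x => (f (cinv (atlas a) x)).2).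

(** A local condition at p, for the pair (t, u) packed as one function; some chart suffices because
    of [sol_chart]. *)
Definition sol f p := exists a B, [/\ cdom (atlas a) p, open B, B `<=` cimg (atlas a), B (cfun (atlas a) p) & chart_sol a B f].

Lemma sol_chart f p a : cdom (atlas a) p -> sol f p ->
  exists B, [/\ open B, B `<=` cimg (atlas a), B (cfun (atlas a) p) & chart_sol a B f].
Proof.
move=> ap [b [B [bp oB Bi Bp so]]].
have oO := overlap_open sM a b; have st := smooth_transition sM a b.
exists [set x | overlap a b x /\ B (transition a b x)].
have ct x : overlap a b x -> {for x, continuous (transition a b)}.
  by move=> o; apply: rV_continuous => l; exact: smooth_on_continuous (st 0 l) o.
have oA := preimage_open oO oB ct.
have Ai : [set x | overlap a b x /\ B (transition a b x)] `<=` cimg (atlas a).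
  by move=> x [ov _]; exact: (overlap_cimg sM a b x ov).
split=> //.
  by split; [exact: overlap_cfun|rewrite transition_cfun].
have mA := metric_on_sub oA Ai (chart_metric sM rg a).
have mB := metric_on_sub oB Bi (chart_metric sM rg b).
have sT : smooth_mx_on [set x | overlap a b x /\ B (transition a b x)] (transition a b).
  by apply: smooth_mx_sub st => x [].
have eE x : overlap a b x -> ue g k b (transition a b x) = ue g k a x *m jac (transition a b) x.
  move=> o; exact: (unit_field_change (@metric_change R M g rg a b) (@sk.2 a b) o).
have := local_sol_comp mA mB (fun x h => h.2) sT (fun x h => metric_change rg h.1) (fun x h => eE x h.1) so.
by apply: local_sol_eq => // x [ov _]; rewrite cinv_transition.
Qed.

Lemma germ_chart a x f F : cimg (atlas a) x -> germ f F (cinv (atlas a) x) ->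
  exists2 d : R, 0 < d & nball x d `<=` cimg (atlas a) /\
    forall y, nball x d y -> f (cinv (atlas a) y) = F (cinv (atlas a) y).
Proof.
move=> ax gf; have n1 : nbhs x (fun y => f (cinv (atlas a) y) = F (cinv (atlas a) y)) := cinv_continuous sM ax gf.
have n2 : nbhs x (cimg (atlas a)) by apply: open_nbhs_nbhs; split; [exact: cimg_open|].
have /nbhs_ballP[d /= d0 H] : nbhs x [set y | cimg (atlas a) y /\ f (cinv (atlas a) y) = F (cinv (atlas a) y)].
  by apply: filterS2 n1 n2 => y.
exists d => //; split=> y yd; have [] := H y _ => //; by rewrite -ball_normE /ball_/= distrC.
Qed.

Lemma sol_germ f F p : germ f F p -> sol f p -> sol F p.
Proof.
move=> gf [a [B [ap oB Bi Bp so]]].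
have [|d d0 [_ dE]] := germ_chart (cimg_cfun ap) (f := f) (F := F); first by rewrite cfunK.
exists a, (B `&` nball (cfun (atlas a) p) d); split=> //.
- by apply: openI => //; exact: nball_open.
- by move=> x [/Bi].
- by split=> //; exact: nball_center.
- apply: local_sol_eq (local_sol_sub _ so); first by apply: openI => //; exact: nball_open.
    by move=> x [_ xd]; rewrite dE.
  by move=> x [].
Qed.

(** The good set is a ball in a chart on which [chart_extension] holds; straight segments in
    coordinates connect its points. *)
Lemma good_exists p : exists2 U, good R sol U & U p.
Proof.
have [a ap] := chart_at sM p; have ax := cimg_cfun ap.
have [r r0 [rA ext uni _]] := chart_extension (ng a) (@par a) ax.
set x0 := cfun (atlas a) p in ax r r0 rA ext uni *.
pose U := [set q | cdom (atlas a) q /\ nball x0 r (cfun (atlas a) q)].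
have oN := @nball_open R 3 x0 r.
have oU : open U := chart_preimage_open a oN.
exists U; last by split=> //; exact: nball_center.
have all_sol F : (forall q, U q -> sol F q) -> chart_sol a (nball x0 r) F.
  move=> H; apply: local_sol_local => x xr; have ax' := rA x xr.
  have cx := cinv_cdom sM ax'.
  have [|B [_ _ Bx so]] := sol_chart cx (H (cinv (atlas a) x) _).
    by split=> //; rewrite cinvK.
  by exists B => //; rewrite -(cinvK sM ax').
split=> //.
- move=> f q [aq xq] sf; have [B [oB Bi Bq so]] := sol_chart aq sf.
  have [t [u [so' [d d0 agree]]]] := ext B _ _ _ oB Bq xq so.
  exists (fun s => (t (cfun (atlas a) s), u (cfun (atlas a) s))).
    move=> s [as_ xs]; exists a, (nball x0 r); split=> //.
    by apply: local_sol_eq oN _ so' => x xr /=; rewrite cinvK//; exact: rA.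
  have n1 : nbhs q [set s | cdom (atlas a) s /\ nball (cfun (atlas a) q) d (cfun (atlas a) s)].
    apply: open_nbhs_nbhs; split; first by apply: chart_preimage_open; exact: nball_open.
    by split=> //; exact: nball_center.
  apply: filterS n1 => s [as_ sd] /=; have [-> ->] := agree _ sd.
  by rewrite cfunK// -surjective_pairing.
- move=> F G q s sF sG [aq xq] [as_ xs] FG.
  have [|d d0 [_ dE]] := germ_chart (cimg_cfun aq) (f := F) (F := G); first by rewrite cfunK.
  have eq := uni _ d _ _ _ _ (all_sol F sF) (all_sol G sG) xq d0.
  have n1 : nbhs s U by apply: open_nbhs_nbhs; split.
  apply: filterS n1 => s' [as' xs'].
  have [|e1 e2] := eq _ _ xs'; first by move=> y yd; rewrite dE.
  by rewrite cfunK// in e1 e2; rewrite [F s']surjective_pairing [G s']surjective_pairing e1 e2.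
- move=> q s [aq xq] [as_ xs].
  pose xq_ := cfun (atlas a) q; pose xs_ := cfun (atlas a) s.
  have inN (w : R) : nball x0 r (xq_ + clamp01 w *: (xs_ - xq_)) by apply: nball_segment => //; exact: clamp01_in.
  exists (fun w => cinv (atlas a) (xq_ + clamp01 w *: (xs_ - xq_))); split.
  + move=> w; have c1 : {for w, continuous (fun w : R => xq_ + clamp01 w *: (xs_ - xq_))}.
      apply: rV_continuous => l.
      rewrite (_ : (fun y => _) = fun y => xq_ 0 l + clamp01 y * (xs_ - xq_) 0 l); last by apply/funext => y; rewrite !mxE.
      apply: continuousD; first exact: cst_continuous.
      by apply: continuousM; [exact: clamp01_continuous|exact: cst_continuous].
    exact: (@continuous_comp R 'rV[R]_3 M (fun w : R => xq_ + clamp01 w *: (xs_ - xq_)) (cinv (atlas a)) w c1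
      (cinv_continuous sM (rA _ (inN w)))).
  + by rewrite clamp01_id ?lexx ?ler01// scale0r addr0 cfunK.
  + by rewrite clamp01_id ?lexx ?ler01// scale1r addrC subrK cfunK.
  + move=> w _; split; first by apply: (cinv_cdom sM); exact: rA (inN w).
    by rewrite cinvK//; exact: rA (inN w).
Qed.

Hypothesis scM : simply_connected M.

Lemma global_paths p q : exists c : R -> M, [/\ continuous c, c 0 = p & c 1 = q].
Proof.
have [_ pc _] := scM; have [c [cc c0 c1]] := pc p q.
exists (c \o @clamp01 R); split.
- apply: (within_comp_continuous cc (@clamp01_continuous R)) => t /=; rewrite in_itv/=; exact: clamp01_in.
- by rewrite /= clamp01_id ?lexx ?ler01.
- by rewrite /= clamp01_id ?lexx ?ler01.
Qed.

(** Clamping both parameters to the unit interval turns the homotopy on the square into one on the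
    whole plane, which is what [monodromy] expects. *)
Lemma global_loops (c : R -> M) : continuous c -> c 0 = c 1 ->
  exists H : R * R -> M, [/\ continuous H, (forall t, 0 <= t <= 1 -> H (0, t) = c t),
    (forall t, H (1, t) = c 0), (forall s, H (s, 0) = c 0) & forall s, H (s, 1) = c 0].
Proof.
move=> cc c01; have [_ _ lp] := scM.
have [H [cH H0 H1 Hs]] := lp c (continuous_subspaceT cc) c01.
pose cl (z : R * R) := (clamp01 z.1, clamp01 z.2).
have z01 : 0 <= (0 : R) <= 1 by rewrite lexx ler01.
have o01 : 0 <= (1 : R) <= 1 by rewrite lexx ler01.
have ccl : continuous cl.
  move=> z; apply: (@cvg_pair _ _ _ _ (nbhs (clamp01 z.1)) (nbhs (clamp01 z.2))).
    by apply: (@continuous_comp _ _ _ fst (@clamp01 R)); [exact: cvg_fst|exact: clamp01_continuous].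
  by apply: (@continuous_comp _ _ _ snd (@clamp01 R)); [exact: cvg_snd|exact: clamp01_continuous].
exists (H \o cl); split.
- apply: (within_comp_continuous cH ccl) => z; split; rewrite /= in_itv/=; exact: clamp01_in.
- by move=> t t01; rewrite /= /cl/= !clamp01_id// H0.
- by move=> t; rewrite /= /cl/= [clamp01 1]clamp01_id// H1//; exact: clamp01_in.
- by move=> s; rewrite /= /cl/= [clamp01 0]clamp01_id//; have [] := Hs _ (clamp01_in s).
- by move=> s; rewrite /= /cl/= [clamp01 1]clamp01_id//; have [] := Hs _ (clamp01_in s).
Qed.

Theorem global_sol p a t0 u0 (eta : 'cV[R]_3) : cdom (atlas a) p -> ue g k a (cfun (atlas a) p) *m eta = 0 ->
  exists F : M -> R * R, [/\ forall q, sol F q, F p = (t0, u0) &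
    grad (fun x => (F (cinv (atlas a) x)).2) (cfun (atlas a) p) = eta].
Proof.
move=> ap ee; have ax := cimg_cfun ap.
have [r r0 [rA _ _ ini]] := chart_extension (ng a) (@par a) ax.
have [t [u [so tx ux gx]]] := ini t0 u0 eta ee.
pose f s := (t (cfun (atlas a) s), u (cfun (atlas a) s)).
have oN := @nball_open R 3 (cfun (atlas a) p) r.
have sf : sol f p.
  exists a, (nball (cfun (atlas a) p) r); split=> //; first exact: nball_center.
  by apply: local_sol_eq oN _ so => x xr /=; rewrite cinvK//; exact: rA.
have [F sF gF] := monodromy sol_germ good_exists global_paths global_loops sf.
exists F; split=> //; first by rewrite (nbhs_singleton gF) /f tx ux.
have [|d d0 [dA dE]] := germ_chart ax (f := F) (F := f); first by rewrite cfunK.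
rewrite -gx; apply/colP => i; rewrite !mxE.
apply: (pderiv_eq (@nball_open R 3 (cfun (atlas a) p) d)); last exact: nball_center.
by move=> y yd; rewrite dE// /f/= cinvK//; exact: dA.
Qed.
End GlobalSolutions.

(** * The developing map *)

(** K u v + g(grad u, grad v). On a sphere of curvature K, for linear functions u and v, this is the
    inner product of their coefficient vectors, which explains why it is constant. *)
Definition obata_form (R : realType) n (g : 'rV[R]_n -> 'M[R]_n) (K : R) (u v : 'rV[R]_n -> R) x : R :=
  K * u x * v x + ((grad u x)^T *m invmx (g x) *m grad v x) 0 0.

Lemma obata_form_comp (R : realType) n (A B : set 'rV[R]_n) (phi : 'rV[R]_n -> 'rV[R]_n) g h (K : R) u v x :
  metric_on A g -> metric_on B h -> (forall x, A x -> B (phi x)) -> smooth_mx_on A phi ->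
  (forall x, A x -> g x = jac phi x *m h (phi x) *m (jac phi x)^T) ->
  smooth_on B u -> smooth_on B v -> A x ->
  obata_form g K (fun y => u (phi y)) (fun y => v (phi y)) x = obata_form h K u v (phi x).
Proof.
move=> mA mB AB sphi gE su sv Ax; rewrite /obata_form.
rewrite (grad_comp mA mB AB sphi su Ax) (grad_comp mA mB AB sphi sv Ax).
congr (_ + _); have [_ _ _ posh] := mB; have [_ _ _ posg] := mA.
have hu := metric_unit posh (AB _ Ax).
have gu := metric_unit posg Ax.
have Ju : jac phi x \in unitmx.
  by move: gu; rewrite gE// unitmx_mul => /andP[]; rewrite unitmx_mul => /andP[].
have JTu : (jac phi x)^T \in unitmx by rewrite unitmx_tr.
have -> : invmx (g x) = invmx (jac phi x)^T *m invmx (h (phi x)) *m invmx (jac phi x).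
  apply: (can_inj (mulKmx gu)); rewrite mulmxV// gE//.
  by rewrite !mulmxA (mulmxK JTu) (mulmxK hu) mulmxV.
by rewrite trmx_mul !mulmxA (mulmxK JTu) (mulmxKV Ju).
Qed.

Section FrameObata.
Variables (R : realType) (B : set 'rV[R]_3) (g E : 'rV[R]_3 -> 'M[R]_3) (k : 'rV[R]_3 -> 'rV[R]_3) (K : R).
Hypothesis aE : adapted_frame B g E k K.
Local Notation e := (unit_field g k).
Hypothesis par : forall x, B x -> covd g e x = 0.
Variable N : set 'rV[R]_3.
Hypotheses (oN : open N) (NB : N `<=` B).
Local Notation st := (sphere_state (fr E)).

Definition state_form (s s' : 'rV[R]_3) : R := K * s 0 o0 * s' 0 o0 + s 0 o1 * s' 0 o1 + s 0 o2 * s' 0 o2.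

Lemma frame_invmx x : B x -> invmx (g x) = (E x)^T *m E x.
Proof.
move=> Bx; have [mB sE [oE nl sc r2]] := aE; have [_ _ _ posg] := mB.
have gu := metric_unit posg Bx; apply: (can_inj (mulKmx gu)); rewrite mulmxV// mulmxA.
by have := coframe_frame oE Bx; rewrite /coframe => ->.
Qed.

Lemma obata_state t u t' u' x : local_sol N g e K t u -> local_sol N g e K t' u' -> N x ->
  obata_form g K u u' x = state_form (st u x) (st u' x).
Proof.
move=> so so' Nx; have [mB sE [oE nl sc r2]] := aE; have Bx := NB Nx; have [_ _ symg posg] := mB.
have z f t1 : local_sol N g e K t1 f -> frame_deriv (fr E) f o2 x = 0.
  move=> [_ _ _ eu _]; have /matrixP/(_ 0 0) := eu x Nx; rewrite [RHS]mxE => <-; rewrite mxE.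
  by apply: eq_bigr => i _; rewrite -r2// !mxE.
have gi := frame_invmx Bx.
have fe f a : (E x *m grad f x) a 0 = frame_deriv (fr E) f a x.
  by rewrite mxE; apply: eq_bigr => i _; rewrite [grad _ _ _ _]mxE.
rewrite /obata_form gi -!mulmxA mulmxA -trmx_mul mxE sum3 ![(_^T) _ _]mxE !fe (z u t so) mul0r addr0.
by rewrite /state_form !mxE/= -!addrA.
Qed.

Lemma state_form_const t u t' u' i x : local_sol N g e K t u -> local_sol N g e K t' u' -> N x ->
  pderiv i (fun y => state_form (st u y) (st u' y)) x = 0.
Proof.
move=> so so' Nx; have [s1 d1 _ _] := local_sol_states aE par oN NB so.
have [s2 d2 _ _] := local_sol_states aE par oN NB so'.
have P b : pderiv i (fun y => st u y 0 b) x = st u x 0 o0 * sphere_system K (cf g E) (cn g E o1 o0) i x o0 b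
    + st u x 0 o1 * sphere_system K (cf g E) (cn g E o1 o0) i x o1 b + st u x 0 o2 * sphere_system K (cf g E) (cn g E o1 o0) i x o2 b.
  by rewrite -mxpderivE d1// mxE sum3.
have P' b : pderiv i (fun y => st u' y 0 b) x = st u' x 0 o0 * sphere_system K (cf g E) (cn g E o1 o0) i x o0 b
    + st u' x 0 o1 * sphere_system K (cf g E) (cn g E o1 o0) i x o1 b + st u' x 0 o2 * sphere_system K (cf g E) (cn g E o1 o0) i x o2 b.
  by rewrite -mxpderivE d2// mxE sum3.
have sK := smooth_on_cst oN K.
have m0 := smooth_onM oN (smooth_onM oN sK (s1 0 o0)) (s2 0 o0).
have m1 := smooth_onM oN (s1 0 o1) (s2 0 o1); have m2 := smooth_onM oN (s1 0 o2) (s2 0 o2).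
rewrite (pderivD i (smooth_onD oN m0 m1) m2 Nx) (pderivD i m0 m1 Nx).
rewrite (pderivM i (smooth_onM oN sK (s1 0 o0)) (s2 0 o0) Nx) (pderivM i sK (s1 0 o0) Nx) pderiv_cst.
rewrite (pderivM i (s1 0 o1) (s2 0 o1) Nx) (pderivM i (s1 0 o2) (s2 0 o2) Nx).
rewrite (P o0) (P o1) (P o2) (P' o0) (P' o1) (P' o2).
move: (st u x) (st u' x) => s s'; rewrite ![sphere_system _ _ _ _ _ _ _]mxE /=.
by move: (cf g E o0 i x) (cf g E o1 i x) (cn g E o1 o0 i x) => a b c; ring.
Qed.

Lemma smooth_state_form t u t' u' : local_sol N g e K t u -> local_sol N g e K t' u' ->
  smooth_on N (fun y => state_form (st u y) (st u' y)).
Proof.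
move=> so so'; have [s1 _ _ _] := local_sol_states aE par oN NB so.
have [s2 _ _ _] := local_sol_states aE par oN NB so'.
have m0 := smooth_onM oN (smooth_onM oN (smooth_on_cst oN K) (s1 0 o0)) (s2 0 o0).
have m1 := smooth_onM oN (s1 0 o1) (s2 0 o1); have m2 := smooth_onM oN (s1 0 o2) (s2 0 o2).
exact: (smooth_onD oN (smooth_onD oN m0 m1) m2).
Qed.

(** If S has the three states as rows and D = diag(K, 1, 1), the hypothesis is S D S^T = 1. Hence D
    S^T S = 1: the corner entry gives the sum of squares, and the lower block the sum of the
    du_c^2. *)
Lemma orthonormal_states (u : 'I_3 -> 'rV[R]_3 -> R) (t : 'rV[R]_3 -> R) x : K != 0 ->
  (forall c, local_sol N g e K t (u c)) -> N x ->
  (forall c d, obata_form g K (u c) (u d) x = (c == d)%:R) ->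
  \sum_c u c x ^+ 2 = K^-1 /\ \sum_c grad (u c) x *m (grad (u c) x)^T = hmet g e x.
Proof.
move=> K0 so Nx H; have Bx := NB Nx; have [mB sE [oE nl sc r2]] := aE.
pose S : 'M[R]_3 := \matrix_(c, b) st (u c) x 0 b.
pose D : 'M[R]_3 := \matrix_(a, b) (if a == b then (if a == o0 then K else 1) else 0).
have SD : S *m (D *m S^T) = 1%:M.
  apply/matrixP => c d; rewrite [RHS]mxE -H (obata_state (so c) (so d) Nx) mulmxA.
  rewrite mxE sum3 ![(_ *m D) _ _]mxE !sum3 /state_form.
  rewrite ![D _ _]mxE ![S^T _ _]mxE ![S _ _]mxE /=; ring.
have DS := mulmx1C SD; rewrite -mulmxA in DS.
have DX (X : 'M[R]_3) a b : (D *m X) a b = (if a == o0 then K else 1) * X a b.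
  rewrite mxE (bigD1 a)//= big1 => [|j ja]; first by rewrite mxE eqxx addr0.
  by rewrite mxE eq_sym (negPf ja) mul0r.
have G a b : (if a == o0 then K else 1) * \sum_c S c a * S c b = (a == b)%:R.
  have /matrixP/(_ a b) := DS; rewrite [RHS]mxE => <-; rewrite DX; congr (_ * _).
  by rewrite mxE; apply: eq_bigr => c _; rewrite [S^T _ _]mxE.
have Su c : S c o0 = u c x by rewrite !mxE.
split.
  have := G o0 o0; rewrite /= => h; apply: (mulfI K0); rewrite mulfV// -[RHS]h; congr (_ * _).
  by apply: eq_bigr => c _; rewrite Su expr2.
have z c : frame_deriv (fr E) (u c) o2 x = 0.
  have [_ _ _ eu _] := so c; have /matrixP/(_ 0 0) := eu x Nx; rewrite [RHS]mxE => <-; rewrite mxE.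
  by apply: eq_bigr => i _; rewrite -r2// !mxE.
apply/matrixP => i j; rewrite (hmet_cf aE i j Bx) summxE.
have gc c l : grad (u c) x l 0 = S c o1 * cf g E o0 l x + S c o2 * cf g E o1 l x.
  by rewrite mxE (pderiv_frame aE (u c) l Bx) sum3 z mul0r addr0 !mxE.
rewrite (eq_bigr (fun c => cf g E o0 i x * cf g E o0 j x * (S c o1 * S c o1) + cf g E o0 i x * cf g E o1 j x * (S c o1 * S c o2)
   + cf g E o1 i x * cf g E o0 j x * (S c o2 * S c o1) + cf g E o1 i x * cf g E o1 j x * (S c o2 * S c o2))).
  rewrite !big_split/= -!mulr_sumr.
  have := G o1 o1; have := G o1 o2; have := G o2 o1; have := G o2 o2; rewrite /= !mul1r => -> -> -> ->.
  by ring.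
by move=> c _; rewrite mxE big_ord1 [_^T _ _]mxE !gc; ring.
Qed.
End FrameObata.

Section DevelopingMap.
Variables (R : realType) (M : manifold R 3) (g : tensor2 M) (K : R) (k : vfield M).
Hypotheses (sM : smooth_manifold M) (rg : riemannian_metric g) (sk : smooth_vfield k).
Hypotheses (nk : nowhere_vanishing k) (ck : curvature_null g k).
Hypotheses (scalK : constant_scalar_curvature g (2 * K)) (Kpos : 0 < K).
Hypotheses (cg : complete_metric g) (scM : simply_connected M).
Implicit Types (a b : idx M) (p q : M).

Let K0 : K != 0. Proof. exact: lt0r_neq0. Qed.
Let ng a : null_geometry (cimg (atlas a)) (g a) (k a) K := chart_geometry sM rg sk nk ck scalK a.
Let par a x : cimg (atlas a) x -> covd (g a) (ue g k a) x = 0.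
Proof. exact: (ue_parallel sM rg sk nk ck scalK Kpos cg). Qed.

Definition developing (t : M -> R) (u : 'I_3 -> M -> R) : Prop :=
  [/\ forall a c, local_sol (cimg (atlas a)) (g a) (ue g k a) K (t \o cinv (atlas a)) (u c \o cinv (atlas a)),
      forall q, \sum_c u c q ^+ 2 = K^-1 &
      forall a x, cimg (atlas a) x -> \sum_c grad (u c \o cinv (atlas a)) x *m (grad (u c \o cinv (atlas a)) x)^T
        = hmet (g a) (ue g k a) x].

Lemma sol_all_chart F a : (forall q, sol g K k F q) -> chart_sol g K k a (cimg (atlas a)) F.
Proof.
move=> sF; apply: local_sol_local => x ax; have cx := cinv_cdom sM ax.
have [B [_ _ Bx so]] := sol_chart sM rg sk cx (sF _).
by exists B => //; rewrite -(cinvK sM ax).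
Qed.

Lemma obata_change (u v : M -> R) a b x : overlap a b x ->
  smooth_on (cimg (atlas b)) (u \o cinv (atlas b)) -> smooth_on (cimg (atlas b)) (v \o cinv (atlas b)) ->
  obata_form (g a) K (u \o cinv (atlas a)) (v \o cinv (atlas a)) x =
  obata_form (g b) K (u \o cinv (atlas b)) (v \o cinv (atlas b)) (transition a b x).
Proof.
move=> o su sv; have oO := overlap_open sM a b.
have mA := metric_on_sub oO (overlap_cimg sM a b) (chart_metric sM rg a).
have <- := obata_form_comp K mA (chart_metric sM rg b) (transition_cimg sM a b) (smooth_transition sM a b)
  (@metric_change R M g rg a b) su sv o.
have eqf (w : M -> R) y : overlap a b y -> (w \o cinv (atlas a)) y = (w \o cinv (atlas b)) (transition a b y).
  by move=> oy; rewrite /= cinv_transition.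
have eqg (w : M -> R) : grad (w \o cinv (atlas a)) x = grad (fun y => (w \o cinv (atlas b)) (transition a b y)) x.
  by apply/colP => i; rewrite !mxE (pderiv_eq oO i (eqf w) o).
by rewrite /obata_form !eqg !eqf.
Qed.

(** Connectedness of M, deduced from path connectedness. *)
Lemma path_constant (P : M -> Prop) : (forall q, exists2 U, open U /\ U q & forall s, U s -> (P s <-> P q)) ->
  forall p q, P p -> P q.
Proof.
move=> H p q Pp; have [c [cc c0 c1]] := global_paths scM p q.
rewrite -c1; apply: (@interval_induction R (fun s => P (c s)) 0 1); [exact: ler01|by rewrite c0|].
move=> s _; have [U [oU Us] HU] := H (c s); have [e e0 He] := path_near cc oU Us.
by exists e => // t _ te; apply: HU; exact: He.
Qed.

(* A base point where (t, u) is the pole (0, (r, 0, 0)) and the differential is onto. *)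
Definition based (t : M -> R) (u : 'I_3 -> M -> R) p0 a0 : Prop :=
  [/\ cdom (atlas a0) p0, t p0 = 0, forall c, u c p0 = (c == o0)%:R * Num.sqrt K^-1 &
    forall (tau : R) (q : 'I_3 -> R), q o0 = 0 -> exists v : 'rV[R]_3,
      (v *m grad (t \o cinv (atlas a0)) (cfun (atlas a0) p0)) 0 0 = tau /\
      forall c, (v *m grad (u c \o cinv (atlas a0)) (cfun (atlas a0) p0)) 0 0 = q c].

(** The solutions start with orthonormal states at p0; constancy of the pairing spreads
    orthonormality over M, and [orthonormal_states] translates it. *)
Theorem developing_exists : exists t u p0 a0, developing t u /\ based t u p0 a0.
Proof.
have [[p0 _] _ _] := scM; have [a0 ap0] := chart_at sM p0; have ax0 := cimg_cfun ap0.
set x0 := cfun (atlas a0) p0 in ax0.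
have [B [E [oB Bx0 BA aE]]] := adapted_frame_exists (ng a0) ax0.
have [mB sE [oE nl sc r2]] := aE.
pose r := Num.sqrt K^-1.
have r2K : K * r * r = 1 by rewrite -mulrA -expr2 sqr_sqrtr ?invr_ge0 ?ltW// mulfV.
(* Initial differentials 0, theta0, theta1, with initial values r, 0, 0; orthonormal since K r^2 =
   1. *)
pose cov (c : 'I_3) : 'cV[R]_3 := match val c with 0%N => 0 | 1%N => col o0 (coframe (g a0) E x0) | _ => col o1 (coframe (g a0) E x0) end.
have frco := frame_coframe oE Bx0.
have Ecol j : E x0 *m col j (coframe (g a0) E x0) = delta_mx j 0.
  rewrite colE mulmxA frco mul1mx; by [].
pose ec (c : 'I_3) : 'cV[R]_3 := match val c with 0%N => 0 | 1%N => delta_mx o0 0 | _ => delta_mx o1 0 end.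
have Ecov c : E x0 *m cov c = ec c.
  by rewrite /cov /ec; case: (val c) => [|[|?]]; rewrite ?mulmx0 ?Ecol.
have ecov c : ue g k a0 x0 *m cov c = 0.
  have <- : row o2 (E x0) = ue g k a0 x0 by exact: r2.
  rewrite -row_mul Ecov; apply/matrixP => i j; rewrite mxE [RHS]mxE /ec.
  by case: (val c) => [|[|?]]; rewrite mxE.
pose u0 (c : 'I_3) := if c == o0 then r else 0.
have /choice[F HF] : forall c, exists F : M -> R * R, [/\ forall q, sol g K k F q, F p0 = (0, u0 c) &
    grad (fun x => (F (cinv (atlas a0) x)).2) x0 = cov c].
  by move=> c; exact: (global_sol sM rg sk nk ck scalK Kpos cg scM 0 (u0 c) ap0 (ecov c)).
have FS c a := sol_all_chart a (let: And3 h _ _ := HF c in h).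
pose t q := (F o0 q).1; pose u c q := (F c q).2.
have LS a c : local_sol (cimg (atlas a)) (g a) (ue g k a) K (t \o cinv (atlas a)) (u c \o cinv (atlas a)).
  have [h1 _ h3 _ _] := FS o0 a; have [_ h2 _ h4 h5] := FS c a.
  by split; [exact: h1|exact: h2|exact: h3|exact: h4|exact: h5].
have su c a : smooth_on (cimg (atlas a)) (u c \o cinv (atlas a)) by case: (LS a c).
(* Stated for all charts at q so that the predicate depends on the point only. *)
pose P q := forall a, cdom (atlas a) q -> forall c d,
  obata_form (g a) K (u c \o cinv (atlas a)) (u d \o cinv (atlas a)) (cfun (atlas a) q) = (c == d)%:R.
have Pchart q a : cdom (atlas a) q -> (forall c d,
   obata_form (g a) K (u c \o cinv (atlas a)) (u d \o cinv (atlas a)) (cfun (atlas a) q) = (c == d)%:R) -> P q.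
  move=> aq H b bq c d; have o := overlap_cfun bq aq.
  by rewrite (obata_change o (su c a) (su d a)) transition_cfun.
have P0 : P p0.
  apply: (Pchart p0 a0 ap0) => c d; rewrite -/x0 /obata_form (frame_invmx aE Bx0).
  have gc e : grad (u e \o cinv (atlas a0)) x0 = cov e by have [_ _ h] := HF e; exact: h.
  rewrite !gc -mulmxA -mulmxA mulmxA -trmx_mul !Ecov.
  have uc e : (u e \o cinv (atlas a0)) x0 = u0 e by rewrite /= /u cfunK//; have [_ -> _] := HF e.
  rewrite !uc mxE sum3 ![_^T _ _]mxE /u0 /ec.
  move: c d; apply: all3; apply: all3; rewrite /= ?mxE /= ?r2K; ring.
have Pq q : P q.
  apply: path_constant P0 => {}q; have [a aq] := chart_at sM q; have ax := cimg_cfun aq.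
  have [B' [E' [oB' Bx' BA' aE']]] := adapted_frame_exists (ng a) ax.
  have [d d0 dB] := open_nball oB' Bx'.
  have oN := @nball_open R 3 (cfun (atlas a) q) d.
  have par' x : B' x -> covd (g a) (unit_field (g a) (k a)) x = 0 by move=> /BA'; exact: par.
  have so c := local_sol_sub (subset_trans dB BA') (LS a c).
  have const c c' x : nball (cfun (atlas a) q) d x ->
     obata_form (g a) K (u c \o cinv (atlas a)) (u c' \o cinv (atlas a)) x =
     obata_form (g a) K (u c \o cinv (atlas a)) (u c' \o cinv (atlas a)) (cfun (atlas a) q).
    move=> xd; rewrite (obata_state aE' dB (so c) (so c') xd) (obata_state aE' dB (so c) (so c') (nball_center _ d0)).
    apply: (const_on_nball d0 (smooth_state_form aE' par' oN dB (so c) (so c')) _ xd) => i y yd.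
    exact: (state_form_const aE' par' oN dB i (so c) (so c') yd).
  exists [set s | cdom (atlas a) s /\ nball (cfun (atlas a) q) d (cfun (atlas a) s)].
    by split; [exact: (chart_preimage_open sM)|split=> //; exact: nball_center].
  move=> s [as_ sd]; split=> Ps.
    by apply: (Pchart q a aq) => c c'; rewrite -(const c c' _ sd); exact: Ps.
  by apply: (Pchart s a as_) => c c'; rewrite (const c c' _ sd); exact: Ps.
have fin a x : cimg (atlas a) x -> \sum_c (u c \o cinv (atlas a)) x ^+ 2 = K^-1 /\
    \sum_c grad (u c \o cinv (atlas a)) x *m (grad (u c \o cinv (atlas a)) x)^T = hmet (g a) (ue g k a) x.
  move=> ax; have [B' [E' [oB' Bx' BA' aE']]] := adapted_frame_exists (ng a) ax.
  have cx := cinv_cdom sM ax; have PP := Pq _ a cx; rewrite cinvK// in PP.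
  exact: (orthonormal_states aE' (@subset_refl _ B') K0 (fun c => local_sol_sub BA' (LS a c)) Bx' PP).
exists t, u, p0, a0; split.
  split; first exact: LS.
    move=> q; have [a aq] := chart_at sM q; have [h _] := fin a _ (cimg_cfun aq).
    by rewrite -h; apply: eq_bigr => c _; rewrite /= cfunK.
  by move=> a x /fin[].
split=> //.
- by have [_ h _] := HF o0; rewrite /t h.
- by move=> c; have [_ h _] := HF c; rewrite /u h /u0 /=; case: eqP => _; rewrite ?mul1r ?mul0r.
move=> tau q q0; exists ((\row_c (if val c == 0%N then q o1 else if val c == 1%N then q o2 else tau)) *m E x0).
rewrite -/x0; split.
  have [_ _ -> // _ _] := LS a0 o0; rewrite /lower -mulmxA.
  have -> : ue g k a0 x0 = row o2 (E x0) by rewrite r2.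
  have -> : E x0 *m (g a0 x0 *m (row o2 (E x0))^T) = col o2 (1%:M : 'M[R]_3).
    by rewrite -(oE _ Bx0) tr_row !colE -!mulmxA.
  by rewrite mxE sum3 !mxE /=; ring.
move=> c; have [_ _ ->] := HF c; rewrite -mulmxA Ecov mxE sum3 /ec !mxE /=.
move: c; apply: all3; rewrite /= ?mxE /= ?q0; ring.
Qed.
End DevelopingMap.

(** * Lifting a family of paths through a local homeomorphism *)

Section LiftedPolar.
Variables (R : realType) (M Z : topologicalType) (F : M -> Z).
Hypotheses (hM : hausdorff_space M) (hZ : hausdorff_space Z) (cF : continuous F).
Hypothesis locinj : forall q, exists2 V : set M, open V /\ V q & forall a b, V a -> V b -> F a = F b -> a = b.
Hypothesis openF : forall q (U : set M), open U -> U q -> \forall y \near F q, exists2 q', U q' & F q' = y.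

Lemma separated (x y : M) : x <> y -> exists A B : set M, [/\ open A, open B, A x, B y & A `&` B = set0].
Proof.
move=> /eqP ne; have h := hM; rewrite open_hausdorff in h.
have [[A B] /= [/set_mem Ax /set_mem By] [oA oB /eqP AB]] := h _ _ ne.
by exists A, B.
Qed.

(** Equal values stay equal by local injectivity, distinct values stay distinct by the Hausdorff
    property; so agreement of two lifts is locally constant. *)
Lemma lift_unique_at (T : topologicalType) (f g : T -> M) s : {for s, continuous f} -> {for s, continuous g} ->
  (forall t, F (f t) = F (g t)) -> \forall t \near s, (f t = g t <-> f s = g s).
Proof.
move=> cf cg fg; have [e|ne] := pselect (f s = g s).
  have [V [oV Vs] inj] := locinj (f s).
  have n1 : nbhs s (f @^-1` V) by apply: cf; exact: open_nbhs_nbhs.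
  have n2 : nbhs s (g @^-1` V) by apply: cg; apply: open_nbhs_nbhs; rewrite -e.
  by apply: filterS2 n1 n2 => t v1 v2; split=> // _; exact: inj.
have [A [B [oA oB As Bs AB]]] := separated ne.
have n1 : nbhs s (f @^-1` A) by apply: cf; exact: open_nbhs_nbhs.
have n2 : nbhs s (g @^-1` B) by apply: cg; exact: open_nbhs_nbhs.
apply: filterS2 n1 n2 => t v1 v2; split=> // e; exfalso.
have : (A `&` B) (f t) by split=> //; rewrite e.
by rewrite AB.
Qed.

Lemma lift_unique (f g : R -> M) (a b : R) : (forall s, a <= s <= b -> {for s, continuous f}) ->
  (forall s, a <= s <= b -> {for s, continuous g}) -> (forall t, F (f t) = F (g t)) ->
  forall s t, a <= s <= b -> a <= t <= b -> f s = g s -> f t = g t.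
Proof.
move=> cf cg fg; apply: locally_constant_iff => s sab.
have [e e0 H] := nbhs_ballR (lift_unique_at (cf s sab) (cg s sab) fg).
by exists e => // t _ te; exact: H.
Qed.

Section Family.
Variables (T : topologicalType) (c : T -> R -> Z) (lft : T -> R -> M) (p0 : M).
Hypothesis c_joint : forall v s (W : set Z), nbhs (c v s) W ->
  exists2 e : R, 0 < e & \forall w \near v, forall t, `|t - s| < e -> W (c w t).
Hypothesis lft_cont : forall v, continuous (lft v).
Hypothesis lft0 : forall v, lft v 0 = p0.
Hypothesis lftE : forall v s, F (lft v s) = c v s.

(** Induction on s: continuity in the parameter passes between nearby times because, inside an open
    set V where F is injective, the lift is determined by its image. *)
Lemma lift_continuous s : 0 <= s -> continuous (fun v => lft v s).
Proof.
move=> s0 v0; apply: (@interval_induction R (fun s => {for v0, continuous (fun v => lft v s)}) 0 s s0).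
  rewrite (_ : (fun v => _) = fun=> p0); first exact: cst_continuous.
  by apply/funext => v; exact: lft0.
move=> s1 _; set q := lft v0 s1.
have [V [oV Vq] inj] := locinj q.
have nW := openF oV Vq; rewrite lftE in nW.
have [e1 e10 box] := c_joint nW.
have [e2 e20 inV] : exists2 e : R, 0 < e & forall t, `|t - s1| < e -> V (lft v0 t).
  by apply: nbhs_ballR; apply: (lft_cont (v := v0)); exact: open_nbhs_nbhs.
pose e := Num.min e1 e2; have e0 : 0 < e by rewrite lt_min e10.
have step t t' : `|t - s1| < e -> `|t' - s1| < e ->
    {for v0, continuous (fun v => lft v t)} -> {for v0, continuous (fun v => lft v t')}.
  rewrite !lt_min => /andP[t1 t2] /andP[t1' t2'] ct.
  have nV : \forall v \near v0, V (lft v t) by apply: ct; apply: open_nbhs_nbhs; split=> //; exact: inV.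
  move=> U nU.
  have [U' [oU' U'q] U'U] : exists2 U' : set M, open U' /\ U' (lft v0 t') & U' `<=` U.
    by move: nU; rewrite /= nbhsE => -[U' [oU' U'q] h]; exists U'.
  have UVq : (U' `&` V) (lft v0 t') by split=> //; exact: inV.
  have := openF (openI oU' oV) UVq; rewrite lftE => /c_joint[e3 e30 box3].
  apply: filterS3 nV box box3 => v vt bx bx3.
  pose lo := Num.min t t'; pose hi := Num.max t t'.
  have lohi w : lo <= w <= hi -> `|w - s1| < e1.
    rewrite /lo /hi; move: t1 t1'; rewrite !ltr_norml => /andP[? ?] /andP[? ?].
    by case: (leP t t') => ? /andP[? ?]; apply/andP; split; lra.
  have tl : lo <= t <= hi by rewrite /lo /hi ge_min le_max lexx.
  have tl' : lo <= t' <= hi by rewrite /lo /hi ge_min le_max lexx !orbT.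
  (* The lift must not leave V between the two times. If it is outside V at time w, the point m of V
     over the same image is separated from it, and nearby lifted points cannot be in V without being
     on the side of m. *)
  have stay : V (lft v t').
    apply: (@locally_constant_iff R (fun w => V (lft v w)) lo hi _ t t') => // w wl.
    have [m Vm mE] := bx w (lohi w wl).
    have [Vw|nVw] := pselect (V (lft v w)).
      have [d d0 H] : exists2 d : R, 0 < d & forall t, `|t - w| < d -> V (lft v t).
        by apply: nbhs_ballR; apply: (lft_cont (v := v)); exact: open_nbhs_nbhs.
      by exists d => // x _ xd; split=> // _; exact: H.
    have ne : lft v w != m by apply: contra_notN nVw => /eqP ->.
    have [A [B [oA oB Aw Bm AB]]] := separated (elimN eqP ne).
    have n1 : \forall x \near w, A (lft v x) by apply: (lft_cont (v := v)); exact: open_nbhs_nbhs.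
    have n2 : \forall y \near c v w, exists2 q', (B `&` V) q' & F q' = y.
      by rewrite -mE; apply: openF; [exact: openI|split].
    have n2' : \forall x \near w, exists2 q', (B `&` V) q' & F q' = c v x.
      have cv : {for w, continuous (c v)}.
        rewrite (_ : c v = F \o lft v); last by apply/funext => x; rewrite /= lftE.
        by apply: continuous_comp; [exact: lft_cont|exact: cF].
      exact: (cv _ n2).
    have [d d0 H] := nbhs_ballR (filterI n1 n2').
    exists d => // x xl xd; split=> // Vx; exfalso.
    have [Ax [q' [Bq' Vq'] q'E]] := H x xd.
    have e' : lft v x = q' by apply: inj => //; rewrite lftE q'E.
    have : (A `&` B) (lft v x) by split=> //; rewrite e'.
    by rewrite AB.
  have tt : `|t' - t'| < e3 by rewrite subrr normr0.
  have [q' [U'q' Vq'] q'E] := bx3 t' tt.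
  by apply: U'U; rewrite (_ : lft v t' = q')//; apply: inj => //; rewrite lftE q'E.
have ss : `|s1 - s1| < e by rewrite subrr normr0.
by exists e => // t _ te; split; exact: step.
Qed.

Variable D : set T.
Hypothesis conn : forall P : M -> Prop,
  (forall q, exists2 U : set M, open U /\ U q & forall s, U s -> (P s <-> P q)) -> forall p q, P p -> P q.
Hypothesis fibre : forall v w, D v -> D w -> c v 1 = c w 1 -> (forall s, c v s = c w s) \/
  exists (f : R -> T) (a b : R), [/\ continuous f, a <= b, f a = v /\ f b = w & forall s, c (f s) 1 = c v 1].
Hypothesis proper : forall z : Z, exists2 W : set Z, nbhs z W & exists C : set T,
  [/\ compact C, C `<=` D & forall y, W y -> exists2 v, C v & c v 1 = y].
Hypothesis base : exists2 v, D v & forall s, c v s = F p0.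

Let E v := lft v 1.

Let cE : continuous E. Proof. exact: lift_continuous. Qed.

(** Either the rays coincide, and so do their lifts, or they are joined by a family with constant
    end point, and the lifted end points form a lift of a constant path. *)
Lemma lift_fibre v w : D v -> D w -> c v 1 = c w 1 -> E v = E w.
Proof.
move=> Dv Dw vw; have [e|[f [a [b [cf ab [fa fb] fc]]]]] := fibre Dv Dw vw.
  by apply: (@lift_unique (lft v) (lft w) 0 1 _ _ _ 0 1); rewrite ?lexx ?ler01 ?lft0//;
    [move=> s _; exact: lft_cont|move=> s _; exact: lft_cont|move=> t; rewrite !lftE].
rewrite -fb -fa.
apply: (@lift_unique (fun=> E (f a)) (E \o f) a b _ _ _ a b); rewrite ?lexx ?ab//.
- by move=> s _; exact: cst_continuous.
- by move=> s _; apply: continuous_comp; [exact: cf|exact: cE].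
- by move=> t; rewrite /E/= !lftE !fc.
Qed.

(** The inverse sends z to the end of the lift of any ray ending at z. Local compactness of the
    family of rays makes it continuous. *)
Theorem lifted_inverse : exists2 G : Z -> M, continuous G & cancel F G /\ cancel G F.
Proof.
have surj z : exists2 v, D v & c v 1 = z.
  by have [W nW [C [_ CD H]]] := proper z; have [v Cv vz] := H z (nbhs_singleton nW); exists v => //; exact: CD.
have /choice[G HG] : forall z, exists q, forall v, D v -> c v 1 = z -> E v = q.
  by move=> z; have [v Dv vz] := surj z; exists (E v) => w Dw wz; apply: lift_fibre => //; rewrite wz.
have GK : cancel G F.
  by move=> z; have [v Dv vz] := surj z; rewrite -(HG z v Dv vz) /E lftE.
have cG : continuous G.
  move=> z U; rewrite /= nbhsE => -[U' [oU' U'z] U'U].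
  have [W nW [C [cC CD H]]] := proper z.
  (* The rays whose lift ends outside U'. Their end points form a compact, hence closed, set that
     misses z. *)
  pose C' := C `&` E @^-1` (~` U').
  have cC' : compact C'.
    apply: compact_closedI => //; apply: closed_comp => [v _|]; first exact: cE.
    by rewrite closedC.
  have cpi : continuous (fun v => c v 1).
    rewrite (_ : (fun v => _) = F \o E); last by apply/funext => v; rewrite /E/= lftE.
    by move=> v; apply: continuous_comp; [exact: cE|exact: cF].
  have cl : closed ((fun v => c v 1) @` C').
    apply: compact_closed => //; apply: continuous_compact => //.
    exact: continuous_subspaceT.
  have nz : nbhs z (~` ((fun v => c v 1) @` C')).
    apply: open_nbhs_nbhs; split; first by rewrite openC.
    by move=> [v [Cv nv] vz]; apply: nv; rewrite (HG z)//; exact: CD.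
  apply: filterS2 nW nz => y Wy ny; apply: U'U; have [v Cv vy] := H y Wy.
  rewrite -(HG y v (CD _ Cv) vy); apply: contrapT => nu; apply: ny.
  by exists v.
exists G => //; split=> // q.
(* By uniqueness of lifts G (F q) = q is an open and closed condition on q. *)
pose P q := G (F q) = q.
have P0 : P p0.
  have [v Dv vp] := base; rewrite /P -(HG _ v Dv (vp 1)).
  apply: (@lift_unique (lft v) (fun=> p0) 0 1 _ _ _ 0 1); rewrite ?lexx ?ler01 ?lft0//.
  - by move=> s _; exact: lft_cont.
  - by move=> s _; exact: cst_continuous.
  - by move=> t; rewrite lftE vp.
apply: conn P0 => {}q.
have cGF : continuous (G \o F) by move=> x; apply: continuous_comp; [exact: cF|exact: cG].
have H : nbhs q [set t | G (F t) = t <-> G (F q) = q].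
  by apply: (@lift_unique_at M (G \o F) id q); [exact: cGF|exact: id|move=> t; rewrite /= GK].
move: H; rewrite nbhsE => -[U [oU Uq] UH]; exists U => // s Us; exact: UH.
Qed.
End Family.
End LiftedPolar.

(** * The inverse function theorem *)

Section StrictMap.
Variables (R : realType) (n : nat) (A : set 'rV[R]_n) (Phi : 'rV[R]_n -> 'rV[R]_n).
Hypotheses (oA : open A) (sPhi : smooth_mx_on A Phi).

Lemma mulmx_norm_le (J : 'M[R]_n) : exists2 C : R, 0 < C & forall v : 'rV[R]_n, `|v *m J| <= C * `|v|.
Proof.
exists (\sum_i \sum_j `|J i j| + 1).
  by rewrite ltr_wpDl// sumr_ge0// => i _; rewrite sumr_ge0.
move=> v; apply: le_rVnorm.
  by rewrite mulr_ge0// addr_ge0// sumr_ge0// => i _; rewrite sumr_ge0.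
move=> j; rewrite mxE (le_trans (ler_norm_sum _ _ _))// mulrDl mul1r ler_wpDr// mulr_suml.
apply: ler_sum => i _; rewrite normrM mulrC ler_pM//; last exact: rVcoord_le.
by rewrite (bigD1 j)//= lerDl sumr_ge0.
Qed.

Lemma jac_strict x (e : R) : A x -> 0 < e -> exists2 d : R, 0 < d & forall y z, nball x d y -> nball x d z ->
  `|Phi z - Phi y - (z - y) *m jac Phi x| <= e * `|z - y|.
Proof.
move=> Ax e0.
have [d d0 H] : exists2 d : R, 0 < d & forall h, h < d -> forall j y z, `|y - x| <= h -> `|z - x| <= h ->
    `|Phi z 0 j - Phi y 0 j - dirderiv (fun w => Phi w 0 j) x (z - y)| <= e * `|z - y|.
  apply: common_radius => j.
  have [d d0 H] := smooth_on_strict oA (sPhi 0 j) Ax e0.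
  by exists d => // h hd y z yh zh; apply: H; [exact: le_lt_trans yh hd|exact: le_lt_trans zh hd].
exists d => // y z yd zd; apply: le_rVnorm; first by rewrite mulr_ge0// ltW.
move=> j; rewrite mxsubE mxsubE.
have -> : ((z - y) *m jac Phi x) 0 j = dirderiv (fun w => Phi w 0 j) x (z - y).
  by rewrite mxE; apply: eq_bigr => i _; rewrite [jac _ _ _ _]mxE.
pose h := Num.max `|y - x| `|z - x|.
by apply: (H h); rewrite /h ?gt_max ?le_max ?lexx ?orbT// yd zd.
Qed.

Variable x0 : 'rV[R]_n.
Hypotheses (Ax0 : A x0) (uJ : jac Phi x0 \in unitmx).

(** After composition with the inverse of its differential, Phi is close to a translation near x0;
    both halves of the inverse function theorem rest on this. *)
Lemma straightened (e : R) : 0 < e -> exists2 d : R, 0 < d & forall y z, nball x0 d y -> nball x0 d z ->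
  `|(Phi z - Phi y) *m invmx (jac Phi x0) - (z - y)| <= e * `|z - y|.
Proof.
move=> e0; have [C Cp HC] := mulmx_norm_le (invmx (jac Phi x0)).
have [d d0 H] := jac_strict Ax0 (divr_gt0 e0 Cp).
exists d => // y z yd zd; have -> : (Phi z - Phi y) *m invmx (jac Phi x0) - (z - y) =
    (Phi z - Phi y - (z - y) *m jac Phi x0) *m invmx (jac Phi x0) by rewrite [RHS]mulmxBl mulmxK.
apply: le_trans (HC _) _; rewrite -ler_pdivlMl// mulrA [C^-1 * e]mulrC.
exact: H.
Qed.

Lemma locally_expanding : exists2 d : R, 0 < d & exists2 C : R, 0 < C &
  forall y z, nball x0 d y -> nball x0 d z -> `|z - y| <= C * `|Phi z - Phi y|.
Proof.
have [C Cp HC] := mulmx_norm_le (invmx (jac Phi x0)).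
have h0 : 0 < 2^-1 :> R by [].
have [d d0 H] := straightened h0; exists d => //; exists (2 * C); first by rewrite mulr_gt0.
move=> y z yd zd; have := H y z yd zd; have := HC (Phi z - Phi y).
move: (_ *m _) => w; move: (Phi z - Phi y) => w' h1 h2.
have h3 : `|z - y| <= `|w| + `|w - (z - y)|.
  by rewrite -{1}(subKr w (z - y)) ler_normB.
rewrite -mulrA; lra.
Qed.

Lemma locally_injective : exists2 d : R, 0 < d &
  forall y z, nball x0 d y -> nball x0 d z -> Phi y = Phi z -> y = z.
Proof.
have [d d0 [C _ H]] := locally_expanding; exists d => // y z yd zd yz.
have := H y z yd zd; rewrite yz subrr normr0 mulr0 normr_le0 subr_eq0 => /eqP ->.
by [].
Qed.

(** Surjectivity by minimization on a compact ball, instead of a fixed point argument. *)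
Lemma locally_open (U : set 'rV[R]_n) : open U -> U x0 -> \forall y \near Phi x0, exists2 x, U x & Phi x = y.
Proof.
move=> oU Ux0; have h0 : 0 < 2^-1 :> R by [].
have [d1 d10 H] := straightened h0.
have [d2 d20 UA] := open_nball (openI oU oA) (conj Ux0 Ax0).
pose r := Num.min d1 d2 / 2; have r0 : 0 < r by rewrite divr_gt0// lt_min d10.
pose B := [set x : 'rV[R]_n | `|x - x0| <= r].
have Bd1 x : B x -> nball x0 d1 x.
  rewrite /B /nball /= /r => h; have : Num.min d1 d2 <= d1 by rewrite ge_min lexx.
  by have : 0 < Num.min d1 d2; [rewrite lt_min d10|lra].
have Bd2 x : B x -> nball x0 d2 x.
  rewrite /B /nball /= /r => h; have : Num.min d1 d2 <= d2 by rewrite ge_min lexx orbT.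
  by have : 0 < Num.min d1 d2; [rewrite lt_min d10|lra].
have B0 : B x0 by rewrite /B/= subrr normr0 ltW.
have cB : compact B.
  have -> : B = closed_ball_ (fun x : 'rV[R]_n => `|x|) x0 r.
    by apply/seteqP; split=> x; rewrite /B/= distrC.
  apply: bounded_closed_compact; last exact: closed_closed_ball_.
  exists (`|x0| + r); split; first by rewrite num_real.
  move=> M hM x; rewrite /closed_ball_ /= distrC => xr; rewrite -(subrK x0 x).
  by apply: le_trans (ler_normD _ _) _; apply: le_trans (ltW hM); rewrite addrC lerD2l.
have [C Cp HC] := mulmx_norm_le (invmx (jac Phi x0)).
have e0 : 0 < r / (8 * C) by rewrite divr_gt0// mulr_gt0.
apply: filterS (open_nbhs_nbhs (conj (@nball_open R n (Phi x0) (r / (8 * C))) (nball_center _ e0))) => y ye.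
(* The straightened distance to the target y; its minimum over B is shown to be zero. *)
pose f x : R := `|(y - Phi x) *m invmx (jac Phi x0)|.
have cf : {within B, continuous f}.
  apply: continuous_in_subspaceT => x /set_mem Bx.
  have [_ Axx] := UA _ (Bd2 _ Bx).
  have cPhi : {for x, continuous Phi}.
    apply/continuous_epsP => e ep.
    have [d d0 HJ] := jac_strict Axx ltr01.
    have [C' C'p HC'] := mulmx_norm_le (jac Phi x).
    exists (Num.min d (e / (1 + C'))); first by rewrite lt_min d0 divr_gt0// addr_gt0.
    move=> z; rewrite lt_min => /andP[z1 z2].
    have := HJ x z (nball_center _ d0) z1; have := HC' (z - x); move: (_ *m _) => w h1 h2.
    rewrite -(subrK w (Phi z - Phi x)); apply: le_trans (ler_normD _ _) _.
    apply: le_trans (lerD h2 h1) _; rewrite -mulrDl mulrC -ler_pdivlMr ?addr_gt0//.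
    exact: ltW.
  apply: continuous_comp; last exact: norm_continuous.
  apply/continuous_epsP => e ep.
  move/continuous_epsP: cPhi => /(_ (e / C) (divr_gt0 ep Cp))[d d0 Hd].
  exists d => // z zd; rewrite -mulmxBl (_ : _ - _ = - (Phi z - Phi x)); last first.
    by rewrite !opprB addrC addrA subrK addrC.
  apply: le_trans (HC _) _; rewrite normrN mulrC -ler_pdivlMr//; exact: Hd.
have [x /set_mem Bx xmin] := compact_EVT_min (ex_intro _ x0 B0) cB cf.
have fx0 : f x0 < r / 8.
  apply: le_lt_trans (HC _) _; rewrite mulrC -ltr_pdivlMr// -mulrA -invfM.
  exact: ye.
have fx : f x < r / 8 by apply: le_lt_trans fx0; apply: xmin; rewrite inE.
have xr : `|x - x0| < r / 2.
  have := H x0 x (nball_center _ d10) (Bd1 _ Bx); rewrite -/(f x).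
  have -> : (Phi x - Phi x0) *m invmx (jac Phi x0) = (y - Phi x0) *m invmx (jac Phi x0) - (y - Phi x) *m invmx (jac Phi x0).
    by rewrite -mulmxBl; congr (_ *m _); apply/rowP => j; rewrite !mxE; ring.
  move: fx fx0; rewrite /f; move: (_ *m _) (_ *m _) => w1 w2 h1 h2 h3.
  have h4 : `|x - x0| <= `|w2| + `|w1| + `|w1 - w2 - (x - x0)|.
    rewrite -{1}(subKr (w1 - w2) (x - x0)) [`|w2| + `|w1|]addrC; apply: le_trans (ler_normB _ _) _.
    by rewrite lerD2r ler_normB.
  lra.
exists x; first by have [] := UA _ (Bd2 _ Bx).
pose w := (y - Phi x) *m invmx (jac Phi x0).
have [w0|w0] := eqVneq w 0.
  apply/eqP; rewrite eq_sym -subr_eq0; apply/eqP.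
  by rewrite -(mulmxKV uJ (y - Phi x)) -/w w0 mul0mx.
exfalso; have wp : 0 < `|w| by rewrite normr_gt0.
have wr : `|w| < r / 8 by [].
(* A Newton step from the minimizer stays in the ball and at least halves the residue, contradicting
   minimality. *)
have Bx' : B (x + w).
  rewrite /B/= addrAC; apply: le_trans (ler_normD _ _) _; lra.
have := H x (x + w) (Bd1 _ Bx) (Bd1 _ Bx'); rewrite [x + w]addrC addrK => h1.
have := xmin (x + w) (mem_set Bx'); rewrite /f -/w.
have -> : (y - Phi (x + w)) *m invmx (jac Phi x0) = - ((Phi (w + x) - Phi x) *m invmx (jac Phi x0) - w).
  by rewrite opprB /w -mulmxBl [w + x]addrC; congr (_ *m _); rewrite opprB addrA subrK.
rewrite normrN; lra.
Qed.
End StrictMap.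

(** The derivative of h(Psi) is a sum of products of the entries of the inverse Jacobian and partial
    derivatives of h, all composed with Psi; so functions h(Psi) generate a stable algebra. *)
Lemma smooth_inverse (R : realType) n (A W : set 'rV[R]_n) (Phi Psi : 'rV[R]_n -> 'rV[R]_n) :
  open A -> open W -> smooth_mx_on A Phi -> (forall x, A x -> jac Phi x \in unitmx) ->
  (forall y, W y -> A (Psi y)) -> (forall y, W y -> Phi (Psi y) = y) ->
  (forall y, W y -> {for y, continuous Psi}) -> smooth_mx_on W Psi.
Proof.
move=> oA oW sPhi uJ WA PhiK cPsi.
have lip y : W y -> exists2 d : R, 0 < d & exists2 C : R, 0 < C & forall z, nball y d z -> `|Psi z - Psi y| <= C * `|z - y|.
  move=> Wy; have [d d0 [C Cp H]] := locally_expanding oA sPhi (WA _ Wy) (uJ _ (WA _ Wy)).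
  have [d1 d10 W1] := open_nball oW Wy.
  have d20 : 0 < d / 2 by rewrite divr_gt0.
  have /continuous_epsP/(_ _ d20)[d3 d30 H3] := cPsi y Wy.
  exists (Num.min d1 d3); first by rewrite lt_min d10.
  exists C => // z; rewrite /nball/= lt_min => /andP[z1 z3].
  have := H (Psi y) (Psi z) (nball_center _ d0); rewrite !PhiK//; last exact: W1.
  by apply; rewrite /nball/=; apply: le_lt_trans (H3 _ z3) _; lra.
have dPsi y i j : W y -> is_derive y (delta_mx 0 i) (fun z => Psi z 0 j) (invmx (jac Phi (Psi y)) i j).
  move=> Wy; apply/is_derive_epsP => e e0.
  have [d d0 [C Cp HC]] := lip y Wy.
  have eC : 0 < e / C by rewrite divr_gt0.
  have [d1 d10 H1] := straightened oA sPhi (WA _ Wy) (uJ _ (WA _ Wy)) eC.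
  have [d2 d20 W2] := open_nball oW Wy.
  pose d' := Num.min (Num.min d d2) (d1 / C).
  exists d'; first by rewrite !lt_min d0 d20 divr_gt0.
  move=> h; rewrite !lt_min => /andP[/andP[h1 h2] h3].
  have hn : `|y + h *: delta_mx 0 i - y| <= `|h|.
    by rewrite addrAC subrr add0r normrZ -[leRHS]mulr1 ler_wpM2l// delta_norm.
  have L := HC _ (le_lt_trans hn h1 : nball y d (y + h *: delta_mx 0 i)).
  have L' : `|Psi (y + h *: delta_mx 0 i) - Psi y| <= C * `|h|.
    by apply: le_trans L _; rewrite ler_pM2l.
  have := H1 (Psi y) (Psi (y + h *: delta_mx 0 i)) (nball_center _ d10).
  rewrite !PhiK//; last by apply: W2; exact: le_lt_trans hn h2.
  have nb : nball (Psi y) d1 (Psi (y + h *: delta_mx 0 i)).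
    by rewrite /nball/=; apply: le_lt_trans L' _; rewrite mulrC -ltr_pdivlMr.
  have -> : y + h *: delta_mx 0 i - y = h *: delta_mx 0 i by rewrite addrAC subrr add0r.
  move=> /(_ nb) H2; have H3 := le_trans (rVcoord_le _ j) H2.
  rewrite mxsubE [X in _ - X]mxsubE -scalemxAl [X in X - _]mxE -rowE [X in _ * X]mxE distrC in H3.
  apply: le_trans H3 _; apply: le_trans (ler_wpM2l (ltW eC) L') _.
  by rewrite mulrA divfK ?gt_eqF.
have cont (h : 'rV[R]_n -> R) y : smooth_on A h -> W y -> {for y, continuous (fun z => h (Psi z))}.
  move=> sh Wy; apply: continuous_comp; first exact: cPsi.
  exact: (smooth_on_continuous sh (WA _ Wy)).
have der (h : 'rV[R]_n -> R) y i : smooth_on A h -> W y -> is_derive y (delta_mx 0 i) (fun z => h (Psi z))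
    (\sum_j invmx (jac Phi (Psi y)) i j * pderiv j h (Psi y)).
  move=> sh Wy.
  have -> : \sum_j invmx (jac Phi (Psi y)) i j * pderiv j h (Psi y) = dirderiv h (Psi y) (row i (invmx (jac Phi (Psi y)))).
    by apply: eq_bigr => j _; rewrite [row _ _ _ _]mxE.
  apply: chain_rule; first exact: (smooth_on_strict oA sh (WA _ Wy)).
  by move=> j; rewrite [row _ _ _ _]mxE; exact: dPsi.
pose B f := exists2 h, smooth_on A h & f = (fun z => h (Psi z)).
have sJ := smooth_invmx oA uJ (smooth_jac oA sPhi).
move=> a j; rewrite ord1.
apply: (@smooth_alg R n W B) => //.
- by move=> f y [h sh ->]; exact: cont.
- by move=> f y i [h sh ->] Wy; have [] := der h y i sh Wy.
- move=> f i [h sh ->]; exists (fun y => \sum_j invmx (jac Phi (Psi y)) i j * pderiv j h (Psi y)).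
    apply: alg_sum => l; apply: alg_mul; apply: alg_base.
      by exists (fun x => invmx (jac Phi x) i l); [exact: sJ|].
    by exists (pderiv l h); [exact: smooth_on_pderiv|].
  by move=> y Wy; have [] := der h y i sh Wy.
- by apply: alg_base; exists (fun x => x 0 j); [exact: smooth_on_coord|].
Qed.

(** * The developing map along geodesics *)

Lemma derive0_const (R : realType) (f : R -> R) : (forall s : R, is_derive s 1 f 0) -> forall s : R, f s = f 0.
Proof.
move=> fd s; have sr : `|s - 0| < `|s| + 1 by rewrite subr0 ltrDl.
exact: (@derive0_eq R f 0 (`|s| + 1) (fun t _ => fd t) s sr).
Qed.

(** Conservation of the energy w^2 z^2 + z'^2 for the difference z. The conclusion uses z' = 0 and
    the initial value, so that w = 0 is allowed; constant rays on the sphere need that case. *)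
Lemma harmonic_unique (R : realType) (w p q : R) (y dy : R -> R) :
  (forall s : R, is_derive s 1 y (dy s)) -> (forall s : R, is_derive s 1 dy (- (w ^+ 2) * y s)) ->
  y 0 = p -> dy 0 = w * q -> forall s, y s = harmonic w p q s.
Proof.
move=> yd dyd y0 dy0.
pose z s := y s + -1 * harmonic w p q s; pose dz s := dy s + -1 * harmonic w (w * q) (- (w * p)) s.
have zd (s : R) : is_derive s 1 z (dz s).
  apply: is_derive_cast (is_derive_addR (yd s) (is_derive_mulR (is_derive_cstR (-1) s 1) (is_derive_harmonic w p q s))) _.
  by rewrite /dz; ring.
have dzd (s : R) : is_derive s 1 dz (- (w ^+ 2) * z s).
  apply: is_derive_cast (is_derive_addR (dyd s) (is_derive_mulR (is_derive_cstR (-1) s 1) (is_derive_harmonic w (w * q) (- (w * p)) s))) _.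
  by rewrite harmonic2 /z; ring.
have z0 : z 0 = 0 by rewrite /z y0 /harmonic mulr0 cos0 sin0; ring.
have dz0 : dz 0 = 0 by rewrite /dz dy0 /harmonic mulr0 cos0 sin0; ring.
have E0 s : w ^+ 2 * (z s * z s) + dz s * dz s = 0.
  have D (t : R) : is_derive t 1 (fun s => w ^+ 2 * (z s * z s) + dz s * dz s) 0; last first.
    by have -> := derive0_const D s; rewrite z0 dz0; ring.
  apply: is_derive_cast (is_derive_addR (is_derive_mulR (is_derive_cstR (w ^+ 2) t 1)
    (is_derive_mulR (zd t) (zd t))) (is_derive_mulR (dzd t) (dzd t))) _.
  by ring.
have dz_0 s : dz s = 0.
  have h1 : 0 <= w ^+ 2 * (z s * z s) by rewrite -expr2 mulr_ge0 ?sqr_ge0.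
  have h2 : 0 <= dz s * dz s by rewrite -expr2 sqr_ge0.
  by apply/eqP; rewrite -sqrf_eq0 expr2; apply/eqP; have := E0 s; lra.
move=> s; have : z s = 0.
  by rewrite -z0; apply: derive0_const => t; rewrite -(dz_0 t).
by rewrite /z; lra.
Qed.

Lemma linear_unique (R : realType) (y dy : R -> R) (q : R) :
  (forall s : R, is_derive s 1 y (dy s)) -> (forall s : R, is_derive s 1 dy 0) ->
  y 0 = 0 -> dy 0 = q -> forall s, y s = s * q.
Proof.
move=> yd dyd y0 dy0.
have dyq s : dy s = q by rewrite -dy0; exact: derive0_const.
move=> s; have : y s + - q * s = 0.
  have D (t : R) : is_derive t 1 (fun s => y s + - q * s) 0; last first.
    by have -> := derive0_const D s; rewrite y0 mulr0 addr0.
  apply: is_derive_cast (is_derive_addR (yd t) (is_derive_mulR (is_derive_cstR (- q) t 1) (is_derive_id t 1))) _.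
  by rewrite dyq; ring.
lra.
Qed.

(* The Christoffel terms of the Hessian and of the geodesic equation cancel. *)
Lemma hessian_geodesic_sum (R : realType) n (v P : 'I_n -> R) (G : 'I_n -> 'I_n -> 'I_n -> R) (H X : 'I_n -> 'I_n -> R) :
  (forall i j, H i j = \sum_l G l i j * P l + X i j) ->
  \sum_j (v j * \sum_i v i * H i j + P j * - (\sum_i \sum_j' G j i j' * v i * v j')) =
  \sum_i \sum_j v i * v j * X i j.
Proof.
move=> HE; rewrite big_split/=.
have -> : \sum_j v j * \sum_i v i * H i j = \sum_i \sum_j v i * v j * X i j + \sum_l P l * \sum_i \sum_j G l i j * v i * v j.
  under eq_bigr do rewrite mulr_sumr.
  rewrite exchange_big/=.
  under [X in _ = _ + X]eq_bigr do rewrite mulr_sumr.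
  rewrite [X in _ = _ + X]exchange_big -big_split/=; apply: eq_bigr => i _.
  under [X in _ = _ + X]eq_bigr do rewrite mulr_sumr.
  rewrite [X in _ = _ + X]exchange_big -big_split/=; apply: eq_bigr => j _.
  rewrite HE; have -> : v j * (v i * (\sum_l G l i j * P l + X i j)) =
    v i * v j * X i j + v i * v j * \sum_l G l i j * P l by ring.
  congr (_ + _); rewrite mulr_sumr; by apply: eq_bigr => l _; ring.
by rewrite -addrA -big_split/= [X in _ + X]big1 ?addr0// => l _; rewrite mulrN subrr.
Qed.

Lemma sum_quadratic (R : realType) n m (a : R) (v : 'I_n -> R) (G : 'I_m -> 'I_n -> R) :
  \sum_i \sum_j v i * v j * (a * \sum_d G d j * G d i) = a * \sum_d (\sum_i v i * G d i) ^+ 2.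
Proof.
rewrite mulr_sumr (eq_bigr (fun i => \sum_d \sum_j v i * v j * (a * (G d j * G d i)))); last first.
  move=> i _; rewrite exchange_big; apply: eq_bigr => j _ /=.
  by rewrite !mulr_sumr.
rewrite exchange_big; apply: eq_bigr => d _ /=.
rewrite expr2 mulr_suml mulr_sumr; apply: eq_bigr => i _.
by rewrite !mulr_sumr; apply: eq_bigr => j _; ring.
Qed.

(** * Derivatives of functions along a geodesic *)

Section AlongGeodesic.
Variables (R : realType) (M : manifold R 3) (g : tensor2 M).
Hypotheses (sM : smooth_manifold M).
Variable c : R -> M.
Hypothesis gc : geodesic g c.

Let cc : continuous c. Proof. by case: gc. Qed.

Lemma is_derive_chart (f : M -> R) a (s : R) : smooth_on (cimg (atlas a)) (f \o cinv (atlas a)) -> cdom (atlas a) (c s) ->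
  is_derive s 1 (fun t : R => f (c t)) (dirderiv (f \o cinv (atlas a)) (chart_curve c a s) (velocity c a s)).
Proof.
move=> sf ac.
have D := chain_rule (smooth_on_strict (cimg_open sM a) sf (cimg_cfun ac)) (geodesic_C1 gc ac).
have [r r0 H] := curve_stays cc (cdom_open sM a) ac.
have e : \forall t \near s, (f \o cinv (atlas a)) (chart_curve c a t) = f (c t).
  apply/nbhs_ballP; exists r => // t; rewrite -ball_normE /ball_/= distrC => /H at_.
  by rewrite /chart_curve cfunK.
by have [d1 d2] := D; split; [exact: near_eq_derivable e d1|exact: (etrans (esym (@near_eq_derive R R^o R^o _ _ s 1 e)) d2)].
Qed.

(** The second derivative along a geodesic is the Hessian on the velocity; [X] is the covariant part
    of the Hessian. *)
Lemma is_derive2_chart (f : M -> R) a (s : R) (X : 'I_3 -> 'cV[R]_3) :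
  smooth_on (cimg (atlas a)) (f \o cinv (atlas a)) -> cdom (atlas a) (c s) ->
  (forall i, mxpderiv i (grad (f \o cinv (atlas a))) (chart_curve c a s) =
     christoffel_mx (g a) i (chart_curve c a s) *m grad (f \o cinv (atlas a)) (chart_curve c a s) + X i) ->
  is_derive s 1 (derive1 (fun t : R => f (c t))) (\sum_i \sum_j velocity c a s 0 i * velocity c a s 0 j * X i j 0).
Proof.
move=> sf ac hX; set F := f \o cinv (atlas a) in sf hX *.
have [r r0 H] := curve_stays cc (cdom_open sM a) ac.
have e : \forall t \near s, dirderiv F (chart_curve c a t) (velocity c a t) = derive1 (fun t : R => f (c t)) t.
  apply/nbhs_ballP; exists r => // t; rewrite -ball_normE /ball_/= distrC => /H at_.
  by rewrite derive1E; have [_ ->] := is_derive_chart sf at_.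
have D : is_derive s 1 (fun t : R => dirderiv F (chart_curve c a t) (velocity c a t))
    (\sum_i \sum_j velocity c a s 0 i * velocity c a s 0 j * X i j 0).
  have dp j := chain_rule (smooth_on_strict (cimg_open sM a) (smooth_on_pderiv j sf) (cimg_cfun ac)) (geodesic_C1 gc ac).
  apply: is_derive_cast (is_derive_sumR (fun j => is_derive_mulR (geodesic_velocity gc j ac) (dp j))) _.
  have hX' i j : pderiv i (pderiv j F) (chart_curve c a s) =
      \sum_l christoffel (g a) l i j (chart_curve c a s) * pderiv l F (chart_curve c a s) + X i j 0.
    have /colP/(_ j) := hX i; rewrite mxE (_ : (fun y => _) = pderiv j F); last by apply/funext => y; rewrite mxE.
    move=> ->; rewrite mxE mxE; congr (_ + _).
    by apply: eq_bigr => l _; rewrite [grad _ _ _ _]mxE [christoffel_mx _ _ _ _ _]mxE.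
  exact: (hessian_geodesic_sum (fun i => velocity c a s 0 i) hX').
by have [d1 d2] := D; split; [exact: near_eq_derivable e d1|exact: (etrans (esym (@near_eq_derive R R^o R^o _ _ s 1 e)) d2)].
Qed.
End AlongGeodesic.

Section DevelopGeodesic.
Variables (R : realType) (M : manifold R 3) (g : tensor2 M) (K : R) (k : vfield M).
Hypotheses (sM : smooth_manifold M) (rg : riemannian_metric g) (sk : smooth_vfield k).
Hypotheses (nk : nowhere_vanishing k) (ck : curvature_null g k).
Hypotheses (scalK : constant_scalar_curvature g (2 * K)) (Kpos : 0 < K).
Hypotheses (cg : complete_metric g).

Let K0 : K != 0. Proof. exact: lt0r_neq0. Qed.
Let ng a : null_geometry (cimg (atlas a)) (g a) (k a) K := chart_geometry sM rg sk nk ck scalK a.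
Let par a x : cimg (atlas a) x -> covd (g a) (ue g k a) x = 0.
Proof. exact: (ue_parallel sM rg sk nk ck scalK Kpos cg). Qed.

Lemma lower_parallel a i x : cimg (atlas a) x ->
  mxpderiv i (lower (g a) (ue g k a)) x = christoffel_mx (g a) i x *m lower (g a) (ue g k a) x.
Proof.
move=> ax; have [B [E [oB Bx BA aE]]] := adapted_frame_exists (ng a) ax.
have par' y : B y -> covd (g a) (unit_field (g a) (k a)) y = 0 by move=> /BA; exact: par.
apply/colP => j; rewrite mxpderivE (pderiv_eq oB i (fun y By => lower_cf aE j By) Bx).
rewrite (frame_d2 aE par' i j Bx) mxE; apply: eq_bigr => l _.
by rewrite (lower_cf aE l Bx) [christoffel_mx _ _ _ _ _]mxE.
Qed.

Variables (t : M -> R) (u : 'I_3 -> M -> R).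
Hypothesis dev : developing g K k t u.
Variable c : R -> M.
Hypothesis gc : geodesic g c.

Lemma line_along_geodesic (s : R) : is_derive s 1 (derive1 (fun s : R => t (c s))) 0.
Proof.
have [so _ _] := dev; have [a ac] := chart_at sM (c s); have ax := cimg_cfun ac.
have [st _ gt _ _] := so a o0.
apply: is_derive_cast (is_derive2_chart (X := fun=> 0) sM gc st ac _) _; last first.
  by apply: big1 => i _; apply: big1 => j _; rewrite [X in _ * X]mxE mulr0.
move=> i; rewrite addr0 (mxpderiv_eq (cimg_open sM a) i gt ax) gt//.
exact: lower_parallel.
Qed.

Let U c' (s : R) := u c' (c s).

Lemma is_derive_dev c' (s : R) : is_derive s 1 (U c') (derive1 (U c') s) /\ is_derive s 1 (fun s : R => t (c s)) (derive1 (fun s : R => t (c s)) s).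
Proof.
have [so _ _] := dev; have [a ac] := chart_at sM (c s); have [st su _ _ _] := so a c'.
by split; rewrite derive1E; [have [h1 _] := is_derive_chart sM gc su ac|have [h1 _] := is_derive_chart sM gc st ac]; exact/derivableP.
Qed.

Definition speed2 (s : R) := \sum_c' (derive1 (U c') s) ^+ 2.

(** The Obata equation gives u'' = -K u hmet(v, v), and hmet is the sum of the du_d^2, so the
    coefficient is the squared speed of the image curve. *)
Lemma sphere_along_geodesic c' (s : R) : is_derive s 1 (derive1 (U c')) (- K * speed2 s * U c' s).
Proof.
have [so _ hm] := dev; have [a ac] := chart_at sM (c s); have ax := cimg_cfun ac.
have [_ su _ _ hu] := so a c'.
pose X i := - ((K * (u c' \o cinv (atlas a)) (chart_curve c a s)) *: col i (hmet (g a) (ue g k a) (chart_curve c a s))).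
apply: is_derive_cast (is_derive2_chart (X := X) sM gc su ac (fun i => hu i _ ax)) _.
have E d : derive1 (U d) s = \sum_i velocity c a s 0 i * grad (u d \o cinv (atlas a)) (chart_curve c a s) i 0.
  have [_ sd _ _ _] := so a d; rewrite derive1E; have [_ ->] := is_derive_chart sM gc sd ac.
  by apply: eq_bigr => i _; rewrite [grad _ _ _ _]mxE.
have uE : (u c' \o cinv (atlas a)) (chart_curve c a s) = U c' s by rewrite /= /chart_curve cfunK.
have XE i j : X i j 0 = - (K * U c' s) * \sum_d grad (u d \o cinv (atlas a)) (chart_curve c a s) j 0 *
    grad (u d \o cinv (atlas a)) (chart_curve c a s) i 0.
  rewrite /X mxE [X in - X]mxE uE [X in _ * X]mxE -mulNr; congr (_ * _).
  rewrite -hm// summxE; apply: eq_bigr => d _; rewrite mxE big_ord1; congr (_ * _).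
  by rewrite mxE.
have -> : speed2 s = \sum_d (\sum_i velocity c a s 0 i * grad (u d \o cinv (atlas a)) (chart_curve c a s) i 0) ^+ 2.
  by apply: eq_bigr => d _; rewrite E.
rewrite (eq_bigr (fun i => \sum_j velocity c a s 0 i * velocity c a s 0 j * (- (K * U c' s) * \sum_d grad (u d \o cinv (atlas a)) (chart_curve c a s) j 0 *
    grad (u d \o cinv (atlas a)) (chart_curve c a s) i 0))); last by move=> i _; apply: eq_bigr => j _; rewrite XE.
rewrite (sum_quadratic _ (fun i => velocity c a s 0 i) (fun d i => grad (u d \o cinv (atlas a)) (chart_curve c a s) i 0)).
by ring.
Qed.

(** Its derivative is a multiple of sum u u', which vanishes because sum u^2 is constant. The
    equations for u thereby become harmonic oscillators. *)
Lemma speed2_const s : speed2 s = speed2 0.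
Proof.
have [_ nu _] := dev.
have UdU s' : \sum_c' U c' s' * derive1 (U c') s' = 0.
  have := is_derive_sumR (fun c' => is_derive_mulR (is_derive_dev c' s').1 (is_derive_dev c' s').1).
  rewrite (_ : (fun t => _) = fun=> K^-1); last first.
    by apply/funext => s2; rewrite -(nu (c s2)); apply: eq_bigr => d _; rewrite expr2.
  case=> _ h; have := etrans (esym h) (derive_cst (K^-1) s' 1); rewrite big_split/= => e; lra.
apply: derive0_const s => s.
rewrite (_ : speed2 = fun s => \sum_c' derive1 (U c') s * derive1 (U c') s); last first.
  by apply/funext => s'; apply: eq_bigr => d _; rewrite expr2.
apply: is_derive_cast (is_derive_sumR (fun c' => is_derive_mulR (sphere_along_geodesic c' s) (sphere_along_geodesic c' s))) _.
rewrite (eq_bigr (fun d => (- 2 * K * speed2 s) * (U d s * derive1 (U d) s))); last by move=> d _; ring.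
by rewrite -mulr_sumr UdU mulr0.
Qed.

Lemma develop_geodesic (w tau : R) (p q : 'I_3 -> R) :
  t (c 0) = 0 -> derive1 (fun s : R => t (c s)) 0 = tau ->
  (forall d, U d 0 = p d) -> (forall d, derive1 (U d) 0 = w * q d) -> K * \sum_d (w * q d) ^+ 2 = w ^+ 2 ->
  forall s, t (c s) = s * tau /\ forall d, U d s = harmonic w (p d) (q d) s.
Proof.
move=> t0 t1 u0 u1 Kw s; split.
  by apply: (linear_unique (fun s => (is_derive_dev o0 s).2) line_along_geodesic t0 t1).
move=> d; apply: (harmonic_unique (fun s => (is_derive_dev d s).1) _ (u0 d) (u1 d)) => s'.
apply: is_derive_cast (sphere_along_geodesic d s') _.
rewrite speed2_const mulNr; congr (- _ * _); rewrite -Kw; congr (_ * _).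
by apply: eq_bigr => e _; rewrite u1.
Qed.
End DevelopGeodesic.

(** The geodesic of M starting at the base point with the velocity that [based] provides is sent to
    the prescribed ray; completeness makes it defined for all s. *)
Lemma developing_lifts (R : realType) (M : manifold R 3) (g : tensor2 M) (K : R) (k : vfield M)
    (t : M -> R) (u : 'I_3 -> M -> R) p0 a0 (w tau : R) (q : 'I_3 -> R) :
  smooth_manifold M -> riemannian_metric g -> smooth_vfield k -> nowhere_vanishing k -> curvature_null g k ->
  constant_scalar_curvature g (2 * K) -> 0 < K -> complete_metric g ->
  developing g K k t u -> based K t u p0 a0 -> q o0 = 0 -> \sum_d q d ^+ 2 = K^-1 ->
  exists c : R -> M, [/\ continuous c, c 0 = p0, forall s, t (c s) = s * tau &
    forall s d, u d (c s) = harmonic w ((d == o0)%:R * Num.sqrt K^-1) (q d) s].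
Proof.
move=> sM rg sk nk ck scalK Kpos cg dev [ap t0 u0 sur] q0 qK.
have wq0 : (fun d => w * q d) o0 = 0 by rewrite /= q0 mulr0.
have [v [vt vu]] := sur tau (fun d => w * q d) wq0.
have [c [gc c0 cv]] := cg p0 a0 v ap; exists c.
have ac : cdom (atlas a0) (c 0) by rewrite c0.
have cx : chart_curve c a0 0 = cfun (atlas a0) p0 by rewrite /chart_curve c0.
have vE : velocity c a0 0 = v by apply/rowP => l; rewrite mxE cv.
have D (f : M -> R) : smooth_on (cimg (atlas a0)) (f \o cinv (atlas a0)) ->
    derive1 (fun s : R => f (c s)) 0 = (v *m grad (f \o cinv (atlas a0)) (cfun (atlas a0) p0)) 0 0.
  move=> sf; rewrite derive1E; have [_ ->] := is_derive_chart sM gc sf ac.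
  by rewrite vE cx mxE; apply: eq_bigr => i _; rewrite [grad _ _ _ _]mxE.
have [so _ _] := dev.
have st : smooth_on (cimg (atlas a0)) (t \o cinv (atlas a0)) by case: (so a0 o0).
have su d : smooth_on (cimg (atlas a0)) (u d \o cinv (atlas a0)) by case: (so a0 d).
have H := develop_geodesic (p := fun d => (d == o0)%:R * Num.sqrt K^-1) (q := q) (w := w) (tau := tau)
  sM rg sk nk ck scalK Kpos cg dev gc.
have {}H s : t (c s) = s * tau /\ forall d, u d (c s) = harmonic w ((d == o0)%:R * Num.sqrt K^-1) (q d) s.
  apply: H.
  - by rewrite c0.
  - by rewrite (D t st).
  - by move=> d; rewrite c0.
  - by move=> d; rewrite (D (u d) (su d)).
  - under eq_bigr do rewrite exprMn.
    by rewrite -mulr_sumr qK mulrCA mulfV ?mulr1// lt0r_neq0.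
split.
- by case: gc.
- exact: c0.
- by move=> s; have [] := H s.
- by move=> s d; have [_] := H s; apply.
Qed.

(** * Local diffeomorphisms of manifolds *)

Section LocalDiffeomorphism.
Variables (R : realType) (n : nat) (M N : manifold R n) (F : M -> N).
Hypotheses (chM : forall a : idx M, is_chart (atlas a)) (chN : forall b : idx N, is_chart (atlas b)).
Hypotheses (coverM : forall p : M, exists a, cdom (atlas a) p) (coverN : forall p : N, exists b, cdom (atlas b) p).
Hypothesis sF : smooth_map F.
Hypothesis uF : forall a b x, coord_map_dom F a b x -> jac (coord_map F a b) x \in unitmx.

Let cF : continuous F. Proof. by case: sF. Qed.
Let sFab a b : smooth_mx_on (coord_map_dom F a b) (coord_map F a b). Proof. by case: sF => _; exact. Qed.
Let invM (a : idx M) (p : M) : cdom (atlas a) p -> cinv (atlas a) (cfun (atlas a) p) = p. Proof. by case: (chM a) => _ _ h _ _; exact: h. Qed.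
Let invN (b : idx N) (p : N) : cdom (atlas b) p -> cinv (atlas b) (cfun (atlas b) p) = p. Proof. by case: (chN b) => _ _ h _ _; exact: h. Qed.

Lemma coord_map_domE (M' N' : manifold R n) (H : M' -> N') (a : idx M') (b : idx N') : is_chart (atlas a) ->
  coord_map_dom H a b = [set x | cimg (atlas a) x /\ (H @^-1` cdom (atlas b)) (cinv (atlas a) x)].
Proof.
move=> ch; apply/seteqP; split=> x.
  case=> p [ap bp] <-; split; first by exists p.
  by have [_ _ h _ _] := ch; rewrite h.
case=> ax bx; exists (cinv (atlas a) x); last exact: is_chart_cinvK.
by split=> //; exact: is_chart_cinv_cdom.
Qed.

Lemma coord_map_dom_open (M' N' : manifold R n) (H : M' -> N') (a : idx M') (b : idx N') : is_chart (atlas a) ->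
  open (cdom (atlas b)) -> continuous H -> open (coord_map_dom H a b).
Proof.
move=> ch ob cH; rewrite (coord_map_domE _ _ ch); apply: is_chart_image_open => //.
by apply: open_comp => // x _; exact: cH.
Qed.

Let oN b : open (cdom (atlas b : chart R n N)). Proof. by case: (chN b). Qed.
Let odom a b : open (coord_map_dom F a b). Proof. exact: coord_map_dom_open. Qed.

Let coord_mapE a b p : cdom (atlas a) p -> coord_map F a b (cfun (atlas a) p) = cfun (atlas b) (F p).
Proof. by move=> ap; rewrite /coord_map /= invM. Qed.

Let dom_cfun a b p : cdom (atlas a) p -> cdom (atlas b) (F p) -> coord_map_dom F a b (cfun (atlas a) p).
Proof. by move=> ap bp; exists p. Qed.

Lemma local_diffeo_injective q : exists2 V : set M, open V /\ V q & forall s s', V s -> V s' -> F s = F s' -> s = s'.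
Proof.
have [a aq] := coverM q; have [b bq] := coverN (F q).
have dq := dom_cfun aq bq.
have [d d0 inj] := locally_injective (@odom a b) (@sFab a b) dq (uF dq).
exists [set s | cdom (atlas a) s /\ nball (cfun (atlas a) q) d (cfun (atlas a) s)].
  split; first by apply: is_chart_preimage_open => //; exact: nball_open.
  by split=> //; exact: nball_center.
move=> s s' [as_ sd] [as' sd'] FF; rewrite -(invM as_) -(invM as') (inj _ _ sd sd')//.
by rewrite !coord_mapE// FF.
Qed.

Lemma local_diffeo_open q (U : set M) : open U -> U q -> \forall y \near F q, exists2 q', U q' & F q' = y.
Proof.
move=> oU Uq; have [a aq] := coverM q; have [b bq] := coverN (F q).
have dq := dom_cfun aq bq.
have oU' : open (coord_map_dom F a b `&` [set x | cimg (atlas a) x /\ U (cinv (atlas a) x)]).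
  by apply: openI => //; exact: is_chart_image_open.
have Uq' : (coord_map_dom F a b `&` [set x | cimg (atlas a) x /\ U (cinv (atlas a) x)]) (cfun (atlas a) q).
  by split=> //; split; [exists q|rewrite invM].
have := locally_open (@odom a b) (@sFab a b) dq (uF dq) oU' Uq'.
rewrite coord_mapE// => n0.
have n1 : nbhs (F q) (cfun (atlas b) @^-1` [set y | exists2 x, (coord_map_dom F a b `&`
    [set x | cimg (atlas a) x /\ U (cinv (atlas a) x)]) x & coord_map F a b x = y]).
  exact: (is_chart_cfun_continuous (chN b) bq n0).
have n2 : nbhs (F q) (cdom (atlas b)) by exact: open_nbhs_nbhs.
apply: filterS2 n1 n2 => z [x [dx [ax Ux]] xz] bz; exists (cinv (atlas a) x) => //.
move: dx; rewrite coord_map_domE// => -[_ bx].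
by rewrite -(invN bz) -(invN bx) -xz.
Qed.

(** In charts G is a continuous right inverse of a map with invertible Jacobian, so [smooth_inverse]
    applies. *)
Lemma local_diffeo_inverse (G : N -> M) : continuous G -> cancel G F -> smooth_map G.
Proof.
move=> cG GK; split=> // b a.
have oW : open (coord_map_dom G b a) by apply: coord_map_dom_open => //; case: (chM a).
have GE y : coord_map_dom G b a y -> [/\ cimg (atlas b) y, cdom (atlas b) (cinv (atlas b) y) & cdom (atlas a) (G (cinv (atlas b) y))].
  by rewrite coord_map_domE// => -[h1 h2]; split=> //; exact: is_chart_cinv_cdom.
apply: (smooth_inverse (@odom a b) oW (@sFab a b) (@uF a b)).
- move=> y /GE[iy by_ ay]; exists (G (cinv (atlas b) y)) => //.
  by split=> //=; rewrite GK.
- move=> y /GE[iy by_ ay]; rewrite coord_mapE//= GK; exact: is_chart_cinvK.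
- move=> y /GE[iy by_ ay].
  have c1 : {for y, continuous (G \o cinv (atlas b))}.
    by apply: continuous_comp; [exact: is_chart_cinv_continuous|exact: cG].
  have c2 := is_chart_cfun_continuous (chM a) ay.
  exact: (continuous_comp c1 c2).
Qed.
End LocalDiffeomorphism.

(** * Charts of the cylinder *)

Section ProductCharts.
Variable R : realType.

Lemma is_chartI n (T : topologicalType) (c : chart R n T) : open (cdom c) -> open (cimg c) ->
  (forall p, cdom c p -> cinv c (cfun c p) = p) -> (forall p, cdom c p -> {for p, continuous (cfun c)}) ->
  (forall x, cimg c x -> {for x, continuous (cinv c)}) -> is_chart c.
Proof.
move=> h1 h2 h3 h4 h5; split=> //.
  by apply: continuous_in_subspaceT => p /set_mem; exact: h4.
by apply: continuous_in_subspaceT => p /set_mem; exact: h5.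
Qed.

Lemma lsubmx_continuous m n : continuous (fun x : 'rV[R]_(m + n) => lsubmx x).
Proof.
move=> x; apply: rV_continuous => l; rewrite (_ : (fun y => _) = fun y : 'rV[R]_(m + n) => y 0 (lshift n l)).
  exact: coord_continuous.
by apply/funext => y; rewrite mxE.
Qed.

Lemma rsubmx_continuous m n : continuous (fun x : 'rV[R]_(m + n) => rsubmx x).
Proof.
move=> x; apply: rV_continuous => l; rewrite (_ : (fun y => _) = fun y : 'rV[R]_(m + n) => y 0 (rshift m l)).
  exact: coord_continuous.
by apply/funext => y; rewrite mxE.
Qed.

Lemma row_mx_continuous (T : topologicalType) m n (f : T -> 'rV[R]_m) (h : T -> 'rV[R]_n) x :
  {for x, continuous f} -> {for x, continuous h} -> {for x, continuous (fun y => row_mx (f y) (h y))}.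
Proof.
move=> cf ch; apply: rV_continuous => l; case: (splitP l) => j lj.
  rewrite (_ : (fun y => _) = fun y => f y 0 j).
    exact: (@continuous_comp _ _ _ f (fun z : 'rV[R]_m => z 0 j) x cf (@coord_continuous _ _ _ _ _ _)).
  by apply/funext => y; rewrite (_ : l = lshift n j) ?row_mxEl//; exact: val_inj.
rewrite (_ : (fun y => _) = fun y => h y 0 j).
  exact: (@continuous_comp _ _ _ h (fun z : 'rV[R]_n => z 0 j) x ch (@coord_continuous _ _ _ _ _ _)).
by apply/funext => y; rewrite (_ : l = rshift m j) ?row_mxEr//; exact: val_inj.
Qed.

Lemma is_chart_prod m n (M : manifold R m) (N : manifold R n) (c : chart R m M) (d : chart R n N) :
  is_chart c -> is_chart d -> is_chart (prod_chart c d).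
Proof.
move=> hc hd; have [oc ic Kc _ _] := hc; have [od id_ Kd _ _] := hd.
have cimgE : cimg (prod_chart c d) = [set x | cimg c (lsubmx x) /\ cimg d (rsubmx x)].
  apply/seteqP; split=> x.
    by move=> [[p q] [/= cp dq] <-]; rewrite row_mxKl row_mxKr; split; [exists p|exists q].
  move=> [[p cp px] [q dq qx]]; exists (p, q); first by split.
  by rewrite /= px qx hsubmxK.
have c1 : continuous (@fst M N) by move=> x; exact: cvg_fst.
have c2 : continuous (@snd M N) by move=> x; exact: cvg_snd.
apply: is_chartI.
- rewrite (_ : cdom _ = fst @^-1` cdom c `&` snd @^-1` cdom d)//.
  by apply: openI; apply: open_comp.
- rewrite cimgE (_ : [set x | _] = lsubmx @^-1` cimg c `&` rsubmx @^-1` cimg d)//.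
  by apply: openI; apply: open_comp => //; [move=> x _; exact: lsubmx_continuous|move=> x _; exact: rsubmx_continuous].
- by move=> [p q] [/= cp dq]; rewrite row_mxKl row_mxKr Kc ?Kd.
- move=> [p q] [/= cp dq]; apply: row_mx_continuous.
    by apply: continuous_comp; [exact: c1|exact: (is_chart_cfun_continuous hc)].
  by apply: continuous_comp; [exact: c2|exact: (is_chart_cfun_continuous hd)].
- move=> x; rewrite cimgE => -[cx dx].
  have e1 : {for x, continuous (cinv c \o (fun y : 'rV[R]_(m + n) => lsubmx y))}.
    by apply: continuous_comp; [exact: lsubmx_continuous|exact: (is_chart_cinv_continuous hc)].
  have e2 : {for x, continuous (cinv d \o (fun y : 'rV[R]_(m + n) => rsubmx y))}.
    by apply: continuous_comp; [exact: rsubmx_continuous|exact: (is_chart_cinv_continuous hd)].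
  exact: (cvg_pair e1 e2).
Qed.

Lemma is_chart_line (b : idx (line R)) : is_chart (atlas b).
Proof.
apply: is_chartI.
- exact: openT.
- rewrite (_ : cimg _ = setT); first exact: openT.
  apply/seteqP; split=> // x _; exists (x 0 0) => //=.
  by apply/rowP => j; rewrite mxE ord1.
- by move=> p _ /=; rewrite mxE.
- move=> p _; apply: rV_continuous => l; rewrite (_ : (fun y => _) = id); first exact: id.
  by apply/funext => y; rewrite /= mxE.
- by move=> x _; exact: coord_continuous.
Qed.
End ProductCharts.

(** * Stereographic charts of the sphere *)

Section SphereCharts.
Variables (R : realType) (n : nat) (r : R).
Hypothesis r0 : 0 < r.

Let rn0 : r != 0. Proof. exact: lt0r_neq0. Qed.
Local Notation eps b := ((-1) ^+ b).

Let den0 (u : 'rV[R]_n) : sqnorm u + r ^+ 2 != 0.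
Proof. by rewrite gt_eqF// ltr_wpDl ?sqnorm_ge0// exprn_gt0. Qed.

Lemma stereo_inv_last (b : bool) (u : 'rV[R]_n) :
  rsubmx (stereo_inv r b u) 0 0 = eps b * r * ((sqnorm u - r ^+ 2) / (sqnorm u + r ^+ 2)).
Proof.
rewrite /stereo_inv -[_^-1 *: _]hsubmxK row_mxKr linearZ/= row_mxKr !mxE eqxx mulr1n.
by ring.
Qed.

Lemma stereo_inv_left b (u : 'rV[R]_n) :
  lsubmx (stereo_inv r b u) = (2 * r ^+ 2 / (sqnorm u + r ^+ 2)) *: u.
Proof. by rewrite /stereo_inv linearZ/= row_mxKl scalerA mulrC. Qed.

Let eps2 (b : bool) : eps b * eps b = 1 :> R.
Proof. by rewrite -expr2 sqrr_sign. Qed.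

Lemma stereo_inv_neq (b : bool) (u : 'rV[R]_n) : rsubmx (stereo_inv r b u) 0 0 != eps b * r.
Proof.
rewrite stereo_inv_last -subr_eq0.
have -> : eps b * r * ((sqnorm u - r ^+ 2) / (sqnorm u + r ^+ 2)) - eps b * r =
   - (eps b * r * (2 * r ^+ 2)) / (sqnorm u + r ^+ 2) by field.
rewrite mulf_eq0 invr_eq0 (negPf (den0 u)) orbF oppr_eq0 !mulf_eq0 signr_eq0 (negPf rn0) /=.
by rewrite orbF pnatr_eq0.
Qed.

Lemma stereo_invK (b : bool) (u : 'rV[R]_n) :
  (r / (r - eps b * rsubmx (stereo_inv r b u) 0 0)) *: lsubmx (stereo_inv r b u) = u.
Proof.
rewrite stereo_inv_last stereo_inv_left scalerA -[RHS]scale1r; congr (_ *: _).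
rewrite [eps b * _]mulrA [eps b * _]mulrA eps2 mul1r.
have h : r - r * ((sqnorm u - r ^+ 2) / (sqnorm u + r ^+ 2)) = 2 * r ^+ 3 / (sqnorm u + r ^+ 2) by field.
rewrite h; field; by rewrite den0 rn0.
Qed.

(** On the sphere |x|^2 = (r - eps z)(r + eps z), where eps is the sign of the pole; one factor
    cancels against the denominator of the projection. *)
Lemma stereoK (b : bool) (p : 'rV[R]_(n + 1)) : @sphere_set R n r p -> rsubmx p 0 0 != eps b * r ->
  stereo_inv r b ((r / (r - eps b * rsubmx p 0 0)) *: lsubmx p) = p.
Proof.
move=> ps pb; set z := rsubmx p 0 0 in pb *; set x := lsubmx p.
have pE : p = row_mx x z%:M by rewrite -[LHS]hsubmxK; congr row_mx; apply/rowP => j; rewrite !ord1 [RHS]mxE eqxx mulr1n.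
have d0 : r - eps b * z != 0.
  apply: contraNneq pb => /eqP; rewrite subr_eq0 => /eqP h.
  by rewrite h mulrA eps2 mul1r.
have xs : sqnorm x = r ^+ 2 - z ^+ 2 by move: ps; rewrite /sphere_set/= pE sqnorm_row_mx => <-; rewrite addrK.
have e2 : (eps b) ^+ 2 = 1 :> R by exact: sqrr_sign.
rewrite [RHS]pE /stereo_inv sqnormZ xs.
have sE : (r / (r - eps b * z)) ^+ 2 * (r ^+ 2 - z ^+ 2) + r ^+ 2 = 2 * r ^+ 3 / (r - eps b * z).
  have -> : r ^+ 2 - z ^+ 2 = (r - eps b * z) * (r + eps b * z).
    by rewrite -subr_sqr exprMn e2 mul1r.
  by field.
have sE' : (r / (r - eps b * z)) ^+ 2 * (r ^+ 2 - z ^+ 2) - r ^+ 2 = 2 * r ^+ 2 * (eps b * z) / (r - eps b * z).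
  have -> : r ^+ 2 - z ^+ 2 = (r - eps b * z) * (r + eps b * z).
    by rewrite -subr_sqr exprMn e2 mul1r.
  by field.
rewrite sE sE' scale_row_mx scalerA scalerA; congr row_mx.
  rewrite -[RHS]scale1r; congr (_ *: _); field; by rewrite rn0 d0.
rewrite scale_scalar_mx; congr (_%:M).
have -> : eps b * r * (2 * r ^+ 2 * (eps b * z) / (r - eps b * z)) =
   eps b ^+ 2 * (2 * r ^+ 3 / (r - eps b * z) * z) by field.
rewrite e2 mul1r mulrA mulVf ?mul1r// mulf_neq0 ?invr_eq0// mulf_neq0 ?pnatr_eq0//.
by rewrite expf_eq0 /= (negPf rn0).
Qed.

Lemma sphere_continuous (T : topologicalType) (f : T -> sphere n r) x :
  {for x, continuous (fun y => set_val (f y))} -> {for x, continuous f}.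
Proof.
move=> cf U /= [V [[W oW <-] Wf VU]].
have nW : nbhs x ((fun y => set_val (f y)) @^-1` W) by apply: cf; exact: open_nbhs_nbhs.
by apply: filterS nW => y Wy; exact: VU.
Qed.

Lemma set_val_continuous : continuous (fun p : sphere n r => set_val p).
Proof. exact: initial_continuous. Qed.

Let last_continuous : continuous (fun p : sphere n r => rsubmx (set_val p) 0 0).
Proof.
move=> p; rewrite (_ : (fun p => _) = (fun x : 'rV[R]_(n + 1) => x 0 (rshift n 0)) \o (fun p : sphere n r => set_val p)).
  by apply: continuous_comp; [exact: set_val_continuous|exact: coord_continuous].
by apply/funext => q; rewrite /= mxE.
Qed.

Lemma stereo_inv_continuous b : continuous (stereo_inv r b : 'rV[R]_n -> 'rV[R]_(n + 1)).
Proof.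
have cs : continuous (fun u : 'rV[R]_n => sqnorm u).
  move=> u; rewrite (_ : (fun u => _) = fun u : 'rV[R]_n => \sum_j u 0 j * u 0 j); last first.
    by apply/funext => v; rewrite /sqnorm mxE; apply: eq_bigr => j _; rewrite mxE.
  by apply: (continuous_bigsumR (F := fun j (v : 'rV[R]_n) => v 0 j * v 0 j)) => j v; apply: continuousM; exact: coord_continuous.
move=> u; rewrite /stereo_inv; apply: rV_continuous => l.
rewrite (_ : (fun y => _) = fun y : 'rV[R]_n => (sqnorm y + r ^+ 2)^-1 *
   row_mx ((2 * r ^+ 2) *: y) (eps b * r * (sqnorm y - r ^+ 2))%:M 0 l); last first.
  by apply/funext => v; rewrite mxE.
apply: continuousM.
  apply: continuousV; first exact: den0.
  by apply: continuousD; [exact: cs|exact: cst_continuous].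
apply: (@continuous_comp _ _ _ (fun y : 'rV[R]_n => row_mx ((2 * r ^+ 2) *: y) (eps b * r * (sqnorm y - r ^+ 2))%:M) (fun x => x 0 l)); last exact: coord_continuous.
apply: row_mx_continuous; apply: rV_continuous => j.
  rewrite (_ : (fun y => _) = fun y : 'rV[R]_n => 2 * r ^+ 2 * y 0 j); last by apply/funext => v; rewrite mxE.
  by apply: continuousM; [exact: cst_continuous|exact: coord_continuous].
rewrite ord1 (_ : (fun y => _) = fun y : 'rV[R]_n => eps b * r * (sqnorm y - r ^+ 2)); last first.
  by apply/funext => v; rewrite mxE eqxx mulr1n.
apply: continuousM; first exact: cst_continuous.
by apply: continuousB; [exact: cs|exact: cst_continuous].
Qed.

Lemma is_chart_sphere (b : idx (sphere n r)) : is_chart (atlas b).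
Proof.
have mem (p : sphere n r) : @sphere_set R n r (set_val p) by exact: set_valP.
have img : cimg (atlas b : chart R n (sphere n r)) = setT.
  apply/seteqP; split=> // u _; exists (cinv (atlas b : chart R n (sphere n r)) u); first exact: stereo_inv_neq.
  exact: stereo_invK.
apply: is_chartI.
- rewrite (_ : cdom _ = (fun p : sphere n r => rsubmx (set_val p) 0 0) @^-1` (~` [set eps b * r])); last first.
    by apply/seteqP; split=> p /=; [move=> /eqP|move=> /eqP].
  apply: open_comp; first by move=> p _; exact: last_continuous.
  apply: closed_openC; apply: accessible_closed_set1; apply: hausdorff_accessible; exact: Rhausdorff.
- by rewrite img; exact: openT.
- by move=> p pb; apply: val_inj; exact: stereoK.
- move=> p pb; apply: rV_continuous => l.
  have d0 : r - eps b * rsubmx (set_val p) 0 0 != 0.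
    apply: contraNneq pb => /eqP; rewrite subr_eq0 => /eqP h.
    by rewrite {2}h mulrA eps2 mul1r.
  rewrite (_ : (fun y => _) = fun y : sphere n r => r * (r - eps b * rsubmx (set_val y) 0 0)^-1 * set_val y 0 (lshift 1 l)); last first.
    by apply/funext => q; rewrite /= mxE [lsubmx _ _ _]mxE.
  apply: continuousM.
    apply: continuousM; first exact: cst_continuous.
    apply: continuousV => //; apply: continuousB; first exact: cst_continuous.
    by apply: continuousM; [exact: cst_continuous|exact: last_continuous].
  by apply: (@continuous_comp _ _ _ (fun p : sphere n r => set_val p) (fun x => x 0 (lshift 1 l))); [exact: set_val_continuous|exact: coord_continuous].
- move=> u _; apply: sphere_continuous; exact: stereo_inv_continuous.
Qed.

Lemma sphere_chart_at (p : sphere n r) : exists b : idx (sphere n r), cdom (atlas b) p.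
Proof.
have [h|h] := eqVneq (rsubmx (set_val p) 0 0) r; last by exists false; rewrite /= expr0 mul1r.
exists true; rewrite /= h expr1 mulN1r -subr_eq0 opprK -mulr2n mulrn_eq0 /=.
exact: rn0.
Qed.
End SphereCharts.

(** * The developing map is a local isometry *)

Lemma jac_comp (R : realType) n m p (A : set 'rV[R]_n) (B : set 'rV[R]_m) (phi : 'rV[R]_n -> 'rV[R]_m)
    (psi : 'rV[R]_m -> 'rV[R]_p) x : open A -> open B -> (forall x, A x -> B (phi x)) ->
  smooth_mx_on A phi -> smooth_mx_on B psi -> A x ->
  jac (fun y => psi (phi y)) x = jac phi x *m jac psi (phi x).
Proof.
move=> oA oB AB sphi spsi Ax; apply/matrixP => i j; rewrite mxE [RHS]mxE.
rewrite (pderiv_comp i oA oB AB sphi (spsi 0 j) Ax); apply: eq_bigr => l _.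
by rewrite [jac psi _ _ _]mxE.
Qed.

Lemma jac_eq (R : realType) n m (A : set 'rV[R]_n) (f h : 'rV[R]_n -> 'rV[R]_m) x : open A ->
  (forall y, A y -> f y = h y) -> A x -> jac f x = jac h x.
Proof.
move=> oA fh Ax; apply/matrixP => i j; rewrite mxE [RHS]mxE.
by apply: (pderiv_eq oA i _ Ax) => y Ay; rewrite fh.
Qed.

Lemma smooth_row_mx (R : realType) n m p (A : set 'rV[R]_n) (f : 'rV[R]_n -> 'rV[R]_m) (h : 'rV[R]_n -> 'rV[R]_p) :
  smooth_mx_on A f -> smooth_mx_on A h -> smooth_mx_on A (fun x => row_mx (f x) (h x)).
Proof.
move=> sf sh i l; rewrite ord1; case: (splitP l) => j lj.
  rewrite (_ : (fun y => _) = fun y => f y 0 j); first exact: sf.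
  by apply/funext => y; rewrite (_ : l = lshift p j) ?row_mxEl//; exact: val_inj.
rewrite (_ : (fun y => _) = fun y => h y 0 j); first exact: sh.
by apply/funext => y; rewrite (_ : l = rshift m j) ?row_mxEr//; exact: val_inj.
Qed.

Lemma jac_row_mx (R : realType) n m p (f : 'rV[R]_n -> 'rV[R]_m) (h : 'rV[R]_n -> 'rV[R]_p) x :
  jac (fun y => row_mx (f y) (h y)) x = row_mx (jac f x) (jac h x).
Proof.
apply/matrixP => i l; rewrite mxE; case: (splitP l) => j lj.
  have -> : l = lshift p j by exact: val_inj.
  by rewrite row_mxEl [RHS]mxE; congr (pderiv i _ x); apply/funext => y; rewrite row_mxEl.
have -> : l = rshift m j by exact: val_inj.
by rewrite row_mxEr [RHS]mxE; congr (pderiv i _ x); apply/funext => y; rewrite row_mxEr.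
Qed.

Lemma smooth_stereo_inv (R : realType) n (r : R) b : 0 < r ->
  smooth_mx_on setT (stereo_inv r b : 'rV[R]_n -> 'rV[R]_(n + 1)).
Proof.
move=> r0; have oT := @openT 'rV[R]_n.
have sc (c : R) := smooth_on_cst oT c.
have ss : smooth_on setT (fun u : 'rV[R]_n => sqnorm u).
  rewrite (_ : (fun u => _) = fun u : 'rV[R]_n => \sum_j u 0 j * u 0 j); last first.
    by apply/funext => v; rewrite /sqnorm mxE; apply: eq_bigr => j _; rewrite mxE.
  by apply: (smooth_on_sum oT) => j; apply: (smooth_onM oT); exact: smooth_on_coord.
have row : smooth_mx_on setT (fun u : 'rV[R]_n => row_mx ((2 * r ^+ 2) *: u) ((-1) ^+ b * r * (sqnorm u - r ^+ 2))%:M).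
  apply: smooth_row_mx => i j; rewrite !ord1.
    rewrite (_ : (fun y => _) = fun y : 'rV[R]_n => 2 * r ^+ 2 * y 0 j); last by apply/funext => v; rewrite mxE.
    by apply: (smooth_onM oT); [exact: sc|exact: smooth_on_coord].
  rewrite (_ : (fun y => _) = fun y : 'rV[R]_n => (-1) ^+ b * r * (sqnorm y - r ^+ 2)); last first.
    by apply/funext => v; rewrite mxE eqxx mulr1n.
  by apply: (smooth_onM oT); [exact: sc|apply: (smooth_onB oT); [exact: ss|exact: sc]].
move=> i j; rewrite ord1 (_ : (fun y => _) = fun y : 'rV[R]_n => (sqnorm y + r ^+ 2)^-1 *
   row_mx ((2 * r ^+ 2) *: y) ((-1) ^+ b * r * (sqnorm y - r ^+ 2))%:M 0 j); last first.
  by apply/funext => v; rewrite mxE.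
apply: (smooth_onM oT); last exact: row.
apply: (smooth_onV oT); last by apply: (smooth_onD oT); [exact: ss|exact: sc].
by move=> u _; rewrite gt_eqF// ltr_wpDl ?sqnorm_ge0// exprn_gt0.
Qed.

Lemma hausdorff_separating (T : topologicalType) :
  (forall x y : T, x <> y -> exists (S : topologicalType) (f : T -> S), [/\ hausdorff_space S, continuous f & f x <> f y]) ->
  hausdorff_space T.
Proof.
move=> H; rewrite open_hausdorff => x y /eqP/H[S [f [hS cf /eqP fxy]]].
move: hS; rewrite open_hausdorff => /(_ _ _ fxy)[[A B] /= [/set_mem Ax /set_mem By] [oA oB /eqP AB]].
exists (f @^-1` A, f @^-1` B) => /=; first by split; exact: mem_set.
split; [by apply: open_comp => // z _; exact: cf|by apply: open_comp => // z _; exact: cf|].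
by apply/eqP; rewrite -preimage_setI AB preimage_set0.
Qed.

Section Target.
Variables (R : realType) (r : R).
Hypothesis r0 : 0 < r.
Definition cylinder := prod_manifold (line R) (sphere 2 r).

Lemma cylinder_chart (b : idx cylinder) : is_chart (atlas b).
Proof. by apply: is_chart_prod; [exact: is_chart_line|exact: is_chart_sphere]. Qed.

Lemma cylinder_chart_at (p : cylinder) : exists b : idx cylinder, cdom (atlas b) p.
Proof. by have [b bp] := sphere_chart_at r0 p.2; exists (tt, b). Qed.

Lemma cylinder_hausdorff : hausdorff_space cylinder.
Proof.
apply: hausdorff_separating => -[t p] [t' p'] ne.
have [tt'|tt'] := pselect (t = t').
  exists 'rV[R]_(2 + 1), (fun z : cylinder => set_val z.2); split.
  - exact: norm_hausdorff.
  - move=> z; apply: (@continuous_comp _ _ _ (fun z : cylinder => z.2) (fun p => set_val p)).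
      exact: cvg_snd.
    exact: set_val_continuous.
  - by move=> /val_inj /= e; apply: ne; rewrite tt' e.
exists R, (fun z : cylinder => z.1); split; [exact: Rhausdorff|by move=> z; exact: cvg_fst|exact: tt'].
Qed.

Lemma cylinder_continuous (T : topologicalType) (f : T -> cylinder) x :
  {for x, continuous (fun y => (f y).1)} -> {for x, continuous (fun y => set_val (f y).2)} -> {for x, continuous f}.
Proof.
move=> c1 c2; rewrite (_ : f = fun y => ((f y).1, (f y).2)); last by apply/funext => y; case: (f y).
exact: (cvg_pair c1 (sphere_continuous c2)).
Qed.
End Target.

Section DevelopingIsometry.
Variables (R : realType) (M : manifold R 3) (g : tensor2 M) (K : R) (k : vfield M).
Hypotheses (sM : smooth_manifold M) (rg : riemannian_metric g) (Kpos : 0 < K).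
Variables (t : M -> R) (u : 'I_3 -> M -> R).
Hypothesis dev : developing g K k t u.

Local Notation r := (Num.sqrt K^-1).

Lemma radius_gt0 : 0 < r. Proof. by rewrite sqrtr_gt0 invr_gt0. Qed.

Definition dvec q : 'rV[R]_(2 + 1) := \row_c u c q.

Lemma dvec_sphere q : @sphere_set R 2 r (dvec q).
Proof.
have [_ nu _] := dev; rewrite /sphere_set /= sqr_sqrtr ?invr_ge0 ?ltW// -(nu q) /sqnorm mxE.
by apply: eq_bigr => c _; rewrite !mxE -expr2.
Qed.

Definition dmap (q : M) : cylinder r := (t q, SigSub (mem_set (dvec_sphere q)) : sphere 2 r).

Lemma dmapE q : set_val (dmap q).2 = dvec q. Proof. by []. Qed.

Let so a c : local_sol (cimg (atlas a)) (g a) (ue g k a) K (t \o cinv (atlas a)) (u c \o cinv (atlas a)).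
Proof. by case: dev => h _ _; exact: h. Qed.

Lemma smooth_function_continuous (f : M -> R) : (forall a, smooth_on (cimg (atlas a)) (f \o cinv (atlas a))) -> continuous f.
Proof.
move=> sf p; have [a ap] := chart_at sM p; have ax := cimg_cfun ap.
have c1 : {for p, continuous ((f \o cinv (atlas a)) \o cfun (atlas a))}.
  apply: continuous_comp; first exact: (cfun_continuous sM ap).
  exact: smooth_on_continuous (sf a) ax.
move=> U nU; have oc := cdom_open sM a.
have n1 : nbhs p (cdom (atlas a)) by exact: open_nbhs_nbhs.
have n2 : nbhs p (((f \o cinv (atlas a)) \o cfun (atlas a)) @^-1` U).
  by apply: c1; rewrite /= cfunK.
by apply: filterS2 n1 n2 => q aq /=; rewrite cfunK.
Qed.

Lemma dmap_continuous : continuous dmap.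
Proof.
move=> p; apply: cylinder_continuous.
  apply: (@smooth_function_continuous t) => a; have [h _ _ _ _] := so a o0; exact: h.
apply: rV_continuous => l; rewrite (_ : (fun y => _) = u l); last by apply/funext => q; rewrite dmapE mxE.
apply: (@smooth_function_continuous (u l)) => a; have [_ h _ _ _] := so a l; exact: h.
Qed.

Variables (a : idx M) (b : idx (cylinder r)).
Local Notation A := (coord_map_dom dmap a b).
Local Notation X := (fun x => dvec (cinv (atlas a) x)).

Let chM : is_chart (atlas a). Proof. by case: sM => _ _ h _ _; exact: h. Qed.

Lemma dmap_dom_open : open A.
Proof. by apply: coord_map_dom_open => //; [case: (cylinder_chart radius_gt0 b)|exact: dmap_continuous]. Qed.

Lemma dmap_dom x : A x -> cimg (atlas a) x /\ rsubmx (X x) 0 0 != (-1) ^+ b.2 * r.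
Proof. by rewrite coord_map_domE// => -[ax [_ bx]]; split. Qed.

Definition dsphere x : 'rV[R]_2 := (r / (r - (-1) ^+ b.2 * rsubmx (X x) 0 0)) *: lsubmx (X x).

Lemma coord_dmapE : coord_map dmap a b = fun x => row_mx (const_mx (t (cinv (atlas a) x))) (dsphere x).
Proof. by apply/funext => x. Qed.

Let AI : A `<=` cimg (atlas a). Proof. by move=> x /dmap_dom[]. Qed.
Let su c : smooth_on A (u c \o cinv (atlas a)). Proof. by apply: smooth_on_sub AI _; case: (so a c). Qed.

Lemma smooth_dvec : smooth_mx_on A X.
Proof.
move=> i j; rewrite ord1 (_ : (fun x => _) = u j \o cinv (atlas a)); first exact: su.
by apply/funext => x; rewrite mxE.
Qed.

Lemma smooth_dsphere : smooth_mx_on A dsphere.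
Proof.
move=> i j; have oA := dmap_dom_open; rewrite ord1.
rewrite (_ : (fun y => _) = fun x => r * (r - (-1) ^+ b.2 * X x 0 (rshift 2 0))^-1 * X x 0 (lshift 1 j)); last first.
  by apply/funext => x; rewrite mxE [lsubmx _ _ _]mxE [rsubmx _ _ _]mxE.
have sc (c : R) := smooth_on_cst oA c.
apply: (smooth_onM oA); last exact: smooth_dvec.
apply: (smooth_onM oA); first exact: sc.
apply: (smooth_onV oA); last first.
  by apply: (smooth_onB oA); [exact: sc|apply: (smooth_onM oA); [exact: sc|exact: smooth_dvec]].
move=> x /dmap_dom[_]; rewrite [rsubmx _ _ _]mxE; apply: contraNneq => /eqP; rewrite subr_eq0 => /eqP h.
by rewrite {2}h mulrA -expr2 sqrr_sign mul1r.
Qed.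

Lemma smooth_coord_dmap : smooth_mx_on A (coord_map dmap a b).
Proof.
rewrite coord_dmapE; apply: smooth_row_mx; last exact: smooth_dsphere.
move=> i j; rewrite (_ : (fun x => _) = t \o cinv (atlas a)); last by apply/funext => x; rewrite mxE.
by apply: smooth_on_sub AI _; case: (so a o0).
Qed.

(** The line factor contributes dt^2 and the sphere factor the sum of the du_c^2, together e^flat
    e^flat + hmet = g. *)
Lemma dmap_pullback x : A x -> let J := jac (coord_map dmap a b) x in
  g a x = J *m prod_metric (@line_metric R) (@round_metric R 2 r) b (coord_map dmap a b x) *m J^T.
Proof.
move=> Ax J; have oA := dmap_dom_open; have [ax _] := dmap_dom Ax.
have sS := @smooth_stereo_inv R 2 r b.2 radius_gt0.
(* Stereographic projection followed by its inverse is the identity, so the pulled-back round metric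
   can be computed from u directly. *)
have SX y : A y -> stereo_inv r b.2 (dsphere y) = X y.
  by move=> /dmap_dom[_ by_]; apply: stereoK => //; [exact: radius_gt0|exact: dvec_sphere].
have JS : jac dsphere x *m jac (stereo_inv r b.2) (dsphere x) = jac X x.
  by rewrite -(jac_comp oA (@openT _) _ smooth_dsphere sS Ax)//; exact: (jac_eq oA SX Ax).
have Jt : jac (fun x => const_mx (t (cinv (atlas a) x)) : 'rV[R]_1) x = grad (t \o cinv (atlas a)) x.
  apply/matrixP => i j; rewrite mxE [RHS]mxE; congr (pderiv i _ x).
  by apply/funext => y; rewrite mxE.
have JE : J = row_mx (grad (t \o cinv (atlas a)) x) (jac dsphere x).
  by rewrite /J coord_dmapE (jac_row_mx (fun x => const_mx (t (cinv (atlas a) x)))) Jt.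
have GE : prod_metric (@line_metric R) (@round_metric R 2 r) b (coord_map dmap a b x) =
    block_mx 1%:M 0 0 (jac (stereo_inv r b.2) (dsphere x) *m (jac (stereo_inv r b.2) (dsphere x))^T).
  by rewrite /prod_metric /round_metric coord_dmapE row_mxKr.
rewrite GE JE (mul_row_block (grad (t \o cinv (atlas a)) x)) !mulmx0 addr0 add0r mulmx1.
rewrite tr_row_mx mul_row_col mulmxA JS -mulmxA -trmx_mul JS.
have [_ _ hm] := dev; have [_ _ gt _ _] := so a o0.
have HX : jac X x *m (jac X x)^T = hmet (g a) (ue g k a) x.
  apply: etrans (hm a x ax); apply/matrixP => i j; apply: etrans (mxE _ _ _ _) _.
  rewrite [RHS]summxE; apply: eq_bigr => c _.
  have e i' : jac X x i' c = grad (u c \o cinv (atlas a)) x i' 0.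
    apply: etrans (mxE _ _ _ _) _; apply: etrans _ (esym (mxE _ _ _ _)); congr (pderiv i' _ x).
    by apply/funext => y; rewrite mxE.
  rewrite [_^T _ _]mxE !e; apply: etrans _ (esym (mxE _ _ _ _)); rewrite big_ord1 [_^T _ _]mxE.
  by [].
by rewrite HX (gt x ax) /hmet addrC subrK.
Qed.

Lemma dmap_jac_unit x : A x -> jac (coord_map dmap a b) x \in unitmx.
Proof.
move=> Ax; have [ax _] := dmap_dom Ax; have [_ _ _ posg] := chart_metric sM rg a.
have := metric_unit posg ax; rewrite (dmap_pullback Ax) unitmx_mul => /andP[].
by rewrite unitmx_mul => /andP[].
Qed.
End DevelopingIsometry.

(** * Polar coordinates on the cylinder *)

Lemma polar_angle (R : realType) (a b : R) : a ^+ 2 + b ^+ 2 = 1 ->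
  exists th : R, [/\ - pi <= th <= pi, cos th = a & sin th = b].
Proof.
move=> ab; have a1 : -1 <= a <= 1 by rewrite -ler_norml -[leRHS](@normr1 R) -ler_sqr ?nnegrE// !real_normK ?num_real// expr1n; have := sqr_ge0 b; lra.
have [/andP[h0 hpi] ca] := acos_def a1; have sa := sin_acos a1.
have e : 1 - a ^+ 2 = b ^+ 2 by lra.
rewrite e sqrtr_sqr in sa; have pi0 := pi_ge0 R.
have [b0|b0] := leP 0 b.
  by exists (acos a); split; [apply/andP; split; lra|exact: ca|rewrite sa ger0_norm].
exists (- acos a); split; [by apply/andP; split; lra|by rewrite cosN|].
by rewrite sinN sa ltr0_norm// opprK.
Qed.

Section PolarFamily.
Variables (R : realType) (r : R).
Hypothesis r0 : 0 < r.

Definition pole (d : 'I_3) : R := (d == o0)%:R * r.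
(** A vector of length r tangent to the sphere at the pole, in direction [th]. *)
Definition heading (th : R) (d : 'I_3) : R :=
  if val d == 0%N then 0 else if val d == 1%N then r * cos th else r * sin th.

Lemma heading0 th : heading th o0 = 0. Proof. by []. Qed.

Lemma heading_norm th : \sum_d heading th d ^+ 2 = r ^+ 2.
Proof.
rewrite sum3 /heading /= expr0n add0r !exprMn -mulrDr cos2Dsin2 mulr1.
by [].
Qed.

(** The great circle through the pole at angular speed [v.1.2] with direction [v.2]; the remaining
    parameter [v.1.1] is the speed along the line. *)
Definition pvec (v : R * R * R) (s : R) : 'rV[R]_(2 + 1) :=
  \row_d harmonic v.1.2 (pole d) (heading v.2 d) s.

Lemma pvec_sphere v s : @sphere_set R 2 r (pvec v s).
Proof.
rewrite /sphere_set /= /sqnorm mxE.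
rewrite (eq_bigr (fun d : 'I_3 => harmonic v.1.2 (pole d) (heading v.2 d) s ^+ 2)); last first.
  by move=> d _; rewrite !mxE expr2.
rewrite sum3 /harmonic /pole /heading /=.
move: (cos2Dsin2 (v.1.2 * s)) (cos2Dsin2 v.2).
move: (cos (v.1.2 * s)) (sin (v.1.2 * s)) (cos v.2) (sin v.2) => c z a b h1 h2.
have -> : (1 * r * c + 0 * z) ^+ 2 + (0 * r * c + r * a * z) ^+ 2 + (0 * r * c + r * b * z) ^+ 2 =
  r ^+ 2 * (c ^+ 2 + z ^+ 2 * (a ^+ 2 + b ^+ 2)) by ring.
by rewrite h2 mulr1 h1 mulr1.
Qed.

Definition polar (v : R * R * R) (s : R) : cylinder r :=
  (s * v.1.1, SigSub (mem_set (pvec_sphere v s)) : sphere 2 r).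

Lemma polar_eq v w s s' : s * v.1.1 = s' * w.1.1 -> pvec v s = pvec w s' -> polar v s = polar w s'.
Proof. by move=> e1 e2; rewrite /polar e1; congr (_, _); exact: val_inj. Qed.

Lemma pvecE (z : sphere 2 r) v s : pvec v s = set_val z -> SigSub (mem_set (pvec_sphere v s)) = z :> sphere 2 r.
Proof. by move=> e; exact: val_inj. Qed.

Lemma polar_pvec v w s : polar v s = polar w s -> pvec v s = pvec w s.
Proof. by move=> e; have : set_val (polar v s).2 = set_val (polar w s).2 by rewrite e. Qed.

Lemma heading_continuous d : continuous (fun th : R => heading th d).
Proof.
rewrite /heading; case: (val d == 0%N) => th; first exact: cst_continuous.
by case: (val d == 1%N); apply: continuousM; [exact: cst_continuous|exact: continuous_cos|exact: cst_continuous|exact: continuous_sin].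
Qed.

Lemma polar_continuous : continuous (fun z : R * R * R * R => polar z.1 z.2).
Proof.
have f1 (U V : topologicalType) : continuous (@fst U V) by move=> x; exact: cvg_fst.
have f2 (U V : topologicalType) : continuous (@snd U V) by move=> x; exact: cvg_snd.
have cc (U V W : topologicalType) (f : U -> V) (h : V -> W) : continuous f -> continuous h -> continuous (fun x => h (f x)).
  by move=> cf ch x; apply: continuous_comp; [exact: cf|exact: ch].
have c1 := f1 (R * R * R)%type R.
have c11 : continuous (fun z : R * R * R * R => z.1.1.1) := cc _ _ _ _ _ (cc _ _ _ _ _ c1 (f1 _ _)) (f1 _ _).
have c12 : continuous (fun z : R * R * R * R => z.1.1.2) := cc _ _ _ _ _ (cc _ _ _ _ _ c1 (f1 _ _)) (f2 _ _).
have c2 : continuous (fun z : R * R * R * R => z.1.2) := cc _ _ _ _ _ c1 (f2 _ _).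
move=> z; apply: cylinder_continuous.
  by apply: (@continuousM _ _ (fun z : R * R * R * R => z.2) (fun z => z.1.1.1)); [exact: f2|exact: c11].
apply: rV_continuous => l.
rewrite (_ : (fun y => _) = fun z : R * R * R * R => pole l * cos (z.1.1.2 * z.2) + heading z.1.2 l * sin (z.1.1.2 * z.2)); last first.
  by apply/funext => y; rewrite /= mxE.
have cm : {for z, continuous (fun z : R * R * R * R => z.1.1.2 * z.2)}.
  by apply: (@continuousM _ _ (fun z : R * R * R * R => z.1.1.2) (fun z => z.2)); [exact: c12|exact: f2].
apply: continuousD.
  apply: continuousM; first exact: cst_continuous.
  by apply: (continuous_comp cm); exact: continuous_cos.
apply: continuousM.
  exact: (cc _ _ _ _ _ c2 (@heading_continuous l) z).
by apply: (continuous_comp cm); exact: continuous_sin.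
Qed.

Lemma polar_joint v s (W : set (cylinder r)) : nbhs (polar v s) W ->
  exists2 e : R, 0 < e & \forall w \near v, forall t, `|t - s| < e -> W (polar w t).
Proof.
move=> nW; have [[A B] [/= nA nB] AB] := @polar_continuous (v, s) W nW.
have [e e0 eB] := nbhs_ballR nB.
exists e => //; apply: filterS nA => w Aw t /eB Bt.
by apply: (AB (w, t)).
Qed.

Definition polar_box : set (R * R * R) := [set v | 0 <= v.1.2 <= pi /\ - pi <= v.2 <= pi].

(** Cosine is injective on [0, pi], so equal end points force equal line speed and angle. If sin phi
    is nonzero, the headings agree as vectors; at phi = 0 the ray does not depend on the heading. *)
Lemma polar_fibre v w : polar_box v -> polar_box w -> polar v 1 = polar w 1 ->
  (forall s, polar v s = polar w s) \/
  exists (f : R -> R * R * R) (a b : R), [/\ continuous f, a <= b, f a = v /\ f b = w & forall s, polar (f s) 1 = polar v 1].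
Proof.
move: v w => [[tau phi] th] [[tau' phi'] th'] [/= p1 t1] [/= p2 t2] e.
have et : tau = tau' by have : (polar (tau, phi, th) 1).1 = (polar (tau', phi', th') 1).1 by [rewrite e]; rewrite /= !mul1r.
have ev := polar_pvec e.
have coord d : harmonic phi (pole d) (heading th d) 1 = harmonic phi' (pole d) (heading th' d) 1.
  by have /rowP/(_ d) := ev; rewrite !mxE.
have ep : phi = phi'.
  have := coord o0; rewrite /harmonic /pole /heading /= !mulr1 !mul0r !addr0 mul1r.
  by move/(mulfI (lt0r_neq0 r0)); apply: cos_inj; rewrite in_itv.
rewrite -et -{}ep in e ev coord *.
have same : (forall d, heading th d * sin phi = heading th' d * sin phi).
  by move=> d; have := coord d; rewrite /harmonic !mulr1; move/addrI.
have [s0|s0] := eqVneq (sin phi) 0; last first.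
  left=> s; apply: polar_eq => //; apply/rowP => d; rewrite !mxE /=; congr harmonic.
  exact: (mulIf s0 (same d)).
have [f0|f0] := eqVneq phi 0.
  left=> s; apply: polar_eq => //; apply/rowP => d; rewrite !mxE /= f0 /harmonic !mul0r sin0 !mulr0.
  by [].
(* Here phi = pi, where the rays of all headings meet. *)
right; exists (fun x => (tau, phi, th + x * (th' - th))), 0, 1; split.
- move=> x; have cl : {for x, continuous (fun y : R => th + y * (th' - th))}.
    by apply: continuousD; [exact: cst_continuous|apply: continuousM; [exact: id|exact: cst_continuous]].
  apply: (@cvg_pair _ _ _ (nbhs x) (nbhs (tau, phi)) (nbhs (th + x * (th' - th))) _ _ _ (fun=> (tau, phi)) (fun x => th + x * (th' - th))).
    exact: cst_continuous.
  exact: cl.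
- exact: ler01.
- by rewrite mul0r addr0 mul1r addrC subrK.
- move=> s; apply: polar_eq => //; apply/rowP => d; rewrite !mxE /= /harmonic mulr1 s0 !mulr0.
  by [].
Qed.

(** Only the line coordinate is unbounded, and restricting it to a segment around z leaves a compact
    box of polar coordinates. *)
Lemma polar_proper (z : cylinder r) : exists2 W : set (cylinder r), nbhs z W & exists C : set (R * R * R),
  [/\ compact C, C `<=` polar_box & forall y, W y -> exists2 v, C v & polar v 1 = y].
Proof.
have c1 : continuous (fun z : cylinder r => z.1 : R) by move=> x; exact: cvg_fst.
exists [set y : cylinder r | `|y.1 - z.1| < 1].
  have nb : nbhs (z.1 : R) [set y : R | `|y - z.1| < 1].
    by apply/nbhs_ballP; exists (1 : R); [exact: ltr01|move=> y]; rewrite -ball_normE /ball_/= distrC.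
  exact: (c1 z _ nb).
exists ([set` `[z.1 - 1 : R, z.1 + 1]] `*` [set` `[0 : R, pi]] `*` [set` `[- pi : R, pi]]); split.
- by apply: compact_setX; [apply: compact_setX|]; exact: segment_compact.
- by move=> [[tau phi] th] [[/= _ h1] h2]; split; [move: h1|move: h2]; rewrite /= in_itv.
move=> [tau p] /= tz; pose x := set_val p.
have px : sqnorm x = r ^+ 2 by exact: (set_valP p).
have sx : x 0 o0 ^+ 2 + x 0 o1 ^+ 2 + x 0 o2 ^+ 2 = r ^+ 2.
  rewrite -px /sqnorm mxE (eq_bigr (fun d : 'I_3 => x 0 d ^+ 2)) ?sum3// => d _.
  by rewrite mxE expr2.
have rn := lt0r_neq0 r0.
have ex2 (y : R) : (y / r) ^+ 2 = y ^+ 2 / r ^+ 2 by rewrite exprMn exprVn.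
have h1 : (x 0 o0 / r) ^+ 2 + ((x 0 o1 / r) ^+ 2 + (x 0 o2 / r) ^+ 2) = 1.
  by rewrite !ex2 -!mulrDl addrA sx mulfV// expf_eq0/= (negPf rn).
have h2 : (x 0 o0 / r) ^+ 2 + Num.sqrt ((x 0 o1 / r) ^+ 2 + (x 0 o2 / r) ^+ 2) ^+ 2 = 1.
  by rewrite sqr_sqrtr// addr_ge0// sqr_ge0.
have [phi0 [_ c0 s0]] := polar_angle h2.
have a1 : -1 <= x 0 o0 / r <= 1 by rewrite -c0 cos_geN1 cos_le1.
pose phi := acos (x 0 o0 / r).
have [phi1 cphi] := acos_def a1; have sphi := sin_acos a1; rewrite -/phi in phi1 cphi sphi.
pose S := sin phi.
have S2 : S ^+ 2 = (x 0 o1 / r) ^+ 2 + (x 0 o2 / r) ^+ 2.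
  by have := cos2Dsin2 phi; rewrite cphi -/S; lra.
have [th [th1 e1 e2]] : exists th : R, [/\ - pi <= th <= pi, r * cos th * S = x 0 o1 & r * sin th * S = x 0 o2].
  have [S0|S0] := eqVneq S 0.
    move: S2; rewrite S0 expr0n => /esym/eqP; rewrite paddr_eq0 ?sqr_ge0// !sqrf_eq0 !mulf_eq0 invr_eq0 (negPf rn) !orbF.
    move=> /andP[/eqP -> /eqP ->]; exists 0; split; rewrite ?mulr0//.
    by have := pi_ge0 R => ?; apply/andP; split; lra.
  have h3 : (x 0 o1 / r / S) ^+ 2 + (x 0 o2 / r / S) ^+ 2 = 1.
    by rewrite !exprMn !exprVn -mulrDl -!exprVn -!exprMn -S2 exprVn mulfV// expf_eq0/= (negPf S0).
  have [th [h4 h5 h6]] := polar_angle h3; exists th; split=> //; rewrite ?h5 ?h6; field; by rewrite S0 rn.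
exists (tau, phi, th).
  split; [split|] => /=; rewrite in_itv//=.
  by move: tz; rewrite ltr_norml => /andP[? ?]; apply/andP; split; lra.
rewrite /polar /= mul1r; congr (_, _); apply: pvecE; apply/rowP; apply: all3; rewrite mxE /harmonic /pole /heading /= mulr1 -/S cphi.
- by field.
- by rewrite mul0r mul0r add0r.
- by rewrite mul0r mul0r add0r.
Qed.
End PolarFamily.

(** * The soliton *)

(** Leibniz rule: scaling e by f adds the symmetrization of df tensor e^flat. *)
Lemma lie_derivative_scale (R : realType) (A : set 'rV[R]_3) (g : 'rV[R]_3 -> 'M[R]_3) (f : 'rV[R]_3 -> R)
    (e : 'rV[R]_3 -> 'rV[R]_3) x : open A -> smooth_on A f -> smooth_mx_on A e -> A x ->
  lie_derivative g (fun y => f y *: e y) x =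
  f x *: lie_derivative g e x + (grad f x *m (e x *m g x) + (grad f x *m (e x *m (g x)^T))^T).
Proof.
move=> oA sf se Ax; apply/matrixP => i j; rewrite mxE.
have P i' l : pderiv i' (fun y => (f y *: e y) 0 l) x = f x * pderiv i' (fun y => e y 0 l) x + e x 0 l * pderiv i' f x.
  rewrite (_ : (fun y => _) = fun y => f y * e y 0 l); last by apply/funext => y; rewrite mxE.
  by rewrite (pderivM i' sf (se 0 l) Ax).
rewrite (eq_bigr (fun l => f x * (e x 0 l * pderiv l (fun y => g y i j) x + pderiv i (fun y => e y 0 l) x * g x l j
   + pderiv j (fun y => e y 0 l) x * g x i l) + (pderiv i f x * (e x 0 l * g x l j) + pderiv j f x * (e x 0 l * g x i l)))); last first.
  move=> l _; rewrite !P [X in X * _ + _]mxE.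
  move: (pderiv l _ x) (pderiv i f x) (pderiv j f x) (pderiv i _ x) (pderiv j _ x) => d1 d2 d3 d4 d5.
  by ring.
rewrite big_split -mulr_sumr /= [RHS]mxE; congr (_ + _); first by rewrite [RHS]mxE [X in _ = _ * X]mxE.
rewrite big_split /= -!mulr_sumr [RHS]mxE; congr (_ + _).
  by rewrite mxE big_ord1 [grad _ _ _ _]mxE [(e x *m _) _ _]mxE.
rewrite mxE mxE big_ord1 [grad _ _ _ _]mxE [(e x *m _) _ _]mxE; congr (_ * _).
by apply: eq_bigr => l _; rewrite [_^T _ _]mxE.
Qed.

(** A parallel field is Killing: its derivatives are minus Christoffel terms, which cancel the
    derivative of g by metric compatibility. *)
Lemma lie_derivative_parallel (R : realType) (A : set 'rV[R]_3) (g : 'rV[R]_3 -> 'M[R]_3)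
    (e : 'rV[R]_3 -> 'rV[R]_3) x : metric_on A g -> covd g e x = 0 -> A x -> lie_derivative g e x = 0.
Proof.
move=> [oA sg symg posg] par Ax; apply/matrixP => i j; rewrite mxE [RHS]mxE.
have de i' l : pderiv i' (fun y => e y 0 l) x = - \sum_m e x 0 m * christoffel g l i' m x.
  have /matrixP/(_ i' l) := par; rewrite mxE [RHS]mxE mxE [X in X + _]mxE => /eqP; rewrite addr_eq0 => /eqP ->.
  congr (- _); rewrite mxE; apply: eq_bigr => m _; by rewrite [christoffel_mx _ _ _ _ _]mxE.
have dg l : pderiv l (fun y => g y i j) x = \sum_m (christoffel g m l i x * g x m j + g x i m * christoffel g m l j x).
  rewrite -mxpderivE (metric_compatible oA symg posg l Ax) mxE mxE [X in _ + X]mxE -big_split /=.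
  by apply: eq_bigr => m _; rewrite [_^T _ _]mxE ![christoffel_mx _ _ _ _ _]mxE.
rewrite 2!big_split /=.
have e1 : \sum_l pderiv i (fun y => e y 0 l) x * g x l j = - \sum_l e x 0 l * \sum_m christoffel g m l i x * g x m j.
  rewrite -sumrN (eq_bigr (fun l => \sum_m - (e x 0 m * christoffel g l m i x * g x l j))).
    rewrite exchange_big; apply: eq_bigr => m _; rewrite mulr_sumr -sumrN; apply: eq_bigr => l _ /=.
    by rewrite mulrA.
  move=> l _; rewrite de mulNr mulr_suml -sumrN; apply: eq_bigr => m _.
  by rewrite (christoffel_sym oA symg l i m Ax).
have e2 : \sum_l pderiv j (fun y => e y 0 l) x * g x i l = - \sum_l e x 0 l * \sum_m g x i m * christoffel g m l j x.
  rewrite -sumrN (eq_bigr (fun l => \sum_m - (e x 0 m * (g x i l * christoffel g l m j x)))).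
    rewrite exchange_big; apply: eq_bigr => m _; rewrite mulr_sumr -sumrN; apply: eq_bigr => l _ /=.
    by [].
  move=> l _; rewrite de mulNr mulr_suml -sumrN; apply: eq_bigr => m _.
  by rewrite (christoffel_sym oA symg l j m Ax); congr (- _); ring.
rewrite e1 e2 (eq_bigr (fun l => e x 0 l * (\sum_m christoffel g m l i x * g x m j) + e x 0 l * \sum_m g x i m * christoffel g m l j x)).
  rewrite big_split /=; ring.
by move=> l _; rewrite dg big_split mulrDr.
Qed.

Section Soliton.
Variables (R : realType) (M : manifold R 3) (g : tensor2 M) (K : R) (k : vfield M).
Hypotheses (sM : smooth_manifold M) (rg : riemannian_metric g) (sk : smooth_vfield k).
Hypotheses (nk : nowhere_vanishing k) (ck : curvature_null g k).
Hypotheses (scalK : constant_scalar_curvature g (2 * K)) (Kpos : 0 < K).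
Hypotheses (cg : complete_metric g).
Variables (t : M -> R) (u : 'I_3 -> M -> R).
Hypothesis dev : developing g K k t u.

Let K0 : K != 0. Proof. exact: lt0r_neq0. Qed.
Let ng a : null_geometry (cimg (atlas a)) (g a) (k a) K := chart_geometry sM rg sk nk ck scalK a.
Local Notation e := (ue g k).

Lemma ricci_hmet a x : cimg (atlas a) x -> ricci (g a) x = K *: hmet (g a) (e a) x.
Proof.
move=> ax; have [B [E [oB Bx BA aE]]] := adapted_frame_exists (ng a) ax.
have [mB sE [oE nl sc r2]] := aE.
apply/matrixP => i j; rewrite [RHS]mxE (hmet_cf aE i j Bx).
exact: (ricci_frame mB sE oE nl sc i j Bx).
Qed.

Lemma ue_norm a x : cimg (atlas a) x -> e a x *m lower (g a) (e a) x = 1%:M.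
Proof.
move=> ax; have mA := chart_metric sM rg a.
have := unit_field_ip mA ax (nk ax); rewrite /ip => h.
by rewrite /lower mulmxA [LHS]mx11_scalar h.
Qed.

Lemma ue_hmet a x : cimg (atlas a) x -> e a x *m hmet (g a) (e a) x = 0.
Proof.
move=> ax; have [_ _ symg _] := chart_metric sM rg a.
rewrite /hmet mulmxBr mulmxA ue_norm// mul1mx /lower trmx_mul trmxK symg// subrr.
by [].
Qed.

(** Ric(e, .) = 0 forces the Einstein constant to be 0, and then the scalar curvature 2K would
    vanish. *)
Lemma not_einstein : (exists p : M, True) -> ~ einstein g.
Proof.
move=> [p _] [c hc]; have [a ap] := chart_at sM p; have ax := cimg_cfun ap.
have := hc a _ ax; rewrite ricci_hmet// => h.
have c0 : c = 0.
  have eh : e a (cfun (atlas a) p) *m (K *: hmet (g a) (e a) (cfun (atlas a) p)) = 0.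
    by rewrite -scalemxAr (ue_hmet ax) scaler0.
  rewrite h -scalemxAr in eh.
  have := congr1 (fun X => X *m (e a (cfun (atlas a) p))^T) eh.
  rewrite /= -scalemxAl -mulmxA (ue_norm ax) mul0mx => /matrixP/(_ 0 0).
  by rewrite !mxE mulr1.
have := scalK ax; rewrite /scalar_curvature big1 => [/esym/eqP|i _].
  by rewrite mulf_eq0 pnatr_eq0 (negPf K0).
by rewrite big1// => j _; rewrite (hc a _ ax) c0 scale0r mxE mulr0.
Qed.

(** The norm |k|, expressed in charts, glued to one function on M by the invariance of the inner
    product. *)
Lemma field_norm : exists nu : M -> R, forall a p, cdom (atlas a) p ->
  nu p = Num.sqrt (ip (g a) (cfun (atlas a) p) (k a (cfun (atlas a) p)) (k a (cfun (atlas a) p))).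
Proof.
have /choice[nu H] : forall p : M, exists y : R, exists2 a, cdom (atlas a) p &
   y = Num.sqrt (ip (g a) (cfun (atlas a) p) (k a (cfun (atlas a) p)) (k a (cfun (atlas a) p))).
  move=> p; have [a ap] := chart_at sM p.
  by exists (Num.sqrt (ip (g a) (cfun (atlas a) p) (k a (cfun (atlas a) p)) (k a (cfun (atlas a) p)))); exists a.
exists nu => a p ap; have [b bp ->] := H p; congr (Num.sqrt _).
have ov := overlap_cfun bp ap; have [_ kc] := sk.
by rewrite -(transition_cfun sM a bp) (kc _ _ _ ov) (ip_change _ _ (metric_change rg ov)).
Qed.

(** For V = K t e the Lie derivative is 2 K e^flat e^flat, so Ric + L_V g / 2 = K hmet + K e^flat
    e^flat = K g. *)
Lemma soliton_exists : exists f : M -> R, smooth_function f /\ ricci_soliton g (scale_vfield f k) (2 * K).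
Proof.
have [nu Hnu] := field_norm; have [so _ _] := dev.
(* Dividing by |k| makes f k equal to K t e. *)
pose f p := K * t p * (nu p)^-1; exists f.
have nuE a x : cimg (atlas a) x -> nu (cinv (atlas a) x) = Num.sqrt (ip (g a) x (k a x) (k a x)).
  by move=> ax; rewrite (Hnu a _ (cinv_cdom sM ax)) cinvK.
have st a : smooth_on (cimg (atlas a)) (t \o cinv (atlas a)) by have [h _ _ _ _] := so a o0; exact: h.
have sf : smooth_function f.
  move=> a; have oA := cimg_open sM a; have mA := chart_metric sM rg a; have [sk1 _] := sk.
  apply: (@smooth_on_eq _ _ _ oA (fun x => K * (t \o cinv (atlas a)) x * (Num.sqrt (ip (g a) x (k a x) (k a x)))^-1)).
    by move=> x ax; rewrite /= /f nuE.
  have pos x : cimg (atlas a) x -> 0 < ip (g a) x (k a x) (k a x).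
    by move=> ax; apply: (ip_gt0 mA ax); exact: nk.
  apply: (smooth_onM oA).
    by apply: (smooth_onM oA); [exact: (smooth_on_cst oA)|exact: st].
  apply: (smooth_onV oA).
    by move=> x ax; rewrite sqrtr_eq0 -ltNge; exact: pos.
  apply: (smooth_on_sqrt oA pos); exact: (smooth_ip mA).
split=> //.
have VE a x : cimg (atlas a) x -> scale_vfield f k a x = (K * (t \o cinv (atlas a)) x) *: e a x.
  by move=> ax; rewrite /scale_vfield /f nuE// /ue /unit_field scalerA.
split=> //.
  have [sk1 sk2] := sk; split=> [a|a b x ov].
    move=> i j; have oA := cimg_open sM a.
    rewrite (_ : (fun x => _) = fun x => (f \o cinv (atlas a)) x * k a x i j).
      by apply: (smooth_onM oA); [exact: sf|exact: sk1].
    by apply/funext => x; rewrite mxE.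
  by rewrite /scale_vfield (cinv_transition sM ov) (sk2 _ _ _ ov) scalemxAl.
move=> a x ax; have oA := cimg_open sM a; have mA := chart_metric sM rg a; have [_ sg symg _] := mA.
have sK := smooth_onM oA (smooth_on_cst oA K) (st a).
have -> : lie_derivative (g a) (scale_vfield f k a) x = lie_derivative (g a) (fun y => (K * (t \o cinv (atlas a)) y) *: e a y) x.
  apply/matrixP => i j; rewrite [LHS]mxE [RHS]mxE; apply: eq_bigr => l _.
  have P i' : pderiv i' (fun y => scale_vfield f k a y 0 l) x = pderiv i' (fun y => ((K * (t \o cinv (atlas a)) y) *: e a y) 0 l) x.
    by apply: (pderiv_eq oA i' _ ax) => y ay; rewrite VE.
  by rewrite !P VE.
have se : smooth_mx_on (cimg (atlas a)) (e a) by exact: (smooth_ue sM rg sk nk ck scalK).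
rewrite (lie_derivative_scale _ oA sK se ax).
have par : covd (g a) (e a) x = 0 by exact: (ue_parallel sM rg sk nk ck scalK Kpos cg).
rewrite (lie_derivative_parallel mA par ax) scaler0 add0r symg//.
have gK : grad (fun y => K * (t \o cinv (atlas a)) y) x = K *: lower (g a) (e a) x.
  have [_ _ <- // _ _] := so a o0; apply/colP => i; rewrite mxE [RHS]mxE [X in _ = _ * X]mxE.
  by rewrite (pderivM i (smooth_on_cst oA K) (st a) ax) pderiv_cst mulr0 addr0.
have eg : e a x *m g a x = (lower (g a) (e a) x)^T by rewrite /lower trmx_mul trmxK symg.
set L := lower (g a) (e a) x in gK eg *.
have LL : (K *: L *m L^T)^T = K *: (L *m L^T) by rewrite trmx_mul trmxK linearZ -scalemxAr.
have half (X : 'M[R]_3) : 2^-1 *: (X + X) = X by apply/matrixP => i j; rewrite !mxE; field.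
rewrite gK eg LL -scalemxAl half.
by rewrite ricci_hmet// -scalerDr /hmet -/L subrK [2 * K]mulrC mulfK// pnatr_eq0.
Qed.
End Soliton.

Theorem corollary1 (R : realType) (M : manifold R 3) (g : tensor2 M) (S : R)
    (k : vfield M) :
  smooth_manifold M -> riemannian_metric g ->
  simply_connected M -> complete_metric g ->
  0 < S -> constant_scalar_curvature g S ->
  smooth_vfield k -> nowhere_vanishing k -> curvature_null g k ->
  (exists2 r : R, 0 < r &
     @isometric R 3 M g (prod_manifold (line R) (sphere 2 r))
       (prod_metric (@line_metric R) (@round_metric R 2 r))) /\
  (exists f : M -> R,
     [/\ smooth_function f,
         shrinking_ricci_soliton g (scale_vfield f k) S &
         ~ einstein g]).
Proof.
move=> sM rg scM cg S0 scalS sk nk ck.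
(* K is the curvature of the sphere factor, of radius 1/sqrt K; its scalar curvature is 2 K. *)
pose K := S / 2; have Kpos : 0 < K by rewrite divr_gt0.
have K2 : 2 * K = S by rewrite /K mulrC divfK.
have scalK : constant_scalar_curvature g (2 * K) by rewrite K2.
have [t [u [p0 [a0 [dev bas]]]]] := developing_exists sM rg sk nk ck scalK Kpos cg scM.
split; last first.
  have [f [sf sol]] := soliton_exists sM rg sk nk ck scalK Kpos cg dev.
  rewrite K2 in sol; exists f; split=> //.
  by apply: (not_einstein sM rg sk nk ck scalK Kpos); case: scM.
have r0 := radius_gt0 Kpos; exists (Num.sqrt K^-1) => //.
pose F := dmap Kpos dev.
have chM (a : idx M) : is_chart (atlas a) by case: sM => _ _ h _ _; exact: h.
have covM (p : M) : exists a : idx M, cdom (atlas a) p by exact: (chart_at sM).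
have sF : smooth_map F.
  split=> [|a b]; first exact: dmap_continuous.
  exact: smooth_coord_dmap.
have uF (a : idx M) (b : idx (cylinder (Num.sqrt K^-1))) x : coord_map_dom F a b x -> jac (coord_map F a b) x \in unitmx by exact: dmap_jac_unit.
(* Each polar ray is lifted by a geodesic from [p0], with line speed [v.1.1] and angular speed
   [v.1.2]. *)
have [lft Hlft] : exists lft : R * R * R -> R -> M, forall v, [/\ continuous (lft v), lft v 0 = p0 &
    forall s, F (lft v s) = polar (Num.sqrt K^-1) v s].
  have H (v : R * R * R) : exists c : R -> M, [/\ continuous c, c 0 = p0 & forall s, F (c s) = polar (Num.sqrt K^-1) v s].
    have qK : \sum_d heading (Num.sqrt K^-1) v.2 d ^+ 2 = K^-1.
      by rewrite heading_norm sqr_sqrtr// invr_ge0 ltW.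
    have [c [cc c0 ct cu]] := developing_lifts v.1.2 v.1.1 sM rg sk nk ck scalK Kpos cg dev bas (heading0 _ _) qK.
    exists c; split=> // s; rewrite /F /dmap /polar ct; congr (_, _); apply: val_inj.
    by apply/rowP => d; rewrite mxE [RHS]mxE cu.
  have /choice[lft Hl] := H; by exists lft.
have l1 v : continuous (lft v) by case: (Hlft v).
have l2 v : lft v 0 = p0 by case: (Hlft v).
have l3 v s : F (lft v s) = polar (Num.sqrt K^-1) v s by case: (Hlft v).
have hM : hausdorff_space M by case: sM.
(* With all parameters zero the ray is constant at the image of the base point. *)
have base : exists2 v, polar_box v & forall s, polar (Num.sqrt K^-1) v s = F p0.
  exists (0, 0, 0) => /=.
    have h := pi_ge0 R; rewrite /polar_box /= lexx h oppr_le0 h.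
    by [].
  move=> s; rewrite -(l2 (0, 0, 0)) l3; apply: polar_eq; first by rewrite /= !mulr0.
  by apply/rowP => d; rewrite !mxE /= /harmonic !mul0r.
have [G cG [FG GF]] := lifted_inverse hM (cylinder_hausdorff (r := Num.sqrt K^-1)) sF.1
  (local_diffeo_injective chM (cylinder_chart r0) covM (cylinder_chart_at r0) sF uF)
  (local_diffeo_open chM (cylinder_chart r0) covM (cylinder_chart_at r0) sF uF)
  (@polar_joint R (Num.sqrt K^-1)) l1 l2 l3 (path_constant scM) (polar_fibre r0) (polar_proper r0) base.
exists F, G; split=> //.
  exact: (local_diffeo_inverse chM (cylinder_chart r0) sF uF).
by move=> a b x Ax; exact: dmap_pullback.
Qed.
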